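(* Let $a<b$, $0<\alpha\le 1$, $x_a,z_a\in\mathbb{R}$, and let $L:[a,b]\times\mathbb{R}^3\to\mathbb{R}$, $(t,x,u,z)\mapsto L(t,x,u,z)$, have continuous partial derivatives with respect to $x$, $u$ and $z$. Consider the fractional Herglotz problem $$z(b)\longrightarrow\min\quad\text{subject to}\quad {}^{C}D_{a^+}^{\alpha}[z](t)=L\big(t,x(t),{}^{C}D_{a^+}^{\alpha}[x](t),z(t)\big),\ t\in[a,b],\quad x(a)=x_a,\ z(a)=z_a.$$ Suppose that $(x^\star,z^\star)\in {}^{C}AC_{a^+}^{\alpha}([a,b],\mathbb{R})\times {}^{C}AC_{a^+}^{\alpha}([a,b],\mathbb{R})$, with ${}^{C}D_{a^+}^{\alpha}[x^\star]\in C([a,b],\mathbb{R})$, solves this problem. Then $$I_{b^-}^{\alpha}\big[p\,\partial_2L(\cdot,x^\star,{}^{C}D_{a^+}^{\alpha}[x^\star],z^\star)\big](t)+p(t)\,\partial_3L\big(t,x^\star(t),{}^{C}D_{a^+}^{\alpha}[x^\star](t),z^\star(t)\big)=0\quad\text{for all }t\in[a,b),$$ where $p$ is the solution of $$D_{b^-}^{\alpha}[p](t)=p(t)\,\partial_4L\big(t,x^\star(t),{}^{C}D_{a^+}^{\alpha}[x^\star](t),z^\star(t)\big),\ t\in[a,b),\qquad I_{b^-}^{1-\alpha}[p](b)=-1.$$ Moreover, if $L$ is twice continuously differentiable with respect to $u$, then the Legendre necessary optimality condition holds: $$\partial_{33}L\big(t,x^\star(t),{}^{C}D_{a^+}^{\alpha}[x^\star](t),z^\star(t)\big)\ge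 0,\quad t\in[a,b].$$
   Context: $\partial_iL$ denotes the partial derivative of $L$ with respect to its $i$-th argument (arguments ordered $t,x,u,z$), and $\partial_{33}L$ the second partial derivative with respect to $u$. For $f\in L^1([a,b],\mathbb{R})$ and $\beta>0$: $I_{a^+}^{\beta}[f](t)=\frac{1}{\Gamma(\beta)}\int_a^t(t-s)^{\beta-1}f(s)\,ds$ and $I_{b^-}^{\beta}[f](t)=\frac{1}{\Gamma(\beta)}\int_t^b(s-t)^{\beta-1}f(s)\,ds$ (whenever they exist), with $I_{a^+}^0[f]=I_{b^-}^0[f]=f$. For $0<\alpha\le1$, the left (right) Riemann--Liouville derivative of $f\in L^1([a,b],\mathbb{R})$ such that $I_{a^+}^{1-\alpha}[f]$ (respectively $I_{b^-}^{1-\alpha}[f]$) is absolutely continuous on $[a,b]$ is $D_{a^+}^{\alpha}[f](t)=\frac{d}{dt}\left[I_{a^+}^{1-\alpha}[f]\right](t)$ (respectively $D_{b^-}^{\alpha}[f](t)=-\frac{d}{dt}\left[I_{b^-}^{1-\alpha}[f]\right](t)$); the sets of such $f$ are $AC_{a^+}^{\alpha}([a,b],\mathbb{R})$ and $AC_{b^-}^{\alpha}([a,b],\mathbb{R})$. The value $I_{b^-}^{1-\alpha}[p](b)$ is the value at $b$ of the absolutely continuous function $I_{b^-}^{1-\alpha}[p]$ (the limit as $t\to b^-$). The left Caputo derivative of $f\in C([a,b],\mathbb{R})$ with $f-f(a)\in AC_{a^+}^{\alpha}([a,b],\mathbb{R})$ is ${}^{C}D_{a^+}^{\alpha}[f](t)=D_{a^+}^{\alpha}[f-f(a)](t)$;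 the set of such $f$ is ${}^{C}AC_{a^+}^{\alpha}([a,b],\mathbb{R})$. ''$(x^\star,z^\star)$ solves the problem'' means that it satisfies all the constraints and minimizes $z(b)$ among all pairs $(x,z)\in {}^{C}AC_{a^+}^{\alpha}([a,b],\mathbb{R})\times {}^{C}AC_{a^+}^{\alpha}([a,b],\mathbb{R})$ satisfying the constraints (the fractional differential equation being understood almost everywhere where the derivatives are only defined almost everywhere). The function $p$ is the solution in $AC_{b^-}^{\alpha}([a,b],\mathbb{R})$ that is continuous on $[a,b)$. *)

(* Defs.v *)
From HB Require Import structures.
From mathcomp Require Import all_boot all_order all_algebra.
From mathcomp Require Import all_classical all_reals all_analysis.

Set Implicit Arguments.
Unset Strict Implicit.
Unset Printing Implicit Defensive.

Import Order.TTheory GRing.Theory Num.Theory.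
Import numFieldNormedType.Exports.

Local Open Scope classical_set_scope.
Local Open Scope ring_scope.

(* Functions on [a, b] are total functions R -> R of which only the values on
   [a, b] are used; likewise L : R -> R -> R -> R -> R stands for a function
   (t, x, u, z) |-> L t x u z on [a, b] * R^3. *)

Definition Gamma (R : realType) (x : R) : R :=
  \int[lebesgue_measure]_(s in `]0, +oo[) (s `^ (x - 1) * expR (- s)).

Definition frac_int_left (R : realType) (a beta : R) (f : R -> R) : R -> R :=
  if beta == 0 then f else fun t =>
    (Gamma beta)^-1 *
    \int[lebesgue_measure]_(s in `[a, t]) ((t - s) `^ (beta - 1) * f s).

Definition frac_int_right (R : realType) (b beta : R) (f : R -> R) : R -> R :=
  if beta == 0 then f else fun t =>
    (Gamma beta)^-1 *
    \int[lebesgue_measure]_(s in `[t, b]) ((s - t) `^ (beta - 1) * f s).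

Definition L1 (R : realType) (a b : R) (f : R -> R) : Prop :=
  (@lebesgue_measure R).-integrable `[a, b] (EFin \o f).

Definition abs_cont (R : realType) (a b : R) (F : R -> R) : Prop :=
  forall e : R, 0 < e -> exists2 d : R, 0 < d &
    forall (n : nat) (u v : 'I_n -> R),
      (forall i, [/\ a <= u i, u i <= v i & v i <= b]) ->
      trivIset [set: 'I_n] (fun i => `]u i, v i[%classic) ->
      \sum_(i < n) (v i - u i) < d ->
      \sum_(i < n) `|F (v i) - F (u i)| < e.

(* A fractional integral of an L^1 function is only defined almost everywhere,
   and its integral formula always yields 0 at the base point; so "it is
   absolutely continuous" means that it has an absolutely continuous
   representative. The latter is unique on [a, b]. *)
Definition ac_repr_of (R : realType) (a b : R) (g F : R -> R) : Prop :=
  abs_cont a b F /\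
  {ae @lebesgue_measure R, forall t, t \in `[a, b] -> g t = F t}.

Definition ac_repr (R : realType) (a b : R) (g : R -> R) : R -> R :=
  xget g [set F | ac_repr_of a b g F].

(* d/dt on [a, b]; one-sided at the end points. *)
Definition derive_on (R : realType) (a b : R) (F : R -> R) (t : R) : R :=
  lim ((fun s => (F s - F t) / (s - t)) @ within `[a, b] (t^')).

Definition AC_left (R : realType) (a b alpha : R) (f : R -> R) : Prop :=
  L1 a b f /\ exists F, ac_repr_of a b (frac_int_left a (1 - alpha) f) F.

Definition AC_right (R : realType) (a b alpha : R) (f : R -> R) : Prop :=
  L1 a b f /\ exists F, ac_repr_of a b (frac_int_right b (1 - alpha) f) F.

Definition RL_deriv_left (R : realType) (a b alpha : R) (f : R -> R) (t : R) : R :=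
  derive_on a b (ac_repr a b (frac_int_left a (1 - alpha) f)) t.

Definition RL_deriv_right (R : realType) (a b alpha : R) (f : R -> R) (t : R) : R :=
  - derive_on a b (ac_repr a b (frac_int_right b (1 - alpha) f)) t.

Definition caputo_AC_left (R : realType) (a b alpha : R) (f : R -> R) : Prop :=
  {within `[a, b], continuous f} /\ AC_left a b alpha (fun t => f t - f a).

Definition caputo_left (R : realType) (a b alpha : R) (f : R -> R) (t : R) : R :=
  RL_deriv_left a b alpha (fun s => f s - f a) t.

Definition d2 (R : realType) (L : R -> R -> R -> R -> R) (t x u z : R) : R :=
  derive1 (fun y => L t y u z) x.

Definition d3 (R : realType) (L : R -> R -> R -> R -> R) (t x u z : R) : R :=
  derive1 (fun y => L t x y z) u.

Definition d4 (R : realType) (L : R -> R -> R -> R -> R) (t x u z : R) : R :=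
  derive1 (fun y => L t x u y) z.

Definition d33 (R : realType) (L : R -> R -> R -> R -> R) :
  R -> R -> R -> R -> R := d3 (d3 L).

Definition continuous_on_strip (R : realType) (a b : R)
    (g : R -> R -> R -> R -> R) : Prop :=
  {within [set q : R * R * R * R | q.1.1.1 \in `[a, b]],
     continuous (fun q : R * R * R * R => g q.1.1.1 q.1.1.2 q.1.2 q.2)}.

Definition C1_xuz (R : realType) (a b : R) (L : R -> R -> R -> R -> R) : Prop :=
  [/\ forall t x u z, t \in `[a, b] ->
        [/\ derivable (fun y => L t y u z) x 1,
            derivable (fun y => L t x y z) u 1 &
            derivable (fun y => L t x u y) z 1],
      continuous_on_strip a b (d2 L),
      continuous_on_strip a b (d3 L) &
      continuous_on_strip a b (d4 L)].

Definition C2_u (R : realType) (a b : R) (L : R -> R -> R -> R -> R) : Prop :=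
  [/\ forall t x u z, t \in `[a, b] ->
        derivable (fun y => L t x y z) u 1 /\
        derivable (fun y => d3 L t x y z) u 1,
      continuous_on_strip a b (d3 L) &
      continuous_on_strip a b (d33 L)].

Definition along (R : realType) (a b alpha : R) (x z : R -> R)
    (g : R -> R -> R -> R -> R) (t : R) : R :=
  g t (x t) (caputo_left a b alpha x t) (z t).

Definition admissible (R : realType) (a b alpha xa za : R)
    (L : R -> R -> R -> R -> R) (x z : R -> R) : Prop :=
  [/\ caputo_AC_left a b alpha x /\ caputo_AC_left a b alpha z,
      {ae @lebesgue_measure R, forall t, t \in `[a, b] ->
         caputo_left a b alpha z t = along a b alpha x z L t},
      x a = xa &
      z a = za].

Definition solves_herglotz (R : realType) (a b alpha xa za : R)
    (L : R -> R -> R -> R -> R) (xs zs : R -> R) : Prop :=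
  admissible a b alpha xa za L xs zs /\
  forall x z, admissible a b alpha xa za L x z -> zs b <= z b.

(* p solves D_{b-}^alpha p = p * q on [a, b[ with I_{b-}^{1-alpha}[p](b) = -1;
   this last value is the one taken by the absolutely continuous
   representative. *)
Definition adjoint_solution (R : realType) (a b alpha : R) (q p : R -> R) :
    Prop :=
  [/\ AC_right a b alpha p,
      {within `[a, b[, continuous p},
      forall t, t \in `[a, b[ -> RL_deriv_right a b alpha p t = p t * q t &
      ac_repr a b (frac_int_right b (1 - alpha) p) b = -1].

(* Main.v *)
Require Import Defs.
From HB Require Import structures.
From mathcomp Require Import all_boot all_order all_algebra.
From mathcomp Require Import all_classical all_reals all_analysis.
From mathcomp Require Import measurable_realfun.
From mathcomp Require Import ring lra.

Import Order.TTheory GRing.Theory Num.Theory.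
Import numFieldNormedType.Exports.

Local Open Scope classical_set_scope.
Local Open Scope ring_scope.
Set Implicit Arguments.
Unset Strict Implicit.
Unset Printing Implicit Defensive.

(** Along the extremal write [us] for the Caputo derivative of [xs], and [c2], [c3],
[c4] for the partial derivatives of [L] in [x], [u], [z].  A continuous
perturbation [eta] of [us] displaces [xs] by [h], the fractional integral of
order [alpha] of [eta], and [zs] by the solution [zeta] of the Volterra equation
whose right-hand side is the fractional integral of the increment [M] of [L].
The displaced pair is admissible, so minimality of [zs b] says [0 <= zeta b]
([perturbation_payoff]).

Let [P] solve the Volterra equation from the right
[P = (b - t) ^ (alpha - 1) / Gamma alpha + I_{b-}^alpha (c4 P)].  Fractional
integrals from the left and from the right are transposes of each other, hence
[zeta b] is exactly the integral of [P (M - c4 zeta)], that is, the integral of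
[H t (eta t)], where [H t e = P t * M t 0 e 0 + Q t * e] and
[Q = I_{b-}^alpha (c2 P)], plus a remainder that is small compared with [h] and
[zeta] ([payoff_formula]).  For a needle [eta], of fixed height and of width
[delta], the remainder is [o(delta)] whereas the integral is of order [delta];
so [H t e] cannot be nonpositive for all small [e] of one sign and negative in
the middle of the needle ([needle_variation]).  If the slope [P c3 + Q] of
[H t] at [0] did not vanish, [H] would be that negative on one side: this is the
Euler-Lagrange equation.  Once the slope vanishes, a negative second derivative
[P * d33 L] would again make [H] negative; as [P] is positive, this is the
Legendre condition.  Both pass to the end points by continuity.

The adjoint function is [p = - P].  The composition of the fractional integrals
of orders [alpha] and [1 - alpha] is the primitive ([rl_semigroup]), which turns
the Volterra equation of [P] into [I_{b-}^{1 - alpha} p = -1 + int_t^b c4 p],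
and the right-hand side can be differentiated at every point.  Conversely every
adjoint solution satisfies this integral equation because an absolutely
continuous function is the integral of its derivative ([abs_cont_derive_ae]),
and the homogeneous equation has no solution but [0] ([volterra_unique]).

Three estimates carry the analysis.  Weights [kern (s - a) * exp (l (s - a))]
make the fractional integral a contraction when [l] is large ([bielecki]): they
give existence by successive approximations, uniqueness, and the bounds on [h]
and [zeta], both uniform and integrated against [P].  The kernel satisfies a
Poisson identity: integrating it up to [t1] against a positive density yields
its value at a later point [t0] ([poisson_kern]); applied at the first zero of
[P] it shows that there is none ([solution_gt0]).  Finally the total variation
of an absolutely continuous function is absolutely continuous, so that its
Lebesgue-Stieltjes measure has a density ([stieltjes_dominated]). *)

(** * Integration of nonnegative functions over intervals *)

Lemma pointwise_continuous_measurable (R : realType) (I : interval R) (f : R -> R) :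
  {in I, forall x, {for x, continuous f}} -> measurable_fun [set` I] f.
Proof.
move=> cf; apply: subspace_continuous_measurable_fun; first exact: measurable_itv.
by apply: continuous_in_subspaceT => x; rewrite inE => /cf.
Qed.

(** The improper integral of a nonnegative function as a limit of integrals over an
increasing sequence of sets, by monotone convergence. *)
Lemma integral_exhaustion (R : realType) (K : nat -> set R) (G : R -> R)
    (v : nat -> \bar R) (l : \bar R) :
  (forall n m x, (n <= m)%N -> K n x -> K m x) ->
  (forall n, measurable (K n)) -> measurable_fun (\bigcup_n K n) G ->
  (forall n x, K n x -> 0 <= G x) ->
  (forall n, \int[lebesgue_measure]_(x in K n) (G x)%:E = v n)%E ->
  v n @[n --> \oo] --> l ->
  (\int[lebesgue_measure]_(x in \bigcup_n K n) (G x)%:E = l)%E.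
Proof.
move=> ndK mK mG G0 Kv vl.
have h := @ge0_nondecreasing_set_cvg_integral _ (measurableTypeR R) R K
  (EFin \o G) lebesgue_measure.
apply: (cvg_unique _ (h _ _ _ _)) => //.
- by move=> n m nm; apply/subsetPset => x; exact: ndK.
- move=> n; apply/measurable_EFinP; apply: measurable_funS mG => //.
    exact: bigcup_measurable.
  by move=> x Kx; exists n.
- by move: vl; apply: cvg_trans; apply: near_eq_cvg; near=> n; rewrite -Kv.
Unshelve. all: by end_near.
Qed.

Lemma eq_integral_exhaustion (R : realType) (K J : nat -> set R) (G H : R -> R) :
  (forall n m x, (n <= m)%N -> K n x -> K m x) ->
  (forall n, measurable (K n)) -> measurable_fun (\bigcup_n K n) G ->
  (forall n x, K n x -> 0 <= G x) ->
  (forall n m x, (n <= m)%N -> J n x -> J m x) ->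
  (forall n, measurable (J n)) -> measurable_fun (\bigcup_n J n) H ->
  (forall n x, J n x -> 0 <= H x) ->
  (forall n, \int[lebesgue_measure]_(x in K n) (G x)%:E =
     \int[lebesgue_measure]_(x in J n) (H x)%:E)%E ->
  (\int[lebesgue_measure]_(x in \bigcup_n K n) (G x)%:E =
   \int[lebesgue_measure]_(x in \bigcup_n J n) (H x)%:E)%E.
Proof.
move=> ndK mK mG G0 ndJ mJ mH H0 KJ.
have h := @ge0_nondecreasing_set_cvg_integral _ (measurableTypeR R) R J
  (EFin \o H) lebesgue_measure.
apply: (integral_exhaustion ndK mK mG G0 KJ).
apply: h => //.
- by move=> n m nm; apply/subsetPset => x; exact: ndJ.
- move=> n; apply/measurable_EFinP; apply: measurable_funS mH => //.
    exact: bigcup_measurable.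
  by move=> x Jx; exists n.
Qed.

(** The change of variables on compact intervals passes to the limit by
monotone convergence; asking only that [F v] runs through the interval [I] lets
[I] be half open, bounded or not. *)
Lemma ge0_substitution_oy (R : realType) (F f G : R -> R) (I : interval R) :
  (forall v : R, 0 < v -> is_derive v (1 : R) F (f v)) ->
  (forall v : R, 0 < v -> {for v, continuous f}) ->
  (forall u v : R, 0 < u -> u < v -> F u < F v) ->
  (forall v : R, 0 < v -> F v \in I) ->
  (forall x : R, x \in I -> exists u v : R, [/\ 0 < u, 0 < v, F u <= x & x <= F v]) ->
  {in I, forall x, {for x, continuous G}} ->
  {in I, forall x, 0 <= G x} ->
  (\int[lebesgue_measure]_(x in [set` I]) (G x)%:E =
   \int[lebesgue_measure]_(v in `]0%R, +oo[) (G (F v) * f v)%:E)%E.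
Proof.
move=> dF cf incF FI IF cG G0.
have f0 (v : R) : 0 < v -> 0 <= f v.
  move=> v0; have [_ <-] := dF v v0; rewrite -derive1E.
  apply: (@incr_derive1_ge0_itvy _ F false 0); last by rewrite in_itv/= v0.
    by move=> x; rewrite inE/= in_itv/= andbT => /dF[].
  by move=> u w; rewrite !in_itv/= !andbT => u0 _; exact: incF.
pose lo (n : nat) : R := n.+1%:R^-1; pose hi (n : nat) : R := n.+1%:R.
have lo0 n : 0 < lo n by rewrite invr_gt0 ltr0n.
have lohi n : lo n <= hi n.
  by rewrite /lo /hi (@le_trans _ _ 1)// ?invf_le1 ?ltr0n ?ler1n.
pose J n : set R := `[lo n, hi n]%classic; pose K n : set R := `[F (lo n), F (hi n)]%classic.
have Fle (u v : R) : 0 < u -> u <= v -> F u <= F v.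
  by move=> u0; rewrite le_eqVlt => /predU1P[->//|/(incF _ _ u0)/ltW].
have lole n m : (n <= m)%N -> lo m <= lo n.
  by move=> nm; rewrite /lo lef_pV2 ?posrE ?ltr0n// ler_nat.
have hile n m : (n <= m)%N -> hi n <= hi m.
  by move=> nm; rewrite /hi ler_nat.
have hi0 n : 0 < hi n by exact: lt_le_trans (lohi n).
have JN (v : R) : 0 < v -> exists n, J n v.
  move=> v0; exists (Num.bound (v + v^-1)); rewrite /J /= in_itv/=.
  have vi : 0 < v^-1 by rewrite invr_gt0.
  have h := archi_boundP (addr_ge0 (ltW v0) (ltW vi)).
  apply/andP; split.
    rewrite /lo invf_ple ?posrE ?ltr0n// -natr1; lra.
  rewrite /hi -natr1; lra.
have UJ : \bigcup_n J n = `]0, +oo[%classic.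
  apply/seteqP; split => [v [n _]|v]; rewrite /J/= !in_itv/= ?andbT.
    by move=> /andP[h _]; exact: lt_le_trans h.
  by move=> /JN[n Jn]; exists n.
have UK : \bigcup_n K n = [set` I].
  apply/seteqP; split => [x [n _]|x] /=.
    rewrite /K /= => xK; have := FI _ (lo0 n); have := FI _ (hi0 n).
    move=> h1 h2; have := xK; rewrite in_itv/= => /andP[a1 a2].
    exact: (@interval_is_interval R I _ _ h2 h1 x).
  move=> /IF[u [v [u0 v0 ux xv]]].
  have [n Jn] := JN _ u0; have [m Jm] := JN _ v0.
  exists (maxn n m) => //; rewrite /K/= in_itv/=.
  move: Jn Jm; rewrite /J/= !in_itv/= => /andP[n1 n2] /andP[m1 m2].
  apply/andP; split.
    apply: le_trans ux; apply: Fle => //; apply: le_trans n1.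
    by apply: lole; rewrite leq_maxl.
  apply: (le_trans xv); apply: Fle => //; apply: (le_trans m2).
  by apply: hile; rewrite leq_maxr.
have KI n (x : R) : x \in `[F (lo n), F (hi n)] -> x \in I.
  by move=> xK; suff : [set` I] x by []; rewrite -UK; exists n.
have J0 n (v : R) : v \in `[lo n, hi n] -> 0 < v.
  by rewrite in_itv/= => /andP[+ _]; exact: lt_le_trans.
have dFv (v : R) : 0 < v -> derivable F v 1 by move=> /dF[].
have cF (v : R) : 0 < v -> {for v, continuous F}.
  by move=> /dFv/derivable1_diffP/differentiable_continuous.
have F'f (v : R) : 0 < v -> F^`()%classic v = f v by rewrite derive1E => /dF[].
have F'cvg (v : R) : 0 < v -> F^`()%classic x @[x --> v] --> f v.
  move=> v0; apply: (@cvg_trans _ (f x @[x --> v])); last exact: cf.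
  apply: near_eq_cvg; near=> x; apply/esym; apply: F'f.
  by near: x; exact: lt_nbhsr.
have E n : (\int[lebesgue_measure]_(x in K n) (G x)%:E =
    \int[lebesgue_measure]_(v in J n) (G (F v) * f v)%:E)%E.
  rewrite integration_by_substitution_increasing//.
  - apply: eq_integral => v; rewrite inE => /J0 v0.
    by rewrite !fctE F'f.
  - by move=> u v /J0 u0 _; exact: incF.
  - move=> v; rewrite in_itv/= => /andP[v1 _].
    have v0 : 0 < v by exact: lt_trans v1.
    by rewrite /continuous_at F'f//; exact: F'cvg.
  - by apply/cvg_ex; exists (f (lo n)); apply: cvg_at_right_filter; exact: F'cvg.
  - by apply/cvg_ex; exists (f (hi n)); apply: cvg_at_left_filter; exact: F'cvg.
  - split.
    + move=> v; rewrite in_itv/= => /andP[v1 _].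
      by apply: dFv; exact: lt_trans v1.
    + by apply: cvg_at_right_filter; exact: cF.
    + by apply: cvg_at_left_filter; exact: cF.
  - by apply: continuous_in_subspaceT => x; rewrite inE => /KI; exact: cG.
have mG : measurable_fun [set` I] G by exact: pointwise_continuous_measurable.
have mGF : measurable_fun (`]0, +oo[%classic : set R) (fun v : R => G (F v) * f v).
  apply: pointwise_continuous_measurable => v; rewrite in_itv/= andbT => v0.
  apply: cvgM; last exact: cf.
  by apply: continuous_comp; [exact: cF|apply: cG; exact: FI].
rewrite -UK -UJ.
apply: (@eq_integral_exhaustion _ K J G (fun v => G (F v) * f v)) => //.
- move=> n m x nm; rewrite /K/= !in_itv/= => /andP[x1 x2].
  by rewrite (le_trans _ x1) ?(le_trans x2)//; apply: Fle => //; [exact: hile|exact: lole].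
- by move=> n; exact: measurable_itv.
- by rewrite UK.
- by move=> n x /KI; exact: G0.
- move=> n m x nm; rewrite /J/= !in_itv/= => /andP[x1 x2].
  by rewrite (le_trans _ x1) ?(le_trans x2)//; [exact: hile|exact: lole].
- by move=> n; exact: measurable_itv.
- by rewrite UJ.
- move=> n x /J0 x0; rewrite mulr_ge0//; last exact: f0.
  by apply: G0; exact: FI.
Unshelve. all: by end_near. Qed.

(** The derivative [G] may blow up at either end point, as the power kernel
does; its integrability is part of the conclusion. *)
Lemma ge0_FTC2_oo (R : realType) (H G : R -> R) (c d : R) : c < d ->
  {within `[c, d], continuous H} ->
  (forall x : R, c < x < d -> is_derive x (1 : R) H (G x)) ->
  (forall x : R, c < x < d -> {for x, continuous G}) ->
  (forall x : R, c < x < d -> 0 <= G x) ->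
  (\int[lebesgue_measure]_(x in `]c, d[) (G x)%:E = (H d - H c)%:E)%E.
Proof.
move=> cd /(continuous_within_itvP _ cd)[cH Hc Hd] dH cG G0.
pose e (n : nat) : R := (d - c) / n.+3%:R.
have dc0 : 0 < d - c by rewrite subr_gt0.
have e0 n : 0 < e n by rewrite divr_gt0// ltr0n.
have e3 n : e n <= (d - c) / 3.
  by rewrite ler_pM2l// lef_pV2 ?posrE ?ltr0n// ler_nat.
have ele n m : (n <= m)%N -> e m <= e n.
  by move=> nm; rewrite ler_pM2l// lef_pV2 ?posrE ?ltr0n// ler_nat.
have ecvg : e n @[n --> \oo] --> (0 : R).
  rewrite -[X in _ --> X](mulr0 (d - c)); apply: cvgMr.
  have := @cvg_harmonic R.
  rewrite -(@cvg_shiftn 2); apply: cvg_trans; apply: near_eq_cvg.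
  by near=> n; rewrite /= addn2.
pose K n : set R := `[c + e n, d - e n]%classic.
have Kin n x : K n x -> c < x < d.
  by rewrite /K/= in_itv/= => /andP[x1 x2]; have := e0 n; lra.
have UK : \bigcup_n K n = `]c, d[%classic.
  apply/seteqP; split => [x [n _] /Kin|x]; first by rewrite /= in_itv.
  rewrite /= in_itv/= => /andP[cx xd].
  have m0 : 0 < Num.min (x - c) (d - x) by rewrite lt_min !subr_gt0 cx.
  have [n en] : exists n, e n < Num.min (x - c) (d - x).
    move/cvgrPdist_lt : ecvg => /(_ _ m0)[n _ /(_ n (leqnn n))].
    by rewrite /= sub0r normrN ger0_norm ?ltW// => h; exists n.
  exists n => //; rewrite /K/= in_itv/=; move: en; rewrite lt_min => /andP[].
  by move=> h1 h2; apply/andP; split; lra.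
have mG : measurable_fun (`]c, d[%classic : set R) G.
  by apply: pointwise_continuous_measurable => x; rewrite in_itv/=; exact: cG.
have E n : (\int[lebesgue_measure]_(x in K n) (G x)%:E = (H (d - e n) - H (c + e n))%:E)%E.
  have ltn : c + e n < d - e n by have := e3 n; have := e0 n; lra.
  have cHx (x : R) : c < x < d -> {for x, continuous H}.
    by move=> /dH[+ _]; move=> /derivable1_diffP/differentiable_continuous.
  have i1 : c < c + e n < d by have := e3 n; have := e0 n; lra.
  have i2 : c < d - e n < d by have := e3 n; have := e0 n; lra.
  rewrite (continuous_FTC2 ltn (F := H)) ?EFinB//.
  - by apply: continuous_in_subspaceT => x; rewrite inE => /(Kin n)/cG.
  - split.
    + by move=> x xi; have [] := dH x (Kin n x (subset_itv_oo_cc xi)).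
    + by apply: cvg_at_right_filter; exact: cHx.
    + by apply: cvg_at_left_filter; exact: cHx.
  - move=> x xi; rewrite derive1E.
    by have [] := dH x (Kin n x (subset_itv_oo_cc xi)).
rewrite -UK.
apply: (integral_exhaustion _ _ _ _ E).
- move=> n m x nm; rewrite /K/= !in_itv/= => /andP[x1 x2].
  by have := ele _ _ nm; move=> h; apply/andP; split; lra.
- by move=> n; exact: measurable_itv.
- by rewrite UK.
- by move=> n x /Kin; exact: G0.
- apply: cvg_EFin; first by near=> n.
  apply: cvgB.
  + move/cvg_at_leftP: Hd; apply; split.
      by move=> n; rewrite ltrBlDr ltrDl.
    by rewrite -[X in _ --> X]subr0; apply: cvgB => //; exact: cvg_cst.
  + move/cvg_at_rightP: Hc; apply; split.
      by move=> n; rewrite ltrDl.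
    by rewrite -[X in _ --> X]addr0; apply: cvgD => //; exact: cvg_cst.
Unshelve. all: by end_near. Qed.

(** [u ^ (g - 1)], extended by [0] so that a convolution with it is an integral over
the whole line. *)
Definition kern (R : realType) (g u : R) : R := if 0 < u then u `^ (g - 1) else 0.

Lemma kern_ge0 (R : realType) (g u : R) : 0 <= kern g u.
Proof. by rewrite /kern; case: ifP => // _; exact: powR_ge0. Qed.

Lemma kern_gt0 (R : realType) (g u : R) : 0 < u -> 0 < kern g u.
Proof. by rewrite /kern => u0; rewrite u0 powR_gt0. Qed.

Lemma kernE (R : realType) (g u : R) : 0 < u -> kern g u = u `^ (g - 1).
Proof. by rewrite /kern => ->. Qed.

Lemma kern_le0 (R : realType) (g u : R) : u <= 0 -> kern g u = 0.
Proof. by rewrite /kern; case: ltP. Qed.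

Lemma kern1 (R : realType) (u : R) : 0 < u -> kern 1 u = 1.
Proof. by move=> u0; rewrite kernE// subrr powRr0. Qed.

Lemma continuous_powRl (R : realType) (r x : R) : 0 < x ->
  {for x, continuous (fun u : R => u `^ r)}.
Proof.
move=> x0; have [+ _] := is_derive1_powR r x0.
by move=> /derivable1_diffP/differentiable_continuous.
Qed.

Lemma kern_continuous (R : realType) (g u : R) : u != 0 ->
  {for u, continuous (kern g)}.
Proof.
rewrite neq_lt => /orP[u0|u0].
  have : (cst (0 : R)) x @[x --> u] --> kern g u.
    by rewrite kern_le0 ?ltW//; exact: cvg_cst.
  apply: cvg_trans; apply: near_eq_cvg; near=> x.
  by rewrite kern_le0//; near: x; exact: lt_le_nbhsl.
have : x `^ (g - 1) @[x --> u] --> kern g u.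
  by rewrite kernE//; exact: continuous_powRl.
apply: cvg_trans; apply: near_eq_cvg; near=> x.
by rewrite kernE//; near: x; exact: lt_nbhsr.
Unshelve. all: by end_near. Qed.

Lemma measurable_kern (R : realType) (g : R) : measurable_fun [set: R] (kern g).
Proof.
apply: measurable_fun_ifT => //.
exact: measurable_fun_ltr.
Qed.

Lemma kern_anti (R : realType) (g u v : R) : g <= 1 -> 0 < u -> u <= v ->
  kern g v <= kern g u.
Proof.
move=> g1 u0 uv; rewrite !kernE ?(lt_le_trans u0)//.
rewrite -[g - 1]opprK -[- (g - 1)]/(- (g - 1)) ![_ `^ (- - _)]powRN lef_pV2 ?posrE ?powR_gt0 ?(lt_le_trans u0)//.
by apply: ge0_ler_powR; rewrite ?nnegrE; lra.
Qed.

(** * Integrals of the power kernel; Beta and Gamma functions *)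

Lemma integral_support (R : realType) (I : interval R) (f : R -> R) :
  (forall x, x \notin I -> f x = 0) ->
  (\int[lebesgue_measure]_x (f x)%:E = \int[lebesgue_measure]_(x in [set` I]) (f x)%:E)%E.
Proof.
move=> f0; rewrite [RHS]integral_mkcond; apply: eq_integral => x _.
rewrite patchE; case: ifPn => //; rewrite notin_setE /= => /negP xI.
by rewrite f0.
Qed.

Lemma kern_cvg0 (R : realType) (g : R) : 1 < g -> kern g u @[u --> (0 : R)] --> (0 : R).
Proof.
move=> g1; apply/cvgrPdist_lt => e e0.
have g0 : 0 < g - 1 by rewrite subr_gt0.
near=> u; rewrite sub0r normrN ger0_norm ?kern_ge0//.
have [u0|u0] := leP u 0; first by rewrite kern_le0.
rewrite kernE//.
have -> : e = (e `^ (g - 1)^-1) `^ (g - 1).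
  by rewrite -powRrM mulVf ?gt_eqF// powRr1// ltW.
rewrite gt0_ltr_powR ?nnegrE ?ltW ?powR_gt0//.
by near: u; apply: lt_nbhsl; rewrite powR_gt0.
Unshelve. all: by end_near. Qed.

Lemma kern_continuousT (R : realType) (g : R) : 1 < g -> continuous (kern g).
Proof.
move=> g1 u; have [->|u0] := eqVneq u 0; last exact: kern_continuous.
by rewrite /continuous_at kern_le0//; exact: kern_cvg0.
Qed.

Lemma is_derive_kern (R : realType) (g u : R) : 0 < u ->
  is_derive u (1 : R) (kern (g + 1)) (g * kern g u).
Proof.
move=> u0; rewrite kernE//.
have -> : g * u `^ (g - 1) = 'D_1 (fun x : R => x `^ g) u.
  by have [_ ->] := is_derive1_powR g u0.
have [d _] := is_derive1_powR g u0.
have h : {near u, (fun x : R => x `^ g) =1 kern (g + 1)}.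
  by near=> x; rewrite kernE ?addrK//; near: x; exact: lt_nbhsr.
split; first exact: near_eq_derivable h d.
by apply/esym; apply: near_eq_derive h.
Unshelve. all: by end_near. Qed.

(** The antiderivative of the kernel of order [g] is the kernel of order [g + 1],
up to the factor [g]. *)
Lemma integral_kern_sub (R : realType) (g a t : R) : 0 < g -> a < t ->
  (\int[lebesgue_measure]_(s in `]a, t[) (kern g (t - s))%:E =
   (kern (g + 1) (t - a) / g)%:E)%E.
Proof.
move=> g0 at_; have g1 : 1 < g + 1 by rewrite ltrDr.
have ct : continuous (fun s : R => t - s).
  by move=> s; apply: cvgB; [exact: cvg_cst|exact: cvg_id].
have cH : {within `[a, t], continuous (fun s : R => - g^-1 * kern (g + 1) (t - s))}.
  apply: continuous_subspaceT => s; apply: cvgM; first exact: cvg_cst.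
  by apply: (@continuous_comp _ _ _ (fun s => t - s)); [exact: ct|exact: kern_continuousT].
have dH : forall x : R, a < x < t -> is_derive x (1 : R) (fun s : R => - g^-1 * kern (g + 1) (t - s)) (kern g (t - x)).
  move=> x /andP[ax xt]; have tx : 0 < t - x by rewrite subr_gt0.
  have d1 : is_derive x (1 : R) (fun s : R => t - s) (-1).
    by rewrite -[X in is_derive _ _ _ X]sub0r; exact: (is_deriveB (is_derive_cst t x 1) (is_derive_id x 1)).
  have d2 := @is_derive1_comp _ (kern (g + 1)) (fun s => t - s) _ _ _ (is_derive_kern g tx) d1.
  apply: (@is_derive_eq _ _ _ (- g^-1 \*: (kern (g + 1) \o (fun s => t - s)))).
  rewrite /GRing.scale/=; field.
  by rewrite gt_eqF.
have cG : forall x : R, a < x < t -> {for x, continuous (fun s => kern g (t - s))}.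
  move=> x /andP[ax xt]; apply: (@continuous_comp _ _ _ (fun s => t - s)); first exact: ct.
  by apply: kern_continuous; rewrite subr_eq0 gt_eqF.
have G0 : forall x : R, a < x < t -> 0 <= kern g (t - x).
  by move=> x _; exact: kern_ge0.
rewrite (ge0_FTC2_oo at_ cH dH cG G0).
by rewrite subrr (kern_le0 _ (lexx _)) mulr0 sub0r mulNr opprK mulrC.
Qed.

Lemma integral_kern (R : realType) (g a t : R) : 0 < g -> a < t ->
  (\int[lebesgue_measure]_(s in `]a, t[) (kern g (s - a))%:E =
   (kern (g + 1) (t - a) / g)%:E)%E.
Proof.
move=> g0 at_; have g1 : 1 < g + 1 by rewrite ltrDr.
have ct : continuous (fun s : R => s - a).
  by move=> s; apply: cvgB; [exact: cvg_id|exact: cvg_cst].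
have cH : {within `[a, t], continuous (fun s : R => g^-1 * kern (g + 1) (s - a))}.
  apply: continuous_subspaceT => s; apply: cvgM; first exact: cvg_cst.
  by apply: (@continuous_comp _ _ _ (fun s => s - a)); [exact: ct|exact: kern_continuousT].
have dH : forall x : R, a < x < t -> is_derive x (1 : R) (fun s : R => g^-1 * kern (g + 1) (s - a)) (kern g (x - a)).
  move=> x /andP[ax xt]; have tx : 0 < x - a by rewrite subr_gt0.
  have d1 : is_derive x (1 : R) (fun s : R => s - a) 1.
    by apply: is_derive_eq; rewrite subr0.
  have d2 := @is_derive1_comp _ (kern (g + 1)) (fun s => s - a) _ _ _ (is_derive_kern g tx) d1.
  apply: (@is_derive_eq _ _ _ (g^-1 \*: (kern (g + 1) \o (fun s => s - a)))).
  rewrite /GRing.scale/=; field.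
  by rewrite gt_eqF.
have cG : forall x : R, a < x < t -> {for x, continuous (fun s => kern g (s - a))}.
  move=> x /andP[ax xt]; apply: (@continuous_comp _ _ _ (fun s => s - a)); first exact: ct.
  by apply: kern_continuous; rewrite subr_eq0 gt_eqF.
have G0 : forall x : R, a < x < t -> 0 <= kern g (x - a).
  by move=> x _; exact: kern_ge0.
rewrite (ge0_FTC2_oo at_ cH dH cG G0).
by rewrite subrr (kern_le0 _ (lexx _)) mulr0 subr0 mulrC.
Qed.

Lemma integral_expRM (R : realType) (c : R) : 0 < c ->
  (\int[lebesgue_measure]_(y in `]0%R, +oo[) (expR (- (y * c)))%:E = (c^-1)%:E)%E.
Proof.
move=> c0.
have dF (x : R) : is_derive x (1 : R) (fun y : R => - c^-1 * expR (- (y * c))) (expR (- (x * c))).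
  have d1 : is_derive x (1 : R) (fun y : R => - (y * c)) (- c).
    by apply: is_derive_eq; rewrite /GRing.scale/=; ring.
  have d2 := @is_derive1_comp _ expR _ _ _ _ (is_derive_expR _) d1.
  apply: (@is_derive_eq _ _ _ (- c^-1 \*: (expR \o (fun y => - (y * c))))).
  by rewrite /GRing.scale/=; field; rewrite gt_eqF.
have cE : continuous (fun y : R => expR (- (y * c))).
  move=> x; apply: (@continuous_comp _ _ _ (fun y : R => - (y * c)) expR); last exact: continuous_expR.
  by apply: cvgN; apply: cvgM; [exact: cvg_id|exact: cvg_cst].
rewrite integral_itv_obnd_cbnd; last first.
  apply/measurable_EFinP; apply: pointwise_continuous_measurable => x _.
  exact: cE.
rewrite (@ge0_continuous_FTC2y _ _ (fun y : R => - c^-1 * expR (- (y * c))) 0 0).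
- by rewrite mul0r oppr0 expR0 mulr1 -EFinB sub0r opprK.
- by move=> x _; exact: expR_ge0.
- exact: continuous_subspaceT.
- rewrite -[X in _ --> X](mulr0 (- c^-1)); apply: cvgMr.
  have h : (x * c : R) @[x --> +oo] --> +oo by apply: gt0_cvgMly.
  exact: (cvg_comp _ _ h (@cvgr_expR R)).
- by move=> x _; have [] := dF x.
- apply: cvg_at_right_filter; apply: cvgM; first exact: cvg_cst.
  exact: cE.
- by move=> x _; rewrite derive1E; have [_ ->] := dF x.
Qed.

Lemma integral_oy_scale (R : realType) (G : R -> R) (y : R) : 0 < y ->
  (forall x, 0 < x -> {for x, continuous G}) -> (forall x, 0 < x -> 0 <= G x) ->
  (\int[lebesgue_measure]_(x in `]0%R, +oo[) (G x)%:E =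
   \int[lebesgue_measure]_(v in `]0%R, +oo[) (G (y * v) * y)%:E)%E.
Proof.
move=> y0 cG G0.
have dF (v : R) : 0 < v -> is_derive v (1 : R) (fun v : R => y * v) y.
  by move=> _; apply: is_derive_eq; rewrite /GRing.scale/= mulr1.
have cf (v : R) : 0 < v -> {for v, continuous (cst y : R -> R)}.
  by move=> _; exact: cvg_cst.
rewrite (ge0_substitution_oy dF cf)//.
- by move=> u v u0 uv; rewrite ltr_pM2l.
- by move=> v v0; rewrite in_itv/= andbT mulr_gt0.
- move=> x; rewrite in_itv/= andbT => x0; exists (x / y), (x / y).
  by rewrite divr_gt0// mulrC divfK ?gt_eqF.
- by move=> x; rewrite in_itv/= andbT; exact: cG.
- by move=> x; rewrite in_itv/= andbT; exact: G0.
Qed.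

(** The substitution [x = (r + t k w) / (1 + k w)] maps the half line onto [(r, t)];
it sends both the Beta integral and the Poisson integral of the kernel to
[beta_int], for two values of [k]. *)
Lemma mobius_substitution (R : realType) (G : R -> R) (r t k : R) :
  r < t -> 0 < k ->
  (forall x, r < x < t -> {for x, continuous G}) ->
  (forall x, r < x < t -> 0 <= G x) ->
  (\int[lebesgue_measure]_(x in `]r, t[) (G x)%:E =
   \int[lebesgue_measure]_(w in `]0%R, +oo[)
     (G ((r + t * (k * w)) / (1 + k * w)) * (k * (t - r) / (1 + k * w) ^+ 2))%:E)%E.
Proof.
move=> rt k0 cG G0.
have kw (w : R) : 0 < w -> 0 < 1 + k * w by move=> w0; rewrite addr_gt0// mulr_gt0.
pose f (w : R) := k * (t - r) / (1 + k * w) ^+ 2.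
have dF (v : R) : 0 < v -> is_derive v (1 : R) (fun w : R => (r + t * (k * w)) / (1 + k * w)) (f v).
  move=> v0; have kv := kw v v0.
  have kv0 : 1 + k * v != 0 by rewrite gt_eqF.
  have d1 : is_derive v (1 : R) (fun w : R => r + t * (k * w)) (t * k).
    by apply: is_derive_eq; rewrite /GRing.scale/=; ring.
  have d2 : is_derive v (1 : R) (fun w : R => 1 + k * w) k.
    by apply: is_derive_eq; rewrite /GRing.scale/=; ring.
  have d3 := @is_deriveV _ (fun w => 1 + k * w) _ _ _ kv0 d2.
  have d4 := is_deriveM d1 d3.
  apply: (@is_derive_eq _ _ _ _ _ _ _ _ d4).
  by rewrite /f /GRing.scale/=; field.
have cf (v : R) : 0 < v -> {for v, continuous f}.
  move=> v0; apply: cvgM; first exact: cvg_cst.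
  apply: cvgV; first by rewrite expf_eq0/= gt_eqF// kw.
  apply: cvgM; apply: cvgD; try exact: cvg_cst.
    by apply: cvgM; [exact: cvg_cst|exact: cvg_id].
  by apply: cvgM; [exact: cvg_cst|exact: cvg_id].
have FE (w : R) : 0 < w ->
    (r + t * (k * w)) / (1 + k * w) = t - (t - r) / (1 + k * w).
  by move=> /kw w0; field; rewrite gt_eqF.
rewrite (ge0_substitution_oy dF cf)//.
- move=> u v u0 uv; have v0 := lt_trans u0 uv.
  rewrite !FE// ltrD2l ltrN2 ltr_pM2l ?subr_gt0// ltf_pV2 ?posrE ?kw//.
  by rewrite ltrD2l ltr_pM2l.
- move=> v v0; rewrite in_itv/= FE//.
  have h : 0 < (t - r) / (1 + k * v) by rewrite divr_gt0 ?kw// subr_gt0.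
  have h2 : (t - r) / (1 + k * v) < t - r.
    by rewrite ltr_pdivrMr ?kw// ltr_pMr ?subr_gt0// ltrDl mulr_gt0.
  by apply/andP; split; lra.
- move=> x; rewrite in_itv/= => /andP[rx xt].
  pose w := (x - r) / (t - x) / k.
  have tx : 0 < t - x by rewrite subr_gt0.
  have w0 : 0 < w by rewrite !divr_gt0// subr_gt0.
  exists w, w; suff -> : (r + t * (k * w)) / (1 + k * w) = x by [].
  have -> : k * w = (x - r) / (t - x) by rewrite /w mulrC divfK// gt_eqF.
  field; apply/andP; split; first by rewrite gt_eqF.
  by rewrite gt_eqF//; lra.
Qed.

Lemma powR_mobius (R : realType) (al A w : R) : 0 < A -> 0 < w ->
  (w * A) `^ (al - 1) * A `^ (- al) = w `^ (al - 1) / A.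
Proof.
move=> A0 w0; rewrite powRM ?ltW// -mulrA -powRD; last first.
  by apply/implyP => _; rewrite gt_eqF.
by rewrite (_ : al - 1 - al = -1) ?powR_inv1 ?ltW//; ring.
Qed.

(** The Beta function at [(al, 1 - al)], written as an integral over the half line. *)
Definition beta_int (R : realType) (al : R) : \bar R :=
  (\int[lebesgue_measure]_(w in `]0%R, +oo[) (w `^ (al - 1) / (1 + w))%:E)%E.

Lemma beta_kern (R : realType) (al r t : R) : r < t ->
  (\int[lebesgue_measure]_(s in `]r, t[) ((s - r) `^ (al - 1) * (t - s) `^ (- al))%:E =
   beta_int al)%E.
Proof.
move=> rt; rewrite (@mobius_substitution _ _ r t 1)//.
- apply: eq_integral => w; rewrite inE/= in_itv/= andbT => w0; congr EFin.
  rewrite !mul1r; have w1 : 0 < 1 + w by rewrite addr_gt0.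
  have w10 : 1 + w != 0 by rewrite gt_eqF.
  pose A := (t - r) / (1 + w).
  have A0 : 0 < A by rewrite divr_gt0// subr_gt0.
  rewrite (_ : _ - r = w * A); last by rewrite /A; field.
  rewrite (_ : t - _ = A); last by rewrite /A; field.
  rewrite powR_mobius// /A; field.
  by rewrite w10 subr_eq0 gt_eqF.
- move=> x /andP[rx xt]; apply: cvgM.
    apply: (@continuous_comp _ _ _ (fun s : R => s - r) (fun u => u `^ _)).
      by apply: cvgB; [exact: cvg_id|exact: cvg_cst].
    by apply: continuous_powRl; rewrite subr_gt0.
  apply: (@continuous_comp _ _ _ (fun s : R => t - s) (fun u => u `^ _)).
    by apply: cvgB; [exact: cvg_cst|exact: cvg_id].
  by apply: continuous_powRl; rewrite subr_gt0.
- by move=> x _; rewrite mulr_ge0 ?powR_ge0.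
Qed.

(** [(t - s) ^ (- al) / (t0 - s)] is, up to a factor, the density of the swept measure
of the point [t0] on the half line before [t]: it reproduces at [t0] the kernels
issued from any [r < t].  The substitution with [k = (t0 - r) / (t0 - t)]
reduces it to [beta_int]. *)
Lemma poisson_kern (R : realType) (al r t t0 : R) : r < t -> t < t0 ->
  (\int[lebesgue_measure]_(s in `]r, t[)
     ((s - r) `^ (al - 1) * (t - s) `^ (- al) / (t0 - s))%:E =
   ((t0 - r) `^ (al - 1) * (t0 - t) `^ (- al))%:E * beta_int al)%E.
Proof.
move=> rt tt0.
have d0 : 0 < t0 - t by rewrite subr_gt0.
have d1 : 0 < t0 - r by lra.
pose k := (t0 - r) / (t0 - t).
have k0 : 0 < k by rewrite divr_gt0.
rewrite (@mobius_substitution _ _ r t k)//.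
- rewrite /beta_int -ge0_integralZl_EFin//; last 3 first.
  + move=> w; rewrite /= in_itv/= andbT => w0.
    by rewrite lee_fin divr_ge0 ?powR_ge0// addr_ge0// ltW.
  + apply/measurable_EFinP; apply: pointwise_continuous_measurable => x.
    rewrite in_itv/= andbT => x0; apply: cvgM; first exact: continuous_powRl.
    apply: cvgV; first by rewrite gt_eqF// addr_gt0.
    by apply: cvgD; [exact: cvg_cst|exact: cvg_id].
  + by rewrite mulr_ge0 ?powR_ge0.
  apply: eq_integral => w; rewrite inE/= in_itv/= andbT => w0; rewrite -EFinM; congr EFin.
  have w1 : 0 < 1 + k * w by rewrite addr_gt0// mulr_gt0.
  have w10 : 1 + k * w != 0 by rewrite gt_eqF.
  pose A := (t - r) / (1 + k * w).
  have A0 : 0 < A by rewrite divr_gt0// subr_gt0.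
  rewrite (_ : _ - r = (k * w) * A); last by rewrite /A; field.
  rewrite (_ : t - _ = A); last by rewrite /A; field.
  rewrite (_ : t0 - _ = (t0 - r) * (1 + w) / (1 + k * w)); last first.
    rewrite /k; field; rewrite (gt_eqF d0)/=.
    by rewrite gt_eqF// addr_gt0// mulr_gt0.
  have kw0 : 0 < k * w by rewrite mulr_gt0.
  rewrite (powR_mobius _ A0 kw0).
  rewrite (powRM _ (ltW k0) (ltW w0)).
  have di0 : 0 <= (t0 - t)^-1 by rewrite invr_ge0 ltW.
  rewrite {1}/k (powRM _ (ltW d1) di0).
  have -> : (t0 - t)^-1 `^ (al - 1) = (t0 - t) `^ (- al) * (t0 - t).
    have -> : (t0 - t)^-1 = (t0 - t) `^ (-1) by rewrite powR_inv1// ltW.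
    rewrite -[X in _ = _ * X](powRr1 (ltW d0)) -powRrM -powRD; last first.
      by apply/implyP => _; rewrite gt_eqF.
    by congr (_ `^ _); ring.
  rewrite /A /k; field.
  have c1 : 0 < t0 - t + (t0 - r) * w by rewrite addr_gt0// mulr_gt0.
  have c2 : 0 < 1 + w by rewrite addr_gt0.
  by do ![apply/andP; split]; rewrite gt_eqF// subr_gt0.
- move=> x /andP[rx xt]; apply: cvgM; first apply: cvgM.
  + apply: (@continuous_comp _ _ _ (fun s : R => s - r) (fun u => u `^ _)).
      by apply: cvgB; [exact: cvg_id|exact: cvg_cst].
    by apply: continuous_powRl; rewrite subr_gt0.
  + apply: (@continuous_comp _ _ _ (fun s : R => t - s) (fun u => u `^ _)).
      by apply: cvgB; [exact: cvg_cst|exact: cvg_id].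
    by apply: continuous_powRl; rewrite subr_gt0.
  + apply: cvgV; first by rewrite gt_eqF// subr_gt0 (lt_trans xt).
    by apply: cvgB; [exact: cvg_cst|exact: cvg_id].
- move=> x /andP[_ xt]; rewrite divr_ge0 ?mulr_ge0 ?powR_ge0// subr_ge0.
  by rewrite ltW// (lt_trans xt).
Qed.

Lemma tonelliR (R : realType) (h : R -> R -> R) :
  measurable_fun [set: measurableTypeR R * measurableTypeR R] (fun p => h p.1 p.2) ->
  (forall x y, 0 <= h x y) ->
  (\int[lebesgue_measure]_x \int[lebesgue_measure]_y (h x y)%:E =
   \int[lebesgue_measure]_y \int[lebesgue_measure]_x (h x y)%:E)%E.
Proof.
move=> mh h0.
have mh' : measurable_fun [set: measurableTypeR R * measurableTypeR R]
    (EFin \o (fun p => h p.1 p.2)) by exact/measurable_EFinP.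
exact: (@fubini_tonelli _ _ (measurableTypeR R) (measurableTypeR R) R lebesgue_measure
  lebesgue_measure _ mh' (fun p => h0 p.1 p.2)).
Qed.

Lemma gamma_kernE (R : realType) (g : R) :
  (\int[lebesgue_measure]_(x in `]0%R, +oo[) (x `^ (g - 1) * expR (- x))%:E =
   \int[lebesgue_measure]_x (kern g x * expR (- x))%:E)%E.
Proof.
rewrite (@integral_support _ `]0%R, +oo[).
  by apply: eq_integral => x; rewrite inE/= in_itv/= andbT => x0; rewrite kernE.
by move=> x; rewrite in_itv/= andbT -leNgt => x0; rewrite kern_le0// mul0r.
Qed.

(** Finiteness is split at [1]: the power is integrable below, the exponential above. *)
Lemma integral_gamma_lty (R : realType) (g : R) : 0 < g -> g <= 1 ->
  (\int[lebesgue_measure]_x (kern g x * expR (- x))%:E < +oo)%E.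
Proof.
move=> g0 g1.
pose f1 (x : R) := if x < 1 then kern g x else 0.
pose f2 (x : R) := if 0 < x then expR (- x) else 0.
have mE : measurable_fun [set: R] (fun x : R => expR (- x)).
  apply: continuous_measurable_fun => x.
  apply: (@continuous_comp _ _ _ (fun x : R => - x) expR); last exact: continuous_expR.
  by apply: cvgN; exact: cvg_id.
have m1 : measurable_fun [set: R] f1.
  apply: measurable_fun_ifT => //; first exact: measurable_fun_ltr.
  exact: measurable_kern.
have m2 : measurable_fun [set: R] f2.
  by apply: measurable_fun_ifT => //; exact: measurable_fun_ltr.
have f10 x : 0 <= f1 x by rewrite /f1; case: ifP => // _; exact: kern_ge0.
have f20 x : 0 <= f2 x by rewrite /f2; case: ifP => // _; exact: expR_ge0.
apply: (@le_lt_trans _ _ (\int[lebesgue_measure]_x ((f1 x)%:E + (f2 x)%:E))%E).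
  apply: ge0_le_integral => //.
  - by move=> x _; rewrite lee_fin mulr_ge0 ?kern_ge0 ?expR_ge0.
  - apply/measurable_EFinP; apply: measurable_funM => //; exact: measurable_kern.
  - by apply: emeasurable_funD; exact/measurable_EFinP.
  - move=> x _; rewrite -EFinD lee_fin /f1 /f2.
    have [x0|x0] := leP x 0; first by rewrite kern_le0// mul0r; case: ifP => _; lra.
    case: ltP => x1.
      have h : expR (- x) <= 1 by rewrite expR_le1; lra.
      have := kern_ge0 g x; have := expR_ge0 (- x); nra.
    have h : kern g x <= 1.
      rewrite kernE// -[X in _ <= X](powRr0 x).
      by apply: ler_powR => //; lra.
    have := kern_ge0 g x; have := expR_ge0 (- x); nra.
rewrite ge0_integralD//; last 4 first.
- by move=> x _; rewrite lee_fin.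
- exact/measurable_EFinP.
- by move=> x _; rewrite lee_fin.
- exact/measurable_EFinP.
apply: lte_add_pinfty.
- rewrite (@integral_support _ `]0%R, 1[).
    rewrite (_ : (\int[lebesgue_measure]_(x in _) _ = \int[lebesgue_measure]_(x in `]0%R, 1%R[) (kern g (x - 0))%:E)%E).
      by rewrite integral_kern// ltry.
    apply: eq_integral => x; rewrite inE/= in_itv/= => /andP[x0 x1].
    by rewrite /f1 x1 subr0.
  move=> x; rewrite in_itv/= /f1 negb_and -!leNgt => /orP[x0|x1].
    by rewrite kern_le0 // if_same.
  by rewrite ltNge x1.
- rewrite (@integral_support _ `]0%R, +oo[).
    rewrite (_ : (\int[lebesgue_measure]_(x in _) _ = \int[lebesgue_measure]_(x in `]0%R, +oo[) (expR (- (x * 1)))%:E)%E).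
      by rewrite integral_expRM// ltry.
    apply: eq_integral => x; rewrite inE/= in_itv/= andbT => x0.
    by rewrite /f2 x0 mulr1.
  by move=> x; rewrite in_itv/= andbT /f2 => /negbTE ->.
Qed.

(** [Gamma] is the real part of an extended integral; finiteness of that integral
makes the two agree. *)
Lemma Gamma_fin (R : realType) (g : R) : 0 < g -> g <= 1 ->
  ((Gamma g)%:E = \int[lebesgue_measure]_x (kern g x * expR (- x))%:E)%E.
Proof.
move=> g0 g1; rewrite /Gamma /Rintegral gamma_kernE fineK//.
rewrite ge0_fin_numE ?integral_gamma_lty//.
by apply: integral_ge0 => x _; rewrite lee_fin mulr_ge0 ?kern_ge0 ?expR_ge0.
Qed.

Lemma Gamma_gt0 (R : realType) (g : R) : 0 < g -> g <= 1 -> 0 < Gamma g.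
Proof.
move=> g0 g1; rewrite -lte_fin Gamma_fin//.
have mf : measurable_fun [set: R] (fun x : R => kern g x * expR (- x)).
  apply: measurable_funM; first exact: measurable_kern.
  apply: continuous_measurable_fun => x.
  apply: (@continuous_comp _ _ _ (fun x : R => - x) expR); last exact: continuous_expR.
  by apply: cvgN; exact: cvg_id.
have h : (\int[lebesgue_measure]_(x in `]0%R, 1%R[) (kern g x * expR (- 1))%:E <=
    \int[lebesgue_measure]_x (kern g x * expR (- x))%:E)%E.
  apply: (@le_trans _ _ (\int[lebesgue_measure]_(x in `]0%R, 1%R[) (kern g x * expR (- x))%:E)%E).
    apply: ge0_le_integral => //.
    - by move=> x _; rewrite lee_fin mulr_ge0 ?kern_ge0 ?expR_ge0.
    - apply/measurable_EFinP; apply: measurable_funM => //.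
      by apply: measurable_funS (measurable_kern g).
    - by apply/measurable_EFinP; apply: measurable_funS mf.
    - move=> x; rewrite /= in_itv/= => /andP[x0 x1]; rewrite lee_fin.
      by apply: ler_wpM2l; [exact: kern_ge0|rewrite ler_expR; lra].
  apply: ge0_subset_integral => //.
  - exact/measurable_EFinP.
  - by move=> x _; rewrite lee_fin mulr_ge0 ?kern_ge0 ?expR_ge0.
apply: lt_le_trans h.
under eq_integral do rewrite mulrC EFinM.
rewrite ge0_integralZl_EFin//.
- rewrite (_ : (\int[lebesgue_measure]_(x in _) _ = \int[lebesgue_measure]_(x in `]0%R, 1%R[) (kern g (x - 0))%:E)%E).
    rewrite integral_kern// -EFinM lte_fin mulr_gt0 ?expR_gt0// divr_gt0//.
    by rewrite kern_gt0// subr0.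
  by apply: eq_integral => x _; rewrite subr0.
- by move=> x _; rewrite lee_fin kern_ge0.
- by apply/measurable_EFinP; apply: measurable_funS (measurable_kern g).
Qed.

Lemma Gamma1 (R : realType) : Gamma (1 : R) = 1.
Proof.
apply: EFin_inj; rewrite Gamma_fin// (@integral_support _ `]0%R, +oo[).
  rewrite (_ : (\int[lebesgue_measure]_(x in _) _ = \int[lebesgue_measure]_(x in `]0%R, +oo[) (expR (- (x * 1)))%:E)%E).
    by rewrite integral_expRM// invr1.
  apply: eq_integral => x; rewrite inE/= in_itv/= andbT => x0.
  by rewrite kern1// mul1r mulr1.
by move=> x; rewrite in_itv/= andbT -leNgt => x0; rewrite kern_le0// mul0r.
Qed.

(** Euler's proof: expand [1 / (1 + w)] as the integral of [exp (- y (1 + w))] and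
exchange the order of integration. *)
Lemma beta_int_Gamma (R : realType) (al : R) : 0 < al -> al < 1 ->
  beta_int al = (Gamma al * Gamma (1 - al))%:E.
Proof.
move=> al0 al1.
have be0 : 0 < 1 - al by rewrite subr_gt0.
have be1 : 1 - al <= 1 by rewrite gerBl ltW.
pose A : \bar R := (Gamma al)%:E.
pose e (y v : R) := if 0 < y then expR (- (y * (1 + v))) else 0.
pose h (y v : R) := kern al v * e y v.
have e0 y v : 0 <= e y v by rewrite /e; case: ifP => // _; exact: expR_ge0.
have h0 y v : 0 <= h y v by rewrite mulr_ge0 ?kern_ge0.
have mE : measurable_fun [set: R] (@expR R).
  by apply: continuous_measurable_fun; exact: continuous_expR.
have mh : measurable_fun [set: measurableTypeR R * measurableTypeR R] (fun p => h p.1 p.2).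
  apply: measurable_funM.
    by apply: measurableT_comp; [exact: measurable_kern|exact: measurable_snd].
  apply: measurable_fun_ifT => //.
    by apply: measurable_fun_ltr => //; exact: measurable_fst.
  apply: measurableT_comp; first exact: mE.
  apply: measurableT_comp; first exact: oppr_measurable.
  apply: measurable_funM; first exact: measurable_fst.
  by apply: measurable_funD => //; exact: measurable_snd.
have E1 (y : R) : (A * (kern (1 - al) y * expR (- y))%:E =
    \int[lebesgue_measure]_v (h y v)%:E)%E.
  have [y0|y0] := leP y 0.
    rewrite kern_le0// mul0r mule0; apply/esym/integral0_eq => v _.
    by rewrite /h /e ltNge y0/= mulr0.
  rewrite /A Gamma_fin ?(ltW al1)// -gamma_kernE.
  rewrite (integral_oy_scale y0); last 2 first.
  - move=> x x0; apply: cvgM; first exact: continuous_powRl.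
    apply: (@continuous_comp _ _ _ (fun x : R => - x) expR); last exact: continuous_expR.
    by apply: cvgN; exact: cvg_id.
  - by move=> x _; rewrite mulr_ge0 ?powR_ge0 ?expR_ge0.
  rewrite muleC -ge0_integralZl_EFin//; last 3 first.
  - by move=> v _; rewrite lee_fin !mulr_ge0 ?powR_ge0 ?expR_ge0// ltW.
  - apply/measurable_EFinP; apply: pointwise_continuous_measurable => v.
    rewrite in_itv/= andbT => v0; apply: cvgM; last exact: cvg_cst.
    have cy : {for v, continuous (fun v : R => y * v)}.
      by apply: cvgM; [exact: cvg_cst|exact: cvg_id].
    apply: cvgM.
      apply: (@continuous_comp _ _ _ (fun v : R => y * v) (fun u => u `^ _)) => //.
      by apply: continuous_powRl; rewrite mulr_gt0.
    apply: (@continuous_comp _ _ _ (fun v : R => - (y * v)) expR); last exact: continuous_expR.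
    exact: cvgN.
  - by rewrite mulr_ge0 ?kern_ge0 ?expR_ge0.
  rewrite [RHS](@integral_support _ `]0%R, +oo[); last first.
    by move=> v; rewrite in_itv/= andbT -leNgt => v0; rewrite /h kern_le0// mul0r.
  apply: eq_integral => v; rewrite inE/= in_itv/= andbT => v0.
  rewrite -EFinM /h /e y0 !kernE// powRM ?ltW//; congr EFin.
  have -> : y * (1 + v) = y + y * v by ring.
  rewrite opprD expRD.
  have -> : y `^ (1 - al - 1) = (y `^ (al - 1) * y)^-1.
    rewrite -[X in _ * X](powRr1 (ltW y0)) -powRD; last first.
      by apply/implyP => _; rewrite gt_eqF.
    by rewrite -powRN; congr (_ `^ _); ring.
  by field; rewrite !gt_eqF// powR_gt0.
have E2 (v : R) : (\int[lebesgue_measure]_y (h y v)%:E = (kern al v / (1 + v))%:E)%E.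
  have [v0|v0] := leP v 0.
    by rewrite kern_le0// mul0r; apply: integral0_eq => y _; rewrite /h kern_le0// mul0r.
  rewrite (@integral_support _ `]0%R, +oo[); last first.
    by move=> y; rewrite in_itv/= andbT /h /e => /negbTE ->; rewrite mulr0.
  have v1 : 0 < 1 + v by rewrite addr_gt0.
  rewrite EFinM -(integral_expRM v1) -ge0_integralZl_EFin ?kern_ge0//.
  - by apply: eq_integral => y; rewrite inE/= in_itv/= andbT => y0; rewrite /h /e y0.
  - apply/measurable_EFinP; apply: pointwise_continuous_measurable => x _.
    apply: (@continuous_comp _ _ _ (fun x : R => - (x * (1 + v))) expR); last exact: continuous_expR.
    by apply: cvgN; apply: cvgM; [exact: cvg_id|exact: cvg_cst].
rewrite EFinM (Gamma_fin be0 be1) -ge0_integralZl_EFin//; last 3 first.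
- by move=> x _; rewrite lee_fin mulr_ge0 ?kern_ge0 ?expR_ge0.
- apply/measurable_EFinP; apply: measurable_funM; first exact: measurable_kern.
  by apply: measurableT_comp; [exact: mE|exact: oppr_measurable].
- by apply/ltW/Gamma_gt0 => //; exact: ltW.
under eq_integral do rewrite E1.
rewrite tonelliR//.
under eq_integral do rewrite E2.
rewrite /beta_int [RHS](@integral_support _ `]0%R, +oo[); last first.
  by move=> x; rewrite in_itv/= andbT -leNgt => x0; rewrite kern_le0// mul0r.
by apply: eq_integral => x; rewrite inE/= in_itv/= andbT => x0; rewrite kernE.
Qed.

(** * The normalized kernel of fractional integration *)

Notation integrableR f := ((@lebesgue_measure _).-integrable [set: _] (EFin \o f)).

(** Extension by [0] outside the open interval, so that all the integrals are
integrals over the line and Fubini needs no domains. *)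
Definition cut (R : realType) (a b : R) (f : R -> R) (s : R) : R :=
  if (a < s) && (s < b) then f s else 0.

Lemma cutE (R : realType) (a b : R) (f : R -> R) s : a < s < b -> cut a b f s = f s.
Proof. by rewrite /cut => ->. Qed.

Lemma cut_out (R : realType) (a b : R) (f : R -> R) s : ~~ (a < s < b) -> cut a b f s = 0.
Proof. by rewrite /cut => /negbTE ->. Qed.

Lemma measurable_cut (R : realType) (a b : R) (f : R -> R) :
  measurable_fun (`]a, b[%classic : set R) f -> measurable_fun [set: R] (cut a b f).
Proof.
move=> mf; rewrite (_ : cut a b f = f \_ (`]a, b[%classic : set R)).
  by apply/(measurable_restrictT _ _).1.
apply/funext => s; rewrite patchE /cut.
by case: ifPn => h; [rewrite mem_set//= in_itv|rewrite memNset//= in_itv/=; exact/negP].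
Qed.

Lemma integral_cut (R : realType) (a b : R) (f : R -> R) :
  (\int[lebesgue_measure]_s (cut a b f s)%:E = \int[lebesgue_measure]_(s in `]a, b[) (f s)%:E)%E.
Proof.
rewrite (@integral_support _ `]a, b[).
  by apply: eq_integral => s; rewrite inE/= in_itv/= => sab; rewrite cutE.
by move=> s; rewrite in_itv/=; exact: cut_out.
Qed.

Lemma ge0_integrableR (R : realType) (f : R -> R) (c : R) :
  measurable_fun [set: R] f -> (forall x, 0 <= f x) ->
  (\int[lebesgue_measure]_x (f x)%:E <= c%:E)%E ->
  integrableR f /\ \int[lebesgue_measure]_x f x <= c.
Proof.
move=> mf f0 fc; have mE : measurable_fun [set: R] (EFin \o f) by exact/measurable_EFinP.
split.
  apply/integrableP; split => //.
  under eq_integral => x _ do rewrite /= ger0_norm//.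
  exact: le_lt_trans (ltry c).
rewrite -lee_fin /Rintegral fineK//.
rewrite ge0_fin_numE; first exact: le_lt_trans (ltry c).
by apply: integral_ge0 => x _; rewrite lee_fin.
Qed.

Lemma le_integrableR (R : realType) (f g : R -> R) :
  measurable_fun [set: R] f -> (forall x, `|f x| <= g x) ->
  integrableR g -> integrableR f.
Proof.
move=> mf fg; apply: le_integrable => //; first exact/measurable_EFinP.
by move=> x _ /=; rewrite lee_fin (le_trans (fg x))// ler_norm.
Qed.

Lemma EFin_Rintegral (R : realType) (f : R -> R) : integrableR f ->
  ((\int[lebesgue_measure]_x f x)%:E = \int[lebesgue_measure]_x (f x)%:E)%E.
Proof.
move=> If; rewrite /Rintegral fineK//; exact: integrable_fin_num If.
Qed.

Lemma RintegralZ (R : realType) (f : R -> R) (k : R) : integrableR f ->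
  integrableR (fun x => k * f x) /\
  \int[lebesgue_measure]_x (k * f x) = k * \int[lebesgue_measure]_x f x.
Proof.
move=> If; split; first by have := integrableZl (measurableT) k If.
by rewrite RintegralZl.
Qed.

Lemma fubiniR (R : realType) (h : R -> R -> R) :
  measurable_fun [set: measurableTypeR R * measurableTypeR R] (fun p => h p.1 p.2) ->
  (\int[lebesgue_measure]_x \int[lebesgue_measure]_y `|h x y|%:E < +oo)%E ->
  \int[lebesgue_measure]_x \int[lebesgue_measure]_y h x y =
  \int[lebesgue_measure]_y \int[lebesgue_measure]_x h x y.
Proof.
move=> mh hfin.
pose f (p : measurableTypeR R * measurableTypeR R) : \bar R := (h p.1 p.2)%:E.
have mf : measurable_fun setT f by exact/measurable_EFinP.
have If : ((@lebesgue_measure R) \x (@lebesgue_measure R))%E.-integrable setT f.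
  by apply/(integrable12ltyP _ _ mf).
have E1 : (\int[lebesgue_measure]_x (\int[lebesgue_measure]_y h x y)%:E =
    \int[lebesgue_measure]_x fubini_F lebesgue_measure f x)%E.
  apply: ae_eq_integral => //.
  - apply/measurable_EFinP; rewrite /Rintegral.
    exact: (measurableT_comp _ (measurable_fubini_F If)).
  - exact: measurable_fubini_F If.
  - have := ae_integrable1 If; apply: filterS => x Ix _.
    by rewrite /Rintegral fineK//; exact: integrable_fin_num Ix.
have E2 : (\int[lebesgue_measure]_y (\int[lebesgue_measure]_x h x y)%:E =
    \int[lebesgue_measure]_y fubini_G lebesgue_measure f y)%E.
  apply: ae_eq_integral => //.
  - apply/measurable_EFinP; rewrite /Rintegral.
    exact: (measurableT_comp _ (measurable_fubini_G If)).
  - exact: measurable_fubini_G If.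
  - have := ae_integrable2 If; apply: filterS => x Ix _.
    by rewrite /Rintegral fineK//; exact: integrable_fin_num Ix.
rewrite [LHS]/Rintegral [RHS]/Rintegral; congr fine.
by rewrite E1 E2; exact: Fubini If.
Qed.

Lemma ge0_integral_opp (R : realType) (f : R -> \bar R) :
  measurable_fun [set: R] f -> (forall x, 0 <= f x)%E ->
  (\int[lebesgue_measure]_x f x = \int[lebesgue_measure]_x f (- x)%R)%E.
Proof.
move=> mf f0.
have mo : measurable_fun [set: measurableTypeR R] (-%R : measurableTypeR R -> measurableTypeR R).
  exact: oppr_measurable.
have h := @ge0_integral_pushforward _ _ (measurableTypeR R) (measurableTypeR R) R -%R
  mo lebesgue_measure setT f measurableT mf (fun y _ => f0 y).
rewrite preimage_setT in h; rewrite -[RHS]h.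
by apply: eq_measure_integral => //= A mA _; exact/esym/lebesgue_measureN.
Qed.

Lemma Rintegral_opp (R : realType) (f : R -> R) : measurable_fun [set: R] f ->
  \int[lebesgue_measure]_x f x = \int[lebesgue_measure]_x f (- x).
Proof.
move=> mf; have mE : measurable_fun [set: R] (EFin \o f) by exact/measurable_EFinP.
rewrite /Rintegral; congr fine; rewrite integralE [RHS]integralE; congr (_ - _)%E.
- rewrite [LHS](ge0_integral_opp (f := ((EFin \o f)^\+)%E)); last exact: funepos_ge0.
    by apply: eq_integral => x _; rewrite !unlock.
  exact: measurable_funepos.
- rewrite [LHS](ge0_integral_opp (f := ((EFin \o f)^\-)%E)); last exact: funeneg_ge0.
    by apply: eq_integral => x _; rewrite !unlock.
  exact: measurable_funeneg.
Qed.

Definition fk (R : realType) (al u : R) : R := (Gamma al)^-1 * kern al u.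

Section fk.
Context {R : realType} (al : R).
Hypotheses (al0 : 0 < al) (al1 : al <= 1).

Lemma Gamma_inv_gt0 : 0 < (Gamma al)^-1.
Proof. by rewrite invr_gt0 Gamma_gt0. Qed.

Lemma fk_ge0 (u : R) : 0 <= fk al u.
Proof. by rewrite mulr_ge0 ?kern_ge0// ltW// Gamma_inv_gt0. Qed.

Lemma fk_gt0 (u : R) : 0 < u -> 0 < fk al u.
Proof. by move=> u0; rewrite mulr_gt0 ?kern_gt0// Gamma_inv_gt0. Qed.

Lemma fk_le0 (u : R) : u <= 0 -> fk al u = 0.
Proof. by move=> u0; rewrite /fk kern_le0// mulr0. Qed.

Lemma measurable_fk : measurable_fun [set: R] (fk al).
Proof. by apply: measurable_funM => //; exact: measurable_kern. Qed.

Lemma fk_continuous (u : R) : u != 0 -> {for u, continuous (fk al)}.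
Proof. by move=> u0; apply: cvgM; [exact: cvg_cst|exact: kern_continuous]. Qed.

Lemma fk_anti (u v : R) : 0 < u -> u <= v -> fk al v <= fk al u.
Proof.
move=> u0 uv; rewrite ler_wpM2l ?kern_anti//.
by rewrite ltW// Gamma_inv_gt0.
Qed.

Lemma measurable_fk_sub (t : R) : measurable_fun [set: R] (fun s => fk al (t - s)).
Proof. by apply: measurableT_comp; [exact: measurable_fk|exact: measurable_funB]. Qed.

Lemma measurable_fk_sub' (t : R) : measurable_fun [set: R] (fun s => fk al (s - t)).
Proof. by apply: measurableT_comp; [exact: measurable_fk|exact: measurable_funB]. Qed.

Lemma measurable_fk2 :
  measurable_fun [set: measurableTypeR R * measurableTypeR R] (fun p => fk al (p.1 - p.2)).
Proof.
apply: measurableT_comp; first exact: measurable_fk.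
by apply: measurable_funB; [exact: measurable_fst|exact: measurable_snd].
Qed.

Lemma integral_fk_sub (a t : R) : a < t ->
  (\int[lebesgue_measure]_(s in `]a, t[) (fk al (t - s))%:E =
   ((Gamma al)^-1 * (kern (al + 1) (t - a) / al))%:E)%E.
Proof.
move=> at_; rewrite EFinM -integral_kern_sub// -ge0_integralZl_EFin//.
- by move=> x _; rewrite lee_fin kern_ge0.
- apply/measurable_EFinP; apply: (measurable_funS (measurableT)) => //.
  by apply: measurableT_comp; [exact: measurable_kern|exact: measurable_funB].
- exact/ltW/Gamma_inv_gt0.
Qed.

Lemma integral_fk (a t : R) : a < t ->
  (\int[lebesgue_measure]_(s in `]a, t[) (fk al (s - a))%:E =
   ((Gamma al)^-1 * (kern (al + 1) (t - a) / al))%:E)%E.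
Proof.
move=> at_; rewrite EFinM -integral_kern// -ge0_integralZl_EFin//.
- by move=> x _; rewrite lee_fin kern_ge0.
- apply/measurable_EFinP; apply: (measurable_funS (measurableT)) => //.
  by apply: measurableT_comp; [exact: measurable_kern|exact: measurable_funB].
- exact/ltW/Gamma_inv_gt0.
Qed.

End fk.

Lemma fk1 (R : realType) (u : R) : 0 < u -> fk 1 u = 1.
Proof. by move=> u0; rewrite /fk Gamma1 invr1 mul1r kern1. Qed.

(** The convolution of the kernels of orders [al] and [1 - al] is the Heaviside
function; hence the semigroup property. *)
Lemma beta_fk (R : realType) (al r t : R) : 0 < al -> al < 1 -> r < t ->
  (\int[lebesgue_measure]_s (fk (1 - al) (t - s) * fk al (s - r))%:E = 1)%E.
Proof.
move=> al0 al1 rt.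
have be0 : 0 < 1 - al by rewrite subr_gt0.
have be1 : 1 - al <= 1 by rewrite gerBl ltW.
have G1 := Gamma_gt0 al0 (ltW al1); have G2 := Gamma_gt0 be0 be1.
rewrite (@integral_support _ `]r, t[); last first.
  move=> s; rewrite in_itv/= negb_and -!leNgt => /orP[sr|ts].
    by rewrite (@fk_le0 _ _ (s - r)) ?mulr0// subr_le0.
  by rewrite fk_le0 ?mul0r// subr_le0.
have := @beta_kern R al _ _ rt; rewrite beta_int_Gamma// => h.
pose c := (Gamma al * Gamma (1 - al))^-1.
have c0 : 0 < c by rewrite invr_gt0 mulr_gt0.
transitivity (c%:E * (Gamma al * Gamma (1 - al))%:E)%E; last first.
  by rewrite -EFinM mulVf// gt_eqF// mulr_gt0.
rewrite -h -ge0_integralZl_EFin//; last 3 first.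
- by move=> x _; rewrite lee_fin mulr_ge0 ?powR_ge0.
- apply/measurable_EFinP; apply: (measurable_funS (measurableT)) => //.
  apply: measurable_funM.
    by apply: (measurableT_comp (measurable_powR (al - 1))); exact: measurable_funB.
  by apply: (measurableT_comp (measurable_powR (- al))); exact: measurable_funB.
- exact: ltW.
apply: eq_integral => s; rewrite inE/= in_itv/= => /andP[rs st].
rewrite -EFinM /fk !kernE ?subr_gt0//; congr EFin.
rewrite (_ : 1 - al - 1 = - al); last by ring.
by rewrite /c invfM; ring.
Qed.

Lemma poisson_fk (R : realType) (al r t t0 : R) : 0 < al -> al < 1 -> r < t -> t < t0 ->
  (\int[lebesgue_measure]_(s in `]r, t[)
     (fk al (s - r) * ((t - s) `^ (- al) / (t0 - s)))%:E =
   (fk al (t0 - r) * ((t0 - t) `^ (- al) * (Gamma al * Gamma (1 - al))))%:E)%E.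
Proof.
move=> al0 al1 rt tt0.
have be0 : 0 < 1 - al by rewrite subr_gt0.
have G1 := Gamma_gt0 al0 (ltW al1).
have := @poisson_kern R al _ _ _ rt tt0; rewrite beta_int_Gamma// => h.
transitivity (((Gamma al)^-1)%:E * (\int[lebesgue_measure]_(s in `]r, t[)
     ((s - r) `^ (al - 1) * (t - s) `^ (- al) / (t0 - s))%:E))%E; last first.
  rewrite h -!EFinM /fk kernE ?subr_gt0 ?(lt_trans rt)//; congr EFin; ring.
rewrite -ge0_integralZl_EFin//.
- apply: eq_integral => s; rewrite inE/= in_itv/= => /andP[rs st].
  rewrite -EFinM /fk kernE ?subr_gt0//; congr EFin; ring.
- move=> x; rewrite /= in_itv/= => /andP[_ xt].
  rewrite lee_fin divr_ge0 ?mulr_ge0 ?powR_ge0// subr_ge0.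
  by rewrite ltW// (lt_trans xt).
- apply/measurable_EFinP; apply: pointwise_continuous_measurable.
  move=> x; rewrite in_itv/= => /andP[rx xt]; apply: cvgM; first apply: cvgM.
  + apply: (@continuous_comp _ _ _ (fun s : R => s - r) (fun u => u `^ _)).
      by apply: cvgB; [exact: cvg_id|exact: cvg_cst].
    by apply: continuous_powRl; rewrite subr_gt0.
  + apply: (@continuous_comp _ _ _ (fun s : R => t - s) (fun u => u `^ _)).
      by apply: cvgB; [exact: cvg_cst|exact: cvg_id].
    by apply: continuous_powRl; rewrite subr_gt0.
  + apply: cvgV; first by rewrite gt_eqF// subr_gt0 (lt_trans xt).
    by apply: cvgB; [exact: cvg_cst|exact: cvg_id].
- by rewrite invr_ge0 ltW.
Qed.

(** * Fractional integrals of functions on the line *)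

(** The left fractional integral of a function that vanishes before the base point. *)
Definition rl (R : realType) (al : R) (f : R -> R) (t : R) : R :=
  \int[lebesgue_measure]_s (fk al (t - s) * f s).

(** The right fractional integral of a function that vanishes after the end point. *)
Definition rrl (R : realType) (al : R) (f : R -> R) (t : R) : R :=
  \int[lebesgue_measure]_s (fk al (s - t) * f s).

Section rl.
Context {R : realType} (al : R).
Hypotheses (al0 : 0 < al) (al1 : al <= 1).
Local Notation fk := (fk al).
Local Notation rl := (rl al).

(** The bound [c] is asked of an extended integral, so the same hypothesis provides
integrability and the estimate. *)
Lemma rl_dominated (f g : R -> R) (t c : R) :
  measurable_fun [set: R] f -> measurable_fun [set: R] g ->
  (forall s, s < t -> `|f s| <= g s) -> (forall s, 0 <= g s) ->
  (\int[lebesgue_measure]_s (fk (t - s) * g s)%:E <= c%:E)%E ->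
  integrableR (fun s => fk (t - s) * f s) /\ `|rl f t| <= c.
Proof.
move=> mf mg fg g0 gc.
have mfg : measurable_fun [set: R] (fun s => fk (t - s) * g s).
  by apply: measurable_funM => //; exact: measurable_fk_sub.
have mff : measurable_fun [set: R] (fun s => fk (t - s) * f s).
  by apply: measurable_funM => //; exact: measurable_fk_sub.
have [Ig gc'] := @ge0_integrableR _ _ c mfg (fun s => mulr_ge0 (fk_ge0 al0 al1 _) (g0 s)) gc.
have le s : `|fk (t - s) * f s| <= fk (t - s) * g s.
  rewrite normrM (ger0_norm (fk_ge0 al0 al1 _)).
  have [st|ts] := ltP s t; first by apply: ler_wpM2l; [exact: fk_ge0|exact: fg].
  by rewrite fk_le0 ?subr_le0// !mul0r.
have If := le_integrableR mff le Ig.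
split => //; rewrite /rl; apply: le_trans gc'.
apply: (le_trans (le_normr_Rintegral measurableT If)).
apply: le_Rintegral => //.
exact: (integrable_norm If).
Qed.

Lemma rl_le (f g : R -> R) t :
  integrableR (fun s => fk (t - s) * f s) -> integrableR (fun s => fk (t - s) * g s) ->
  (forall s, s < t -> f s <= g s) -> rl f t <= rl g t.
Proof.
move=> If Ig fg; apply: le_Rintegral => // s _.
have [st|ts] := ltP s t; first by apply: ler_wpM2l; [exact: fk_ge0|exact: fg].
by rewrite fk_le0 ?mul0r// subr_le0.
Qed.

Lemma eq_rl (f g : R -> R) t : (forall s, s < t -> f s = g s) -> rl f t = rl g t.
Proof.
move=> fg; apply: eq_Rintegral => s _.
have [st|ts] := ltP s t; first by rewrite fg.
by rewrite fk_le0 ?mul0r// subr_le0.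
Qed.

Lemma rlD (f g : R -> R) t :
  integrableR (fun s => fk (t - s) * f s) -> integrableR (fun s => fk (t - s) * g s) ->
  integrableR (fun s => fk (t - s) * (f s + g s)) /\
  rl (fun s => f s + g s) t = rl f t + rl g t.
Proof.
move=> If Ig; split.
  have := integrableD measurableT If Ig; apply: eq_integrable => // s _ /=.
  by rewrite mulrDr EFinD.
by rewrite /rl -RintegralD//; apply: eq_Rintegral => s _; rewrite mulrDr.
Qed.

Lemma rlZ (f : R -> R) k t :
  integrableR (fun s => fk (t - s) * f s) ->
  integrableR (fun s => fk (t - s) * (k * f s)) /\
  rl (fun s => k * f s) t = k * rl f t.
Proof.
move=> If; have [I1 E1] := RintegralZ k If; split.
  by move: I1; apply: eq_integrable => // s _ /=; rewrite mulrCA.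
by rewrite -E1; apply: eq_Rintegral => s _; rewrite mulrCA.
Qed.

Lemma rlB (f g : R -> R) t :
  integrableR (fun s => fk (t - s) * f s) -> integrableR (fun s => fk (t - s) * g s) ->
  integrableR (fun s => fk (t - s) * (f s - g s)) /\
  rl (fun s => f s - g s) t = rl f t - rl g t.
Proof.
move=> If Ig; have [In En] := rlZ (-1) Ig.
have [I E] := rlD If In.
have e : (fun s => f s + -1 * g s) = (fun s => f s - g s).
  by apply/funext => s; rewrite mulN1r.
rewrite -e E En mulN1r; split => //.
by move: I; apply: eq_integrable => // s _ /=; rewrite mulN1r.
Qed.

Lemma rl_reflect (f : R -> R) t : measurable_fun [set: R] f ->
  rrl al f t = rl (fun s => f (- s)) (- t).
Proof.
move=> mf; rewrite /rrl Rintegral_opp.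
  by apply: eq_Rintegral => s _; rewrite addrC.
by apply: measurable_funM => //; exact: measurable_fk_sub'.
Qed.

(** The fractional integral of the constant [1] over an interval of length [d]. *)
Definition rlcst (d : R) := (Gamma al)^-1 * (kern (al + 1) d / al).

Lemma rlcst_ge0 d : 0 <= rlcst d.
Proof. by rewrite mulr_ge0 ?divr_ge0 ?kern_ge0 ?ltW// Gamma_inv_gt0. Qed.

Lemma rlcst_le d d' : d <= d' -> rlcst d <= rlcst d'.
Proof.
move=> dd; apply: ler_wpM2l; first exact/ltW/Gamma_inv_gt0.
apply: ler_wpM2r; first by rewrite invr_ge0 ltW.
have [d0|d0] := leP d 0; first by rewrite kern_le0// kern_ge0.
rewrite !kernE ?(lt_le_trans d0)// addrK.
by apply: ge0_ler_powR; rewrite ?nnegrE// ltW// (lt_le_trans d0).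
Qed.

Lemma rlcst_cvg0 : rlcst d @[d --> (0 : R)] --> (0 : R).
Proof.
rewrite [X in _ --> X](_ : 0 = (Gamma al)^-1 * (0 / al)); last by rewrite mul0r mulr0.
apply: cvgM; first exact: cvg_cst.
apply: cvgM; last exact: cvg_cst.
by apply: kern_cvg0; rewrite ltrDr.
Qed.

Lemma integral_fk_cut a b t B : 0 <= B ->
  (\int[lebesgue_measure]_s (fk (t - s) * cut a b (cst B) s)%:E <=
   (B * rlcst (t - a))%:E)%E.
Proof.
move=> B0; have m1 : measurable_fun [set: R] (fun s => fk (t - s) * cut a b (cst B) s).
  by apply: measurable_funM; [exact: measurable_fk_sub|exact: measurable_cut].
have [at_|ta] := ltP a t; last first.
  rewrite integral0_eq; first by rewrite lee_fin mulr_ge0// rlcst_ge0.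
  move=> s _; rewrite /cut; case: ifPn => [/andP[as_ _]|_]; last by rewrite mulr0.
  by rewrite fk_le0 ?mul0r// subr_le0 (le_trans ta)// ltW.
rewrite EFinM /rlcst -integral_fk_sub// -ge0_integralZl_EFin//; last 2 first.
- by move=> s _; rewrite lee_fin fk_ge0.
- by apply/measurable_EFinP; apply: measurable_funS (measurable_fk_sub al t).
rewrite (@integral_support _ `]a, t[).
  apply: ge0_le_integral => //.
  - move=> s _; rewrite lee_fin mulr_ge0 ?fk_ge0// /cut; by case: ifP.
  - by apply/measurable_EFinP; apply: measurable_funS m1.
  - apply/measurable_EFinP; apply: measurable_funM => //.
    by apply: measurable_funS (measurable_fk_sub al t).
  - move=> s _; rewrite -EFinM lee_fin mulrC ler_wpM2r ?fk_ge0//.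
    by rewrite /cut; case: ifP.
move=> s; rewrite in_itv/= negb_and -!leNgt => /orP[sa|ts].
  by rewrite cut_out ?mulr0// negb_and -leNgt sa.
by rewrite fk_le0 ?mul0r// subr_le0.
Qed.

Lemma rl_bounded (f : R -> R) a b t B : 0 <= B -> measurable_fun [set: R] f ->
  (forall s, ~~ (a < s < b) -> f s = 0) ->
  (forall s, a < s < b -> s < t -> `|f s| <= B) ->
  integrableR (fun s => fk (t - s) * f s) /\ `|rl f t| <= B * rlcst (t - a).
Proof.
move=> B0 mf f0 fB.
apply: (@rl_dominated f (cut a b (cst B))) => //.
- exact: measurable_cut.
- move=> s st; have [sab|sab] := boolP (a < s < b).
    by rewrite cutE// fB.
  by rewrite cut_out// f0// normr0.
- by move=> s; rewrite /cut; case: ifP.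
- exact: integral_fk_cut.
Qed.

Lemma rl_integrable (f : R -> R) (t r B : R) : 0 < r -> 0 <= B ->
  integrableR f -> (forall s, t - r < s < t -> `|f s| <= B) ->
  integrableR (fun s => fk (t - s) * f s).
Proof.
move=> r0 B0 If fB.
have mf : measurable_fun [set: R] f by have /measurable_int/measurable_EFinP := If.
pose t1 := t - r.
have mcut : measurable_fun [set: R] (cut t1 t f).
  by apply: measurable_cut; exact: measurable_funS mf.
have [I1 _] : integrableR (fun s => fk (t - s) * cut t1 t f s) /\ `|rl (cut t1 t f) t| <= B * rlcst (t - t1).
  apply: (@rl_bounded _ t1 t) => // [s h|s h _]; first exact: cut_out.
  by rewrite cutE//; exact: fB.
have [I2 _] : integrableR (fun s => fk r * `|f s|) /\ True.
  by split=> //; have [] := RintegralZ (fk r) (integrable_norm If).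
have I3 : integrableR (fun s => `|fk (t - s) * cut t1 t f s| + fk r * `|f s|).
  exact: (integrableD measurableT (integrable_norm I1) I2).
apply: le_integrableR I3.
  by apply: measurable_funM => //; exact: measurable_fk_sub.
move=> s; have [ts|st] := leP t s.
  by rewrite fk_le0 ?subr_le0// mul0r normr0 addr_ge0// mulr_ge0// fk_ge0.
have [s1|s1] := ltP t1 s.
  by rewrite cutE ?s1// lerDl mulr_ge0// fk_ge0.
rewrite normrM (ger0_norm (fk_ge0 al0 al1 _)) ler_wpDl// ler_wpM2r// fk_anti//.
by move: s1; rewrite /t1; lra.
Qed.

(** Near [t0] the data is bounded and the contribution of a short window is small
uniformly; away from [t0] the integrand is dominated and depends continuously on
the time. *)
Lemma rl_continuous (f : R -> R) (t0 r B : R) : 0 < r -> 0 <= B ->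
  integrableR f -> (forall s, t0 - r < s < t0 + r -> `|f s| <= B) ->
  {for t0, continuous (rl f)}.
Proof.
move=> r0 B0 If fB; apply/cvgrPdist_lt => e e0.
have mf : measurable_fun [set: R] f by have /measurable_int/measurable_EFinP := If.
have e6 : 0 < e / (3 * (B + 1)) by rewrite divr_gt0// mulr_gt0// ltr_wpDl.
have [rho [rho0 rhor rhoe]] : exists rho, [/\ 0 < rho, rho < r & rlcst (2 * rho) < e / (3 * (B + 1))].
  move/cvgrPdist_lt : rlcst_cvg0 => /(_ _ e6)/nbhs_ballP[d /= d0 hd].
  exists (Num.min (r / 2) (d / 3)).
  have m0 : 0 < Num.min (r / 2) (d / 3) by rewrite lt_min !divr_gt0.
  have m1 : Num.min (r / 2) (d / 3) <= r / 2 by rewrite ge_min lexx.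
  have m2 : Num.min (r / 2) (d / 3) <= d / 3 by rewrite ge_min lexx orbT.
  split => //; first by lra.
  have := hd (2 * Num.min (r / 2) (d / 3)).
  rewrite /ball/= sub0r normrN ger0_norm ?mulr_ge0 ?ltW// => /(_ _).
  rewrite sub0r normrN ger0_norm ?rlcst_ge0//; apply; lra.
pose t1 := t0 - rho.
pose f1 s := if s < t1 then f s else 0.
pose f2 s := if s < t1 then 0 else f s.
have fE s : f s = f1 s + f2 s by rewrite /f1 /f2; case: ifP; rewrite ?addr0 ?add0r.
have mlt : measurable_fun [set: R] (fun s : R => s < t1) by exact: measurable_fun_ltr.
have mf1 : measurable_fun [set: R] f1 by exact: measurable_fun_ifT.
have mf2 : measurable_fun [set: R] f2 by exact: measurable_fun_ifT.
have If1 : integrableR f1.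
  apply: (@le_integrableR _ _ (fun s => `|f s|)) => //.
    by move=> s; rewrite /f1; case: ifP; rewrite ?normr0.
  exact: integrable_norm.
pose C := fk (rho / 2).
have rho2 : 0 < rho / 2 by rewrite divr_gt0.
have C0 : 0 <= C by exact: fk_ge0.
have dom t s : t0 - rho / 2 < t < t0 + rho / 2 -> `|fk (t - s) * f1 s| <= C * `|f1 s|.
  move=> /andP[ta tb]; rewrite normrM (ger0_norm (fk_ge0 al0 al1 _)) /f1.
  case: ltP => [st|]; last by rewrite normr0 !mulr0.
  apply: ler_wpM2r => //; apply: fk_anti => //; move: st; rewrite /t1; lra.
have [ICf1 _] : integrableR (fun s => C * `|f1 s|) /\ True.
  by split=> //; have [] := RintegralZ C (integrable_norm If1).
have I1 t : t0 - rho / 2 < t < t0 + rho / 2 -> integrableR (fun s => fk (t - s) * f1 s).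
  move=> ht; apply: (le_integrableR _ (dom t ^~ ht)) => //.
  by apply: measurable_funM => //; exact: measurable_fk_sub.
have c1 : {for t0, continuous (rl f1)}.
  have := @continuity_under_integral R _ (measurableTypeR R) lebesgue_measure
    (fun t s => fk (t - s) * f1 s) setT measurableT (t0 - rho / 2) (t0 + rho / 2).
  move=> /(_ _ _ (fun s => C * `|f1 s|)); apply.
  - by move=> t; rewrite /= in_itv/=; exact: I1.
  - apply/aeW => s _ t; rewrite inE/= in_itv/= => /andP[ta tb].
    rewrite /f1; case: ltP => [st|_]; last first.
      have -> : (fun x => fk (x - s) * 0) = cst 0 by apply/funext => x; rewrite mulr0.
      exact: cvg_cst.
    apply: cvgM; last exact: cvg_cst.
    apply: (@continuous_comp _ _ _ (fun x : R => x - s) fk).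
      by apply: cvgB; [exact: cvg_id|exact: cvg_cst].
    by apply: fk_continuous; rewrite subr_eq0 gt_eqF//; move: st; rewrite /t1; lra.
  - exact: ICf1.
  - move=> t; rewrite /= in_itv/= => ht; apply/aeW => s _; exact: dom.
  - by rewrite inE/= in_itv/=; apply/andP; split; lra.
have I2 t : t0 - rho / 2 < t < t0 + rho / 2 ->
    integrableR (fun s => fk (t - s) * f2 s) /\ `|rl f2 t| <= B * rlcst (2 * rho).
  move=> /andP[ta tb].
  pose a := t0 - rho - rho / 2.
  pose g := cut a (t0 + r) f2.
  have mg : measurable_fun [set: R] g by apply: measurable_cut; exact: measurable_funS mf2.
  have gf s : s < t -> g s = f2 s.
    move=> st; rewrite /g; have [as_|sa] := ltP a s; first by rewrite cutE// as_/=; lra.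
    rewrite cut_out; last by rewrite negb_and -leNgt sa.
    by rewrite /f2 ifT// /t1; move: sa; rewrite /a; lra.
  have gB s : a < s < t0 + r -> s < t -> `|g s| <= B.
    move=> sab st; rewrite /g cutE// /f2; case: ltP; first by rewrite normr0.
    by rewrite /t1 => h; apply: fB; apply/andP; split; lra.
  have [J1 J2] := rl_bounded B0 mg (fun s h => cut_out _ h) gB.
  have E s : fk (t - s) * g s = fk (t - s) * f2 s.
    have [/gf -> //|ts] := ltP s t.
    by rewrite fk_le0 ?mul0r// subr_le0.
  have E' : (fun s => fk (t - s) * g s) = (fun s => fk (t - s) * f2 s) by apply/funext.
  move: J1 J2; rewrite E' => J1 J2; split => //.
  rewrite -(eq_rl gf); apply: (le_trans J2); rewrite ler_wpM2l// rlcst_le// /a; lra.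
have rlE t : t0 - rho / 2 < t < t0 + rho / 2 -> rl f t = rl f1 t + rl f2 t.
  move=> ht; have [_ <-] := rlD (I1 t ht) (I2 t ht).1.
  by apply: eq_rl => s _; exact: fE.
have Be : B * rlcst (2 * rho) <= e / 3.
  apply: (@le_trans _ _ (B * (e / (3 * (B + 1))))); first by rewrite ler_wpM2l// ltW.
  rewrite mulrA ler_pdivrMr ?mulr_gt0 ?ltr_wpDl//; nra.
near=> t.
have ht0 : t0 - rho / 2 < t0 < t0 + rho / 2 by apply/andP; split; lra.
have ht : t0 - rho / 2 < t < t0 + rho / 2.
  apply/andP; split; near: t.
    by apply: lt_nbhsr; lra.
  by apply: lt_nbhsl; lra.
rewrite (rlE _ ht0) (rlE _ ht).
have h1 : `|rl f1 t0 - rl f1 t| < e / 3.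
  by near: t; move/cvgrPdist_lt : c1; apply; rewrite divr_gt0.
have [_ h2] := I2 _ ht0; have [_ h3] := I2 _ ht.
rewrite opprD addrACA; apply: (le_lt_trans (ler_normD _ _)).
rewrite [ltRHS](_ : e = e / 3 + (e / 3 + e / 3)); last by field.
apply: (ltr_leD h1); apply: (le_trans (ler_normB _ _)).
by apply: lerD; [exact: le_trans h2 Be|exact: le_trans h3 Be].
Unshelve. all: by end_near. Qed.

End rl.

(** * Transposition and semigroup property *)

Section rl_fubini.
Context {R : realType} (al : R).
Hypotheses (al0 : 0 < al) (al1 : al <= 1).
Local Notation fk := (fk al).

(** Fubini for the kernel [fk (t - s)]: the transpose of the left fractional integral
is the right one. *)
Lemma rl_transpose (f g : R -> R) (a b B : R) : 0 <= B ->
  measurable_fun [set: R] f -> integrableR g ->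
  (forall s, ~~ (a < s < b) -> f s = 0) -> (forall s, `|f s| <= B) ->
  (forall t, ~~ (a < t < b) -> g t = 0) ->
  (forall s, a < s < b -> integrableR (fun t => fk (t - s) * g t)) ->
  \int[lebesgue_measure]_t (g t * rl al f t) =
  \int[lebesgue_measure]_s (f s * rrl al g s).
Proof.
move=> B0 mf Ig f0 fB g0 Ifg.
have mg : measurable_fun [set: R] g by have /measurable_int/measurable_EFinP := Ig.
pose h t s := g t * (fk (t - s) * f s).
have mh : measurable_fun [set: measurableTypeR R * measurableTypeR R] (fun p => h p.1 p.2).
  apply: measurable_funM.
    by apply: (measurableT_comp mg); exact: measurable_fst.
  apply: measurable_funM; first exact: measurable_fk2.
  by apply: (measurableT_comp mf); exact: measurable_snd.
pose C := B * rlcst al (b - a).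
have C0 : 0 <= C by rewrite mulr_ge0 ?rlcst_ge0.
have hfin : (\int[lebesgue_measure]_t \int[lebesgue_measure]_s `|h t s|%:E < +oo)%E.
  have [Ign _] := RintegralZ C (integrable_norm Ig).
  have : (\int[lebesgue_measure]_t (C * `|g t|)%:E < +oo)%E.
    by rewrite -EFin_Rintegral// ltry.
  apply: le_lt_trans; apply: ge0_le_integral => //.
  - by move=> t _; apply: integral_ge0 => s _; rewrite lee_fin.
  - apply: (@measurable_fun_fubini_tonelli_F _ _ _ _ _ lebesgue_measure
      (fun p : measurableTypeR R * measurableTypeR R => `|h p.1 p.2|%:E)).
    + by apply/measurable_EFinP; exact: measurableT_comp.
    + by move=> p; rewrite lee_fin.
  - apply/measurable_EFinP; apply: measurable_funM => //; exact: measurableT_comp.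
  - move=> t _; have [tab|/g0 gt] := boolP (a < t < b); last first.
      rewrite gt normr0 mulr0 integral0_eq// => s _.
      by rewrite /h gt mul0r normr0.
    rewrite mulrC EFinM.
    under eq_integral do rewrite /h normrM EFinM.
    rewrite ge0_integralZl_EFin//; last first.
      apply/measurable_EFinP; apply: measurableT_comp => //.
      by apply: measurable_funM => //; exact: measurable_fk_sub.
    apply: lee_wpmul2l; first by rewrite lee_fin.
    apply: (@le_trans _ _ (\int[lebesgue_measure]_s (fk (t - s) * cut a b (cst B) s)%:E)%E).
      apply: ge0_le_integral => //.
      - apply/measurable_EFinP; apply: measurableT_comp => //.
        by apply: measurable_funM => //; exact: measurable_fk_sub.
      - apply/measurable_EFinP; apply: measurable_funM; first exact: measurable_fk_sub.
        exact: measurable_cut.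
      - move=> s _; rewrite lee_fin normrM (ger0_norm (fk_ge0 al0 al1 _)).
        apply: ler_wpM2l; first exact: fk_ge0.
        by have [sab|sab] := boolP (a < s < b); [rewrite cutE|rewrite cut_out// f0// normr0].
    apply: (le_trans (integral_fk_cut al0 al1 a b t B0)).
    by rewrite lee_fin ler_wpM2l// rlcst_le// lerB// ltW//; case/andP : tab.
transitivity (\int[lebesgue_measure]_t \int[lebesgue_measure]_s h t s).
  apply: eq_Rintegral => t _; have [tab|/g0 gt] := boolP (a < t < b); last first.
    rewrite gt mul0r /h /Rintegral integral0_eq// => s _; by rewrite gt mul0r.
  have [If _] := @rl_bounded _ _ al0 al1 f a b t B B0 mf f0 (fun s _ _ => fB s).
  by have [_ <-] := RintegralZ (g t) If.
rewrite fubiniR//; apply: eq_Rintegral => s _.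
have [/Ifg I|/f0 fs] := boolP (a < s < b); last first.
  rewrite fs mul0r /h /Rintegral integral0_eq// => t _.
  by rewrite fs !mulr0.
have [_ <-] := RintegralZ (f s) I; apply: eq_Rintegral => t _.
by rewrite /h; ring.
Qed.

End rl_fubini.

(** After Fubini the inner integral is the one of [beta_fk], equal to [1] before [t]. *)
Lemma rl_semigroup (R : realType) (al : R) (f : R -> R) (t : R) :
  0 < al -> al < 1 -> integrableR f ->
  (forall s, s < t -> integrableR (fun r => fk al (s - r) * f r)) ->
  rl (1 - al) (rl al f) t = \int[lebesgue_measure]_s (if s < t then f s else 0).
Proof.
move=> al0 al1 If Iff.
have be0 : 0 < 1 - al by rewrite subr_gt0.
have be1 : 1 - al <= 1 by rewrite gerBl ltW.
have mf : measurable_fun [set: R] f by have /measurable_int/measurable_EFinP := If.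
pose k s r := fk (1 - al) (t - s) * fk al (s - r).
have k0 s r : 0 <= k s r.
  by apply: mulr_ge0; apply: fk_ge0 => //; exact: ltW.
have mk : measurable_fun [set: measurableTypeR R * measurableTypeR R] (fun p => k p.1 p.2).
  apply: measurable_funM; last exact: measurable_fk2.
  by apply: (measurableT_comp (measurable_fk_sub (1 - al) t)); exact: measurable_fst.
have mkr r : measurable_fun [set: R] (fun s => k s r).
  by apply: measurable_funM; [exact: measurable_fk_sub|exact: measurable_fk_sub'].
pose h s r := k s r * f r.
have mh : measurable_fun [set: measurableTypeR R * measurableTypeR R] (fun p => h p.1 p.2).
  by apply: measurable_funM => //; apply: (measurableT_comp mf); exact: measurable_snd.
have Ek r : (\int[lebesgue_measure]_s (k s r)%:E = (if (r < t)%R then 1 else 0)%:E)%E.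
  have [rt|tr] := ltP r t; first exact: beta_fk.
  apply: integral0_eq => s _; rewrite /k.
  have [st|ts] := ltP s t; last by rewrite fk_le0 ?mul0r// subr_le0.
  by rewrite (@fk_le0 _ _ (s - r)) ?mulr0// subr_le0 (le_trans _ tr)// ltW.
have Ih r : (\int[lebesgue_measure]_s `|h s r|%:E = (if (r < t)%R then `|f r| else 0)%:E)%E.
  under eq_integral do rewrite /h normrM (ger0_norm (k0 _ _)) mulrC EFinM.
  rewrite ge0_integralZl_EFin//; last 2 first.
  - by move=> s _; rewrite lee_fin.
  - by apply/measurable_EFinP; exact: mkr.
  by rewrite Ek -EFinM; case: ifP; rewrite ?mulr1 ?mulr0.
rewrite {1}/rl.
transitivity (\int[lebesgue_measure]_s \int[lebesgue_measure]_r h s r).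
  apply: eq_Rintegral => s _; have [st|ts] := ltP s t; last first.
    rewrite fk_le0 ?subr_le0// mul0r /Rintegral integral0_eq// => r _.
    by rewrite /h /k fk_le0 ?subr_le0// !mul0r.
  have [_ <-] := RintegralZ (fk (1 - al) (t - s)) (Iff s st).
  by apply: eq_Rintegral => r _; rewrite /h /k mulrA.
rewrite fubiniR//.
  apply: eq_Rintegral => r _.
  have [Ikr _] : integrableR (fun s => k s r) /\ \int[lebesgue_measure]_s k s r <= 1.
    by apply: ge0_integrableR => //; rewrite Ek lee_fin; case: ifP.
  transitivity (f r * \int[lebesgue_measure]_s k s r).
    have [_ <-] := RintegralZ (f r) Ikr.
    by apply: eq_Rintegral => s _; rewrite /h mulrC.
  by rewrite /Rintegral Ek/=; case: ifP; rewrite ?mulr1 ?mulr0.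
rewrite tonelliR//; last exact: measurableT_comp.
under eq_integral do rewrite Ih.
have : (\int[lebesgue_measure]_r (`|f r|)%:E < +oo)%E.
  by rewrite -EFin_Rintegral ?ltry//; exact: integrable_norm If.
apply: le_lt_trans; apply: ge0_le_integral => //.
- by move=> r _; rewrite lee_fin; case: ifP.
- apply/measurable_EFinP; apply: measurable_fun_ifT => //; first exact: measurable_fun_ltr.
  exact: measurableT_comp.
- by apply/measurable_EFinP; exact: measurableT_comp.
- by move=> r _; rewrite lee_fin; case: ifP.
Qed.

Lemma integrable_fubiniR (R : realType) (h : R -> R -> R) :
  measurable_fun [set: measurableTypeR R * measurableTypeR R] (fun p => h p.1 p.2) ->
  (\int[lebesgue_measure]_x \int[lebesgue_measure]_y `|h x y|%:E < +oo)%E ->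
  integrableR (fun x => \int[lebesgue_measure]_y h x y).
Proof.
move=> mh hfin.
pose f (p : measurableTypeR R * measurableTypeR R) : \bar R := (h p.1 p.2)%:E.
have mf : measurable_fun setT f by exact/measurable_EFinP.
have If : ((@lebesgue_measure R) \x (@lebesgue_measure R))%E.-integrable setT f.
  by apply/(integrable12ltyP _ _ mf).
have I1 := integrable_fubini_F If.
have m1 : measurable_fun setT (fun x => (\int[lebesgue_measure]_y h x y)%:E).
  apply/measurable_EFinP; rewrite /Rintegral.
  exact: (measurableT_comp _ (measurable_fubini_F If)).
apply/integrableP; split; first exact: m1.
have /integrableP[_ fin1] := I1; apply: le_lt_trans fin1.
apply: ge0_le_integral => //.
- exact: measurableT_comp.
- by apply: measurableT_comp => //; exact: measurable_fubini_F If.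
- move=> x _ /=; rewrite /fubini_F /f /Rintegral/=.
  by case: (integral _ _ _) => [r| |]/=; rewrite ?normr0 ?leey.
Qed.

(** * Exponential weights and Volterra equations *)

Lemma expR_powR_le (R : realType) (h l u : R) : 0 < h -> h <= 1 -> 0 < l -> 0 < u ->
  u `^ h * expR (- (l * u)) <= l `^ (- h).
Proof.
move=> h0 h1 l0 u0; have lu0 : 0 < l * u by rewrite mulr_gt0.
have e : (l * u) `^ h <= expR (l * u).
  have [lu1|lu1] := leP (l * u) 1.
    apply: (@le_trans _ _ 1); last by rewrite -expR0 ler_expR ltW.
    have <- : 1 `^ h = 1 :> R by rewrite powR1.
    by apply: ge0_ler_powR; rewrite ?nnegrE// ltW.
  apply: (@le_trans _ _ (l * u)); first by apply: ler1_powR => //; exact: ltW.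
  by apply: le_trans (expR_ge1Dx _); lra.
rewrite expRN ler_pdivrMr ?expR_gt0// powRN.
rewrite (powRM _ (ltW l0) (ltW u0)) in e.
by rewrite ler_pdivlMl ?powR_gt0.
Qed.

Section bielecki.
Context {R : realType} (al : R).
Hypotheses (al0 : 0 < al) (al1 : al <= 1).

(** Bielecki's exponential weight times the singularity that solutions with the
kernel as datum have at [a]. *)
Definition bweight (a b l s : R) : R := cut a b (fun s => kern al (s - a) * expR (l * (s - a))) s.

Lemma bweight_ge0 a b l s : 0 <= bweight a b l s.
Proof. by rewrite /bweight /cut; case: ifP => // _; rewrite mulr_ge0 ?kern_ge0 ?expR_ge0. Qed.

Lemma measurable_bweight a b l : measurable_fun [set: R] (bweight a b l).
Proof.
apply: measurable_cut; apply: pointwise_continuous_measurable => s.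
rewrite in_itv/= => /andP[as_ _].
have ca : {for s, continuous (fun s : R => s - a)}.
  by apply: cvgB; [exact: cvg_id|exact: cvg_cst].
apply: cvgM.
  apply: (@continuous_comp _ _ _ (fun s : R => s - a) (kern al)) => //.
  by apply: kern_continuous; rewrite subr_eq0 gt_eqF.
apply: (@continuous_comp _ _ _ (fun s : R => l * (s - a)) expR); last exact: continuous_expR.
by apply: cvgM; [exact: cvg_cst|exact: ca].
Qed.

(** Each of the two singularities is bounded away from its own half of the interval. *)
Lemma kern_conv_le (h a t : R) : 0 < h -> h <= 1 -> a < t ->
  (\int[lebesgue_measure]_(s in `]a, t[) (kern h (t - s) * kern al (s - a))%:E <=
   (kern h ((t - a) / 2) * (kern (al + 1) (t - a) / al) +
    kern al ((t - a) / 2) * (kern (h + 1) (t - a) / h))%:E)%E.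
Proof.
move=> h0 h1 at_; set d := (t - a) / 2.
have d0 : 0 < d by rewrite divr_gt0// subr_gt0.
have mka : measurable_fun (`]a, t[%classic : set R) (fun s => kern al (s - a)).
  apply: (measurable_funS (measurableT)) => //.
  by apply: measurableT_comp; [exact: measurable_kern|exact: measurable_funB].
have mkh : measurable_fun (`]a, t[%classic : set R) (fun s => kern h (t - s)).
  apply: (measurable_funS (measurableT)) => //.
  by apply: measurableT_comp; [exact: measurable_kern|exact: measurable_funB].
rewrite EFinD (EFinM (kern h d)) (EFinM (kern al d)) -integral_kern// -(integral_kern_sub h0 at_).
rewrite -!ge0_integralZl_EFin ?kern_ge0//; last 4 first.
- by move=> s _; rewrite lee_fin kern_ge0.
- exact/measurable_EFinP.
- by move=> s _; rewrite lee_fin kern_ge0.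
- exact/measurable_EFinP.
rewrite -ge0_integralD//; last 4 first.
- by move=> s _; rewrite -EFinM lee_fin mulr_ge0 ?kern_ge0.
- by apply/measurable_EFinP; exact: measurable_funM.
- by move=> s _; rewrite -EFinM lee_fin mulr_ge0 ?kern_ge0.
- by apply/measurable_EFinP; exact: measurable_funM.
apply: ge0_le_integral => //.
- by move=> s _; rewrite lee_fin mulr_ge0 ?kern_ge0.
- by apply/measurable_EFinP; exact: measurable_funM.
- by apply: emeasurable_funD; apply/measurable_EFinP; exact: measurable_funM.
- move=> s; rewrite /= in_itv/= => /andP[as_ st]; rewrite -!EFinM -EFinD lee_fin.
  have [sd|sd] := leP (s - a) d.
    apply: ler_wpDr; first by rewrite mulr_ge0 ?kern_ge0.
    by apply: ler_wpM2r; [exact: kern_ge0|apply: kern_anti => //; rewrite /d in sd *; lra].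
  apply: ler_wpDl; first by rewrite mulr_ge0 ?kern_ge0.
  rewrite mulrC; apply: ler_wpM2r; first exact: kern_ge0.
  by apply: kern_anti => //; exact: ltW.
Qed.

(** [exp (- l u)] is at most [(l u) ^ (- al / 2)]; this power spoils half of the order of
the kernel, the other half keeps the convolution finite, and the
factor [l ^ (- al / 2)] is as small as wanted. *)
Lemma bielecki (a b e : R) : a < b -> 0 < e ->
  exists2 l, 0 <= l & forall t, a < t < b ->
    (\int[lebesgue_measure]_s (fk al (t - s) * bweight a b l s)%:E <= (e * bweight a b l t)%:E)%E.
Proof.
move=> ab e0; pose h := al / 2.
have h0 : 0 < h by rewrite divr_gt0.
have h1 : h <= 1 by move: al1; rewrite /h; lra.
have G0 := Gamma_inv_gt0 al0 al1.
have ba0 : 0 < b - a by rewrite subr_gt0.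
(* the bound of [kern_conv_le] has the homogeneity of [u ^ (al - 1)] times [u ^ h] *)
have [C C0 hC] : exists2 C, 0 < C & forall t, a < t < b ->
    kern h ((t - a) / 2) * (kern (al + 1) (t - a) / al) +
    kern al ((t - a) / 2) * (kern (h + 1) (t - a) / h) <= C * kern al (t - a).
  have two (g u : R) : 0 < u -> kern g (u / 2) = 2 `^ (1 - g) * kern g u.
    move=> u0; rewrite !kernE ?divr_gt0// mulrC powRM ?invr_ge0 ?ltW//.
    by congr (_ * _); rewrite -powR_inv1// -powRrM; congr (_ `^ _); ring.
  exists (2 `^ (1 - h) * (b - a) `^ h / al + 2 `^ (1 - al) * (b - a) `^ h / h).
    by rewrite addr_gt0// divr_gt0// mulr_gt0// powR_gt0.
  move=> t /andP[at_ tb]; have u0 : 0 < t - a by rewrite subr_gt0.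
  have uh : (t - a) `^ h <= (b - a) `^ h.
    by apply: ge0_ler_powR; rewrite ?nnegrE; [exact: ltW|exact: ltW|exact: ltW|lra].
  rewrite !two// mulrDl; apply: lerD.
    rewrite !kernE// addrK.
    have -> : 2 `^ (1 - h) * (t - a) `^ (h - 1) * ((t - a) `^ al / al) =
       (t - a) `^ h * (2 `^ (1 - h) / al * (t - a) `^ (al - 1)).
      have : (t - a) `^ (h - 1) * (t - a) `^ al = (t - a) `^ h * (t - a) `^ (al - 1).
        rewrite -!powRD; [by congr (_ `^ _); ring| |]; apply/implyP => _; rewrite gt_eqF//.
      move=> E; rewrite [LHS](_ : _ = 2 `^ (1 - h) / al * ((t - a) `^ (h - 1) * (t - a) `^ al)); last by ring.
      by rewrite E; ring.
    rewrite [leRHS](_ : _ = (b - a) `^ h * (2 `^ (1 - h) / al * (t - a) `^ (al - 1))); last by ring.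
    by apply: ler_wpM2r => //; rewrite mulr_ge0 ?powR_ge0// divr_ge0 ?powR_ge0// ltW.
  rewrite !kernE// addrK.
  rewrite [leLHS](_ : _ = (t - a) `^ h * (2 `^ (1 - al) / h * (t - a) `^ (al - 1))); last by ring.
  rewrite [leRHS](_ : _ = (b - a) `^ h * (2 `^ (1 - al) / h * (t - a) `^ (al - 1))); last by ring.
  by apply: ler_wpM2r => //; rewrite mulr_ge0 ?powR_ge0// divr_ge0 ?powR_ge0// ltW.
pose c := (Gamma al)^-1 * C.
have c0 : 0 < c by rewrite mulr_gt0.
pose l := (c / e) `^ h^-1.
have ce0 : 0 < c / e by rewrite divr_gt0.
have l0 : 0 < l by rewrite powR_gt0.
have lh : c * l `^ (- h) = e.
  rewrite /l -powRrM mulrN mulVf ?gt_eqF// powR_inv1 ?ltW//.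
  by rewrite invf_div mulrCA divff ?mulr1// gt_eqF.
exists l; first exact: ltW.
move=> t /[dup] tab /andP[at_ tb].
rewrite {2}/bweight cutE//.
rewrite (@integral_support _ `]a, t[); last first.
  move=> s; rewrite in_itv/= negb_and -!leNgt => /orP[sa|ts].
    by rewrite /bweight cut_out ?mulr0// negb_and -leNgt sa.
  by rewrite fk_le0 ?mul0r// subr_le0.
pose k := (Gamma al)^-1 * expR (l * (t - a)) * l `^ (- h).
have k0 : 0 <= k by rewrite !mulr_ge0 ?powR_ge0 ?expR_ge0// ltW.
apply: (@le_trans _ _ (k%:E * \int[lebesgue_measure]_(s in `]a, t[) (kern h (t - s) * kern al (s - a))%:E)%E).
  rewrite -ge0_integralZl_EFin//; last 2 first.
  - by move=> s _; rewrite lee_fin mulr_ge0 ?kern_ge0.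
  - apply/measurable_EFinP; apply: measurable_funM; apply: (measurable_funS (measurableT)) => //;
    by apply: measurableT_comp; [exact: measurable_kern|exact: measurable_funB].
  apply: ge0_le_integral => //.
  - by move=> s _; rewrite lee_fin mulr_ge0 ?fk_ge0 ?bweight_ge0.
  - apply/measurable_EFinP; apply: (measurable_funS (measurableT)) => //.
    by apply: measurable_funM; [exact: measurable_fk_sub|exact: measurable_bweight].
  - apply/measurable_EFinP; apply: measurable_funM => //.
    apply: measurable_funM; apply: (measurable_funS (measurableT)) => //;
    by apply: measurableT_comp; [exact: measurable_kern|exact: measurable_funB].
  - move=> s; rewrite /= in_itv/= => /andP[as_ st]; rewrite -EFinM lee_fin.
    have sab : a < s < b by rewrite as_ (lt_trans st tb).
    rewrite /bweight cutE// /fk /k.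
    have u0 : 0 < t - s by rewrite subr_gt0.
    have key : kern al (t - s) * expR (l * (s - a)) <= expR (l * (t - a)) * l `^ (- h) * kern h (t - s).
      have -> : l * (s - a) = l * (t - a) + - (l * (t - s)) by ring.
      rewrite expRD mulrCA -!mulrA ler_wpM2l ?expR_ge0//.
      rewrite !kernE//.
      have -> : (t - s) `^ (al - 1) = (t - s) `^ h * (t - s) `^ (h - 1).
        rewrite -powRD; last by apply/implyP => _; rewrite gt_eqF.
        by congr (_ `^ _); rewrite /h; field.
      rewrite mulrAC ler_wpM2r ?powR_ge0//; exact: expR_powR_le.
    rewrite [leLHS](_ : _ = (Gamma al)^-1 * kern al (s - a) * (kern al (t - s) * expR (l * (s - a)))); last by ring.
    rewrite [leRHS](_ : _ = (Gamma al)^-1 * kern al (s - a) * (expR (l * (t - a)) * l `^ (- h) * kern h (t - s))); last by ring.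
    by apply: ler_wpM2l => //; rewrite mulr_ge0 ?kern_ge0// ltW.
apply: (@le_trans _ _ (k%:E * (C * kern al (t - a))%:E)%E).
  apply: lee_wpmul2l; first by rewrite lee_fin.
  by apply: (le_trans (kern_conv_le h0 h1 at_)); rewrite lee_fin hC.
rewrite -EFinM lee_fin -lh /k /c.
by rewrite le_eqVlt; apply/orP; left; apply/eqP; ring.
Qed.

End bielecki.

(** Pointwise limits of the successive approximations, with a rate. *)
Lemma geometric_limit (R : realType) (u : nat -> R) (C : R) :
  (forall n, `|u n.+1 - u n| <= C / 2 ^+ n) ->
  exists l, forall n, `|l - u n| <= 2 * C / 2 ^+ n.
Proof.
move=> uC.
have p2 n : (0 : R) < 2 ^+ n by rewrite exprn_gt0.
have E n : 2 * C / 2 ^+ n.+1 = C / 2 ^+ n.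
  by rewrite exprS; field; rewrite gt_eqF.
have C0' : 0 <= C by have := uC 0%N; rewrite expr0 divr1; apply: le_trans.
have C0 n : 0 <= 2 * C / 2 ^+ n by rewrite divr_ge0 ?mulr_ge0 ?exprn_ge0.
have lo n m : (n <= m)%N -> u n - 2 * C / 2 ^+ n <= u m - 2 * C / 2 ^+ m.
  move=> nm; rewrite -(subnK nm); elim: (m - n)%N => [|k IH]; first by rewrite add0n.
  apply: (le_trans IH); rewrite addSn.
  have := uC (k + n)%N; rewrite E -mulrA ler_norml => /andP[h1 h2]; lra.
have hi n m : (n <= m)%N -> u m + 2 * C / 2 ^+ m <= u n + 2 * C / 2 ^+ n.
  move=> nm; rewrite -(subnK nm); elim: (m - n)%N => [|k IH]; first by rewrite add0n.
  apply: le_trans IH; rewrite addSn.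
  have := uC (k + n)%N; rewrite E -mulrA ler_norml => /andP[h1 h2]; lra.
have ub n m : u n - 2 * C / 2 ^+ n <= u m + 2 * C / 2 ^+ m.
  apply: (@le_trans _ _ (u (maxn n m) - 2 * C / 2 ^+ (maxn n m))).
    by apply: lo; rewrite leq_maxl.
  apply: (@le_trans _ _ (u (maxn n m) + 2 * C / 2 ^+ (maxn n m))).
    by have := C0 (maxn n m); lra.
  by apply: hi; rewrite leq_maxr.
pose A := [set u n - 2 * C / 2 ^+ n | n in [set: nat]].
have A0 : A !=set0 by exists (u 0%N - 2 * C / 2 ^+ 0), 0%N.
exists (sup A) => n; rewrite ler_norml; apply/andP; split.
  rewrite lerNl opprB lerBlDr -lerBlDl.
  apply: ub_le_sup; last by exists n.
  by exists (u 0%N + 2 * C / 2 ^+ 0) => _ [k _ <-]; exact: ub.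
by rewrite lerBlDl; apply: ge_sup => // _ [k _ <-]; exact: ub.
Qed.

Lemma le0_geometric (R : realType) (x C : R) :
  (forall n : nat, x <= C / 2 ^+ n) -> x <= 0.
Proof.
move=> h; have C0 : 0 <= `|C| by [].
rewrite leNgt; apply/negP => x0.
have [n hn] : exists n : nat, `|C| / x < n%:R.
  by exists (Num.bound (`|C| / x)); apply: archi_boundP; rewrite divr_ge0// ltW.
have h2 : (n%:R : R) <= 2 ^+ n.
  by rewrite -natrX ler_nat ltnW// ltn_expl.
have := h n; rewrite leNgt => /negP; apply.
rewrite ltr_pdivrMr ?exprn_gt0//.
apply: (le_lt_trans (ler_norm C)); rewrite mulrC -ltr_pdivrMr//.
exact: lt_le_trans h2.
Qed.

Section picard.
Context {R : realType} (al a b : R).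
Hypotheses (al0 : 0 < al) (al1 : al <= 1) (ab : a < b).
Local Notation phi := (fun s => kern al (s - a)).

Lemma phi_le_bweight l s : 0 <= l -> a < s < b -> phi s <= bweight al a b l s.
Proof.
move=> l0 /[dup] sab /andP[as_ _]; rewrite /bweight cutE//.
rewrite -[leLHS]mulr1 ler_wpM2l ?kern_ge0// -expR0 ler_expR.
by rewrite mulr_ge0// subr_ge0 ltW.
Qed.

Lemma bweight_le_phi l s : 0 <= l -> a < s < b ->
  bweight al a b l s <= expR (l * (b - a)) * phi s.
Proof.
move=> l0 /[dup] sab /andP[_ sb]; rewrite /bweight cutE// mulrC.
by rewrite ler_wpM2r ?kern_ge0// ler_expR ler_wpM2l// lerB// ltW.
Qed.

Lemma measurable_phi : measurable_fun [set: R] phi.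
Proof. by apply: measurableT_comp; [exact: measurable_kern|exact: measurable_funB]. Qed.

Lemma integrable_cut_phi : integrableR (cut a b phi).
Proof.
have m1 : measurable_fun [set: R] (cut a b phi).
  by apply: measurable_cut; apply: measurable_funS measurable_phi.
have p1 s : 0 <= cut a b phi s by rewrite /cut; case: ifP => // _; exact: kern_ge0.
have [|//] := @ge0_integrableR _ (cut a b phi) (kern (al + 1) (b - a) / al) m1 p1 _.
by rewrite integral_cut integral_kern.
Qed.

(** The data that the Volterra equation propagates: those bounded by a multiple of
the singular kernel at [a]. *)
Lemma phi_dominated (f : R -> R) A : 0 <= A -> measurable_fun [set: R] f ->
  (forall s, ~~ (a < s < b) -> f s = 0) -> (forall s, a < s < b -> `|f s| <= A * phi s) ->
  [/\ integrableR f,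
     (forall t, a < t < b -> {for t, continuous (rl al f)}) &
     (forall t, t < b -> integrableR (fun s => fk al (t - s) * f s))].
Proof.
move=> A0 mf f0 fA.
have If : integrableR f.
  have [IA _] := RintegralZ A integrable_cut_phi.
  apply: le_integrableR IA => // s.
  have [sab|sab] := boolP (a < s < b); first by rewrite cutE// fA.
  by rewrite cut_out// f0// normr0 mulr0.
have loc t : a < t < b -> exists r B, [/\ 0 < r, 0 <= B & forall s, t - r < s < t + r -> `|f s| <= B].
  move=> /andP[at_ tb]; exists ((t - a) / 2), (A * kern al ((t - a) / 2)).
  have r0 : 0 < (t - a) / 2 by rewrite divr_gt0// subr_gt0.
  split => //; first by rewrite mulr_ge0 ?kern_ge0.
  move=> s /andP[s1 s2]; have [sab|sab] := boolP (a < s < b); last first.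
    by rewrite f0// normr0 mulr_ge0 ?kern_ge0.
  apply: (le_trans (fA s sab)); apply: ler_wpM2l => //.
  by apply: kern_anti => //; lra.
split => //.
  by move=> t /loc[r [B [r0 B0 h]]]; exact: (rl_continuous al0 al1 r0 B0 If h).
move=> t tb; have [ta|at_] := leP t a.
  have -> : (fun s => fk al (t - s) * f s) = cst 0.
    apply/funext => s; have [sa|sa] := leP s a.
      by rewrite f0 ?mulr0// negb_and -leNgt sa.
    by rewrite fk_le0 ?mul0r// subr_le0 (le_trans ta)// ltW.
  exact: integrable0.
have [|r [B [r0 B0 h]]] := loc t; first by rewrite at_.
apply: (rl_integrable al0 al1 r0 B0 If) => s /andP[s1 s2].
by apply: h; rewrite s1 (lt_trans s2)// ltrDl.
Qed.

(** The fractional integral contracts the weighted uniform norm by the factor [e]. *)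
Lemma rl_bielecki (f : R -> R) A l e : 0 <= A -> measurable_fun [set: R] f ->
  (forall s, ~~ (a < s < b) -> f s = 0) ->
  (forall s, a < s < b -> `|f s| <= A * bweight al a b l s) ->
  (forall t, a < t < b -> (\int[lebesgue_measure]_s (fk al (t - s) * bweight al a b l s)%:E
     <= (e * bweight al a b l t)%:E)%E) ->
  forall t, a < t < b -> `|rl al f t| <= A * (e * bweight al a b l t).
Proof.
move=> A0 mf f0 fA he t tab.
have mA : measurable_fun [set: R] (fun s => A * bweight al a b l s).
  by apply: measurable_funM => //; exact: measurable_bweight.
have fg s : s < t -> `|f s| <= A * bweight al a b l s.
  move=> _; have [sab|sab] := boolP (a < s < b); first exact: fA.
  by rewrite f0// normr0 mulr_ge0 ?bweight_ge0.
have g0 s : 0 <= A * bweight al a b l s by rewrite mulr_ge0 ?bweight_ge0.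
have [] // := @rl_dominated _ _ al0 al1 f (fun s => A * bweight al a b l s) t (A * (e * bweight al a b l t)) mf mA fg g0 _.
under eq_integral do rewrite mulrCA EFinM.
rewrite ge0_integralZl_EFin//; last 2 first.
- by move=> s _; rewrite lee_fin mulr_ge0 ?fk_ge0 ?bweight_ge0.
- apply/measurable_EFinP; apply: measurable_funM; first exact: measurable_fk_sub.
  exact: measurable_bweight.
by rewrite EFinM; apply: lee_wpmul2l; [rewrite lee_fin|exact: he].
Qed.

(** Successive approximations contract by [1/2] in the weighted uniform norm.  The
limit is continuous because it satisfies the equation, whose right-hand side is. *)
Lemma picard (F : R -> R -> R) (g : R -> R) (M A : R) : 0 <= M -> 0 <= A ->
  (forall t x y, a < t < b -> `|F t x - F t y| <= M * `|x - y|) ->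
  (forall t, a < t < b -> `|F t 0| <= A * phi t) ->
  (forall y : R -> R, (forall t, a < t < b -> {for t, continuous y}) ->
     measurable_fun (`]a, b[%classic : set R) (fun t => F t (y t))) ->
  (forall t, a < t < b -> {for t, continuous g}) ->
  (forall t, a < t < b -> `|g t| <= A * phi t) ->
  exists y A', [/\ 0 <= A', (forall t, a < t < b -> {for t, continuous y}),
    (forall t, a < t < b -> `|y t| <= A' * phi t) &
    forall t, a < t < b -> y t = g t + rl al (cut a b (fun s => F s (y s))) t].
Proof.
move=> M0 A0 FM F0 Fm cg gA.
pose e := (2 * (M + 1))^-1.
have e0 : 0 < e by rewrite invr_gt0 mulr_gt0// ltr_wpDl.
have Me : M * e <= 1 / 2.
  by rewrite /e ler_pdivrMr ?mulr_gt0 ?ltr_wpDl//; lra.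
have e12 : e <= 1 / 2.
  by rewrite /e mul1r lef_pV2 ?posrE ?mulr_gt0 ?ltr_wpDl//; lra.
have [l l0 hl] := bielecki al0 al1 ab e0.
pose W := bweight al a b l.
have W0 s : 0 <= W s by exact: bweight_ge0.
pose E := expR (l * (b - a)).
have E0 : 0 <= E by exact: expR_ge0.
pose N (y : R -> R) := cut a b (fun s => F s (y s)).
pose y_ := fix y_ n := if n is m.+1 then (fun t => g t + rl al (N (y_ m)) t) else g.
have yS n t : y_ n.+1 t = g t + rl al (N (y_ n)) t by [].
have Nout y s : ~~ (a < s < b) -> N y s = 0 by exact: cut_out.
have FB y B s : 0 <= B -> a < s < b -> `|y s| <= B * W s -> `|N y s| <= (M * B + A) * W s.
  move=> B0 sab yB; rewrite /N cutE//.
  have h1 := FM s (y s) 0 sab; rewrite subr0 in h1.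
  have h2 := F0 s sab; have h3 := phi_le_bweight l0 sab.
  have := ler_normD (F s (y s) - F s 0) (F s 0); rewrite subrK => h4.
  rewrite mulrDl -mulrA; apply: (le_trans h4); apply: lerD.
    by apply: (le_trans h1); exact: ler_wpM2l.
  by apply: (le_trans h2); exact: ler_wpM2l.
have Nphi y B s : 0 <= B -> a < s < b -> `|N y s| <= B * W s -> `|N y s| <= (B * E) * phi s.
  move=> B0 sab h; apply: (le_trans h); rewrite -mulrA; apply: ler_wpM2l => //.
  exact: bweight_le_phi.
have gW s : a < s < b -> `|g s| <= A * W s.
  move=> sab; apply: (le_trans (gA s sab)); apply: ler_wpM2l => //.
  exact: phi_le_bweight.
have step y : (forall t, a < t < b -> {for t, continuous y}) ->
    (forall s, a < s < b -> `|y s| <= 3 * A * W s) ->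
    [/\ measurable_fun [set: R] (N y), (forall t, a < t < b -> {for t, continuous (rl al (N y))}),
      (forall t, t < b -> integrableR (fun s => fk al (t - s) * N y s)) &
      (forall s, a < s < b -> `|g s + rl al (N y) s| <= 3 * A * W s)].
  move=> cy yA; have mN : measurable_fun [set: R] (N y) by apply: measurable_cut; exact: Fm.
  have B0 : 0 <= M * (3 * A) + A by rewrite addr_ge0// !mulr_ge0.
  have NB s : a < s < b -> `|N y s| <= (M * (3 * A) + A) * W s.
    by move=> sab; apply: FB => //; [rewrite mulr_ge0|exact: yA].
  have [_ c I] := phi_dominated (mulr_ge0 B0 E0) mN (Nout y)
    (fun s sab => Nphi y _ s B0 sab (NB s sab)).
  split => // s sab; have h := rl_bielecki B0 mN (Nout y) NB hl sab.
  apply: (le_trans (ler_normD _ _)); apply: (le_trans (lerD (gW s sab) h)).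
  rewrite -/(W s) [X in _ + X]mulrA -mulrDl; apply: ler_wpM2r; first exact: W0.
  have : M * e * A <= 1 / 2 * A by exact: ler_wpM2r.
  have : e * A <= 1 / 2 * A by exact: ler_wpM2r.
  by move=> h1 h2; lra.
have inv n : (forall t, a < t < b -> {for t, continuous (y_ n)}) /\
    (forall s, a < s < b -> `|y_ n s| <= 3 * A * W s).
  elim: n => [|n [c1 c2]]; split => //.
  - move=> s sab; apply: (le_trans (gW s sab)); apply: ler_wpM2r => //; lra.
  - move=> t tab; have [_ h _ _] := step _ c1 c2; rewrite /=.
    by apply: cvgD; [exact: cg|exact: h].
  - by have [_ _ _ h] := step _ c1 c2.
have diff y z D : (forall t, a < t < b -> {for t, continuous y}) -> 0 <= D ->
    measurable_fun [set: R] (N y) -> measurable_fun [set: R] (N z) ->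
    (forall t, t < b -> integrableR (fun s => fk al (t - s) * N y s)) ->
    (forall t, t < b -> integrableR (fun s => fk al (t - s) * N z s)) ->
    (forall s, a < s < b -> `|y s - z s| <= D * W s) ->
    forall s, a < s < b -> `|rl al (N y) s - rl al (N z) s| <= D / 2 * W s.
  move=> _ D0 my mz Iy Iz yz s sab; have sb : s < b by case/andP : sab.
  have [_ <-] := rlB (Iy s sb) (Iz s sb).
  have MD0 : 0 <= M * D by exact: mulr_ge0.
  apply: (@le_trans _ _ (M * D * (e * W s))).
    apply: (rl_bielecki (l := l)) => //.
    - exact: measurable_funB.
    - by move=> r rab; rewrite !Nout// subr0.
    - move=> r rab; rewrite /N !cutE//; apply: (le_trans (FM _ _ _ rab)).
      by rewrite -mulrA ler_wpM2l// yz.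
  rewrite mulrA; apply: ler_wpM2r => //; rewrite mulrAC.
  have : M * e * D <= 1 / 2 * D by exact: ler_wpM2r.
  by move=> h1; lra.
have dn n s : a < s < b -> `|y_ n.+1 s - y_ n s| <= 6 * A * W s / 2 ^+ n.
  elim: n s => [|n IH] s sab.
    rewrite expr0 divr1; have [_ h1] := inv 1%N; have [_ h0] := inv 0%N.
    apply: (le_trans (ler_normB _ _)); apply: (le_trans (lerD (h1 s sab) (h0 s sab))).
    by rewrite -mulrDl; apply: ler_wpM2r => //; lra.
  have [c1 c2] := inv n; have [c3 c4] := inv n.+1.
  have [m1 _ I1 _] := step _ c1 c2; have [m2 _ I2 _] := step _ c3 c4.
  rewrite (yS n.+1) (yS n) opprD addrACA subrr add0r.
  have D0 : 0 <= 6 * A / 2 ^+ n by rewrite divr_ge0 ?mulr_ge0 ?exprn_ge0.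
  have IH' r : a < r < b -> `|y_ n.+1 r - y_ n r| <= 6 * A / 2 ^+ n * W r.
    by move=> rab; rewrite mulrAC; exact: IH.
  apply: (le_trans (diff _ _ _ c3 D0 m2 m1 I2 I1 IH' s sab)).
  rewrite [leLHS](_ : _ = 6 * A * W s / 2 ^+ n.+1)// exprSr; field.
  by rewrite expf_neq0.
have /choice[y hy] : forall t, exists v, a < t < b -> forall n, `|v - y_ n t| <= 2 * (6 * A * W t) / 2 ^+ n.
  move=> t; have [tab|tab] := boolP (a < t < b); last by exists 0.
  by have [v hv] := geometric_limit (dn ^~ t ^~ tab); exists v.
have yW s : a < s < b -> `|y s| <= 13 * A * W s.
  move=> sab; have := hy s sab 0%N; rewrite expr0 divr1 => h.
  have := ler_normD (y s - g s) (g s); rewrite subrK => h2.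
  apply: (le_trans h2); have := gW s sab => h3.
  apply: (le_trans (lerD h h3)).
  by rewrite [leLHS](_ : _ = 13 * A * W s)//; ring.
have ycvg t : a < t < b -> y_ n t @[n --> \oo] --> y t.
  move=> tab; apply/cvgrPdist_le => eps eps0.
  have [n hn] : exists n, 2 * (6 * A * W t) / 2 ^+ n <= eps.
    apply/not_existsP => h; suff : eps <= 0 by rewrite leNgt eps0.
    by apply: (@le0_geometric _ _ (2 * (6 * A * W t))) => n; have /negP := h n; rewrite -ltNge => /ltW.
  exists n => // m /= nm; apply: (le_trans (hy t tab m)); apply: le_trans hn.
  apply: ler_wpM2l; first by rewrite !mulr_ge0.
  by rewrite lef_pV2 ?posrE ?exprn_gt0// ler_eXn2l// ltr1n.
have mN : measurable_fun [set: R] (N y).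
  apply: measurable_cut.
  apply: (@measurable_fun_cvg _ _ _ _ (fun n t => F t (y_ n t))).
    by move=> n; apply: Fm; have [] := inv n.
  move=> t; rewrite /= in_itv/= => tab; apply/cvgrPdist_lt => eps eps0.
  move/cvgrPdist_lt : (ycvg t tab) => /(_ (eps / (M + 1)))[|n _ hn].
    by rewrite divr_gt0// ltr_wpDl.
  exists n => // m nm; apply: (le_lt_trans (FM _ _ _ tab)).
  have := hn m nm; rewrite ltr_pdivlMr ?ltr_wpDl//; apply: le_lt_trans.
  by rewrite mulrC ler_wpM2l// lerDl.
have A13 : 0 <= 13 * A by rewrite mulr_ge0.
have B0 : 0 <= M * (13 * A) + A by rewrite addr_ge0// mulr_ge0.
have NB s : a < s < b -> `|N y s| <= (M * (13 * A) + A) * W s.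
  by move=> sab; apply: FB => //; exact: yW.
have [_ c I] := phi_dominated (mulr_ge0 B0 E0) mN (Nout y)
    (fun s sab => Nphi y _ s B0 sab (NB s sab)).
have Ey t : a < t < b -> y t = g t + rl al (N y) t.
  move=> tab; apply/eqP; rewrite -subr_eq0 -normr_eq0 eq_le normr_ge0 andbT.
  apply: (@le0_geometric _ _ (12 * A * W t)) => n.
  have [c1 c2] := inv n; have [m1 _ I1 _] := step _ c1 c2.
  have h1 := hy t tab n.+1.
  have D0 : 0 <= 12 * A / 2 ^+ n by rewrite divr_ge0 ?mulr_ge0 ?exprn_ge0.
  have h' r : a < r < b -> `|y_ n r - y r| <= 12 * A / 2 ^+ n * W r.
    move=> rab; rewrite distrC; apply: (le_trans (hy r rab n)).
    by rewrite [leLHS](_ : _ = 12 * A / 2 ^+ n * W r)//; ring.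
  have h2 := diff _ _ _ c1 D0 m1 mN I1 I h' t tab.
  have -> : y t - (g t + rl al (N y) t) = (y t - y_ n.+1 t) + (rl al (N (y_ n)) t - rl al (N y) t).
    by rewrite yS; ring.
  apply: (le_trans (ler_normD _ _)); apply: (le_trans (lerD h1 h2)).
  rewrite [leLHS](_ : _ = 12 * A * W t / 2 ^+ n)//.
  by rewrite exprS; field; rewrite expf_neq0.
exists y, (13 * A * E); split => //.
- by rewrite mulr_ge0.
- move=> t /[dup] tab /andP[at_ tb]; have : (g x + rl al (N y) x) @[x --> t] --> y t.
    by rewrite (Ey t tab); apply: cvgD; [exact: cg|exact: c].
  apply: cvg_trans; apply: near_eq_cvg; near=> x; rewrite Ey//.
  apply/andP; split.
    by near: x; exact: lt_nbhsr.
  by near: x; exact: lt_nbhsl.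
- move=> t tab; apply: (le_trans (yW t tab)); rewrite -[leRHS]mulrA; apply: ler_wpM2l => //.
  exact: bweight_le_phi.
Unshelve. all: by end_near. Qed.

End picard.

(** * Positivity of the resolvent kernel *)

Section positivity.
Context {R : realType} (al a b : R).
Hypotheses (al0 : 0 < al) (al1 : al <= 1) (ab : a < b).
Variables (q y : R -> R) (M A : R).
Hypotheses (M0 : 0 <= M) (A0 : 0 <= A)
  (cq : forall t, a < t < b -> {for t, continuous q})
  (qM : forall t, a < t < b -> `|q t| <= M)
  (cy : forall t, a < t < b -> {for t, continuous y})
  (yA : forall t, a < t < b -> `|y t| <= A * kern al (t - a))
  (ysol : forall t, a < t < b -> y t = fk al (t - a) + rl al (cut a b (fun s => q s * y s)) t).
Local Notation f := (cut a b (fun s => q s * y s)).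

Let mf : measurable_fun [set: R] f.
Proof.
apply: measurable_cut; apply: pointwise_continuous_measurable => s; rewrite in_itv/= => sab.
by apply: cvgM; [exact: cq|exact: cy].
Qed.

Let f0 s : ~~ (a < s < b) -> f s = 0.
Proof. exact: cut_out. Qed.

Let fA s : a < s < b -> `|f s| <= (M * A) * kern al (s - a).
Proof.
move=> sab; rewrite cutE// normrM -mulrA ler_pM//; [exact: qM|exact: yA].
Qed.

Let MA0 : 0 <= M * A. Proof. exact: mulr_ge0. Qed.

Let If : integrableR f.
Proof. by have [] := phi_dominated al0 al1 ab MA0 mf f0 fA. Qed.

Let Iff t : t < b -> integrableR (fun s => fk al (t - s) * f s).
Proof. by have [_ _] := phi_dominated al0 al1 ab MA0 mf f0 fA; apply. Qed.

(** Near [a] the singular datum [fk (t - a)] dominates the integral term. *)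
Let near_a : exists2 m, a < m < b & forall t, a < t < m -> fk al (b - a) / 2 <= y t.
Proof.
have G0 := Gamma_inv_gt0 al0 al1.
pose e := (Gamma al)^-1 / (4 * (M * A + 1)).
have e0 : 0 < e by rewrite divr_gt0// mulr_gt0// ltr_wpDl.
have [l l0 hl] := bielecki al0 al1 ab e0.
have ln20 : 0 < ln (2 : R) by rewrite ln_gt0 ?ltr1n.
pose d := Num.min ((b - a) / 2) (ln 2 / (l + 1)).
have l10 : 0 < l + 1 by rewrite ltr_wpDl.
have d0 : 0 < d by rewrite lt_min !divr_gt0// subr_gt0.
have d1 : d <= (b - a) / 2 by rewrite ge_min lexx.
have d2 : d <= ln 2 / (l + 1) by rewrite ge_min lexx orbT.
have amb : a < a + d < b by apply/andP; split; move: ab; lra.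
exists (a + d) => // t /andP[at_ td].
have tab : a < t < b by rewrite at_; case/andP: amb => _; exact: lt_trans.
have fW s : a < s < b -> `|f s| <= M * A * bweight al a b l s.
  by move=> sab; apply: (le_trans (fA sab)); apply: ler_wpM2l => //; exact: phi_le_bweight.
have h := rl_bielecki al0 al1 MA0 mf f0 fW hl tab.
have E2 : expR (l * (t - a)) <= 2.
  rewrite -[leRHS]lnK ?posrE// ler_expR.
  apply: (@le_trans _ _ ((l + 1) * d)); last by rewrite mulrC -ler_pdivlMr.
  by apply: ler_pM => //; [rewrite subr_ge0 ltW|rewrite lerDl|lra].
have k0 := kern_ge0 al (t - a).
have : `|rl al f t| <= fk al (t - a) / 2.
  apply: (le_trans h); rewrite /bweight cutE//.
  apply: (@le_trans _ _ (M * A * (e * (kern al (t - a) * 2)))).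
    apply: ler_wpM2l => //; apply: ler_wpM2l; first exact: ltW.
    exact: ler_wpM2l.
  rewrite /e /fk [leLHS](_ : _ = (M * A / (M * A + 1)) * ((Gamma al)^-1 * kern al (t - a) / 2)); last first.
    by field; rewrite !gt_eqF//= ?ltr_wpDl// -invr_gt0.
  apply: ler_piMl; first by rewrite divr_ge0// mulr_ge0// ltW.
  by rewrite ler_pdivrMr ?ltr_wpDl// mul1r lerDl.
rewrite ler_norml => /andP[h1 _]; rewrite ysol//.
have : fk al (b - a) <= fk al (t - a).
  by apply: fk_anti => //; [rewrite subr_gt0|rewrite lerB// ltW//; case/andP: tab].
by move: h1; lra.
Qed.

(** The sum on the right is the part of the equation at [t0] that comes from the past
before [t1].  By the Poisson identity it is an average of the values of [y] before [t1],
so nonnegativity there and the bound [c] near [a] give a lower bound of the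
order of [(t0 - t1) ^ al]. *)
Let continuation (t1 t0 : R) : al < 1 -> a < t1 -> t1 < t0 -> t0 < b ->
  (forall t, a < t < t1 -> 0 <= y t) ->
  forall m c, a < m < t1 -> 0 <= c -> (forall t, a < t < m -> c <= y t) ->
  kern (al + 1) (t0 - t1) * ((Gamma al * Gamma (1 - al))^-1 * (kern (1 - al) (b - a) / (b - a) * (c * (m - a))))
  <= fk al (t0 - a) + rl al (fun s => if s < t1 then f s else 0) t0.
Proof.
move=> al1' at1 t10 t0b y0 m c /andP[am mt1] c0 yc.
have be0 : 0 < 1 - al by rewrite subr_gt0.
have be1 : 1 - al <= 1 by rewrite gerBl ltW.
have G1 := Gamma_gt0 al0 al1; have G2 := Gamma_gt0 be0 be1.
have d0 : 0 < t0 - t1 by rewrite subr_gt0.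
pose f1 s := if s < t1 then f s else 0.
pose K := (t0 - t1) `^ al / (Gamma al * Gamma (1 - al)).
have K0 : 0 < K by rewrite divr_gt0 ?powR_gt0// mulr_gt0.
pose Pk := cut a t1 (fun t => K * ((t1 - t) `^ (- al) / (t0 - t))).
have mPk : measurable_fun [set: R] Pk.
  apply: measurable_cut; apply: pointwise_continuous_measurable => x.
  rewrite in_itv/= => /andP[ax xt]; apply: cvgM; first exact: cvg_cst.
  apply: cvgM.
    apply: (@continuous_comp _ _ _ (fun s : R => t1 - s) (fun u => u `^ _)).
      by apply: cvgB; [exact: cvg_cst|exact: cvg_id].
    by apply: continuous_powRl; rewrite subr_gt0.
  apply: cvgV; first by rewrite gt_eqF// subr_gt0 (lt_trans xt).
  by apply: cvgB; [exact: cvg_cst|exact: cvg_id].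
have Pk0 t : 0 <= Pk t.
  rewrite /Pk /cut; case: ifP => // /andP[_ tt1].
  by rewrite mulr_ge0 ?(ltW K0)// divr_ge0 ?powR_ge0// subr_ge0 ltW// (lt_trans tt1).
(* [Pk] is the density of the Poisson identity, normalized *)
have bal r : a <= r -> r < t1 ->
    (\int[lebesgue_measure]_t (Pk t * fk al (t - r))%:E = (fk al (t0 - r))%:E)%E.
  move=> ar rt1.
  rewrite (@integral_support _ `]r, t1[); last first.
    move=> t; rewrite in_itv/= negb_and -!leNgt => /orP[tr|t1t].
      by rewrite fk_le0 ?mulr0// subr_le0.
    by rewrite /Pk cut_out ?mul0r// negb_and -!leNgt t1t orbT.
  transitivity (K%:E * \int[lebesgue_measure]_(t in `]r, t1[)
      (fk al (t - r) * ((t1 - t) `^ (- al) / (t0 - t)))%:E)%E.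
    rewrite -ge0_integralZl_EFin ?(ltW K0)//.
    - apply: eq_integral => t; rewrite inE/= in_itv/= => /andP[rt tt1].
      by rewrite /Pk cutE ?tt1 ?(le_lt_trans ar)// -EFinM; congr EFin; ring.
    - move=> t; rewrite /= in_itv/= => /andP[_ tt1].
      by rewrite lee_fin mulr_ge0 ?fk_ge0// divr_ge0 ?powR_ge0// subr_ge0 ltW// (lt_trans tt1).
    - apply/measurable_EFinP; apply: measurable_funM.
        by apply: measurable_funS (measurable_fk_sub' al r).
      apply: pointwise_continuous_measurable => x.
      rewrite in_itv/= => /andP[ax xt]; apply: cvgM.
        apply: (@continuous_comp _ _ _ (fun s : R => t1 - s) (fun u => u `^ _)).
          by apply: cvgB; [exact: cvg_cst|exact: cvg_id].
        by apply: continuous_powRl; rewrite subr_gt0.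
      apply: cvgV; first by rewrite gt_eqF// subr_gt0 (lt_trans xt).
      by apply: cvgB; [exact: cvg_cst|exact: cvg_id].
  rewrite poisson_fk// -EFinM; congr EFin.
  have : (t0 - t1) `^ al * (t0 - t1) `^ (- al) = 1.
    rewrite -powRD; last by apply/implyP => _; rewrite gt_eqF.
    by rewrite subrr powRr0.
  move=> E; rewrite /K [LHS](_ : _ = fk al (t0 - r) * ((t0 - t1) `^ al * (t0 - t1) `^ (- al)) *
    ((Gamma al * Gamma (1 - al))^-1 * (Gamma al * Gamma (1 - al)))); last by ring.
  by rewrite E mulVf ?mulr1// gt_eqF// mulr_gt0.
have mPf r : measurable_fun [set: R] (fun t => Pk t * fk al (t - r)).
  by apply: measurable_funM => //; exact: measurable_fk_sub'.
have balR r : a <= r -> r < t1 -> integrableR (fun t => Pk t * fk al (t - r)) /\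
    \int[lebesgue_measure]_t (Pk t * fk al (t - r)) = fk al (t0 - r).
  move=> ar rt1; have [||I _] := @ge0_integrableR _ _ (fk al (t0 - r)) (mPf r).
  - by move=> t; rewrite mulr_ge0 ?fk_ge0.
  - by rewrite bal.
  - by split => //; rewrite /Rintegral bal.
have [Ia Ea] := balR a (lexx a) at1.
have mf1 : measurable_fun [set: R] f1.
  by apply: measurable_fun_ifT => //; exact: measurable_fun_ltr.
pose h t s := Pk t * fk al (t - s) * f1 s.
have mh : measurable_fun [set: measurableTypeR R * measurableTypeR R] (fun p => h p.1 p.2).
  apply: measurable_funM.
    apply: measurable_funM; last exact: measurable_fk2.
    by apply: (measurableT_comp mPk); exact: measurable_fst.
  by apply: (measurableT_comp mf1); exact: measurable_snd.
have If10 : integrableR (fun s => fk al (t0 - s) * f1 s).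
  have I0 := integrable_norm (Iff t0b); apply: le_integrableR I0.
    by apply: measurable_funM => //; exact: measurable_fk_sub.
  move=> s /=; rewrite !normrM; apply: ler_wpM2l => //.
  by rewrite /f1; case: ifP; rewrite ?normr0.
have f1out s : (a <= s) && (s < t1) = false -> f1 s = 0.
  by rewrite /f1; case: ltP => //; rewrite andbT => _ /negbT; rewrite -ltNge => sa;
    rewrite f0// negb_and -leNgt ltW.
have hfin : (\int[lebesgue_measure]_t \int[lebesgue_measure]_s `|h t s|%:E < +oo)%E.
  rewrite tonelliR//; last exact: measurableT_comp.
  rewrite (_ : (\int[lebesgue_measure]_s _ = \int[lebesgue_measure]_s `|fk al (t0 - s) * f1 s|%:E)%E).
    by have /integrableP[_] := If10.
  apply: eq_integral => s _.
  have [/andP[as_ st1]|/negbTE/f1out fs] := boolP ((a <= s) && (s < t1)); last first.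
    by rewrite fs mulr0 normr0 integral0_eq// => t _; rewrite /h fs mulr0 normr0.
  under eq_integral.
    move=> t _; rewrite /h normrM (@ger0_norm _ (_ * _)); last by rewrite mulr_ge0 ?fk_ge0.
    rewrite mulrC EFinM; over.
  rewrite ge0_integralZl_EFin//; last 2 first.
  - by move=> t _; rewrite lee_fin mulr_ge0 ?fk_ge0.
  - by apply/measurable_EFinP; exact: mPf.
  by rewrite bal// -EFinM normrM (ger0_norm (fk_ge0 al0 al1 _)) mulrC.
have Eh t : \int[lebesgue_measure]_s h t s = Pk t * rl al f1 t.
  have [tt|tt] := boolP (a < t < t1); last first.
    by rewrite /h /Pk cut_out// mul0r /Rintegral integral0_eq// => s _; rewrite !mul0r.
  have tb : t < b by case/andP: tt => _ ?; apply: lt_trans t0b; exact: lt_trans t10.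
  have I1 : integrableR (fun s => fk al (t - s) * f1 s).
    have I0 := integrable_norm (Iff tb); apply: le_integrableR I0.
      by apply: measurable_funM => //; exact: measurable_fk_sub.
    move=> s /=; rewrite !normrM; apply: ler_wpM2l => //.
    by rewrite /f1; case: ifP; rewrite ?normr0.
  by have [_ <-] := RintegralZ (Pk t) I1; apply: eq_Rintegral => s _; rewrite /h mulrA.
have EX : rl al f1 t0 = \int[lebesgue_measure]_t (Pk t * rl al f1 t).
  transitivity (\int[lebesgue_measure]_t \int[lebesgue_measure]_s h t s); last first.
    by apply: eq_Rintegral => t _; exact: Eh.
  rewrite fubiniR//; apply: eq_Rintegral => s _.
  have [/andP[as_ st1]|/negbTE/f1out fs] := boolP ((a <= s) && (s < t1)); last first.
    by rewrite /h fs mulr0 /Rintegral integral0_eq// => t _; rewrite mulr0.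
  have [Is Es] := balR s as_ st1.
  rewrite -Es mulrC; have [_ <-] := RintegralZ (f1 s) Is.
  by apply: eq_Rintegral => t _; rewrite /h mulrC.
have IPf : integrableR (fun t => Pk t * rl al f1 t).
  have := integrable_fubiniR mh hfin; apply: eq_integrable => // t _ /=.
  by rewrite Eh.
rewrite -/f1 EX -Ea -RintegralD//.
have Ey t : a < t < t1 -> Pk t * fk al (t - a) + Pk t * rl al f1 t = Pk t * y t.
  move=> /andP[at_ tt1]; rewrite -mulrDr ysol; last first.
    by rewrite at_ (lt_trans tt1)// (lt_trans t10).
  by congr (_ * (_ + _)); apply: eq_rl => s st; rewrite /f1 (lt_trans st).
pose k0 := (Gamma al * Gamma (1 - al))^-1 * (t0 - t1) `^ al * (kern (1 - al) (b - a) / (b - a) * c).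
have k00 : 0 <= k0.
  rewrite !mulr_ge0 ?powR_ge0 ?kern_ge0//; first by rewrite invr_ge0 mulr_ge0 ?ltW.
  by rewrite invr_ge0 subr_ge0 ltW.
have Ic : integrableR (cut a m (cst k0)) /\ \int[lebesgue_measure]_t cut a m (cst k0) t = k0 * (m - a).
  have E : (\int[lebesgue_measure]_t (cut a m (cst k0) t)%:E = (k0 * (m - a))%:E)%E.
    rewrite integral_cut.
    have -> : (\int[lebesgue_measure]_(s in `]a, m[) (cst k0 s)%:E = \int[lebesgue_measure]_(s in `]a, m[) cst k0%:E s)%E by [].
    by rewrite integral_cst//= lebesgue_measure_itv/= lte_fin am -EFinB -EFinM.
  have [|||I _] := @ge0_integrableR _ (cut a m (cst k0)) (k0 * (m - a)).
  - exact: measurable_cut.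
  - by move=> t; rewrite /cut; case: ifP.
  - by rewrite E.
  - by split => //; rewrite /Rintegral E.
have -> : kern (al + 1) (t0 - t1) * ((Gamma al * Gamma (1 - al))^-1 * (kern (1 - al) (b - a) / (b - a) * (c * (m - a)))) = \int[lebesgue_measure]_t cut a m (cst k0) t.
  by rewrite Ic.2 kernE// addrK /k0; ring.
apply: le_Rintegral => //; first exact: Ic.1.
  exact: (integrableD measurableT Ia IPf).
move=> t _; have [/[dup] tt /andP[at_ tt1]|tt] := boolP (a < t < t1); last first.
  rewrite /Pk (cut_out _ tt) !mul0r addr0 cut_out//.
  by apply: contra tt => /andP[-> tm]; rewrite (lt_trans tm).
rewrite Ey//; rewrite /cut at_/=; case: ltP => tm; last by rewrite mulr_ge0// y0.
rewrite /Pk cutE//.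
apply: (@le_trans _ _ (K * ((t1 - t) `^ (- al) / (t0 - t)) * c)); last first.
  apply: ler_wpM2l; last by apply: yc; rewrite at_.
  by rewrite mulr_ge0 ?(ltW K0)// divr_ge0 ?powR_ge0// subr_ge0 ltW// (lt_trans tt1).
rewrite /k0 /K /= [leLHS](_ : _ = (t0 - t1) `^ al / (Gamma al * Gamma (1 - al)) * (kern (1 - al) (b - a) / (b - a)) * c); last by ring.
apply: ler_wpM2r => //; apply: ler_wpM2l; first exact: ltW.
apply: ler_pM; rewrite ?kern_ge0 ?invr_ge0 ?subr_ge0 ?(ltW ab)//.
- have -> : (t1 - t) `^ (- al) = kern (1 - al) (t1 - t).
    by rewrite kernE ?subr_gt0//; congr (_ `^ _); ring.
  by apply: kern_anti => //; [rewrite subr_gt0|lra].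
- by rewrite lef_pV2 ?posrE ?subr_gt0//; lra.
Qed.

(** At the first zero [t0] the past before [t1] contributes at least a fixed multiple of
[(t0 - t1) ^ al], by [continuation].  What remains of the equation is the integral
over [(t1, t0)], where [y] is small by continuity: it contributes a
smaller multiple of the same power.  This contradicts [y t0 = 0]. *)
Lemma solution_gt0 t : a < t < b -> 0 < y t.
Proof.
have [m0 am0b near0] := near_a.
pose c := fk al (b - a) / 2.
have c0 : 0 < c by rewrite divr_gt0// fk_gt0// subr_gt0.
move=> tab; rewrite ltNge; apply/negP => yt0.
pose S := [set s | a < s < b /\ y s <= 0].
have St : S t by [].
have Sm s : S s -> m0 <= s.
  move=> [/andP[as_ _] ys]; rewrite leNgt; apply/negP => sm.
  by have := near0 s; rewrite as_ sm => /(_ isT); move: c0; rewrite /c; lra.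
have hS : has_inf S by split; [exists t|exists m0 => s; exact: Sm].
pose t0 := inf S.
have t0m : m0 <= t0 by apply: lb_le_inf; [exists t|move=> s; exact: Sm].
have t0t : t0 <= t by apply: ge_inf => //; exists m0 => s; exact: Sm.
have t0ab : a < t0 < b.
  case/andP: tab => _ tb; case/andP: am0b => am0 _.
  by rewrite (lt_le_trans am0)// (le_lt_trans t0t).
have [at0 t0b] := andP t0ab.
have ypos s : a < s < t0 -> 0 < y s.
  move=> /andP[as_ st0]; rewrite ltNge; apply/negP => ys.
  have : t0 <= s.
    apply: ge_inf; first by exists m0 => r; exact: Sm.
    by split => //; rewrite as_ (lt_trans st0).
  by rewrite leNgt st0.
have yt0' : y t0 = 0.
  apply/eqP; rewrite eq_le; apply/andP; split.
    rewrite leNgt; apply/negP => yp.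
    have [d /= d0 hd] := (nbhs_ballP _ _).1 (cvgr_gt (y t0) (cy t0ab) 0 yp).
    have [s [sab ys] sd] := inf_adherent d0 hS.
    have t0s : t0 <= s by apply: ge_inf; [exists m0 => r; exact: Sm|].
    have : 0 < y s.
      apply: hd; rewrite /ball/= distrC ger0_norm ?subr_ge0//.
      by rewrite ltrBlDl.
    by rewrite ltNge ys.
  rewrite leNgt; apply/negP => yn.
  have [d /= d0 hd] := (nbhs_ballP _ _).1 (cvgr_lt (y t0) (cy t0ab) 0 yn).
  pose s := Num.max ((a + t0) / 2) (t0 - d / 2).
  have s1 : (a + t0) / 2 <= s by rewrite le_max lexx.
  have s2 : t0 - d / 2 <= s by rewrite le_max lexx orbT.
  have s3 : s < t0 by rewrite gt_max; apply/andP; split; lra.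
  have : y s < 0.
    by apply: hd; rewrite /ball/= ger0_norm ?subr_ge0 ?ltW//; lra.
  by rewrite ltNge ltW// ypos// s3 andbT; lra.
(* as [y t0] is zero, the past before [t1] is the opposite of the integral over [(t1, t0)] *)
have split_at t1 eta : a < t1 < t0 -> 0 <= eta -> (forall s, t1 <= s <= t0 -> `|y s| <= eta) ->
    fk al (t0 - a) + rl al (fun s => if s < t1 then f s else 0) t0 <= M * eta * rlcst al (t0 - t1).
  move=> /andP[at1 t10] eta0 yeta.
  pose f1 s := if s < t1 then f s else 0; pose f2 s := if s < t1 then 0 else f s.
  have mlt : measurable_fun [set: R] (fun s : R => s < t1) by exact: measurable_fun_ltr.
  have I1 : integrableR (fun s => fk al (t0 - s) * f1 s).
    have I0 := integrable_norm (Iff t0b); apply: le_integrableR I0.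
      apply: measurable_funM; first exact: measurable_fk_sub.
      exact: measurable_fun_ifT.
    move=> s /=; rewrite !normrM; apply: ler_wpM2l => //.
    by rewrite /f1; case: ifP; rewrite ?normr0.
  have I2 : integrableR (fun s => fk al (t0 - s) * f2 s).
    have I0 := integrable_norm (Iff t0b); apply: le_integrableR I0.
      apply: measurable_funM; first exact: measurable_fk_sub.
      exact: measurable_fun_ifT.
    move=> s /=; rewrite !normrM; apply: ler_wpM2l => //.
    by rewrite /f2; case: ifP; rewrite ?normr0.
  have E : rl al f t0 = rl al f1 t0 + rl al f2 t0.
    have [_ <-] := rlD I1 I2; apply: eq_rl => s _.
    by rewrite /f1 /f2; case: ifP; rewrite ?addr0 ?add0r.
  have := ysol t0ab; rewrite yt0' E addrA => /esym/eqP; rewrite addr_eq0 => /eqP ->.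
  apply: (le_trans (ler_norm _)); rewrite normrN.
  have MeB : 0 <= M * eta by exact: mulr_ge0.
  have E2 : rl al f2 t0 = rl al (cut t1 t0 f) t0.
    rewrite /rl; rewrite /Rintegral; congr fine.
    rewrite [LHS](@integral_support _ `[t1, t0[); last first.
      move=> s; rewrite in_itv/= negb_and -leNgt -ltNge => /orP[st|ts].
        by rewrite /f2 st mulr0.
      by rewrite fk_le0 ?mul0r// subr_le0.
    rewrite [RHS](@integral_support _ `]t1, t0[); last first.
      by move=> s; rewrite in_itv/= => st; rewrite cut_out ?mulr0.
    have m2 : measurable_fun (`]t1, t0[%classic : set R) (fun s => fk al (t0 - s) * f2 s).
      apply: (measurable_funS measurableT) => //.
      apply: measurable_funM; first exact: measurable_fk_sub.
      exact: measurable_fun_ifT.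
    rewrite integral_itv_bndoo; last exact/measurable_EFinP.
    apply: eq_integral => s; rewrite inE/= in_itv/= => st; rewrite cutE//.
    by rewrite /f2 ltNge (ltW (andP st).1).
  rewrite E2.
  apply: (@rl_bounded _ _ al0 al1 (cut t1 t0 f) t1 t0 t0 (M * eta) _ _ _ _).2 => //.
  - by apply: measurable_cut; exact: measurable_funS mf.
  - by move=> s; exact: cut_out.
  - move=> s /[dup] st /andP[s1 s2] _; rewrite cutE//.
    have sab : a < s < b by rewrite (lt_trans at1 s1) (lt_trans s2 t0b).
    rewrite cutE// normrM; apply: ler_pM => //; first exact: qM.
    by apply: yeta; rewrite !ltW.
have small eta : 0 < eta -> exists t1, [/\ (a + t0) / 2 <= t1, a < t1 < t0 & forall s, t1 <= s <= t0 -> `|y s| <= eta].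
  move=> eta0; move/cvgrPdist_le : (cy t0ab) => /(_ _ eta0)/nbhs_ballP[d /= d0 hd].
  exists (Num.max ((a + t0) / 2) (t0 - d / 2)).
  set s0 := Num.max _ _.
  have s1 : (a + t0) / 2 <= s0 by rewrite le_max lexx.
  have s2 : t0 - d / 2 <= s0 by rewrite le_max lexx orbT.
  have s3 : s0 < t0 by rewrite gt_max; apply/andP; split; lra.
  split; [by []|by rewrite s3 andbT; lra|].
  move=> s /andP[h1 h2]; have := hd s; rewrite yt0' sub0r normrN; apply.
  by rewrite /ball/= ger0_norm ?subr_ge0//; lra.
have [al1'|al1'] := ltP al 1; last first.
  (* At order [1] the past before [t1] is [y t1]; choosing [t1] where [y] is largest on a
     short interval gives the contradiction. *)
  have E1 : al = 1 by apply/eqP; rewrite eq_le al1 al1'.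
  pose tau := Num.max ((a + t0) / 2) (t0 - 1 / (2 * (M + 1))).
  have M1 : 0 < M + 1 by rewrite ltr_wpDl.
  have M2 : 0 < 1 / (2 * (M + 1)) by rewrite divr_gt0// mulr_gt0.
  have s1 : (a + t0) / 2 <= tau by rewrite le_max lexx.
  have s2 : t0 - 1 / (2 * (M + 1)) <= tau by rewrite le_max lexx orbT.
  have s3 : tau < t0 by rewrite gt_max; apply/andP; split; lra.
  have ctau : {within `[tau, t0], continuous y}.
    apply: continuous_in_subspaceT => s; rewrite inE/= in_itv/= => /andP[h1 h2].
    by apply: cy; apply/andP; split; lra.
  have [t1 + yt1] := EVT_max (ltW s3) ctau.
  rewrite in_itv/= => /andP[h1 h2].
  have ytau : 0 < y tau by apply: ypos; apply/andP; split; lra.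
  have yt10 : 0 < y t1 by apply: lt_le_trans ytau _; apply: yt1; rewrite in_itv/= lexx ltW.
  have t10 : t1 < t0.
    by rewrite lt_neqAle h2 andbT; apply: contraTneq yt10 => ->; rewrite yt0' ltxx.
  have at1 : a < t1 by lra.
  have t1i : a < t1 < t0 by rewrite at1.
  have ynn s : t1 <= s <= t0 -> `|y s| <= y t1.
    move=> /andP[k1 k2]; rewrite ger0_norm; first by apply: yt1; rewrite in_itv/= (le_trans h1 k1).
    move: k2; rewrite le_eqVlt => /predU1P[->|k2]; first by rewrite yt0'.
    by apply/ltW/ypos; rewrite k2 andbT (lt_le_trans at1).
  have := split_at t1 (y t1) t1i (ltW yt10) ynn.
  have -> : fk al (t0 - a) + rl al (fun s => if s < t1 then f s else 0) t0 = y t1.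
    rewrite ysol; last by rewrite at1 (lt_trans t10).
    rewrite E1 !fk1 ?subr_gt0//; congr (_ + _); apply: eq_Rintegral => s _.
    case: ltP => st1; last by rewrite mulr0 fk_le0 ?mul0r// subr_le0.
    by rewrite !fk1 ?subr_gt0// (lt_trans st1).
  have -> : rlcst al (t0 - t1) = t0 - t1.
    rewrite /rlcst E1 Gamma1 invr1 mul1r mulr1 kernE ?subr_gt0// addrK powRr1//.
    by rewrite subr_ge0.
  apply/negP; rewrite -ltNge.
  have h3 : (M + 1) * (t0 - t1) <= 1 / 2.
    apply: (@le_trans _ _ ((M + 1) * (1 / (2 * (M + 1))))); first by rewrite ler_pM2l//; lra.
    by rewrite le_eqVlt; apply/orP; left; apply/eqP; field; rewrite gt_eqF.
  have h4 : M * (t0 - t1) < 1 by nra.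
  rewrite mulrAC -[ltRHS]mul1r ltr_pM2r//.
have be0 : 0 < 1 - al by rewrite subr_gt0.
have be1 : 1 - al <= 1 by rewrite gerBl ltW.
have G1 := Gamma_gt0 al0 al1; have G2 := Gamma_gt0 be0 be1.
pose m := Num.min m0 ((a + t0) / 4 + a / 2).
have am : a < m by rewrite lt_min; apply/andP; split; [by case/andP: am0b|lra].
have mm0 : m <= m0 by rewrite ge_min lexx.
have mt : m <= (a + t0) / 4 + a / 2 by rewrite ge_min lexx orbT.
pose k := (Gamma al * Gamma (1 - al))^-1 * (kern (1 - al) (b - a) / (b - a) * (c * (m - a))).
have k0 : 0 < k.
  apply: mulr_gt0; first by rewrite invr_gt0 mulr_gt0.
  apply: mulr_gt0; first by apply: divr_gt0; [apply: kern_gt0|]; rewrite subr_gt0.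
  by apply: mulr_gt0 => //; rewrite subr_gt0.
pose eta := k * al * Gamma al / (2 * (M + 1)).
have M1 : 0 < M + 1 by rewrite ltr_wpDl.
have eta0 : 0 < eta.
  by apply: divr_gt0; [apply: mulr_gt0 => //; exact: mulr_gt0|exact: mulr_gt0].
have [t1 [at1' /[dup] t1i /andP[at1 t10] yeta]] := small eta eta0.
have at1m : a < m < t1 by rewrite am/=; lra.
have ynn s : a < s < t1 -> 0 <= y s.
  by move=> /andP[as_ st1]; apply/ltW/ypos; rewrite as_ (lt_trans st1).
have yc s : a < s < m -> c <= y s.
  by move=> /andP[as_ sm]; apply: near0; rewrite as_ (lt_le_trans sm).
have h1 := continuation al1' at1 t10 t0b ynn at1m (ltW c0) yc.
have h2 := split_at t1 eta t1i (ltW eta0) yeta.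
have := le_trans h1 h2; rewrite -/k; apply/negP; rewrite -ltNge.
have kd : 0 < kern (al + 1) (t0 - t1) by rewrite kern_gt0// subr_gt0.
rewrite /rlcst /eta [ltLHS](_ : _ = kern (al + 1) (t0 - t1) * (k * (M / (2 * (M + 1))))); last first.
  by field; rewrite !gt_eqF.
rewrite ltr_pM2l// -[ltRHS]mulr1 ltr_pM2l// ltr_pdivrMr ?mulr_gt0//; lra.
Qed.

End positivity.

(** * Absolutely continuous functions and their densities *)

(** Lists of nonoverlapping intervals are easier to concatenate than the indexed
families in the definition of absolute continuity. *)
Definition intervals_apart (R : realType) (l : seq (R * R)) : bool :=
  pairwise (fun p q => (p.2 <= q.1) || (q.2 <= p.1)) l.

Lemma abs_cont_seq (R : realType) (a b : R) (F : R -> R) (e : R) :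
  abs_cont a b F -> 0 < e -> exists2 d, 0 < d & forall l : seq (R * R),
    all (fun p => [&& a <= p.1, p.1 <= p.2 & p.2 <= b]) l -> intervals_apart l ->
    \sum_(p <- l) (p.2 - p.1) < d -> \sum_(p <- l) `|F p.2 - F p.1| < e.
Proof.
move=> acF e0; have [d d0 hd] := acF _ e0; exists d => // l lab lap lsum.
pose z : R * R := (a, a).
have := hd (size l) (fun i => (nth z l i).1) (fun i => (nth z l i).2).
rewrite (big_nth z) big_mkord; apply.
- by move=> i; have /and3P[] := all_nthP z lab i (ltn_ord i).
- apply/trivIsetP => i j _ _ ij; apply/seteqP; split => // x [].
  rewrite /= !in_itv/= => /andP[h1 h2] /andP[h3 h4].
  wlog lij : i j ij h1 h2 h3 h4 / (i < j)%N.
    move=> H; have := ij; rewrite -val_eqE/= neq_ltn => /orP[h|h].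
      exact: (H i j ij).
    by apply: (H j i) => //; rewrite eq_sym.
  have /(pairwiseP z) := lap => /(_ i j); rewrite !inE => /(_ (ltn_ord i) (ltn_ord j) lij).
  by move=> /orP[] h; [have := lt_le_trans h2 h|have := lt_le_trans h4 h] => ?; 
    [have := lt_trans h3 (lt_le_trans h2 h)|have := lt_trans h1 (lt_le_trans h4 h)]; rewrite ltxx.
- by move: lsum; rewrite (big_nth z) big_mkord.
Qed.

Definition cells (R : realType) (u : R) (s : seq R) : seq (R * R) := zip (u :: s) s.

Lemma cellsP (R : realType) (u : R) (s : seq R) : path <%R u s ->
  [/\ all (fun p => [&& u <= p.1, p.1 <= p.2 & p.2 <= last u s]) (cells u s),
      intervals_apart (cells u s) & \sum_(p <- cells u s) (p.2 - p.1) = last u s - u].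
Proof.
elim: s u => [|v s IH] u /=; first by rewrite /cells/= big_nil subrr.
move=> /andP[uv ps]; have [h1 h2 h3] := IH v ps.
have vl : v <= last v s.
  elim: s v {IH h1 h2 h3 uv} ps => //= w s IH v /andP[vw /IH]; apply: le_trans; exact: ltW.
rewrite /cells/= -/(cells v s); split.
- rewrite lexx (ltW uv) vl /=; apply/allP => p /(allP h1)/and3P[k1 k2 k3].
  by rewrite (le_trans (ltW uv) k1) k2.
- rewrite /intervals_apart/= -/(intervals_apart _) h2 andbT.
  by apply/allP => p /(allP h1)/and3P[k1 _ _]; rewrite k1.
- by rewrite big_cons/= h3; ring.
Qed.

Lemma variation_cells (R : realType) (u v : R) (F : R -> R) (s : seq R) : itv_partition u v s ->
  variation u v F s = \sum_(p <- cells u s) `|F p.2 - F p.1|.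
Proof.
move=> us; rewrite variation_zip//; elim: s u {us} => [|w s IH] u.
  by rewrite /cells !big_nil.
by rewrite /cells/= !big_cons/= IH.
Qed.

Section total_variation_abs_cont.
Context {R : realType} (a b : R) (F : R -> R).
Hypotheses (ab : a < b) (acF : abs_cont a b F).

(** The intervals of [l1] are refined one after the other into subdivisions
almost realizing their total variation; [l2] collects the intervals already
refined. *)
Lemma total_variation_sum (e d : R) :
  (forall l : seq (R * R),
    all (fun p => [&& a <= p.1, p.1 <= p.2 & p.2 <= b]) l -> intervals_apart l ->
    \sum_(p <- l) (p.2 - p.1) < d -> \sum_(p <- l) `|F p.2 - F p.1| < e) ->
  forall l1 l2, all (fun p => [&& a <= p.1, p.1 <= p.2 & p.2 <= b]) (l1 ++ l2) ->
    intervals_apart (l1 ++ l2) -> \sum_(p <- l1 ++ l2) (p.2 - p.1) < d ->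
    (\sum_(p <- l1) total_variation p.1 p.2 F + (\sum_(p <- l2) `|F p.2 - F p.1|)%:E <= e%:E)%E.
Proof.
move=> hd; elim=> [|p l1 IH] l2 hall hap hsum.
  by rewrite big_nil add0e lee_fin ltW// hd.
have [ap pp pb] : [/\ a <= p.1, p.1 <= p.2 & p.2 <= b] by case/andP: hall => /and3P.
have hall' : all (fun p => [&& a <= p.1, p.1 <= p.2 & p.2 <= b]) (l1 ++ l2) by case/andP: hall.
have hap' : intervals_apart (l1 ++ l2) by case/andP: hap.
have hp : all (fun q => (p.2 <= q.1) || (q.2 <= p.1)) (l1 ++ l2) by case/andP: hap.
rewrite big_cons -addeA.
have [fin1|] := boolP ((\sum_(p <- l1) total_variation p.1 p.2 F)%E \is a fin_num); last first.
  move=> nfin; have := IH l2 hall' hap'.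
  rewrite big_cons in hsum; have h1 : 0 <= p.2 - p.1 by rewrite subr_ge0.
  move=> /(_ (le_lt_trans _ hsum)); rewrite lerDr => /(_ h1).
  move: nfin; rewrite fin_numE negb_and !negbK => /orP[/eqP E|/eqP -> //].
  have : (0 <= \sum_(p <- l1) total_variation p.1 p.2 F)%E.
    rewrite big_seq; apply: sume_ge0 => q ql; apply: total_variation_ge0.
    by move/allP: hall' => /(_ q); rewrite mem_cat ql => /(_ isT)/and3P[].
  by rewrite E.
rewrite -leeBrDr ?fin_numD ?fin1//.
apply: ge_ereal_sup => _ [_ [s ps <-] <-].
rewrite leeBrDr ?fin_numD ?fin1// addeCA -EFinD.
have [cs1 cs2 cs3] := cellsP ps.1; rewrite (eqP ps.2) in cs1 cs3.
rewrite (variation_cells _ ps) -big_cat; apply: IH.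
- move: hall'; rewrite !all_cat => /andP[-> ->]; rewrite andbT/=.
  apply/allP => q /(allP cs1)/and3P[k1 k2 k3].
  by rewrite (le_trans ap k1) k2 (le_trans k3 pb).
- move: hap' hp; rewrite /intervals_apart !pairwise_cat !all_cat => /and3P[h1 h2 h3] /andP[h4 h5].
  apply/and3P; split => //.
    rewrite allrel_catr h1 andbT; apply/allrelP => q r /(allP h4) /orP qp /(allP cs1)/and3P[k1 k2 k3].
    by case: qp => h; apply/orP; [right; exact: le_trans k3 h|left; exact: le_trans h k1].
  apply/and3P; split => //.
  apply/allrelP => r q /(allP cs1)/and3P[k1 k2 k3] /(allP h5) /orP qp.
  by case: qp => h; apply/orP; [left; exact: le_trans k3 h|right; exact: le_trans h k1].
- move: hsum; rewrite /= big_cons !big_cat/= cs3 => h; move: h; lra.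
Qed.

(** A subdivision into pieces shorter than the modulus of absolute continuity
has variation less than [1] on each piece. *)
Lemma abs_cont_bounded_variation : bounded_variation a b F.
Proof.
have [d d0 hd] := abs_cont_seq acF ltr01.
pose h := d / 2.
have h0 : 0 < h by rewrite divr_gt0.
have loc u v : a <= u -> u <= v -> v <= b -> v - u <= h -> bounded_variation u v F.
  move=> au uv vb vu; exists 1 => _ [s ps <-].
  rewrite (variation_cells _ ps); have [cs1 cs2 cs3] := cellsP ps.1; rewrite (eqP ps.2) in cs1 cs3.
  apply/ltW/hd => //.
    by apply/allP => q /(allP cs1)/and3P[k1 k2 k3]; rewrite (le_trans au k1) k2 (le_trans k3 vb).
  by rewrite cs3; move: vu; rewrite /h; lra.
have steps (n : nat) c : a <= c -> c <= b -> c - a <= n%:R * h -> bounded_variation a c F.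
  elim: n c => [|n IH] c ac cb ca.
    have -> : c = a by apply/eqP; rewrite eq_le ac andbT; move: ca; lra.
    exact: bounded_variationxx.
  have [ch|ch] := leP (c - h) a.
    by apply: loc => //; lra.
  have B1 : bounded_variation a (c - h) F.
    apply: IH; [exact: ltW|lra|move: ca; rewrite -natr1; lra].
  have B2 : bounded_variation (c - h) c F by apply: loc => //; lra.
  apply/bounded_variationP => //.
  rewrite (total_variationD _ (ltW ch)); last by lra.
  by rewrite fin_numD; apply/andP; split; apply/bounded_variationP => //; lra.
apply: (steps (Num.bound ((b - a) / h))) => //; first exact: ltW.
rewrite -ler_pdivrMr//; apply/ltW/archi_boundP.
by rewrite divr_ge0 ?subr_ge0 ?ltW.
Qed.

Definition tvar (x : R) : R := fine (total_variation a x F).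

Let TVfin u v : a <= u -> u <= v -> v <= b -> total_variation u v F \is a fin_num.
Proof.
move=> au uv vb; apply/bounded_variationP => //.
exact: (bounded_variationr au uv (bounded_variationl (le_trans au uv) vb abs_cont_bounded_variation)).
Qed.

Lemma tvarB u v : a <= u -> u <= v -> v <= b ->
  total_variation u v F = (tvar v - tvar u)%:E.
Proof.
move=> au uv vb; have avb := le_trans au uv.
rewrite /tvar (total_variationD _ au uv) fineD ?TVfin ?(le_trans uv)//.
by rewrite addrAC subrr add0r fineK// TVfin.
Qed.

Lemma tvar_le u v : a <= u -> u <= v -> v <= b -> `|F v - F u| <= tvar v - tvar u.
Proof.
by move=> au uv vb; rewrite -lee_fin -tvarB// total_variation_ge.
Qed.

(** The total variation inherits the modulus of absolute continuity, by
[total_variation_sum] with no interval refined yet. *)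
Lemma tvar_abs_cont (e : R) : 0 < e -> exists2 d, 0 < d & forall l : seq (R * R),
    all (fun p => [&& a <= p.1, p.1 <= p.2 & p.2 <= b]) l -> intervals_apart l ->
    \sum_(p <- l) (p.2 - p.1) < d -> \sum_(p <- l) (tvar p.2 - tvar p.1) <= e.
Proof.
move=> e0; have [d d0 hd] := abs_cont_seq acF e0; exists d => // l hall hap hsum.
have := total_variation_sum hd (l1 := l) (l2 := [::]); rewrite cats0 big_nil adde0.
move=> /(_ hall hap hsum); rewrite -lee_fin; apply: le_trans.
rewrite -sumEFin big_seq [leRHS]big_seq le_eqVlt; apply/orP; left; apply/eqP.
by apply: eq_bigr => p /(allP hall)/and3P[h1 h2 h3]; rewrite tvarB.
Qed.

End total_variation_abs_cont.

Lemma stieltjes_itv (R : realType) (G : cumulative R R) (u v : R) : u <= v ->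
  lebesgue_stieltjes_measure G `]u, v]%classic = (G v - G u)%:E.
Proof.
move=> uv; rewrite /lebesgue_stieltjes_measure /measure_extension measurable_mu_extE/=.
  by rewrite wlength_itv_bnd.
exact: is_ocitv.
Qed.

Lemma lebesgue_ocitv (R : realType) (u v : R) : u <= v ->
  (@lebesgue_measure R) `]u, v]%classic = (v - u)%:E.
Proof.
move=> uv; rewrite lebesgue_measure_itv/= lte_fin.
by case: ltgtP uv => // -> _; rewrite subrr.
Qed.

Section stieltjes_dominated.
Context {R : realType} (G : cumulative R R).
Hypothesis acG : forall e, 0 < e -> exists2 d, 0 < d & forall l : seq (R * R),
  all (fun p => p.1 <= p.2) l -> intervals_apart l ->
  \sum_(p <- l) (p.2 - p.1) < d -> \sum_(p <- l) (G p.2 - G p.1) <= e.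
Local Notation nu := (lebesgue_stieltjes_measure G).

(** Finite unions of half-open intervals form a ring of sets, whose elements are finite
disjoint unions; both measures are then sums over the same list of intervals. *)
Lemma ocitv_union_disjoint (F : nat -> set R) n : (forall k, ocitv (F k)) ->
  exists l : seq (R * R), [/\ all (fun p => p.1 <= p.2) l, intervals_apart l,
    (@lebesgue_measure R) (\big[setU/set0]_(k < n) F k) = (\sum_(p <- l) (p.2 - p.1))%:E &
    nu (\big[setU/set0]_(k < n) F k) = (\sum_(p <- l) (G p.2 - G p.1))%:E].
Proof.
move=> oF.
have mU : (R.-ocitv.-ring).-measurable (\big[setU/set0]_(k < n) F k : set (SetRing.type (ocitv_type R))).
  by apply: bigsetU_measurable => k _; apply: SetRing.measurable_subring; exact: oF.
have [B [finB B0 tB mB UB]] := SetRing.ring_finite_set mU.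
have oB X : B X -> exists p : R * R, p.1 < p.2 /\ X = `]p.1, p.2]%classic.
  move=> BX; have : ocitv X by apply: mB; rewrite inE.
  move/ocitvP => [X0|[p pp XE]]; last by exists p.
  by have /set0P := B0 X BX; rewrite X0 eqxx.
have [g hg] : exists g : set R -> R * R, forall X, B X -> (g X).1 < (g X).2 /\ X = `](g X).1, (g X).2]%classic.
  have : forall X, exists p : R * R, B X -> p.1 < p.2 /\ X = `]p.1, p.2]%classic.
    move=> X; have [BX|nBX] := pselect (B X); last by exists (0, 0).
    by have [p hp] := oB X BX; exists p.
  by move=> /choice[g hg]; exists g.
pose s : seq (set R) := finmap.enum_fset (fset_set B).
have sB X : X \in s = (X \in B) by exact: in_fset_set.
exists (map g s).
have us : uniq s by exact: finmap.fset_uniq.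
have sum_measure (m : {measure set (measurableTypeR R) -> \bar R}) :
    m (\big[setU/set0]_(k < n) F k) = (\sum_(X <- s) m X)%E.
  rewrite UB (_ : \bigcup_(X in B) X = \bigcup_(X in B) id X)// measure_fin_bigcup//.
    by rewrite fsbig_finite.
  by move=> X /hg[_ ->]; exact: measurable_itv.
split.
- apply/allP => _ /mapP[X + ->]; rewrite sB inE => /hg[h _]; exact: ltW.
- rewrite /intervals_apart pairwise_map.
  have : pairwise (fun X Y : set R => X != Y) s by rewrite -uniq_pairwise.
  apply: (@sub_in_pairwise _ (fun X : set R => X \in s)); last by apply/allP.
  move=> X Y Xs Ys XY.
  have BX : B X by move: (Xs : X \in s); rewrite sB inE.
  have BY : B Y by move: (Ys : Y \in s); rewrite sB inE.
  have [gX EX] := hg X BX; have [gY EY] := hg Y BY.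
  rewrite /=; case: leP => //= h1; rewrite leNgt; apply/negP => h2.
  have := tB X Y BX BY => H; have : X = Y.
    apply: H; exists (Num.min (g X).2 (g Y).2); split.
      have : `](g X).1, (g X).2]%classic (Num.min (g X).2 (g Y).2).
        by rewrite /= in_itv/= lt_min gX h2 ge_min lexx.
      by rewrite -EX.
    have : `](g Y).1, (g Y).2]%classic (Num.min (g X).2 (g Y).2).
      by rewrite /= in_itv/= lt_min gY h1 ge_min lexx orbT.
    by rewrite -EY.
  by move/eqP: XY.
- rewrite sum_measure big_map -sumEFin big_seq [RHS]big_seq.
  apply: eq_bigr => X; rewrite sB inE => /hg[h E]; rewrite {1}E.
  by apply: lebesgue_ocitv; exact: ltW.
- rewrite sum_measure big_map -sumEFin big_seq [RHS]big_seq.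
  apply: eq_bigr => X; rewrite sB inE => /hg[h E]; rewrite {1}E.
  by apply: stieltjes_itv; exact: ltW.
Qed.

(** A Lebesgue-null set is covered by intervals of small total length; absolute
continuity bounds the Stieltjes measure of the finite unions of them, hence of
the whole cover. *)
Lemma stieltjes_dominated : nu `<< (@lebesgue_measure R).
Proof.
apply/null_content_dominatesP => A mA A0.
apply/eqP; rewrite eq_le measure_ge0 andbT.
apply/lee_addgt0Pr => e e0; rewrite add0e.
have [d d0 hd] := acG e0.
have [F [oF AF Fd]] : exists F : nat -> set R, [/\ (forall k, ocitv (F k)),
    A `<=` \bigcup_k F k & (\sum_(0 <= k <oo) (@lebesgue_measure R) (F k) < d%:E)%E].
  have : (@lebesgue_measure R A < d%:E)%E by rewrite A0 lte_fin.
  rewrite /lebesgue_measure /lebesgue_stieltjes_measure /measure_extension/= /mu_ext.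
  move=> /ereal_inf_lt[_ [F [oF AF] <-]] hF; exists F; split => //.
  apply: le_lt_trans hF; apply: lee_nneseries => [k _ _|k _]; first exact: (@measure_ge0 _ _ _ (@lebesgue_measure R)).
  have E := @measurable_mu_extE _ _ _ (wlength idfun) _ (oF k).
  by rewrite le_eqVlt; apply/orP; left; apply/eqP; exact: E.
have mF k : measurable (F k : set (measurableTypeR R)).
  by apply: sub_sigma_algebra; exact: oF.
pose U n := \big[setU/set0]_(k < n.+1) F k.
have nuU n : (nu (U n) <= e%:E)%E.
  have [l [l1 l2 l3 l4]] := ocitv_union_disjoint n.+1 oF.
  rewrite /U l4 lee_fin; apply: hd => //.
  rewrite -lte_fin -l3; apply: le_lt_trans Fd.
  apply: (@le_trans _ _ (\sum_(k < n.+1) (@lebesgue_measure R) (F k))%E).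
    by apply: content_subadditive => //; exact: bigsetU_measurable.
  by rewrite -(big_mkord xpredT (fun k => (@lebesgue_measure R) (F k))); exact: nneseries_lim_ge.
apply: (@le_trans _ _ (nu (\bigcup_k F k))).
  by apply: le_measure; rewrite ?inE//; exact: bigcup_measurable.
have : nu (U n) @[n --> \oo] --> nu (\bigcup_n U n).
  apply: nondecreasing_cvg_mu.
  - by move=> n; apply: bigsetU_measurable.
  - by apply: bigcup_measurable => n _; apply: bigsetU_measurable.
  - by move=> n m nm; apply/subsetPset; apply: subset_bigsetU.
rewrite bigcup_bigsetU_bigcup => /cvg_lim <-//.
apply: lime_le; last by near=> n; exact: nuU.
apply: ereal_nondecreasing_is_cvgn => n m nm.
by apply: le_measure; rewrite ?inE//; [apply: bigsetU_measurable|apply: bigsetU_measurable|exact: subset_bigsetU].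
Unshelve. all: by end_near. Qed.

End stieltjes_dominated.

Lemma abs_cont_continuous (R : realType) (a b : R) (F : R -> R) (e : R) :
  abs_cont a b F -> 0 < e -> exists2 d, 0 < d & forall u v, a <= u -> u <= v -> v <= b ->
    v - u < d -> `|F v - F u| < e.
Proof.
move=> acF e0; have [d d0 hd] := abs_cont_seq acF e0; exists d => // u v au uv vb vu.
have := hd [:: (u, v)]; rewrite /intervals_apart/= !big_cons !big_nil !addr0 au uv vb/=.
by apply.
Qed.

Section abs_cont_density.
Context {R : realType} (a b : R).
Hypothesis ab : a < b.

(** The projection of the line on [[a, b]]: it extends functions on the interval
to the line, continuously. *)
Definition clip (t : R) : R := Num.max a (Num.min b t).

Lemma clip_itv t : a <= clip t <= b.
Proof. by rewrite /clip le_max lexx/= ge_max (ltW ab) ge_min lexx. Qed.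

Lemma clip_id t : a <= t <= b -> clip t = t.
Proof. by move=> /andP[at_ tb]; rewrite /clip (min_idPr tb) (max_idPr at_). Qed.

Lemma clip_ge s : b <= s -> clip s = b.
Proof. by move=> bs; rewrite /clip (min_idPl bs); apply/max_idPr/ltW. Qed.

Lemma clip_le s : s <= a -> clip s = a.
Proof. by move=> sa; rewrite /clip (min_idPr (le_trans sa (ltW ab))); apply/max_idPl. Qed.

Lemma le_clip s t : s <= t -> clip s <= clip t.
Proof. by move=> st; rewrite /clip; apply: le_max2 => //; apply: le_min2. Qed.

Lemma clipB_le s t : s <= t -> clip t - clip s <= t - s.
Proof.
move=> st; have [sa|sa] := leP s a.
  rewrite (clip_le sa); have [ta|ta] := leP t a; first by rewrite clip_le//; lra.
  have [tb|tb] := leP t b; first by rewrite clip_id ?(ltW ta)//; lra.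
  by rewrite clip_ge ?ltW//; lra.
have [sb|sb] := leP s b; last by rewrite !clip_ge ?(ltW sb) ?(le_trans (ltW sb))//; lra.
rewrite (clip_id (t := s)) ?(ltW sa)//.
have [tb|tb] := leP t b; first by rewrite clip_id// tb andbT; lra.
by rewrite clip_ge ?ltW//; lra.
Qed.

Lemma clip_continuous : continuous clip.
Proof.
move=> t; rewrite /clip; apply: (@continuous_max _ _ (cst a) (fun t => Num.min b t)).
  exact: cvg_cst.
by apply: (@continuous_min _ _ (cst b) id); [exact: cvg_cst|exact: cvg_id].
Qed.

Lemma clip_list (l : seq (R * R)) : all (fun p => p.1 <= p.2) l -> intervals_apart l ->
  let l' := map (fun p => (clip p.1, clip p.2)) l in
  [/\ all (fun p => [&& a <= p.1, p.1 <= p.2 & p.2 <= b]) l', intervals_apart l' &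
    \sum_(p <- l') (p.2 - p.1) <= \sum_(p <- l) (p.2 - p.1)].
Proof.
move=> hl ap l'; split.
- apply/allP => _ /mapP[p pl ->] /=.
  by have /andP[-> _] := clip_itv p.1; have /andP[_ ->] := clip_itv p.2; rewrite le_clip// (allP hl).
- rewrite /intervals_apart pairwise_map; apply: sub_pairwise ap => p q /=.
  by move=> /orP[h|h]; apply/orP; [left|right]; exact: le_clip.
- rewrite big_map big_seq [leRHS]big_seq; apply: ler_sum => p /(allP hl) pp.
  exact: clipB_le.
Qed.

(** Radon-Nikodym for the Stieltjes measure of [G], extended by constants
outside the interval. *)
Lemma monotone_density (G : R -> R) :
  (forall u v, a <= u -> u <= v -> v <= b -> G u <= G v) ->
  (forall e, 0 < e -> exists2 d, 0 < d & forall l : seq (R * R),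
    all (fun p => [&& a <= p.1, p.1 <= p.2 & p.2 <= b]) l -> intervals_apart l ->
    \sum_(p <- l) (p.2 - p.1) < d -> \sum_(p <- l) (G p.2 - G p.1) <= e) ->
  exists2 f : R -> R, integrableR f &
    forall t, a <= t <= b -> G t - G a = \int[lebesgue_measure]_(s in `]a, t]) f s.
Proof.
move=> ndG acG; pose H t := G (clip t).
have ndH : nondecreasing H.
  move=> u v uv; have /andP[h1 _] := clip_itv u; have /andP[_ h2] := clip_itv v.
  by apply: ndG => //; exact: le_clip.
have Hd e : 0 < e -> exists2 d, 0 < d & forall u v, u <= v -> v - u < d -> H v - H u <= e.
  move=> e0; have [d d0 hd] := acG e e0; exists d => // u v uv vu.
  have [||h1 h2 h3] := @clip_list [:: (u, v)] => //=; first by rewrite uv.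
  have := hd _ h1 h2; rewrite /= !big_cons !big_nil !addr0/=; apply.
  by apply: le_lt_trans vu; exact: clipB_le.
have rcH : right_continuous H.
  move=> t; apply/cvgrPdist_le => e e0; have [d d0 hd] := Hd e e0.
  near=> s; have ts : t <= s by near: s; exact: nbhs_right_ge.
  rewrite distrC ger0_norm ?subr_ge0 ?ndH//; apply: hd => //.
  by rewrite ltrBlDl; near: s; apply: nbhs_right_lt; rewrite ltrDl.
pose Hc := isCumulative.Build R _ R H ndH rcH.
pose C : cumulative R R := HB.pack H Hc.
have CE : C = H :> (R -> R) by [].
have acC e : 0 < e -> exists2 d, 0 < d & forall l : seq (R * R),
  all (fun p => p.1 <= p.2) l -> intervals_apart l ->
  \sum_(p <- l) (p.2 - p.1) < d -> \sum_(p <- l) (C p.2 - C p.1) <= e.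
  move=> e0; have [d d0 hd] := acG e e0; exists d => // l hl ap hsum.
  have [h1 h2 h3] := clip_list hl ap.
  by have := hd _ h1 h2 (le_lt_trans h3 hsum); rewrite big_map.
have dom := stieltjes_dominated acC.
pose nu0 := lebesgue_stieltjes_measure C.
have mab : measurable (`]a, b]%classic : set (measurableTypeR R)) by exact: measurable_itv.
pose nu := mrestr nu0 mab.
have nufin : fin_num_fun nu.
  move=> A mA; rewrite ge0_fin_numE; last exact: measure_ge0.
  apply: (@le_lt_trans _ _ (nu0 `]a, b]%classic)).
    by apply: le_measure; rewrite ?inE//; exact: measurableI.
  by rewrite /nu0 stieltjes_itv ?(ltW ab)// ltry.
pose nuF := @Measure_isFinite.Build _ _ _ nu nufin.
pose nufm : {finite_measure set _ -> \bar R} := HB.pack nu nuF.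
have dom' : nufm `<< (@lebesgue_measure R).
  apply/null_content_dominatesP => A mA A0.
  apply/eqP; rewrite eq_le measure_ge0 andbT.
  have /null_content_dominatesP/(_ A mA A0) <- := dom.
  by apply: le_measure; rewrite ?inE//; exact: measurableI.
have [f [f0 ffin If fE]] := radon_nikodym_sigma_finite dom'.
exists (fine \o f).
  by move: If; apply: eq_integrable => // x _ /=; rewrite fineK.
move=> t /andP[at_ tb]; rewrite /Rintegral.
under eq_integral do rewrite /= fineK//.
rewrite -fE; last exact: measurable_itv.
rewrite /= /nu /mrestr/= /nu0.
have -> : `]a, t] `&` `]a, b] = `]a, t]%classic :> set R.
  by apply/setIidl => x; rewrite /= !in_itv/= => /andP[-> xt]; exact: le_trans tb.
rewrite stieltjes_itv//= /H (clip_id (t := t)) ?at_// clip_id// lexx ltW//.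
Unshelve. all: by end_near. Qed.

(** [F] is the difference of its total variation and of a nondecreasing function, both
absolutely continuous. *)
Lemma abs_cont_density (F : R -> R) : abs_cont a b F ->
  exists2 f : R -> R, integrableR f &
    forall t, a <= t <= b -> F t = F a + \int[lebesgue_measure]_(s in `]a, t]) f s.
Proof.
move=> acF; pose V := tvar a F.
have VF := tvar_le ab acF.
have [f1 If1 E1] : exists2 f : R -> R, integrableR f &
    forall t, a <= t <= b -> V t - V a = \int[lebesgue_measure]_(s in `]a, t]) f s.
  apply: monotone_density; last exact: tvar_abs_cont.
  by move=> u v au uv vb; rewrite -subr_ge0; apply: le_trans (VF u v au uv vb).
have [f2 If2 E2] : exists2 f : R -> R, integrableR f &
    forall t, a <= t <= b -> (V t - F t) - (V a - F a) = \int[lebesgue_measure]_(s in `]a, t]) f s.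
  apply: (monotone_density (G := fun t => V t - F t)).
    move=> u v au uv vb; have := VF u v au uv vb; rewrite ler_norml => /andP[_ h].
    by rewrite /V; lra.
  move=> e e0; have e2 : 0 < e / 2 by rewrite divr_gt0.
  have [d1 d10 h1] := tvar_abs_cont ab acF e2.
  have [d2 d20 h2] := abs_cont_seq acF e2.
  exists (Num.min d1 d2); first by rewrite lt_min d10.
  move=> l hl ap; rewrite lt_min => /andP[s1 s2].
  have := h1 l hl ap s1; have := h2 l hl ap s2 => k2 k1.
  apply: (@le_trans _ _ (\sum_(p <- l) ((tvar a F p.2 - tvar a F p.1) + `|F p.2 - F p.1|))).
    apply: ler_sum => p _; rewrite /V; have := ler_norm (- (F p.2 - F p.1)); rewrite normrN; lra.
  by rewrite big_split/=; lra.
exists (fun s => f1 s - f2 s); first exact: (integrableB measurableT If1 If2).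
move=> t tab; have e1 := E1 t tab; have e2 := E2 t tab.
rewrite RintegralB//; [|exact: integrableS If1|exact: integrableS If2].
by rewrite -e1 -e2; ring.
Qed.

End abs_cont_density.

(** * Differentiation of absolutely continuous functions *)

Section abs_cont_derivative.
Context {R : realType} (a b : R).
Hypothesis ab : a < b.

Lemma ae_itv_point (u v : R) (P : R -> Prop) : u < v ->
  {ae @lebesgue_measure R, forall t, P t} -> exists2 t, u < t < v & P t.
Proof.
move=> uv [N [mN N0 PN]].
have [//|nex] := pselect (exists2 t, u < t < v & P t); exfalso.
have sub : `]u, v[%classic `<=` N.
  move=> t; rewrite /= in_itv/= => tuv; apply: PN => /= Pt.
  by apply: nex; exists t.
have : ((@lebesgue_measure R) `]u, v[%classic <= (@lebesgue_measure R) N)%E.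
  by apply: le_measure; rewrite ?inE//; exact: measurable_itv.
by rewrite N0 lebesgue_measure_itv/= lte_fin uv -EFinD lee_fin subr_le0 leNgt uv.
Qed.

(** Two continuous functions that differ at a point differ on an interval. *)
Lemma abs_cont_ae_eq (F G : R -> R) : abs_cont a b F -> abs_cont a b G ->
  {ae @lebesgue_measure R, forall t, t \in `[a, b] -> F t = G t} ->
  forall t, t \in `[a, b] -> F t = G t.
Proof.
move=> acF acG FG t; rewrite in_itv/= => /andP[at_ tb].
apply/eqP; apply/negPn/negP => neq.
have e0 : 0 < `|F t - G t| / 2 by rewrite divr_gt0// normr_gt0 subr_eq0.
have [d1 d10 h1] := abs_cont_continuous acF e0.
have [d2 d20 h2] := abs_cont_continuous acG e0.
pose d := Num.min d1 d2.
have d0 : 0 < d by rewrite lt_min d10.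
have uv : Num.max a (t - d) < Num.min b (t + d).
  by rewrite lt_min !gt_max ab; lra.
have [s] := ae_itv_point uv FG.
rewrite gt_max lt_min -!andbA => /and4P[as_ sd sb sd'] /(_ _).
rewrite in_itv/= !ltW// => /(_ isT) FGs.
have [k1 k2] : `|F t - F s| < `|F t - G t| / 2 /\ `|G t - G s| < `|F t - G t| / 2.
  have [st|ts] := leP s t.
    split; [apply: h1|apply: h2] => //; rewrite ?(ltW as_)//.
      by apply: (@lt_le_trans _ _ d); [lra|rewrite /d ge_min lexx].
    by apply: (@lt_le_trans _ _ d); [lra|rewrite /d ge_min lexx orbT].
  rewrite distrC [X in _ /\ X < _]distrC.
  split; [apply: h1|apply: h2] => //; rewrite ?(ltW sb) ?(ltW ts)//.
    by apply: (@lt_le_trans _ _ d); [lra|rewrite /d ge_min lexx].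
  by apply: (@lt_le_trans _ _ d); [lra|rewrite /d ge_min lexx orbT].
have : `|F t - G t| <= `|F t - F s| + `|G t - G s|.
  have -> : F t - G t = (F t - F s) - (G t - G s) by rewrite FGs; ring.
  exact: ler_normB.
lra.
Qed.

Lemma ac_repr_of_ac_repr (g F : R -> R) : ac_repr_of a b g F ->
  ac_repr_of a b g (ac_repr a b g).
Proof. by move=> gF; rewrite /ac_repr; case: xgetP => [G _ //|/(_ F)]; case. Qed.

Lemma ac_repr_eq (g F : R -> R) : ac_repr_of a b g F ->
  forall t, t \in `[a, b] -> ac_repr a b g t = F t.
Proof.
move=> gF; have [acF eF] := gF; have [acG eG] := ac_repr_of_ac_repr gF.
apply: abs_cont_ae_eq => //.
apply: (@filterS2 _ _ (ae_filter_ringOfSetsType (@lebesgue_measure R)) _ _ _ _ eF eG).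
by move=> t h1 h2 tab; rewrite -h1// -h2.
Qed.

Lemma integrable_itvR (D : set R) (f : R -> R) : measurable D -> integrableR f ->
  (@lebesgue_measure R).-integrable D (EFin \o f).
Proof. by move=> mD If; exact: integrableS If. Qed.

Lemma prim_itvB (f : R -> R) (u v : R) : integrableR f -> a <= u -> u <= v ->
  \int[lebesgue_measure]_(s in `]a, v]) f s - \int[lebesgue_measure]_(s in `]a, u]) f s =
  \int[lebesgue_measure]_(s in `]u, v]) f s.
Proof.
move=> If au uv; rewrite Rintegral_itvB//.
by apply: integrable_itvR.
Qed.

(** Absolute continuity of the Lebesgue integral, applied to the union of the
intervals. *)
Lemma abs_cont_prim (F f : R -> R) (c : R) : integrableR f ->
  (forall t, a <= t <= b -> F t = c + \int[lebesgue_measure]_(s in `]a, t]) f s) ->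
  abs_cont a b F.
Proof.
move=> If FE e e0.
have [d [d0 hd]] := integral_normr_continuous If e0.
exists d => // n u v huv tuv sd.
have mI i : measurable (`]u i, v i[%classic : set (measurableTypeR R)) by exact: measurable_itv.
pose D := \big[setU/set0]_(i < n) `]u i, v i[%classic.
have mD : measurable (D : set (measurableTypeR R)) by exact: bigsetU_measurable.
have tI : trivIset [set` index_enum 'I_n] (fun i : 'I_n => `]u i, v i[%classic).
  by apply: sub_trivIset tuv.
have mf : measurable_fun [set: R] f by have /measurable_int/measurable_EFinP := If.
have mun : measurable_fun D (fun x => `|f x|%:E).
  apply/measurable_EFinP; apply: measurableT_comp => //.
  exact: measurable_funTS.
have muD : ((@lebesgue_measure R) D < d%:E)%E.
  have -> : ((@lebesgue_measure R) D = \sum_(i < n) (@lebesgue_measure R) `]u i, v i[%classic)%E.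
    rewrite -[LHS]mul1e -integral_cst// ge0_integral_bigsetU//; last exact: index_enum_uniq.
    by apply: eq_bigr => i _; rewrite integral_cst// mul1e.
  rewrite (eq_bigr (fun i => (v i - u i)%:E)) ?sumEFin ?lte_fin// => i _.
  have [_ uvi _] := huv i; rewrite lebesgue_measure_itv/= lte_fin.
  by case: ltgtP uvi => // -> _; rewrite subrr.
have := hd D mD muD; rewrite -lte_fin.
have If' := integrable_itvR mD If.
rewrite /Rintegral fineK; last first.
  by apply: integrable_fin_num => //; exact: integrable_norm If'.
move=> hDe; rewrite -lte_fin; apply: le_lt_trans hDe.
have -> : (\int[lebesgue_measure]_(x in D) (`|f x|)%:E = \sum_(i < n) \int[lebesgue_measure]_(x in `]u i, v i[) (`|f x|)%:E)%E.
  rewrite ge0_integral_bigsetU//; first exact: index_enum_uniq.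
rewrite -sumEFin; apply: lee_sum => i _.
have [aui uvi vib] := huv i.
rewrite !FE ?aui ?(le_trans uvi)// ?vib ?(le_trans aui)//.
rewrite opprD addrACA subrr add0r prim_itvB//.
rewrite -Rintegral_itv_bndo_bndc; last exact: integrable_itvR.
have If2 : (@lebesgue_measure R).-integrable `]u i, v i[ (EFin \o f) by exact: integrable_itvR.
have := le_normr_Rintegral (mI i) If2; rewrite -lee_fin => /le_trans; apply.
rewrite /Rintegral fineK//; apply: integrable_fin_num => //.
exact: integrable_norm If2.
Qed.

(** The filter that defines the derivative at [t], one-sided at the end points, is
proper, so limits along it are unique. *)
Lemma within_dnbhs_proper (t : R) : t \in `[a, b] ->
  ProperFilter (within (`[a, b]%classic : set R) (t^')).
Proof.
rewrite in_itv/= => /andP[at_ tb]; apply: Build_ProperFilter_ex => P /(nbhs_ballP _ _).1 [e /= e0 hP].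
have e2 : 0 < e / 2 by rewrite divr_gt0.
have [tb'|bt] := ltP t b.
  exists (t + Num.min (e / 2) (b - t)).
  have m0 : 0 < Num.min (e / 2) (b - t) by rewrite lt_min e2 subr_gt0.
  have m1 : Num.min (e / 2) (b - t) <= e / 2 by rewrite ge_min lexx.
  have m2 : Num.min (e / 2) (b - t) <= b - t by rewrite ge_min lexx orbT.
  apply: hP.
  - by rewrite /ball/= opprD addrA subrr sub0r normrN gtr0_norm//; lra.
  - by rewrite gt_eqF// ltrDl.
  - by rewrite /= in_itv/=; apply/andP; split; lra.
exists (t - Num.min (e / 2) (t - a)).
have m0 : 0 < Num.min (e / 2) (t - a) by rewrite lt_min e2 subr_gt0 (lt_le_trans ab).
have m1 : Num.min (e / 2) (t - a) <= e / 2 by rewrite ge_min lexx.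
have m2 : Num.min (e / 2) (t - a) <= t - a by rewrite ge_min lexx orbT.
apply: hP.
- by rewrite /ball/= opprB addrCA subrr addr0 gtr0_norm//; lra.
- by rewrite lt_eqF// ltrBlDr ltrDl.
- by rewrite /= in_itv/=; apply/andP; split; lra.
Qed.

Lemma derive_onE (F : R -> R) (t l : R) : t \in `[a, b] ->
  (fun s => (F s - F t) / (s - t)) @ within (`[a, b]%classic : set R) (t^') --> l ->
  derive_on a b F t = l.
Proof.
move=> tab h; have := within_dnbhs_proper tab => pf.
by apply: (@cvg_lim _ _ _ _ _ _ _ h); exact: Rhausdorff.
Qed.

Lemma eq_derive_on (F G : R -> R) (t : R) : t \in `[a, b] ->
  (forall s, s \in `[a, b] -> F s = G s) -> derive_on a b F t = derive_on a b G t.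
Proof.
move=> tab FG; rewrite /derive_on; congr (lim _).
apply: (@eq_trans _ _ ((fun s => (G s - G t) / (s - t)) @ within (`[a, b]%classic : set R) (t^'))) => //.
apply/seteqP; split => P; rewrite /nbhs/= /within/=; apply: filterS => s h sab.
  by move: (h sab); rewrite -!FG.
by move: (h sab); rewrite !FG.
Qed.

Lemma derivable_quotient (G : R -> R) (t : R) : derivable G t 1 ->
  (fun s => (G s - G t) / (s - t)) @ within (`[a, b]%classic : set R) (t^') --> derive1 G t.
Proof.
move=> dG; have : (fun h => h^-1 *: (G (h *: 1 + t) - G t)) @ (0 : R)^' --> derive1 G t.
  by rewrite derive1E; exact: dG.
move/cvgrPdist_lt => h; apply/cvgrPdist_lt => e e0; have := h e e0.
move=> /(nbhs_ballP _ _).1 [r /= r0 hr].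
apply/(nbhs_ballP _ _).2; exists r => //= s bs st _.
have := hr (s - t).
rewrite /ball/= sub0r normrN distrC => /(_ bs).
rewrite subr_eq0 => /(_ st) /=.
by rewrite [_%R *: 1]mulr1 subrK [_ *: _]mulrC.
Qed.

Lemma derive_on_derivable (F G : R -> R) (t : R) : t \in `[a, b] ->
  (forall s, s \in `[a, b] -> F s = G s) -> derivable G t 1 ->
  derive_on a b F t = derive1 G t.
Proof.
move=> tab FG dG; rewrite (eq_derive_on tab FG); apply: (derive_onE tab).
exact: (derivable_quotient dG).
Qed.

Lemma integrable_locally (f : R -> R) : integrableR f -> locally_integrable [set: R] f.
Proof.
move=> If; have mf : measurable_fun [set: R] f by have /measurable_int/measurable_EFinP := If.
split => //; first exact: openT.
move=> K _ cK; have mK := compact_measurable cK.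
have /integrableP[_] := integrable_itvR mK If.
by [].
Qed.

Lemma prim_derive_ae (F f : R -> R) (c : R) : integrableR f ->
  (forall t, a <= t <= b -> F t = c + \int[lebesgue_measure]_(s in `]a, t]) f s) ->
  {ae @lebesgue_measure R, forall t, t \in `[a, b] -> derive_on a b F t = f t}.
Proof.
move=> If FE.
have := @FTC1Ny R f (fun y => integrable_itvR (measurable_itv _) If) (integrable_locally If).
apply: (@filterS _ _ (ae_filter_ringOfSetsType (@lebesgue_measure R))) => t [dG GE] tab.
pose G x := \int[lebesgue_measure]_(s in `]-oo, x]) f s.
pose H x := (c - G a) + G x.
have FH s : s \in `[a, b] -> F s = H s.
  rewrite in_itv/= => /andP[as_ sb]; rewrite FE ?as_// /H -addrA; congr (_ + _).
  by rewrite addrC /G Rintegral_itvB//; exact: integrable_itvR.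
have dH : is_derive (t : R) (1 : R) H (f t).
  have iG : is_derive (t : R) (1 : R) G (f t).
    by have := DeriveDef dG erefl; rewrite -derive1E GE.
  have := is_deriveD (is_derive_cst (c - G a) t 1) iG.
  by rewrite add0r.
rewrite (derive_on_derivable tab FH); last by case: dH.
by rewrite derive1E; case: dH.
Qed.

(** Lebesgue's theorem: the density of an absolutely continuous function is its
derivative almost everywhere. *)
Lemma abs_cont_derive_ae (F : R -> R) : abs_cont a b F -> exists f : R -> R,
  [/\ integrableR f,
    forall t, a <= t <= b -> F t = F a + \int[lebesgue_measure]_(s in `]a, t]) f s &
    {ae @lebesgue_measure R, forall t, t \in `[a, b] -> derive_on a b F t = f t}].
Proof.
move=> acF; have [f If FE] := abs_cont_density ab acF.
by exists f; split => //; exact: prim_derive_ae FE.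
Qed.

End abs_cont_derivative.

(** * Fractional integrals on an interval *)

Section fractional_integrals.
Context {R : realType}.
Implicit Types (f F w : R -> R) (a b al be t u v : R).

(** Both definitions of the fractional integral, left with [w s = t - s] and
right with [w s = s - t], are integrals over a closed interval; the end points are
null and the rest is an integral over the line. *)
Lemma frac_kernel_integral be (w f F : R -> R) u v : 0 < be -> be <= 1 ->
  (forall s, ~~ (u < s < v) -> fk be (w s) * F s = 0) ->
  (forall s, u < s < v -> 0 < w s /\ F s = f s) ->
  integrableR (fun s => fk be (w s) * F s) ->
  (Gamma be)^-1 * \int[lebesgue_measure]_(s in `[u, v]) (w s `^ (be - 1) * f s) =
  \int[lebesgue_measure]_s (fk be (w s) * F s).
Proof.
move=> be0 be1 out in_ IF; have G0 := Gamma_gt0 be0 be1.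
have [IG EG] := RintegralZ (Gamma be) IF.
have E s : u < s < v -> Gamma be * (fk be (w s) * F s) = w s `^ (be - 1) * f s.
  move=> /in_[ws ->]; rewrite /fk kernE// !mulrA mulfV ?mul1r//.
  by rewrite gt_eqF.
have mG : measurable_fun (`]u, v[%classic : set R) (fun s => Gamma be * (fk be (w s) * F s)).
  by apply: measurable_funTS; have /measurable_int/measurable_EFinP := IG.
rewrite -(mulKf (lt0r_neq0 G0) (\int[_]_s _)) -EG; congr (_ * _).
rewrite /Rintegral; congr fine.
rewrite integral_itv_bndoo; last first.
  apply/measurable_EFinP; move: mG; apply: eq_measurable_fun => s; rewrite inE/= in_itv/=.
  exact: E.
rewrite [RHS](@integral_support _ `]u, v[).
  by apply: eq_integral => s; rewrite inE/= in_itv/= => suv; rewrite E.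
by move=> s; rewrite in_itv/= => suv; rewrite out// mulr0.
Qed.

Lemma frac_left_rl a b be f t : 0 < be -> be <= 1 -> t <= b ->
  integrableR (fun s => fk be (t - s) * cut a b f s) ->
  frac_int_left a be f t = rl be (cut a b f) t.
Proof.
move=> be0 be1 tb If; rewrite /frac_int_left gt_eqF// (@frac_kernel_integral _ _ _ (cut a b f))//.
  move=> s; rewrite negb_and -!leNgt => /orP[sa|ts].
    by rewrite cut_out ?mulr0// ltNge sa.
  by rewrite fk_le0 ?mul0r// subr_le0.
by move=> s /andP[as_ st]; rewrite subr_gt0 st cutE// as_ (lt_le_trans st).
Qed.

Lemma frac_right_rrl a b be f t : 0 < be -> be <= 1 -> a <= t ->
  integrableR (fun s => fk be (s - t) * cut a b f s) ->
  frac_int_right b be f t = rrl be (cut a b f) t.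
Proof.
move=> be0 be1 at_ If; rewrite /frac_int_right gt_eqF// (@frac_kernel_integral _ _ _ (cut a b f))//.
  move=> s; rewrite negb_and -!leNgt => /orP[st|bs].
    by rewrite fk_le0 ?mul0r// subr_le0.
  by rewrite cut_out ?mulr0// negb_and -!leNgt bs orbT.
by move=> s /andP[ts sb]; rewrite subr_gt0 ts cutE// sb (le_lt_trans at_).
Qed.

Lemma rl_before al a b f t : t <= a -> rl al (cut a b f) t = 0.
Proof.
move=> ta; have E s : fk al (t - s) * cut a b f s = 0.
  have [st|ts] := ltP s t.
    by rewrite cut_out ?mulr0//; apply/negP => /andP[as_ _]; lra.
  by rewrite fk_le0 ?mul0r// subr_le0.
rewrite /rl; under eq_Rintegral do rewrite E.
by rewrite /Rintegral integral0.
Qed.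

Lemma prim_before f a t : integrableR f -> (forall s, s <= a -> f s = 0) ->
  \int[lebesgue_measure]_s (if s < t then f s else 0) =
  \int[lebesgue_measure]_(s in `]a, t]) f s.
Proof.
move=> If f0.
have If1 : (@lebesgue_measure R).-integrable `]a, t[ (EFin \o f) by exact: integrable_itvR.
rewrite -Rintegral_itv_bndo_bndc// /Rintegral; congr fine.
rewrite (@integral_support _ `]a, t[).
  by apply: eq_integral => s; rewrite inE/= in_itv/= => /andP[_ ->].
move=> s; rewrite in_itv/= negb_and -!leNgt => /orP[sa|ts]; last by rewrite ltNge ts.
by rewrite f0// if_same.
Qed.

Lemma rl1 f t : rl 1 f t = \int[lebesgue_measure]_s (if s < t then f s else 0).
Proof.
apply: eq_Rintegral => s _; have [st|ts] := ltP s t.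
  by rewrite fk1 ?mul1r// subr_gt0.
by rewrite fk_le0 ?mul0r// subr_le0.
Qed.

Lemma integrable_bounded_cut a b f (B : R) : measurable_fun (`]a, b[%classic : set R) f ->
  (forall s, a < s < b -> `|f s| <= B) -> integrableR (cut a b f).
Proof.
move=> mf fB; have mc := measurable_cut mf.
have mB : measurable_fun [set: R] (cut a b (cst `|B|)).
  by apply: measurable_cut; exact: measurable_cst.
apply: (@le_integrableR _ _ (cut a b (cst `|B|))) => //.
  move=> s; rewrite /cut; case: ifPn => [sab|_]; last by rewrite normr0.
  by rewrite (le_trans (fB s sab))// ler_norm.
apply: (proj1 (@ge0_integrableR _ (cut a b (cst `|B|)) (`|B| * `|b - a|) mB _ _)).
- by move=> s; rewrite /cut; case: ifPn.
- rewrite (integral_cut a b (cst `|B|)).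
  have -> : (\int[lebesgue_measure]_(s in `]a, b[) (cst `|B| s)%:E = `|B|%:E * (@lebesgue_measure R) `]a, b[%classic)%E.
    by rewrite -integral_cst//; exact: measurable_itv.
  rewrite lebesgue_measure_itv/= lte_fin; case: ifPn => _; last by rewrite mule0 lee_fin mulr_ge0.
  by rewrite -EFinD -EFinM lee_fin ler_wpM2l// ler_norm.
Qed.

(** The primitive of [f] is the fractional integral of order [1 - al] of its
    fractional integral of order [al]. *)
Lemma frac_left_rl_semigroup al a b f (B : R) t : 0 < al -> al <= 1 ->
  measurable_fun (`]a, b[%classic : set R) f -> (forall s, a < s < b -> `|f s| <= B) ->
  a <= t <= b ->
  frac_int_left a (1 - al) (rl al (cut a b f)) t =
  \int[lebesgue_measure]_(s in `]a, t]) cut a b f s.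
Proof.
move=> al0 al1 mf fB /andP[at_ tb].
have Ic := integrable_bounded_cut mf fB.
have mc := measurable_cut mf.
have B0 : 0 <= `|B| by [].
have c0 s : ~~ (a < s < b) -> cut a b f s = 0 by exact: cut_out.
have cB s : a < s < b -> `|cut a b f s| <= `|B|.
  by move=> sab; rewrite cutE// (le_trans (fB s sab))// ler_norm.
rewrite -(@prim_before (cut a b f))//; last first.
  by move=> s sa; rewrite cut_out// ltNge sa.
move: al1; rewrite le_eqVlt => /predU1P[->|al1].
  by rewrite subrr /frac_int_left eqxx rl1.
have be0 : 0 < 1 - al by rewrite subr_gt0.
have be1 : 1 - al <= 1 by rewrite gerBl ltW.
have rlB s := @rl_bounded R al al0 (ltW al1) (cut a b f) a b s `|B| B0 mc c0 (fun r rab _ => cB r rab).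
have rlc : continuous (rl al (cut a b f)).
  move=> s; apply: (@rl_continuous R al al0 (ltW al1) _ s 1 `|B|) => // r _.
  have [rab|rab] := boolP (a < r < b); first exact: cB.
  by rewrite c0// normr0.
have mrl : measurable_fun (`]a, b[%classic : set R) (rl al (cut a b f)).
  apply: measurable_funTS; exact: continuous_measurable_fun.
rewrite (@frac_left_rl _ b)//; last first.
  apply: (proj1 (@rl_bounded R (1 - al) be0 be1 _ a b t (`|B| * rlcst al (b - a)) _ _ _ _)).
  - by rewrite mulr_ge0// rlcst_ge0// ltW.
  - exact: measurable_cut.
  - by move=> s; exact: cut_out.
  - move=> s sab _; rewrite cutE//; apply: le_trans (rlB s).2 _.
    by rewrite ler_wpM2l// rlcst_le ?(ltW al1)//; case/andP: sab; lra.
rewrite -(@rl_semigroup _ al)//; last by move=> s _; have [] := rlB s.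
apply: eq_rl => s st; rewrite /cut.
have [sab//|] := boolP (a < s < b).
rewrite (lt_le_trans st tb) andbT -leNgt => sa.
by rewrite (@rl_before al a b f s sa).
Qed.

End fractional_integrals.

(** * Weighted estimates and a Gronwall inequality *)

Section weights.
Context {R : realType} (al a b : R).
Hypotheses (al0 : 0 < al) (al1 : al <= 1) (ab : a < b).
Local Notation fk := (fk al).

(** The singular weight issued from a point [a - 1] before the interval is bounded on it
from above and from below. *)
Lemma bounded_weight (e : R) : 0 < e -> exists (w : R -> R) (K : R), [/\ measurable_fun [set: R] w,
  (forall s : R, 0 <= w s <= K), (forall s, a < s < b -> 1 <= w s),
  (forall s, ~~ (a < s < b) -> w s = 0) &
  forall t, a < t < b -> (\int[lebesgue_measure]_s (fk (t - s) * w s)%:E <= (e * w t)%:E)%E].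
Proof.
move=> e0; have a1b : a - 1 < b by move: ab; lra.
have [l l0 hl] := bielecki al0 al1 a1b e0.
(* [c] is the least value of the kernel on the interval *)
pose c := kern al (b - (a - 1)).
have c0 : 0 < c by rewrite kern_gt0// subr_gt0.
pose W := bweight al (a - 1) b l.
have W0 s : 0 <= W s := bweight_ge0 al (a - 1) b l s.
have mW : measurable_fun [set: R] W := measurable_bweight al (a - 1) b l.
pose K := c^-1 * (kern al 1 * expR (l * (b - (a - 1)))).
have K0 : 0 <= K by rewrite mulr_ge0 ?invr_ge0 ?(ltW c0)// mulr_ge0 ?kern_ge0 ?expR_ge0.
exists (cut a b (fun s => c^-1 * W s)), K.
have WE s : a < s < b -> W s = kern al (s - (a - 1)) * expR (l * (s - (a - 1))).
  by move=> /andP[as_ sb]; rewrite /W /bweight cutE// sb andbT; lra.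
split.
- apply: measurable_cut; apply: measurable_funTS.
  exact: measurable_funM.
- move=> s; rewrite /cut; case: ifP => [sab|_]; last by rewrite lexx.
  apply/andP; split; first by rewrite mulr_ge0 ?invr_ge0 ?(ltW c0).
  apply: ler_wpM2l; first by rewrite invr_ge0 ltW.
  have /andP[as_ sb] := sab.
  rewrite WE//; apply: ler_pM; rewrite ?kern_ge0 ?expR_ge0//.
    by apply: kern_anti => //; lra.
  by rewrite ler_expR ler_wpM2l//; lra.
- move=> s sab; have /andP[as_ sb] := sab.
  rewrite cutE// mulrC ler_pdivlMr// mul1r WE//.
  rewrite -[leLHS]mulr1; apply: ler_pM; rewrite ?kern_ge0//.
    by apply: kern_anti => //; lra.
  by rewrite -[leLHS]expR0 ler_expR mulr_ge0//; lra.
- by move=> s; exact: cut_out.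
- move=> t tab; have /andP[at_ tb] := tab.
  have t1 : a - 1 < t < b by rewrite tb andbT; lra.
  apply: (@le_trans _ _ (\int[lebesgue_measure]_s (c^-1%:E * (fk (t - s) * W s)%:E))%E).
    apply: ge0_le_integral => //.
    + move=> s _; rewrite lee_fin mulr_ge0 ?fk_ge0// /cut; case: ifP => // _.
      by rewrite mulr_ge0 ?invr_ge0 ?(ltW c0).
    + apply/measurable_EFinP; apply: measurable_funM; first exact: measurable_fk_sub.
      apply: measurable_cut; apply: measurable_funTS.
      exact: measurable_funM.
    + apply/measurable_EFinP; apply: measurable_funM => //.
      by apply: measurable_funM => //; exact: measurable_fk_sub.
    + move=> s _; rewrite -EFinM lee_fin [leRHS]mulrCA ler_wpM2l ?fk_ge0//.
      rewrite /cut; case: ifP => // _.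
      by rewrite mulr_ge0 ?invr_ge0 ?(ltW c0).
  rewrite ge0_integralZl_EFin ?invr_ge0 ?(ltW c0)//.
  + rewrite cutE// [(e * _)%R]mulrCA EFinM.
    apply: lee_wpmul2l; first by rewrite lee_fin invr_ge0 ltW.
    exact: hl.
  + by move=> s _; rewrite lee_fin mulr_ge0 ?fk_ge0.
  + apply/measurable_EFinP.
    by apply: measurable_funM => //; exact: measurable_fk_sub.
Qed.

(** If [u] is at most [S * w], then it is at most [(k + S / 2) * w]; iterate and pass to the
limit. *)
Lemma gronwall_bounded (C : R) : 0 <= C -> exists2 K : R, 0 <= K &
  forall (u : R -> R) (k B : R), 0 <= k -> 0 <= B ->
  measurable_fun (`]a, b[%classic : set R) u ->
  (forall s, a < s < b -> 0 <= u s <= B) ->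
  (forall t, a < t < b -> u t <= k + C * rl al (cut a b u) t) ->
  forall t, a < t < b -> u t <= K * k.
Proof.
move=> C0; pose e := (2 * (C + 1))^-1.
have e0 : 0 < e by rewrite invr_gt0 mulr_gt0// ltr_wpDl.
have Ce : C * e <= 1 / 2.
  rewrite /e ler_pdivrMr ?mulr_gt0 ?ltr_wpDl//; lra.
have [w [K [mw wK w1 w0 hw]]] := bounded_weight e0.
have K0 : 0 <= K by have /andP[h1 h2] := wK 0; exact: le_trans h2.
exists (2 * K); first by rewrite mulr_ge0.
move=> u k B k0 B0 mu_ uB ule t tab.
have step S : 0 <= S -> (forall s, a < s < b -> u s <= S * w s) ->
    forall s, a < s < b -> u s <= (k + S / 2) * w s.
  move=> S0 uS s sab; apply: (le_trans (ule s sab)).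
  have mc := measurable_cut mu_.
  have mg : measurable_fun [set: R] (fun s => S * w s) by exact: measurable_funM.
  have fg r : r < s -> `|cut a b u r| <= S * w r.
    move=> _; rewrite /cut; case: ifPn => [rab|rab]; last first.
      by rewrite normr0 mulr_ge0//; case/andP: (wK r).
    by rewrite ger0_norm ?uS//; case/andP: (uB r rab).
  have g0 r : 0 <= S * w r by rewrite mulr_ge0//; case/andP: (wK r).
  have [|_ h] := @rl_dominated _ _ al0 al1 (cut a b u) (fun r => S * w r) s (S * (e * w s)) mc mg fg g0.
    under eq_integral do rewrite mulrCA EFinM.
    rewrite ge0_integralZl_EFin//; last 2 first.
    - by move=> r _; rewrite lee_fin mulr_ge0 ?fk_ge0//; case/andP: (wK r).
    - apply/measurable_EFinP; apply: measurable_funM => //; exact: measurable_fk_sub.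
    by rewrite EFinM; apply: lee_wpmul2l; [rewrite lee_fin|exact: hw].
  have h1 : C * rl al (cut a b u) s <= S / 2 * w s.
    apply: (@le_trans _ _ (C * (S * (e * w s)))).
      by apply: ler_wpM2l => //; exact: le_trans (ler_norm _) h.
    rewrite [leLHS](_ : _ = C * e * (S * w s)); last by ring.
    rewrite [leRHS](_ : _ = 1 / 2 * (S * w s)); last by field.
    exact: ler_wpM2r.
  rewrite mulrDl; apply: lerD => //.
  by rewrite ler_peMr// w1.
have it n : forall s, a < s < b -> u s <= (2 * k + B / 2 ^+ n) * w s.
  elim: n => [|n IH] s sab.
    rewrite expr0 divr1; have /andP[_ h] := uB s sab; apply: (le_trans h).
    by rewrite -[leLHS]mulr1; apply: ler_pM => //; [lra|exact: w1].
  apply: le_trans (step (2 * k + B / 2 ^+ n) _ IH s sab) _.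
    by rewrite addr_ge0 ?mulr_ge0// divr_ge0// exprn_ge0.
  apply: ler_wpM2r; first by case/andP: (wK s).
  rewrite mulrDl; set x := B / 2 ^+ n.
  have -> : B / 2 ^+ n.+1 = x / 2 by rewrite /x exprS invfM; ring.
  by rewrite [2 * k / 2]mulrAC divff ?mul1r; lra.
have : u t - 2 * k * w t <= 0.
  apply: (@le0_geometric _ _ (B * w t)) => n.
  have := it n t tab; rewrite mulrDl mulrAC.
  by lra.
have /andP[w0t wKt] := wK t.
move=> h; apply: (@le_trans _ _ (2 * k * w t)); first by lra.
by rewrite [leRHS]mulrAC; apply: ler_wpM2l => //; rewrite mulr_ge0.
Qed.

(** Transposition against a weight that the transposed operator contracts. *)
Lemma weight_rl_le (u v w : R -> R) (C e : R) : 0 <= C -> 0 <= e ->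
  measurable_fun [set: R] w -> (forall s, 0 <= w s) -> (forall s, ~~ (a < s < b) -> w s = 0) ->
  measurable_fun [set: R] u -> (forall s, 0 <= u s) -> (forall s, ~~ (a < s < b) -> u s = 0) ->
  integrableR (fun s => w s * u s) ->
  (forall s, a < s < b -> (\int[lebesgue_measure]_t (fk (t - s) * w t)%:E <= (e * w s)%:E)%E) ->
  measurable_fun (`]a, b[%classic : set R) v ->
  (forall t, a < t < b -> integrableR (fun s => fk (t - s) * u s) /\ `|v t| <= C * rl al u t) ->
  integrableR (fun t => w t * cut a b v t) /\
  \int[lebesgue_measure]_t (w t * `|cut a b v t|) <= C * (e * \int[lebesgue_measure]_t (w t * u t)).
Proof.
move=> C0 e0 mw w0 w_out mu_ u0 u_out Iwu hw mv vu.
have mcv := measurable_cut mv.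
have mn : measurable_fun [set: R] (fun t => w t * `|cut a b v t|).
  by apply: measurable_funM => //; exact: measurableT_comp.
have [||h1 h2] := @ge0_integrableR _ (fun t => w t * `|cut a b v t|) (C * (e * \int[lebesgue_measure]_t (w t * u t))) mn.
- by move=> t; rewrite mulr_ge0.
- pose h t s := C * (w t * (fk (t - s) * u s)).
  have h0 t s : 0 <= h t s.
    by rewrite /h; apply: mulr_ge0 => //; apply: mulr_ge0 => //; apply: mulr_ge0 => //; exact: fk_ge0.
  have mh : measurable_fun [set: measurableTypeR R * measurableTypeR R] (fun p => h p.1 p.2).
    apply: measurable_funM => //.
    apply: measurable_funM.
      by apply: (measurableT_comp mw); exact: measurable_fst.
    apply: measurable_funM; first exact: measurable_fk2.
    by apply: (measurableT_comp mu_); exact: measurable_snd.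
  apply: (@le_trans _ _ (\int[lebesgue_measure]_t \int[lebesgue_measure]_s (h t s)%:E)%E).
    apply: ge0_le_integral => //.
    + by move=> t _; rewrite lee_fin mulr_ge0.
    + exact/measurable_EFinP.
    + apply: (@measurable_fun_fubini_tonelli_F _ _ _ _ _ (@lebesgue_measure R) (fun p => (h p.1 p.2)%:E)).
        exact/measurable_EFinP.
      by move=> p; rewrite lee_fin.
    + move=> t _; have [tab|tab] := boolP (a < t < b); last first.
        by rewrite w_out// mul0r; apply: integral_ge0 => s _; rewrite lee_fin.
      have [Iu vt] := vu t tab; have [I1 E1] := RintegralZ (w t) Iu.
      have [I2 E2] := RintegralZ C I1.
      rewrite -EFin_Rintegral// E2 E1 lee_fin cutE// mulrCA ler_wpM2l//.
  rewrite tonelliR// EFinM EFinM EFin_Rintegral// -ge0_integralZl_EFin//; last 2 first.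
  + by move=> t _; rewrite lee_fin mulr_ge0.
  + by apply/measurable_EFinP; exact: measurable_funM.
  rewrite -ge0_integralZl_EFin//; last 2 first.
  + by move=> t _; rewrite -EFinM lee_fin !mulr_ge0.
  + by apply/measurable_EFinP; apply: measurable_funM => //; exact: measurable_funM.
  apply: ge0_le_integral => //.
  + by move=> t _; apply: integral_ge0 => s _; rewrite lee_fin.
  + apply: (@measurable_fun_fubini_tonelli_G _ _ _ _ _ (@lebesgue_measure R) (fun p => (h p.1 p.2)%:E)).
      exact/measurable_EFinP.
    by move=> p; rewrite lee_fin.
  + apply/measurable_EFinP; do 2 apply: measurable_funM => //.
    exact: measurable_funM.
  + move=> s _; have [sab|sab] := boolP (a < s < b); last first.
      under eq_integral do rewrite /h (u_out s sab) !mulr0.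
      by rewrite integral0 (u_out s sab) mulr0 !mule0.
    have hE t : (h t s)%:E = ((C * u s)%:E * (fk (t - s) * w t)%:E)%E.
      by rewrite -EFinM; congr (_%:E); rewrite /h; ring.
    under eq_integral do rewrite hE.
    rewrite ge0_integralZl_EFin ?mulr_ge0//; last 2 first.
    * by move=> t _; rewrite lee_fin mulr_ge0 ?fk_ge0.
    * by apply/measurable_EFinP; apply: measurable_funM => //; exact: measurable_fk_sub'.
    rewrite -!EFinM (_ : C * (e * _) = C * u s * (e * w s)); last by ring.
    rewrite [X in (_ <= X)%E]EFinM; apply: lee_wpmul2l; first by rewrite lee_fin mulr_ge0.
    exact: hw.
split => //; apply: le_integrableR h1.
  exact: measurable_funM.
by move=> t; rewrite normrM (ger0_norm (w0 t)).
Qed.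

End weights.

Lemma bounded_weight_right (R : realType) (al a b e : R) : 0 < al -> al <= 1 -> a < b -> 0 < e ->
  exists (w : R -> R) (K : R), [/\ measurable_fun [set: R] w,
  (forall s : R, 0 <= w s <= K), (forall s, a < s < b -> 1 <= w s),
  (forall s, ~~ (a < s < b) -> w s = 0) &
  forall s, a < s < b -> (\int[lebesgue_measure]_t (fk al (t - s) * w t)%:E <= (e * w s)%:E)%E].
Proof.
move=> al0 al1 ab e0; have ba : - b < - a by rewrite ltrN2.
have [w [K [mw wK w1 w0 hw]]] := bounded_weight al0 al1 ba e0.
have sw s : (- b < - s < - a) = (a < s < b) by rewrite !ltrN2 andbC.
exists (fun s => w (- s)), K; split => //.
- by apply: measurableT_comp.
- by move=> s sab; apply: w1; rewrite sw.
- by move=> s sab; apply: w0; rewrite sw.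
- move=> s sab; rewrite -sw in sab; apply: le_trans (hw _ sab).
  rewrite ge0_integral_opp.
  + by rewrite le_eqVlt; apply/orP; left; apply/eqP; apply: eq_integral => t _; rewrite opprK addrC.
  + apply/measurable_EFinP; apply: measurable_funM; first exact: measurable_fk_sub'.
    exact: measurableT_comp.
  + by move=> t; rewrite lee_fin mulr_ge0 ?fk_ge0//; case/andP: (wK (- t)).
Qed.

(** * Uniqueness for Volterra equations with integrable solutions *)

Section uniqueness.
Context {R : realType} (al a b : R).
Hypotheses (al0 : 0 < al) (al1 : al <= 1) (ab : a < b).

Lemma ae0_continuous (d : R -> R) (t : R) : a < t < b -> {for t, continuous d} ->
  {ae @lebesgue_measure R, forall s, a < s < b -> d s = 0} -> d t = 0.
Proof.
move=> /andP[at_ tb] cd dae; apply/eqP; apply/negPn/negP => dt0.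
have e0 : 0 < `|d t| by rewrite normr_gt0.
have /cvgrPdist_lt/(_ _ e0)/(nbhs_ballP _ _).1[r /= r0 hr] := cd.
have uv : Num.max a (t - r) < Num.min b (t + r) by rewrite lt_min !gt_max; move: ab; lra.
have [s] := ae_itv_point uv dae.
rewrite gt_max lt_min -!andbA => /and4P[as_ sr sb sr'] /(_ _).
rewrite as_ sb => /(_ isT) ds0.
have : ball t r s by rewrite /ball/= ltr_norml; lra.
by move=> /hr; rewrite /= ds0 subr0 ltxx.
Qed.

(** Integrating the inequality against a weight that the transposed operator contracts
bounds the weighted norm of [d] by half of itself. *)
Lemma rl_fixpoint_eq0 (d : R -> R) (M : R) : 0 <= M -> integrableR d ->
  (forall s, ~~ (a < s < b) -> d s = 0) ->
  (forall t, a < t < b -> {for t, continuous d}) ->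
  (forall t, a < t < b -> integrableR (fun s => fk al (t - s) * `|d s|) /\
     `|d t| <= M * rl al (fun s => `|d s|) t) ->
  forall t, a < t < b -> d t = 0.
Proof.
have aux (x y : R) : 0 <= x -> x <= y -> y <= 1 / 2 * x -> x <= 0 by lra.
move=> M0 Id d0 cd hd t tab; pose e := (2 * (M + 1))^-1.
have e0 : 0 < e by rewrite invr_gt0 mulr_gt0// ltr_wpDl.
have Me : M * e <= 1 / 2.
  rewrite /e ler_pdivrMr ?mulr_gt0 ?ltr_wpDl//; lra.
have [w [K [mw wK w1 w0 hw]]] := bounded_weight_right al0 al1 ab e0.
have wge0 s : 0 <= w s by case/andP: (wK s).
have md : measurable_fun [set: R] d by have /measurable_int/measurable_EFinP := Id.
have mn : measurable_fun [set: R] (fun s => `|d s|) by exact: measurableT_comp.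
have In : integrableR (fun s => `|d s|) := integrable_norm Id.
have Iw : integrableR (fun s => w s * `|d s|).
  have [IK _] := RintegralZ K In; apply: le_integrableR IK.
    exact: measurable_funM.
  by move=> s; rewrite normrM normr_id ger0_norm// ler_wpM2r//; case/andP: (wK s).
have ce : cut a b d = d.
  by apply/funext => s; rewrite /cut; case: ifPn => // /d0.
have dn0 s : ~~ (a < s < b) -> `|d s| = 0 by move=> sab; rewrite d0// normr0.
have [_] := @weight_rl_le _ al a b al0 al1 (fun s => `|d s|) d w M e M0 (ltW e0) mw wge0 w0 mn (fun s => normr_ge0 _) dn0 Iw hw (measurable_funTS md) hd.
rewrite ce => hI.
have I0 : \int[lebesgue_measure]_s (w s * `|d s|) <= 0.
  have h0 : 0 <= \int[lebesgue_measure]_s (w s * `|d s|) by apply: Rintegral_ge0 => s _; rewrite mulr_ge0.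
  have : M * (e * \int[lebesgue_measure]_s (w s * `|d s|)) <= 1 / 2 * \int[lebesgue_measure]_s (w s * `|d s|).
    by rewrite mulrA ler_wpM2r.
  exact: aux h0 hI.
have I1 : (\int[lebesgue_measure]_s `|(d s)%:E| = 0)%E.
  apply/eqP; rewrite eq_le integral_ge0// andbT.
  apply: (@le_trans _ _ (\int[lebesgue_measure]_s (w s * `|d s|)%:E)%E).
    apply: ge0_le_integral => //.
    - by apply/measurable_EFinP.
    - by apply/measurable_EFinP; exact: measurable_funM.
    - move=> s _; rewrite abse_EFin lee_fin; have [sab|sab] := boolP (a < s < b).
        by rewrite ler_peMl// w1.
      by rewrite d0// normr0 mulr0.
  by rewrite -EFin_Rintegral// lee_fin.
apply: (ae0_continuous tab (cd t tab)).
have mdE : measurable_fun [set: R] (EFin \o d) by exact/measurable_EFinP.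
have [/(_ I1) + _] := ae_eq_integral_abs (@lebesgue_measure R) measurableT mdE.
apply: (@filterS _ _ (ae_filter_ringOfSetsType (@lebesgue_measure R))) => s /(_ I) /= [->] //.
Qed.

(** By Tonelli the norm is at most that of [f] times the integral of the kernel over an
interval. *)
Lemma integrable_rl (f : R -> R) : integrableR f ->
  integrableR (cut a b (rl al f)).
Proof.
move=> If; have mf : measurable_fun [set: R] f by have /measurable_int/measurable_EFinP := If.
pose c := cut a b (cst (1 : R)).
have mc : measurable_fun [set: R] c by apply: measurable_cut; exact: measurable_cst.
have c0 t : 0 <= c t by rewrite /c /cut; case: ifP.
pose h t s := c t * (fk al (t - s) * f s).
have mh : measurable_fun [set: measurableTypeR R * measurableTypeR R] (fun p => h p.1 p.2).
  apply: measurable_funM; first by apply: (measurableT_comp mc); exact: measurable_fst.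
  apply: measurable_funM; first exact: measurable_fk2.
  by apply: (measurableT_comp mf); exact: measurable_snd.
have hfin : (\int[lebesgue_measure]_t \int[lebesgue_measure]_s `|h t s|%:E < +oo)%E.
  pose h' t s := `|h t s|.
  have mh' : measurable_fun [set: measurableTypeR R * measurableTypeR R] (fun p => h' p.1 p.2).
    exact: measurableT_comp.
  rewrite (tonelliR mh' (fun t s => normr_ge0 _)).
  have In : integrableR (fun s => `|f s|) := integrable_norm If.
  have [IK EK] := RintegralZ (rlcst al (b - a)) In.
  apply: (@le_lt_trans _ _ (\int[lebesgue_measure]_s (rlcst al (b - a) * `|f s|)%:E)%E); last first.
    by rewrite -EFin_Rintegral// ltry.
  apply: ge0_le_integral => //.
  - by move=> s _; apply: integral_ge0 => t _; rewrite lee_fin /h'.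
  - apply: (@measurable_fun_fubini_tonelli_G _ _ _ _ _ (@lebesgue_measure R) (fun p => (h' p.1 p.2)%:E)).
      exact/measurable_EFinP.
    by move=> p; rewrite lee_fin /h'.
  - by apply/measurable_EFinP; apply: measurable_funM => //; exact: measurableT_comp.
  - move=> s _.
    have hE t : (h' t s)%:E = (`|f s|%:E * (fk al (t - s) * c t)%:E)%E.
      rewrite -EFinM; congr (_%:E); rewrite /h' /h normrM (ger0_norm (c0 t)) normrM (ger0_norm (fk_ge0 al0 al1 _)).
      by ring.
    under eq_integral do rewrite hE.
    rewrite ge0_integralZl_EFin//; last 2 first.
    + by move=> t _; rewrite lee_fin mulr_ge0 ?fk_ge0.
    + by apply/measurable_EFinP; apply: measurable_funM => //; exact: measurable_fk_sub'.
    rewrite mulrC EFinM; apply: lee_wpmul2l; first by rewrite lee_fin.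
    have mfk : measurable_fun [set: R] (fun t => fk al (t - s) * c t).
      by apply: measurable_funM => //; exact: measurable_fk_sub'.
    pose m := Num.max s a.
    have sm : s <= m by rewrite le_max lexx.
    have am : a <= m by rewrite le_max lexx orbT.
    have [bm|mb] := leP b m.
      rewrite (eq_integral (cst 0%E)) ?integral0 ?lee_fin ?rlcst_ge0// => t _.
      rewrite /c /cut; case: ifP => [/andP[t1 t2]|_]; last by rewrite mulr0.
      rewrite fk_le0 ?mul0r// subr_le0.
      by move: (lt_le_trans t2 bm); rewrite lt_max => /orP[/ltW//|]; lra.
    apply: (@le_trans _ _ (\int[lebesgue_measure]_t (cut m b (fun t => fk al (t - m)) t)%:E)%E).
      apply: ge0_le_integral => //.
      - by move=> t _; rewrite lee_fin mulr_ge0 ?fk_ge0.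
      - exact/measurable_EFinP.
      - apply/measurable_EFinP; apply: measurable_cut; apply: measurable_funTS.
        exact: measurable_fk_sub'.
      - move=> t _; rewrite lee_fin /c /cut; case: ifP => [/andP[t1 t2]|_]; last first.
          by rewrite mulr0; case: ifP => // _; exact: fk_ge0.
        rewrite mulr1 t2 andbT; case: ltP => [mt|tm].
          by apply: fk_anti => //; lra.
        rewrite fk_le0 ?subr_le0//; move: tm; rewrite le_max; lra.
    rewrite integral_cut integral_fk// lee_fin.
    by apply: rlcst_le => //; lra.
rewrite (_ : cut a b (rl al f) = fun t => \int[lebesgue_measure]_s h t s); first exact: integrable_fubiniR.
apply/funext => t; rewrite /cut; case: ifPn => tab.
  by apply: eq_Rintegral => s _; rewrite /h /c cutE// mul1r.
rewrite /h /c (cut_out _ tab); under eq_Rintegral do rewrite mul0r.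
by rewrite /Rintegral integral0.
Qed.

End uniqueness.

(** The identity at order [al = 1], which is not the integral operator with kernel
    [fk 0]. *)
Definition rl0 (R : realType) (be : R) (f : R -> R) (t : R) : R :=
  if be == 0 then f t else rl be f t.

Definition rrl0 (R : realType) (be : R) (f : R -> R) (t : R) : R :=
  if be == 0 then f t else rrl be f t.

Section volterra.
Context {R : realType} (a b : R).
Hypothesis ab : a < b.

Lemma cut_locally_bounded (g : R -> R) t : a < t < b -> {for t, continuous g} ->
  exists r B, [/\ 0 < r, 0 <= B & forall s, t - r < s < t + r -> `|cut a b g s| <= B].
Proof.
move=> tab cg; have /cvgrPdist_lt/(_ _ ltr01)/(nbhs_ballP _ _).1[r /= r0 hr] := cg.
exists r, (`|g t| + 1); split => // s /andP[s1 s2].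
rewrite /cut; case: ifP => _; last by rewrite normr0.
have : ball t r s by rewrite /ball/= ltr_norml; lra.
move=> /hr/= h; have := lerB_dist (g s) (g t); rewrite (distrC (g s)); lra.
Qed.

Lemma cut_continuous (g : R -> R) t : a < t < b -> {for t, continuous g} ->
  {for t, continuous (cut a b g)}.
Proof.
move=> tab; have /andP[at_ tb] := tab.
rewrite /prop_for /continuous_at [in X in _ -> X](cutE g tab); apply: cvg_trans; apply: near_eq_cvg.
near=> r; rewrite cutE//; apply/andP; split; near: r; [exact: lt_nbhsr|exact: lt_nbhsl].
Unshelve. all: by end_near. Qed.

(** An integrable function that is continuous inside the interval has a fractional
integral at every point: it is bounded near the singularity of the kernel. *)
Lemma cut_local be (g : R -> R) t : 0 < be -> be <= 1 -> integrableR (cut a b g) ->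
  (forall s, a < s < b -> {for s, continuous g}) -> t < b ->
  integrableR (fun s => fk be (t - s) * cut a b g s) /\
  (a < t -> {for t, continuous (rl be (cut a b g))}).
Proof.
move=> be0 be1 Ig cg tb; have [ta|at_] := leP t a.
  split; last by [].
  have -> : (fun s => fk be (t - s) * cut a b g s) = cst 0.
    apply/funext => s; have [sa|sa] := leP s a.
      by rewrite cut_out ?mulr0// ltNge sa.
    by rewrite fk_le0 ?mul0r// subr_le0 (le_trans ta)// ltW.
  exact: integrable0.
have tab : a < t < b by rewrite at_.
have [r [B [r0 B0 h]]] := cut_locally_bounded tab (cg t tab).
split; last by move=> _; exact: (rl_continuous be0 be1 r0 B0 Ig h).
apply: (rl_integrable be0 be1 r0 B0 Ig) => s /andP[s1 s2].
by apply: h; rewrite s1 (lt_trans s2)// ltrDl.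
Qed.

Context (al : R).
Hypotheses (al0 : 0 < al) (al1 : al <= 1).

Lemma rl_eq0 be (g : R -> R) t : (forall s, s < t -> g s = 0) -> rl be g t = 0.
Proof.
move=> g0; rewrite (@eq_rl _ _ _ (cst 0))//.
by rewrite /rl; under eq_Rintegral do rewrite mulr0; rewrite /Rintegral integral0.
Qed.

Lemma prim_eq0 (e : R -> R) : integrableR e ->
  (forall t, a < t < b -> {for t, continuous e}) ->
  (forall t, a <= t < b -> \int[lebesgue_measure]_(s in `]a, t]) e s = 0) ->
  forall t, a < t < b -> e t = 0.
Proof.
move=> Ie ce e0 t tab; have /andP[at_ tb] := tab.
pose b' := (t + b) / 2; have ab' : a < b' by rewrite /b'; lra.
have b'b : b' < b by rewrite /b'; lra.
have tb' : t < b' by rewrite /b'; lra.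
have := @prim_derive_ae _ a b' ab' (cst 0) e 0 Ie.
have E s : a <= s <= b' -> cst 0 s = 0 + \int[lebesgue_measure]_(r in `]a, s]) e r.
  by move=> /andP[h1 h2]; rewrite e0 ?addr0// h1 (le_lt_trans h2).
move=> /(_ E) dae; apply: (@ae0_continuous _ a b' ab' e t _ (ce t tab)); first by rewrite at_.
apply: (@filterS _ _ (ae_filter_ringOfSetsType (@lebesgue_measure R)) _ _ _ dae) => s h sab.
have sI : s \in `[a, b'] by rewrite in_itv/=; case/andP: sab => /ltW-> /ltW->.
rewrite -h//; apply: derive_onE => //.
rewrite (_ : (fun r => _) = cst 0); first exact: cvg_cst.
by apply/funext => r; rewrite subrr mul0r.
Qed.

(** Applying the semigroup property twice removes the operator of order
[1 - al]: the difference of [d] and of the fractional integral of [q * d] has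
primitive zero.  So [d] is a fixed point, to which [rl_fixpoint_eq0] applies.
At order [1] the equation is already of this form. *)
Lemma volterra_unique (q d : R -> R) (M : R) : 0 <= M -> integrableR (cut a b d) ->
  (forall t, a < t < b -> {for t, continuous q}) ->
  (forall t, a < t < b -> `|q t| <= M) ->
  (forall t, a < t < b -> {for t, continuous d}) ->
  (forall t, a < t < b -> rl0 (1 - al) (cut a b d) t =
     \int[lebesgue_measure]_s (if s < t then cut a b (fun s => q s * d s) s else 0)) ->
  forall t, a < t < b -> d t = 0.
Proof.
move=> M0 Id cq qM cd dae; set f := cut a b (fun s => q s * d s) in dae *.
have cqd t : a < t < b -> {for t, continuous (fun s => q s * d s)}.
  by move=> tab; apply: cvgM; [exact: cq|exact: cd].
have mf : measurable_fun [set: R] f.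
  by apply: measurable_cut; apply: pointwise_continuous_measurable => s; rewrite in_itv/=; exact: cqd.
have md : measurable_fun [set: R] (cut a b d) by have /measurable_int/measurable_EFinP := Id.
have In : integrableR (fun s => `|cut a b d s|) := integrable_norm Id.
have fM s : `|f s| <= M * `|cut a b d s|.
  rewrite /f /cut; case: ifP => [sab|_]; last by rewrite normr0 mulr0.
  by rewrite normrM ler_wpM2r// qM.
have If : integrableR f.
  by have [IM _] := RintegralZ M In; apply: le_integrableR IM.
have fl be t : 0 < be -> be <= 1 -> t < b -> _ := fun h0 h1 h2 => @cut_local be _ t h0 h1 If cqd h2.
have dE t : a < t < b -> d t = rl al f t.
  have c_e t' : a < t' < b -> {for t', continuous (fun s => d s - rl al f s)}.
    move=> tab; apply: cvgB; first exact: cd.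
    by have /andP[h1 h2] := tab; have [_ h] := fl al t' al0 al1 h2; exact: h.
  move=> tab; apply/eqP; rewrite -subr_eq0; apply/eqP.
  move: (al1); rewrite le_eqVlt => /predU1P[al_1|al1'].
    by have := dae t tab; rewrite al_1 subrr /rl0 eqxx cutE// => ->; rewrite rl1 subrr.
  have be0 : 0 < 1 - al by rewrite subr_gt0.
  have be1 : 1 - al <= 1 by rewrite gerBl ltW.
  pose e := cut a b (fun s => d s - rl al f s).
  have Irl := @integrable_rl _ al a b al0 al1 f If.
  have eE s : e s = cut a b d s - cut a b (rl al f) s.
    by rewrite /e /cut; case: ifP => //; rewrite subr0.
  have Ie : integrableR e.
    rewrite (_ : e = fun s => cut a b d s - cut a b (rl al f) s); last exact/funext.
    exact: (integrableB measurableT Id Irl).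
  have me : measurable_fun [set: R] e by have /measurable_int/measurable_EFinP := Ie.
  have crl s : a < s < b -> {for s, continuous (rl al f)}.
    by move=> /andP[h1 h2]; have [_ h] := fl al s al0 al1 h2; exact: h.
  have e_rl s : s < b -> rl (1 - al) e s = 0.
    move=> sb.
    have [sa|as_] := leP s a; first exact: rl_before.
    have := dae s; rewrite as_ sb => /(_ isT); rewrite /rl0 gt_eqF// => hs.
    have [I1 _] := @cut_local (1 - al) d s be0 be1 Id cd sb.
    have [I2 _] := @cut_local (1 - al) (rl al f) s be0 be1 Irl crl sb.
    have [_] := rlB I1 I2.
    have <- : e = (fun s => cut a b d s - cut a b (rl al f) s) by exact/funext.
    move=> ->; rewrite hs.
    rewrite (@eq_rl _ _ _ (rl al f)); last first.
      move=> r rs; rewrite /cut; case: ifPn => //.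
      rewrite (lt_trans rs sb) andbT -leNgt => ra.
      by rewrite (@rl_before _ al a b _ r ra).
    rewrite (@rl_semigroup _ al f s al0 al1' If) ?subrr// => r rs.
    by have [] := fl al r al0 al1 (lt_trans rs sb).
  have e_prim s : s < b -> \int[lebesgue_measure]_r (if r < s then e r else 0) = 0.
    move=> sb; have be1' : 1 - al < 1 by rewrite gtrBl.
    rewrite -(@rl_semigroup _ (1 - al) e s be0 be1' Ie); last first.
      by move=> r rs; have [] := @cut_local (1 - al) _ r be0 be1 Ie c_e (lt_trans rs sb).
    by apply: rl_eq0 => r rs; apply: e_rl; exact: lt_trans rs sb.
  rewrite -[LHS](@cutE _ a b (fun s => d s - rl al f s))//.
  apply: (prim_eq0 Ie _ _ tab).
    by move=> s sab; apply: cut_continuous => //; exact: c_e.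
  move=> s /andP[as_ sb]; rewrite -(@prim_before _ e a s Ie) ?e_prim//.
  by move=> r ra; rewrite /e cut_out// ltNge ra.
move=> t tab; rewrite -(@cutE _ a b d t tab).
apply: (@rl_fixpoint_eq0 _ al a b al0 al1 ab (cut a b d) M M0 Id _ _ _ t tab).
- by move=> s; exact: cut_out.
- by move=> s sab; apply: cut_continuous => //; exact: cd.
- move=> s sab; have /andP[as_ sb] := sab.
  have [I1 _] := @cut_local al d s al0 al1 Id cd sb.
  have I2 : integrableR (fun r => fk al (s - r) * `|cut a b d r|).
    have := integrable_norm I1; apply: eq_integrable => // r _ /=.
    by rewrite normrM ger0_norm// fk_ge0.
  split => //; rewrite cutE// dE//.
  have [I3 _] := fl al s al0 al1 sb.
  apply: (le_trans (le_normr_Rintegral measurableT I3)).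
  have [IM EM] := rlZ M I2; rewrite -EM; apply: le_Rintegral => //.
    exact: (integrable_norm I3).
  by move=> r _; rewrite normrM (ger0_norm (fk_ge0 al0 al1 _)) ler_wpM2l// fk_ge0.
Unshelve. all: by end_near. Qed.

End volterra.

(** * The adjoint equation *)

Section adjoint_kernel.
Context {R : realType} (al : R).
Hypotheses (al0 : 0 < al) (al1 : al <= 1).

(** The solution with the kernel itself as datum: the fundamental solution of the
equation of fractional order [al]. *)
Lemma resolvent (a b : R) (q : R -> R) (M : R) : a < b -> 0 <= M ->
  (forall t, a < t < b -> {for t, continuous q}) -> (forall t, a < t < b -> `|q t| <= M) ->
  exists (y : R -> R) (A : R), [/\ 0 <= A /\ integrableR (cut a b y),
    (forall t, a < t < b -> {for t, continuous y}),
    (forall t, a < t < b -> `|y t| <= A * kern al (t - a)),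
    (forall t, a < t < b -> y t = fk al (t - a) + rl al (cut a b (fun s => q s * y s)) t) &
    forall t, a < t < b -> 0 < y t].
Proof.
move=> ab M0 cq qM; have G0 := Gamma_inv_gt0 al0 al1.
have [|||||y [A [A0 cy yA ye]]] := @picard R al a b al0 al1 ab (fun t x => q t * x) (fun t => fk al (t - a)) M (Gamma al)^-1 M0 (ltW G0).
- by move=> t x y tab; rewrite -mulrBr normrM ler_wpM2r// qM.
- by move=> t _; rewrite mulr0 normr0 mulr_ge0 ?kern_ge0// ltW.
- move=> y cy; apply: pointwise_continuous_measurable => s; rewrite in_itv/= => sab.
  by apply: cvgM; [exact: cq|exact: cy].
- move=> t /andP[at_ _]; apply: (@continuous_comp _ _ _ (fun s : R => s - a) (fk al)).
    by apply: cvgB; [exact: cvg_id|exact: cvg_cst].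
  by apply: fk_continuous; rewrite subr_eq0 gt_eqF.
- by move=> t _; rewrite ger0_norm ?fk_ge0// /fk.
exists y, A; split => //; last first.
  exact: (solution_gt0 al0 al1 ab M0 A0 cq qM cy yA ye).
split => //; have my : measurable_fun [set: R] (cut a b y).
  by apply: measurable_cut; apply: pointwise_continuous_measurable => s; rewrite in_itv/=; exact: cy.
by have [] := phi_dominated al0 al1 ab A0 my (cut_out y) (fun s sab => ltac:(rewrite cutE//; exact: yA)).
Qed.

(** The operator of order [1 - al] sends the kernel to [1] and the integral term to a
primitive: the integrated form of the differential equation. *)
Lemma resolvent_integral (a b : R) (q y : R -> R) (M A : R) : a < b -> 0 <= M -> 0 <= A ->
  (forall t, a < t < b -> {for t, continuous q}) -> (forall t, a < t < b -> `|q t| <= M) ->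
  (forall t, a < t < b -> {for t, continuous y}) ->
  (forall t, a < t < b -> `|y t| <= A * kern al (t - a)) ->
  (forall t, a < t < b -> y t = fk al (t - a) + rl al (cut a b (fun s => q s * y s)) t) ->
  forall t, a < t < b -> rl0 (1 - al) (cut a b y) t =
    1 + \int[lebesgue_measure]_s (if s < t then cut a b (fun s => q s * y s) s else 0).
Proof.
move=> ab M0 A0 cq qM cy yA ye t tab; have /andP[at_ tb] := tab.
set f := cut a b (fun s => q s * y s).
have cqy s : a < s < b -> {for s, continuous (fun s => q s * y s)}.
  by move=> sab; apply: cvgM; [exact: cq|exact: cy].
have my : measurable_fun [set: R] (cut a b y).
  by apply: measurable_cut; apply: pointwise_continuous_measurable => s; rewrite in_itv/=; exact: cy.
have mf : measurable_fun [set: R] f.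
  by apply: measurable_cut; apply: pointwise_continuous_measurable => s; rewrite in_itv/=; exact: cqy.
have [Iy _ _] := phi_dominated al0 al1 ab A0 my (cut_out y) (fun s sab => ltac:(rewrite cutE//; exact: yA)).
have MA0 : 0 <= M * A by exact: mulr_ge0.
have [If _ Iff] : [/\ integrableR f,
    (forall t, a < t < b -> {for t, continuous (rl al f)}) &
    (forall t, t < b -> integrableR (fun s => fk al (t - s) * f s))].
  apply: (phi_dominated al0 al1 ab MA0 mf); first by move=> s; exact: cut_out.
  by move=> s sab; rewrite /f cutE// normrM -mulrA ler_pM//; [exact: qM|exact: yA].
move: (al1); rewrite /rl0 le_eqVlt => /predU1P[al_1|al1'].
  by rewrite al_1 subrr eqxx cutE// ye// al_1 fk1 ?subr_gt0// rl1.
have be0 : 0 < 1 - al by rewrite subr_gt0.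
have be1 : 1 - al <= 1 by rewrite gerBl ltW.
rewrite gt_eqF//.
have [I1 _] := @cut_local _ a b (1 - al) y t be0 be1 Iy cy tb.
have E2 := @beta_fk R al a t al0 al1' at_.
have [I2 _] : integrableR (fun s => fk (1 - al) (t - s) * fk al (s - a)) /\
    \int[lebesgue_measure]_s (fk (1 - al) (t - s) * fk al (s - a)) <= 1.
  apply: ge0_integrableR; last by rewrite E2.
    apply: measurable_funM; [exact: measurable_fk_sub|exact: measurable_fk_sub'].
  by move=> s; rewrite mulr_ge0 ?fk_ge0.
have [_ E3] := rlB I1 I2.
have E4 : rl (1 - al) (fun s => fk al (s - a)) t = 1 by rewrite /rl /Rintegral E2.
rewrite -[LHS](subrK (rl (1 - al) (fun s => fk al (s - a)) t)) -E3 E4 addrC; congr (_ + _).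
rewrite -(@rl_semigroup _ al f t al0 al1' If); last by move=> s st; apply: Iff; exact: lt_trans st tb.
apply: eq_rl => s st; rewrite /cut.
case: ifPn => [sab|]; first by rewrite ye// addrAC subrr add0r.
rewrite (lt_trans st tb) andbT -leNgt => sa.
by rewrite fk_le0 ?subr_le0// subrr rl_before.
Qed.

Lemma integrable_opp (f : R -> R) : integrableR f -> integrableR (fun s => f (- s)).
Proof.
move=> If; have mf : measurable_fun [set: R] f by have /measurable_int/measurable_EFinP := If.
have mo : measurable_fun [set: R] (fun s => f (- s)) by exact: measurableT_comp.
apply/integrableP; split; first exact/measurable_EFinP.
have /integrableP[_] := If; rewrite ge0_integral_opp//.
by apply: measurableT_comp => //; exact/measurable_EFinP.
Qed.

Lemma cut_opp (a b : R) (f : R -> R) s : cut a b f (- s) = cut (- b) (- a) (fun r => f (- r)) s.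
Proof. by rewrite /cut ltrNr ltrNl andbC. Qed.

Lemma rrl0_opp be (a b : R) (f : R -> R) t : measurable_fun [set: R] (cut a b f) ->
  rrl0 be (cut a b f) t = rl0 be (cut (- b) (- a) (fun s => f (- s))) (- t).
Proof.
move=> mf; rewrite /rrl0 /rl0; case: ifP => _; first by rewrite -cut_opp opprK.
rewrite rl_reflect//; congr (rl _ _ _); apply/funext => s; exact: cut_opp.
Qed.

Lemma integral_after_opp (a b : R) (f : R -> R) t : measurable_fun [set: R] (cut a b f) ->
  \int[lebesgue_measure]_s (if t < s then cut a b f s else 0) =
  \int[lebesgue_measure]_s (if s < - t then cut (- b) (- a) (fun s => f (- s)) s else 0).
Proof.
move=> mf; rewrite Rintegral_opp.
  by apply: eq_Rintegral => s _; rewrite ltrNr cut_opp.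
apply: measurable_fun_ifT => //; exact: measurable_fun_ltr.
Qed.

Lemma continuous_opp_at (f : R -> R) (t : R) : {for - t, continuous f} ->
  {for t, continuous (fun s => f (- s))}.
Proof.
move=> cf; apply: (@continuous_comp _ _ _ (fun s : R => - s) f) => //.
by apply: cvgN; exact: cvg_id.
Qed.

Lemma oppK_itv (a b t : R) : (- b < t < - a) = (a < - t < b).
Proof. by rewrite ltrNr ltrNl andbC. Qed.

(** The resolvent read backwards in time. *)
Lemma adjoint_kernel (a b : R) (c : R -> R) (M : R) : a < b -> 0 <= M ->
  (forall t, a < t < b -> {for t, continuous c}) -> (forall t, a < t < b -> `|c t| <= M) ->
  exists (P : R -> R) (A : R), [/\ integrableR (cut a b P),
    (forall t, a < t < b -> {for t, continuous P}),
    (forall t, a < t < b -> 0 < P t <= A * kern al (b - t)),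
    (forall t, a < t < b -> P t = fk al (b - t) + rrl al (cut a b (fun s => c s * P s)) t) &
    forall t, a < t < b -> rrl0 (1 - al) (cut a b P) t =
      1 + \int[lebesgue_measure]_s (if t < s then cut a b (fun s => c s * P s) s else 0)].
Proof.
move=> ab M0 cc cM; have ba : - b < - a by rewrite ltrN2.
have cq t : - b < t < - a -> {for t, continuous (fun s => c (- s))}.
  by rewrite oppK_itv => tab; apply: continuous_opp_at; exact: cc.
have qM t : - b < t < - a -> `|c (- t)| <= M by rewrite oppK_itv; exact: cM.
have [y [A [[A0 Iy] cy yA ye y0]]] := resolvent ba M0 cq qM.
have yJ := resolvent_integral ba M0 A0 cq qM cy yA ye.
have cP t : a < t < b -> {for t, continuous (fun s => y (- s))}.
  by move=> tab; apply: continuous_opp_at; apply: cy; rewrite oppK_itv opprK.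
have mP : measurable_fun [set: R] (cut a b (fun s => y (- s))).
  by apply: measurable_cut; apply: pointwise_continuous_measurable => s; rewrite in_itv/=; exact: cP.
have mcP : measurable_fun [set: R] (cut a b (fun s => c s * y (- s))).
  apply: measurable_cut; apply: pointwise_continuous_measurable => s; rewrite in_itv/= => sab.
  by apply: cvgM; [exact: cc|exact: cP].
have yE : (fun r => c (- r) * y (- - r)) = (fun r => c (- r) * y r).
  by apply/funext => r; rewrite opprK.
have yE' : (fun r => y (- - r)) = y by apply/funext => r; rewrite opprK.
exists (fun s => y (- s)), A; split => //.
- have := integrable_opp Iy; congr (integrable _ _ _).
  by apply/funext => s /=; rewrite cut_opp !opprK.
- move=> t tab; have tab' : - b < - t < - a by rewrite oppK_itv opprK.
  rewrite y0//=; apply: le_trans (ler_norm _) _; apply: (le_trans (yA _ tab')).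
  by rewrite opprK addrC.
- move=> t tab; have tab' : - b < - t < - a by rewrite oppK_itv opprK.
  rewrite ye//; congr (_ + _); first by rewrite opprK addrC.
  rewrite rl_reflect//; congr (rl _ _ _); apply/funext => s; rewrite cut_opp.
  by rewrite yE.
- move=> t tab; have tab' : - b < - t < - a by rewrite oppK_itv opprK.
  by rewrite rrl0_opp// yE' yJ// integral_after_opp// yE.
Qed.

Lemma volterra_unique_right (a b : R) (c d : R -> R) (M : R) : a < b -> 0 <= M ->
  integrableR (cut a b d) ->
  (forall t, a < t < b -> {for t, continuous c}) -> (forall t, a < t < b -> `|c t| <= M) ->
  (forall t, a < t < b -> {for t, continuous d}) ->
  (forall t, a < t < b -> rrl0 (1 - al) (cut a b d) t =
     \int[lebesgue_measure]_s (if t < s then cut a b (fun s => c s * d s) s else 0)) ->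
  forall t, a < t < b -> d t = 0.
Proof.
move=> ab M0 Id cc cM cd dae; have ba : - b < - a by rewrite ltrN2.
have md : measurable_fun [set: R] (cut a b d) by have /measurable_int/measurable_EFinP := Id.
have mcd : measurable_fun [set: R] (cut a b (fun s => c s * d s)).
  apply: measurable_cut; apply: pointwise_continuous_measurable => s; rewrite in_itv/= => sab.
  by apply: cvgM; [exact: cc|exact: cd].
move=> t tab; rewrite -(opprK t).
apply: (@volterra_unique R (- b) (- a) ba al al0 al1 (fun s => c (- s)) (fun s => d (- s)) M M0).
- have := integrable_opp Id; congr (integrable _ _ _).
  by apply/funext => s /=; rewrite cut_opp.
- by move=> s; rewrite oppK_itv => sab; apply: continuous_opp_at; exact: cc.
- by move=> s; rewrite oppK_itv; exact: cM.
- by move=> s; rewrite oppK_itv => sab; apply: continuous_opp_at; exact: cd.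
- move=> s; rewrite oppK_itv => sab; have := dae _ sab.
  by rewrite rrl0_opp// integral_after_opp// opprK.
- by rewrite oppK_itv opprK.
Qed.

Lemma cut_local_right be (a b : R) (g : R -> R) t : 0 < be -> be <= 1 -> a < b ->
  integrableR (cut a b g) -> (forall s, a < s < b -> {for s, continuous g}) -> a < t ->
  integrableR (fun s => fk be (s - t) * cut a b g s) /\
  (t < b -> {for t, continuous (rrl be (cut a b g))}).
Proof.
move=> be0 be1 ab Ig cg at_.
have mg : measurable_fun [set: R] (cut a b g) by have /measurable_int/measurable_EFinP := Ig.
have cg' s : - b < s < - a -> {for s, continuous (fun r => g (- r))}.
  by rewrite oppK_itv => sab; apply: continuous_opp_at; exact: cg.
have Ig' : integrableR (cut (- b) (- a) (fun r => g (- r))).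
  have := integrable_opp Ig; congr (integrable _ _ _).
  by apply/funext => s /=; rewrite cut_opp.
have ta : - t < - a by rewrite ltrN2.
have [I1 C1] := @cut_local _ (- b) (- a) be _ _ be0 be1 Ig' cg' ta.
split.
  have := integrable_opp I1; congr (integrable _ _ _).
  by apply/funext => s /=; rewrite -cut_opp !opprK addrC.
move=> tb; have bt : - b < - t by rewrite ltrN2.
have -> : rrl be (cut a b g) = (fun t => rl be (cut (- b) (- a) (fun r => g (- r))) (- t)).
  apply/funext => s; rewrite rl_reflect//; congr (rl _ _ _).
  by apply/funext => r; rewrite cut_opp.
apply: continuous_opp_at; exact: C1.
Qed.

End adjoint_kernel.

(** The epsilon-delta form of continuity on a set, which avoids the subspace
topology. *)
Lemma within_continuousP (R : realType) (T : pseudoMetricType R) (A : set T) (f : T -> R) :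
  {within A, continuous f} <-> forall t, A t -> forall e, 0 < e ->
    exists2 r, 0 < r & forall s, A s -> ball t r s -> `|f t - f s| < e.
Proof.
split => [cf t At e e0|h].
  have : (f @ within A (nbhs t)) --> f t by rewrite (nbhs_subspace_in At); exact: cf.
  move=> /cvgrPdist_lt/(_ _ e0); rewrite /within => /(nbhs_ballP _ _).1[r /= r0 hr].
  by exists r => // s As ts; exact: hr.
rewrite continuous_subspace_in => t; rewrite inE => At.
suff : (f @ within A (nbhs t)) --> f t by rewrite (nbhs_subspace_in At).
apply/cvgrPdist_lt => e e0.
have [r r0 hr] := h t At e e0; rewrite /within.
by apply/(nbhs_ballP _ _).2; exists r => //= s ts As; exact: hr.
Qed.

(** The integral over the future of [t] as a function of the primitive, which can be
differentiated. *)
Lemma integral_after (R : realType) (a' : R) (f : R -> R) t : integrableR f -> (forall s, s <= a' -> f s = 0) ->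
  \int[lebesgue_measure]_s (if t < s then f s else 0) =
  \int[lebesgue_measure]_s f s - \int[lebesgue_measure]_(s in `]a', t]) f s.
Proof.
move=> If f0; have mf : measurable_fun [set: R] f by have /measurable_int/measurable_EFinP := If.
have mif (B : R -> bool) : measurable_fun [set: R] B -> integrableR (fun s => if B s then f s else 0).
  move=> mB; apply: le_integrableR (integrable_norm If).
    by apply: measurable_fun_ifT.
  by move=> s /=; case: ifP => // _; rewrite normr0.
have I1 : integrableR (fun s => if t < s then f s else 0) by apply: mif; exact: measurable_fun_ltr.
have I2 : integrableR (fun s => if s <= t then f s else 0) by apply: mif; exact: measurable_fun_ler.
have -> : \int[lebesgue_measure]_(s in `]a', t]) f s = \int[lebesgue_measure]_s (if s <= t then f s else 0).
  rewrite /Rintegral; congr fine; rewrite [RHS](@integral_support _ `]a', t]).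
    by apply: eq_integral => s; rewrite inE/= in_itv/= => /andP[_ ->].
  move=> s; rewrite in_itv/= negb_and -leNgt => /orP[sa|/negbTE->//].
  by rewrite f0// if_same.
rewrite -RintegralB//.
apply: eq_Rintegral => s _; rewrite leNgt; case: ltP => _ /=; by rewrite ?subr0 ?subrr.
Qed.

Section clip_composition.
Context {R : realType} (a b : R).
Hypothesis ab : a < b.

Lemma clip_comp_continuous (q : R -> R) : {within `[a, b], continuous q} ->
  continuous (fun s => q (clip a b s)).
Proof.
move=> cq t; apply/cvgrPdist_lt => e e0.
have cI s : `[a, b]%classic (clip a b s) by rewrite /= in_itv/=; exact: clip_itv.
have [r r0 hr] := (within_continuousP _ _).1 cq _ (cI t) e e0.
have /cvgrPdist_lt/(_ _ r0) := @clip_continuous R a b t.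
by apply: filterS => s hs; apply: hr.
Qed.

Lemma within_continuous_bounded (q : R -> R) : {within `[a, b], continuous q} ->
  exists2 M, 0 <= M & forall t, `|q (clip a b t)| <= M.
Proof.
move=> cq.
have cn : {within `[a, b], continuous (fun s => `|q s|)}.
  apply/within_continuousP => t tI e e0; have [r r0 hr] := (within_continuousP _ _).1 cq t tI e e0.
  by exists r => // s sI ts; apply: le_lt_trans (ler_dist_dist _ _) _; exact: hr.
have [c _ hc] := EVT_max (ltW ab) cn.
by exists `|q c| => // t; apply: hc; rewrite in_itv/= clip_itv.
Qed.

Lemma within_itvco_continuous (g : R -> R) t : {within `[a, b[, continuous g} ->
  a < t < b -> {for t, continuous g}.
Proof.
move=> cg /andP[at_ tb]; apply/cvgrPdist_lt => e e0.
have At : `[a, b[%classic t by rewrite /= in_itv/= (ltW at_).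
have [r r0 hr] := (within_continuousP _ _).1 cg t At e e0.
have Bt : nbhs t (ball t r) := nbhsx_ballx t r r0.
near=> s; apply: hr.
  rewrite /= in_itv/=; apply/andP; split; [apply: ltW|]; near: s; [exact: lt_nbhsr|exact: lt_nbhsl].
by near: s; exact: Bt.
Unshelve. all: by end_near. Qed.

Lemma within_itvco_eq0 (g : R -> R) : {within `[a, b[, continuous g} ->
  (forall t, a < t < b -> g t = 0) -> forall t, t \in `[a, b[ -> g t = 0.
Proof.
move=> cg g0 t; rewrite in_itv/= => /andP[]; rewrite le_eqVlt => /predU1P[<-{t} _|at_ tb].
  apply/eqP; apply/negPn/negP => ga0; have e0 : 0 < `|g a| by rewrite normr_gt0.
  have Aa : `[a, b[%classic a by rewrite /= in_itv/= lexx ab.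
  have [r r0 hr] := (within_continuousP _ _).1 cg a Aa _ e0.
  pose s := a + Num.min (r / 2) ((b - a) / 2).
  have m0 : 0 < Num.min (r / 2) ((b - a) / 2) by rewrite lt_min !divr_gt0// subr_gt0.
  have m1 : Num.min (r / 2) ((b - a) / 2) <= r / 2 by rewrite ge_min lexx.
  have m2 : Num.min (r / 2) ((b - a) / 2) <= (b - a) / 2 by rewrite ge_min lexx orbT.
  have sab : a < s < b by rewrite /s; move: ab; lra.
  have := hr s; rewrite (g0 s sab) subr0 ltxx => H; suff: false by [].
  apply: H.
    by rewrite /= in_itv/=; case/andP: sab => /ltW-> ->.
  by rewrite /ball/= /s opprD addrA subrr sub0r normrN gtr0_norm//; lra.
by apply: g0; rewrite at_.
Qed.

Lemma integrable_cutR (f : R -> R) : (@lebesgue_measure R).-integrable `[a, b] (EFin \o f) ->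
  integrableR (cut a b f).
Proof.
move=> If; have mI : measurable (`]a, b[%classic : set (measurableTypeR R)) by exact: measurable_itv.
have If' : (@lebesgue_measure R).-integrable `]a, b[ (EFin \o f).
  by apply: integrableS If => //; exact: subset_itv_oo_cc.
have := (integrable_mkcond _ mI).1 If'; congr (integrable _ _ _).
apply/funext => s; rewrite patchE /= /cut.
have -> : (s \in (`]a, b[%classic : set R)) = (a < s < b).
  by apply/idP/idP; rewrite inE/= in_itv/=.
by case: ifP.
Qed.

End clip_composition.

Section adjoint_equation.
Context {R : realType} (al a b : R).
Hypotheses (al0 : 0 < al) (al1 : al <= 1) (ab : a < b).

Lemma frac_right_rrl0 (a' : R) (f : R -> R) t : a' <= a -> a' < t < b ->
  integrableR (cut a' b f) -> (forall s, a' < s < b -> {for s, continuous f}) ->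
  frac_int_right b (1 - al) f t = rrl0 (1 - al) (cut a' b f) t.
Proof.
move=> a'a /andP[at_ tb] If cf; move: (al1); rewrite le_eqVlt => /predU1P[->|al1'].
  by rewrite subrr /frac_int_right /rrl0 eqxx cutE// at_.
have be0 : 0 < 1 - al by rewrite subr_gt0.
have be1 : 1 - al <= 1 by rewrite gerBl ltW.
rewrite /rrl0 gt_eqF// (@frac_right_rrl _ a')// ?(ltW at_)//.
by have [] := @cut_local_right _ (1 - al) a' b f t be0 be1 (lt_trans at_ tb) If cf at_.
Qed.

Lemma rrl0_continuous (f : R -> R) t : a < t < b ->
  integrableR (cut a b f) -> (forall s, a < s < b -> {for s, continuous f}) ->
  {for t, continuous (rrl0 (1 - al) (cut a b f))}.
Proof.
move=> tab If cf; have /andP[at_ tb] := tab.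
move: (al1); rewrite le_eqVlt => /predU1P[->|al1'].
  rewrite subrr (_ : rrl0 0 (cut a b f) = cut a b f); last first.
    by apply/funext => s; rewrite /rrl0 eqxx.
  by apply: cut_continuous => //; exact: cf.
have be0 : 0 < 1 - al by rewrite subr_gt0.
have be1 : 1 - al <= 1 by rewrite gerBl ltW.
rewrite (_ : rrl0 _ _ = rrl (1 - al) (cut a b f)); last first.
  by apply/funext => s; rewrite /rrl0 gt_eqF.
by have [_] := @cut_local_right _ (1 - al) a b f t be0 be1 ab If cf at_; apply.
Qed.

Variable (q : R -> R).
Hypothesis cq : {within `[a, b], continuous q}.
Let c s := q (clip a b s).

(** The absolutely continuous representative of the fractional integral of [p] is the
integral of its derivative [- q * p], and its value at [b] is [-1].  The
representative agrees with the integral only almost everywhere, but inside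
the interval both are continuous. *)
Lemma adjoint_solution_integral p : adjoint_solution a b al q p ->
  [/\ integrableR (cut a b p), (forall t, a < t < b -> {for t, continuous p}) &
  forall t, a < t < b -> rrl0 (1 - al) (cut a b p) t =
    -1 + \int[lebesgue_measure]_s (if t < s then cut a b (fun s => c s * p s) s else 0)].
Proof.
move=> [[L1p [F0 F0r]] cp dp Fb].
have Ip : integrableR (cut a b p) by exact: integrable_cutR.
have cp' t : a < t < b -> {for t, continuous p} by exact: within_itvco_continuous.
split => // t tab; have /andP[at_ tb] := tab.
set F := ac_repr a b (frac_int_right b (1 - al) p) in Fb.
have [acF eF] := ac_repr_of_ac_repr F0r; rewrite -/F in acF eF.
have [f [If FE fE]] := abs_cont_derive_ae ab acF.
have Fc s : a < s < b -> {for s, continuous F}.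
  move=> /andP[as_ sb]; apply/cvgrPdist_lt => e e0.
  have [d d0 hd] := abs_cont_continuous acF e0.
  near=> r.
  have ar : a < r by near: r; exact: lt_nbhsr.
  have rb : r < b by near: r; exact: lt_nbhsl.
  have sr : `|s - r| < d by near: r; apply: (@nbhsx_ballx _ R^o).
  have [rs|rs] := leP r s.
    by apply: hd => //; rewrite ?ltW//; apply: le_lt_trans sr; exact: ler_norm.
  rewrite distrC; apply: hd => //; rewrite ?ltW//; apply: le_lt_trans sr.
  by rewrite distrC ler_norm.
have -> : rrl0 (1 - al) (cut a b p) t = F t.
  apply/eqP; rewrite -subr_eq0; apply/eqP.
  apply: (@ae0_continuous _ a b ab (fun s => rrl0 (1 - al) (cut a b p) s - F s) t tab).
    by apply: cvgB; [exact: rrl0_continuous|exact: Fc].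
  apply: (@filterS _ _ (ae_filter_ringOfSetsType (@lebesgue_measure R)) _ _ _ eF) => s h sab.
  have sI : s \in `[a, b] by rewrite in_itv/=; case/andP: sab => /ltW-> /ltW->.
  by rewrite -(h sI) (@frac_right_rrl0 a)// subrr.
have Eb : F b = F a + \int[lebesgue_measure]_(s in `]a, b]) f s by apply: FE; rewrite lexx ltW.
have Et : F t = F a + \int[lebesgue_measure]_(s in `]a, t]) f s by apply: FE; rewrite !ltW.
have -> : F t = -1 - \int[lebesgue_measure]_(s in `]t, b]) f s.
  rewrite -Fb Eb Et -(@prim_itvB _ a f t b If (ltW at_) (ltW tb)).
  by rewrite opprB; ring.
congr (_ + _).
have cmp : measurable_fun [set: R] (cut a b (fun s => c s * p s)).
  apply: measurable_cut; apply: pointwise_continuous_measurable => s; rewrite in_itv/= => sab.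
  by apply: cvgM; [exact: (clip_comp_continuous ab cq)|exact: cp'].
have If' : (@lebesgue_measure R).-integrable `]t, b[ (EFin \o f) by exact: integrable_itvR.
rewrite -Rintegral_itv_bndo_bndc//.
rewrite /Rintegral -fineN; congr fine.
rewrite -integralN; last by apply: integrable_add_def.
rewrite [RHS](@integral_support _ `]t, b[); last first.
  move=> s; rewrite in_itv/= negb_and -!leNgt => /orP[st|bs]; first by rewrite ltNge st.
  by rewrite cut_out ?if_same// negb_and -!leNgt bs orbT.
apply: ae_eq_integral => //.
- by apply: measurable_funTS; apply: measurableT_comp => //; have /measurable_int := If.
- apply: measurable_funTS; apply/measurable_EFinP.
  by apply: measurable_fun_ifT => //; exact: measurable_fun_ltr.
- apply: (@filterS _ _ (ae_filter_ringOfSetsType (@lebesgue_measure R)) _ _ _ fE) => s h.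
  rewrite /= in_itv/= => /andP[ts sb].
  have as_ := lt_trans at_ ts.
  have sI : s \in `[a, b] by rewrite in_itv/= !ltW.
  have sI' : s \in `[a, b[ by rewrite in_itv/= sb ltW.
  rewrite -h// ts cutE ?as_// /c clip_id ?ltW//=; congr (_%:E).
  by have := dp s sI'; rewrite /RL_deriv_right -/F => ->; rewrite mulrC.
Unshelve. all: by end_near. Qed.

Lemma adjoint_solution_unique p p' : adjoint_solution a b al q p -> adjoint_solution a b al q p' ->
  forall t, t \in `[a, b[ -> p' t = p t.
Proof.
move=> hp hp'; have [Ip cp Ep] := adjoint_solution_integral hp.
have [Ip' cp' Ep'] := adjoint_solution_integral hp'.
have [M M0 cM] := within_continuous_bounded ab cq.
have cc := clip_comp_continuous ab cq.
have Id : integrableR (cut a b (fun s => p' s - p s)).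
  have -> : cut a b (fun s => p' s - p s) = (fun s => cut a b p' s - cut a b p s).
    by apply/funext => s; rewrite /cut; case: ifP => //; rewrite subr0.
  exact: (integrableB measurableT Ip' Ip).
have cd t : a < t < b -> {for t, continuous (fun s => p' s - p s)}.
  by move=> tab; apply: cvgB; [exact: cp'|exact: cp].
have d0 : forall t, a < t < b -> p' t - p t = 0.
  apply: (@volterra_unique_right _ al al0 al1 a b c (fun s => p' s - p s) M ab M0 Id) => //.
  - by move=> t _; exact: cc.
  - by move=> t _; exact: cM.
  - move=> t tab; have /andP[at_ tb] := tab.
    have IcM g : integrableR (cut a b g) -> integrableR (fun s => if t < s then cut a b (fun s => c s * g s) s else 0).
      move=> Ig; have [IMg _] := RintegralZ M (integrable_norm Ig).
      have mg : measurable_fun [set: R] (cut a b g) by have /measurable_int/measurable_EFinP := Ig.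
      have E s : cut a b (fun s => c s * g s) s = c s * cut a b g s.
        by rewrite /cut; case: ifP => //; rewrite mulr0.
      apply: le_integrableR IMg.
        apply: measurable_fun_ifT => //; first exact: measurable_fun_ltr.
        rewrite (_ : cut a b _ = fun s => c s * cut a b g s); last exact/funext.
        by apply: measurable_funM => //; exact: continuous_measurable_fun.
      move=> s /=; case: ifP => _; last by rewrite normr0 mulr_ge0.
      by rewrite E normrM ler_wpM2r//; exact: cM.
    have -> : rrl0 (1 - al) (cut a b (fun s => p' s - p s)) t = rrl0 (1 - al) (cut a b p') t - rrl0 (1 - al) (cut a b p) t.
      rewrite /rrl0; case: ifPn => [_|be]; first by rewrite !cutE.
      have be0 : 0 < 1 - al by rewrite lt_neqAle eq_sym be subr_ge0.
      have be1 : 1 - al <= 1 by rewrite gerBl ltW.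
      have [I1 _] := @cut_local_right _ (1 - al) a b p' t be0 be1 ab Ip' cp' at_.
      have [I2 _] := @cut_local_right _ (1 - al) a b p t be0 be1 ab Ip cp at_.
      rewrite /rrl -RintegralB//; apply: eq_Rintegral => s _; rewrite -mulrBr; congr (_ * _).
      by rewrite /cut; case: ifP => //; rewrite subr0.
    rewrite Ep// Ep'// opprD addrACA subrr add0r -RintegralB//; [|exact: IcM|exact: IcM].
    apply: eq_Rintegral => s _; case: ifP => _; last by rewrite subr0.
    by rewrite /cut; case: ifP => _; rewrite ?subr0// mulrBr.
have [_ wp _ _] := hp; have [_ wp' _ _] := hp'.
move=> t tI; apply/eqP; rewrite -subr_eq0; apply/eqP.
apply: (@within_itvco_eq0 _ a b ab (fun s => p' s - p s)) => //.
by move=> s; apply: cvgB; [exact: wp'|exact: wp].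
Qed.

(** The kernel is solved for on the larger interval that starts at [a - 1], so
    that it is continuous at [a] from both sides. *)
Lemma adjoint_solution_kernel : exists (P : R -> R) (A : R), [/\
    integrableR (cut a b P) /\ integrableR (cut (a - 1) b P),
    (forall t, a - 1 < t < b -> {for t, continuous P}),
    (forall t, a <= t < b -> 0 < P t <= A * kern al (b - t)),
    (forall t, a < t < b -> P t = fk al (b - t) + rrl al (cut a b (fun s => c s * P s)) t) &
    adjoint_solution a b al q (fun t => - cut (a - 1) b P t)].
Proof.
have [M M0 cM] := within_continuous_bounded ab cq.
have cc := clip_comp_continuous ab cq.
have a1b : a - 1 < b by move: ab; lra.
have [P [A [IP cP P0 PE PJ]]] := @adjoint_kernel _ al al0 al1 (a - 1) b c M a1b M0 (fun t _ => cc t) (fun t _ => cM t).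
have sub t : a < t < b -> a - 1 < t < b by move=> /andP[h ->]; rewrite andbT; lra.
set f := cut (a - 1) b (fun s => c s * P s) in PJ.
have mP : measurable_fun [set: R] (cut (a - 1) b P) by have /measurable_int/measurable_EFinP := IP.
have fE s : f s = c s * cut (a - 1) b P s by rewrite /f /cut; case: ifP => //; rewrite mulr0.
have If : integrableR f.
  have [IM _] := RintegralZ M (integrable_norm IP).
  apply: le_integrableR IM.
    rewrite (_ : f = fun s => c s * cut (a - 1) b P s); last exact/funext.
    by apply: measurable_funM => //; exact: continuous_measurable_fun.
  by move=> s /=; rewrite fE normrM ler_wpM2r//; exact: cM.
have f0 s : s <= a - 1 -> f s = 0 by move=> sa; rewrite /f cut_out// ltNge sa.
pose I := \int[lebesgue_measure]_s f s.
pose H t := \int[lebesgue_measure]_(s in `]a - 1, t]) f s.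
pose F t := (-1 - I) + H t.
have a1a : a - 1 < a by lra.
have acF : abs_cont a b F.
  apply: (@abs_cont_prim _ a b F f (F a) If) => t /andP[at_ tb].
  by rewrite -(@prim_itvB _ (a - 1) f a t If (ltW a1a) at_) -/(H t) -/(H a) /F; ring.
have FJ t : F t = - (1 + \int[lebesgue_measure]_s (if t < s then f s else 0)).
  by rewrite (integral_after t If f0) /F /H /I; ring.
have frF t : a - 1 < t < b -> frac_int_right b (1 - al) (fun t => - cut (a - 1) b P t) t = F t.
  move=> tab; have cp s : a - 1 < s < b -> {for s, continuous (fun t => - cut (a - 1) b P t)}.
    by move=> sab; apply: cvgN; apply: cut_continuous => //; exact: cP.
  have cpE : cut (a - 1) b (fun t => - cut (a - 1) b P t) = (fun t => - cut (a - 1) b P t).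
    apply/funext => s; have [h|h] := boolP (a - 1 < s < b); first by rewrite (cutE _ h).
    by rewrite !(cut_out _ h) oppr0.
  have Ip : integrableR (cut (a - 1) b (fun t => - cut (a - 1) b P t)).
    by rewrite cpE; have := integrableN IP.
  rewrite (@frac_right_rrl0 (a - 1))// ?(ltW a1a)// FJ -PJ// cpE /rrl0; case: ifPn => // be.
  have be0 : 0 < 1 - al by rewrite lt_neqAle eq_sym be subr_ge0.
  have be1 : 1 - al <= 1 by rewrite gerBl ltW.
  have /andP[a1t _] := tab.
  have [I1 _] := @cut_local_right _ (1 - al) (a - 1) b P t be0 be1 a1b IP cP a1t.
  rewrite /rrl; have [_ E] := RintegralZ (-1) I1; rewrite mulN1r in E; rewrite -E.
  by apply: eq_Rintegral => s _; ring.
have Fr : ac_repr_of a b (frac_int_right b (1 - al) (fun t => - cut (a - 1) b P t)) F.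
  split => //.
  have : {ae @lebesgue_measure R, forall t, t != b}.
    exists [set b]; split => //; first exact: lebesgue_measure_set1.
    by move=> t /= /negP; rewrite negbK => /eqP.
  apply: (@filterS _ _ (ae_filter_ringOfSetsType (@lebesgue_measure R))) => t tb.
  rewrite in_itv/= => /andP[at_ tb']; apply: frF.
  by rewrite (lt_le_trans a1a at_) lt_neqAle tb.
have Fb : F b = -1.
  rewrite FJ (_ : \int[_]_s _ = 0) ?addr0// /Rintegral (eq_integral (cst 0%E)) ?integral0// => s _.
  by case: ltP => // bs; rewrite /f cut_out// negb_and -!leNgt (ltW bs) orbT.
exists P, A; split => //.
- split => //; apply: le_integrableR (integrable_norm IP).
    apply: measurable_cut; apply: pointwise_continuous_measurable => s; rewrite in_itv/= => sab.
    by apply: cP; exact: sub.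
  move=> s /=; rewrite /cut; case: ifP => [sab|_]; last by rewrite normr0.
  by rewrite sub.
- by move=> t /andP[at_ tb]; apply: P0; rewrite tb andbT (lt_le_trans a1a).
- move=> t tab; rewrite PE ?sub//; congr (_ + _); apply: eq_Rintegral => s _.
  have /andP[at_ tb] := tab.
  have [ts|st] := ltP t s; last by rewrite fk_le0 ?mul0r// subr_le0.
  by congr (_ * _); rewrite /cut (lt_trans at_ ts) (lt_trans (lt_trans a1a at_) ts).
- have Rb : ac_repr a b (frac_int_right b (1 - al) (fun t => - cut (a - 1) b P t)) b = F b.
    by apply: (ac_repr_eq ab Fr); rewrite in_itv/= lexx ltW.
  split; last by rewrite Rb.
  + split; last by exists F.
    apply: integrable_itvR => //.
    by have := integrableN IP.
  + apply: continuous_in_subspaceT => t; rewrite inE/= in_itv/= => /andP[at_ tb].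
    have tab : a - 1 < t < b by rewrite tb andbT (lt_le_trans a1a).
    by apply: cvgN; apply: cut_continuous => //; exact: cP.
  + move=> t; rewrite in_itv/= => /andP[at_ tb].
    have tI : t \in `[a, b] by rewrite in_itv/= at_ ltW.
    have tab : a - 1 < t < b by rewrite tb andbT (lt_le_trans a1a).
    rewrite /RL_deriv_right (eq_derive_on tI (ac_repr_eq ab Fr)).
    have cf : {for t, continuous f}.
      by apply: cut_continuous => //; apply: cvgM; [exact: cc|exact: cP].
    have Ifb : (@lebesgue_measure R).-integrable `]a - 1, b] (EFin \o f) by exact: integrable_itvR.
    have at' : (BRight (a - 1) < BRight t)%O by rewrite bnd_simp; case/andP: tab.
    have [dH HE] := continuous_FTC1 tb Ifb at' cf.
    have dF : is_derive (t : R) (1 : R) F (f t).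
      have dH' : is_derive (t : R) (1 : R) H (f t) by have := DeriveDef dH erefl; rewrite -derive1E HE.
      have := is_deriveD (is_derive_cst (-1 - I) t 1) dH'.
      by rewrite add0r.
    rewrite (derive_on_derivable ab tI (fun s _ => erefl (F s))); last by case: dF.
    rewrite derive1E; case: dF => _ ->.
    by rewrite fE /c clip_id ?at_ ?(ltW tb)//; ring.
Qed.

End adjoint_equation.

(** * Needle variations *)

Lemma integral_cut_cst (R : realType) (B u v : R) : u <= v ->
  integrableR (cut u v (cst B)) /\ \int[lebesgue_measure]_t cut u v (cst B) t = B * (v - u).
Proof.
move=> uv; have I : integrableR (cut u v (cst B)).
  apply: (@integrable_bounded_cut _ u v (cst B) `|B|) => //.
split=> //; rewrite /Rintegral integral_cut.
have -> : (\int[lebesgue_measure]_(s in `]u, v[) (cst B s)%:E = B%:E * (@lebesgue_measure R) `]u, v[%classic)%E.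
  by rewrite -integral_cst//; exact: measurable_itv.
rewrite lebesgue_measure_itv/= lte_fin; move: uv; rewrite le_eqVlt => /predU1P[->|uv].
  by rewrite ltxx mule0 subrr mulr0.
by rewrite uv -EFinD -EFinM.
Qed.

Section needle_tools.
Context {R : realType} (al a b : R).
Hypotheses (al0 : 0 < al) (al1 : al <= 1) (ab : a < b).
Local Notation fk := (fk al).

(** A weight comparable with the adjoint kernel [P], which has the singularity of the kernel at
[b], and contracted by the transposed operator. *)
Lemma singular_weight_right (e : R) : 0 < e -> exists (W : R -> R) (C : R), [/\
  measurable_fun [set: R] W /\ integrableR W,
  (forall s, 0 <= W s), (forall s, ~~ (a < s < b) -> W s = 0),
  (forall s, a < s < b -> kern al (b - s) <= W s <= C * kern al (b - s)) &
  forall s, a < s < b -> (\int[lebesgue_measure]_t (fk (t - s) * W t)%:E <= (e * W s)%:E)%E].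
Proof.
move=> e0; have ba : - b < - a by rewrite ltrN2.
have [l l0 hl] := bielecki al0 al1 ba e0.
pose w := bweight al (- b) (- a) l.
have mw : measurable_fun [set: R] w := measurable_bweight al (- b) (- a) l.
have w0 s : 0 <= w s := bweight_ge0 al (- b) (- a) l s.
have wphi s : - b < s < - a -> w s <= expR (l * (b - a)) * kern al (s - - b).
  have E0 : b - a = - a - - b by rewrite opprK addrC.
  by move=> sab; rewrite E0; exact: bweight_le_phi.
have Iw : integrableR w.
  have [IA _] := RintegralZ (expR (l * (b - a))) (integrable_cut_phi al0 ba).
  apply: le_integrableR IA => // s; rewrite ger0_norm//.
  have [sab|sab] := boolP (- b < s < - a); first by rewrite cutE// wphi.
  by rewrite /w /bweight !(cut_out _ sab) mulr0.
exists (fun s => w (- s)), (expR (l * (b - a))).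
have sw s : (- b < - s < - a) = (a < s < b) by rewrite !ltrN2 andbC.
split.
- by split; [exact: measurableT_comp|exact: integrable_opp].
- by move=> s.
- by move=> s sab; rewrite /w /bweight cut_out// sw.
- move=> s sab; rewrite -sw in sab.
  have E : b - s = - s - - b by rewrite opprK addrC.
  by rewrite E wphi// phi_le_bweight.
- move=> s sab; rewrite -sw in sab; apply: le_trans (hl _ sab).
  rewrite ge0_integral_opp.
  + by rewrite le_eqVlt; apply/orP; left; apply/eqP; apply: eq_integral => t _; rewrite opprK addrC.
  + apply/measurable_EFinP; apply: measurable_funM; first exact: measurable_fk_sub'.
    exact: measurableT_comp.
  + by move=> t; rewrite lee_fin mulr_ge0 ?fk_ge0.
Qed.

(** After the needle has passed the kernel only decreases, so that the value at [v]
bounds all the later ones. *)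
Lemma rl_needle (f : R -> R) (B u v t : R) : u < v -> 0 <= B -> measurable_fun [set: R] f ->
  (forall s, ~~ (u < s < v) -> f s = 0) -> (forall s, `|f s| <= B) ->
  integrableR (fun s => fk (t - s) * f s) /\ `|rl al f t| <= B * rlcst al (v - u).
Proof.
move=> uv B0 mf f0 f1.
have If' t' := @rl_bounded R al al0 al1 f u v t' B B0 mf f0 (fun s _ _ => f1 s).
split; first by have [] := If' t.
have [tv|vt] := leP t v.
  have [_ h] := If' t; apply: (le_trans h); rewrite ler_wpM2l//; apply: rlcst_le => //; lra.
pose g s := fk (v - s) * cut u v (cst B) s.
have mg : measurable_fun [set: R] g.
  by apply: measurable_funM; [exact: measurable_fk_sub|apply: measurable_cut; exact: measurable_cst].
have g0 s : 0 <= g s by rewrite mulr_ge0 ?fk_ge0// /cut; case: ifP.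
have [Ig Eg] : integrableR g /\ \int[lebesgue_measure]_s g s <= B * rlcst al (v - u).
  apply: ge0_integrableR => //.
  exact: (integral_fk_cut al0 al1 u v v B0).
apply: le_trans Eg; have [It _] := If' t.
apply: (le_trans (le_normr_Rintegral measurableT It)).
apply: le_Rintegral => //; first exact: (integrable_norm It).
move=> s _; rewrite normrM (ger0_norm (fk_ge0 al0 al1 _)) /g.
have [suv|suv] := boolP (u < s < v); last by rewrite f0// normr0 mulr0 cut_out// mulr0.
rewrite cutE//; apply: ler_pM; rewrite ?fk_ge0//.
by apply: fk_anti => //; move/andP: suv => [_ sv]; lra.
Qed.

Lemma ler_norm_rl (f : R -> R) t : integrableR (fun s => fk (t - s) * f s) ->
  integrableR (fun s => fk (t - s) * `|f s|) /\ `|rl al f t| <= rl al (fun s => `|f s|) t.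
Proof.
move=> If; have E s : `|fk (t - s) * f s| = fk (t - s) * `|f s|.
  by rewrite normrM (ger0_norm (fk_ge0 al0 al1 _)).
split; first by have := integrable_norm If; apply: eq_integrable => // s _ /=; rewrite E.
apply: (le_trans (le_normr_Rintegral measurableT If)).
by rewrite le_eqVlt; apply/orP; left; apply/eqP/eq_Rintegral => s _; rewrite E.
Qed.

(** The profile of the needle; it is at least [1/2] on the middle half of its support. *)
Definition tent (t0 d t : R) : R := Num.max 0 (1 - `|t - t0| / d).

Lemma tent_continuous t0 d : continuous (tent t0 d).
Proof.
move=> t; rewrite /tent; apply: (@continuous_max _ _ (cst 0) (fun t => 1 - `|t - t0| / d)).
  exact: cvg_cst.
apply: cvgB; first exact: cvg_cst.
apply: cvgM; last exact: cvg_cst.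
apply: (@continuous_comp _ _ _ (fun t : R => t - t0) (fun x : R => `|x|)).
  by apply: cvgB; [exact: cvg_id|exact: cvg_cst].
exact: norm_continuous.
Qed.

Lemma tent_itv t0 d t : 0 < d -> 0 <= tent t0 d t <= 1.
Proof.
move=> d0; rewrite le_max lexx/= ge_max ler01/= gerBl divr_ge0// ltW//.
Qed.

Lemma tent_out t0 d t : 0 < d -> ~~ (t0 - d < t < t0 + d) -> tent t0 d t = 0.
Proof.
move=> d0 out; apply/max_idPl; rewrite subr_le0 ler_pdivlMr// mul1r.
move: out; rewrite negb_and -!leNgt => /orP[h|h].
  by rewrite ler0_norm; lra.
by rewrite ger0_norm; lra.
Qed.

Lemma tent_half t0 d t : 0 < d -> t0 - d / 2 < t < t0 + d / 2 -> 1 / 2 <= tent t0 d t.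
Proof.
move=> d0 /andP[h1 h2]; rewrite le_max; apply/orP; right.
have : `|t - t0| / d <= 1 / 2; last lra.
by rewrite ler_pdivrMr// ler_norml; apply/andP; split; lra.
Qed.

End needle_tools.

Lemma clip_lipschitz (R : realType) (a b x y : R) : a < b ->
  `|clip a b x - clip a b y| <= `|x - y|.
Proof.
move=> ab; wlog xy : x y / x <= y.
  move=> H; have [h|h] := leP x y; first exact: H.
  by rewrite distrC (distrC x) H// ltW.
rewrite distrC (distrC x) !ger0_norm ?subr_ge0 ?le_clip//.
exact: clipB_le.
Qed.

Lemma integrable_cutD (R : realType) (a b : R) (f g : R -> R) :
  integrableR (cut a b f) -> integrableR (cut a b g) ->
  integrableR (cut a b (fun t => f t + g t)) /\
  \int[lebesgue_measure]_t cut a b (fun t => f t + g t) t =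
  \int[lebesgue_measure]_t cut a b f t + \int[lebesgue_measure]_t cut a b g t.
Proof.
move=> If Ig; rewrite (_ : cut a b (fun t => f t + g t) = fun t => cut a b f t + cut a b g t).
  by split; [exact: (integrableD measurableT If Ig)|rewrite RintegralD].
by apply/funext => t; rewrite /cut; case: ifP => //; rewrite addr0.
Qed.

Lemma integrable_rrl (R : realType) (al a b : R) (f : R -> R) : 0 < al -> al <= 1 ->
  integrableR f -> integrableR (cut a b (rrl al f)).
Proof.
move=> al0 al1 If; have mf : measurable_fun [set: R] f by have /measurable_int/measurable_EFinP := If.
have := integrable_opp (@integrable_rl _ al (- b) (- a) al0 al1 _ (integrable_opp If)).
congr (integrable _ _ _); apply/funext => s /=; rewrite cut_opp !opprK.
by congr (cut _ _ _ _)%:E; apply/funext => t; rewrite rl_reflect.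
Qed.

Lemma needle_balance (R : realFieldType) (z i j x y c d : R) : 0 <= z -> z = i + j ->
  i <= - c * d -> j <= x + y -> x <= c / 3 * d -> y <= c / 3 * d -> 0 < c * d -> False.
Proof. by move=> z0 zij i1 j1 x1 y1 cd; lra. Qed.

Lemma ler_sum3 (R : realFieldType) (x y z : R) : x <= 1 -> y <= 1 -> z <= 1 -> x + y + z <= 3.
Proof. by move=> x1 y1 z1; lra. Qed.

Lemma centered_itv_widen (R : realFieldType) (c d r x : R) : d <= r ->
  c - d < x < c + d -> c - r < x < c + r.
Proof. by move=> dr /andP[x1 x2]; apply/andP; split; lra. Qed.

Lemma ler_half_sum (R : realFieldType) (k x y z : R) : 0 <= x -> 0 <= y + z + x -> k <= 1 / 2 ->
  x <= k * (y + z + x) -> x <= y + z.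
Proof.
move=> x0 s0 k1 xk; have : k * (y + z + x) <= 1 / 2 * (y + z + x) by apply: ler_wpM2r.
lra.
Qed.

Lemma ler_quotient_succ (R : realFieldType) (c p q : R) : 0 <= c -> 0 <= p -> 0 < q ->
  c / (q * (p + 1)) * p <= c / q.
Proof.
move=> c0 p0 q0; have p1 : 0 < p + 1 by rewrite ltr_wpDl.
rewrite invfM mulrA -[_ / _ / _ * _]mulrA ler_piMr ?divr_ge0 ?(ltW q0)//.
by rewrite mulrC ler_pdivrMr// mul1r lerDl.
Qed.

Section needle.
Context {R : realType} (al a b : R).
Hypotheses (al0 : 0 < al) (al1 : al <= 1) (ab : a < b).
Variables (M : R -> R -> R -> R -> R) (c2 c4 P : R -> R) (K A : R).
Hypotheses (K0 : 0 <= K) (A0 : 0 <= A) (M0 : forall t, M t 0 0 0 = 0)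
  (MK : forall t h e y h' e' y', `|h| <= 1 -> `|e| <= 1 -> `|y| <= 1 ->
    `|h'| <= 1 -> `|e'| <= 1 -> `|y'| <= 1 ->
    `|M t h e y - M t h' e' y'| <= K * (`|h - h'| + `|e - e'| + `|y - y'|))
  (cc2 : continuous c2) (cc4 : continuous c4)
  (c2K : forall t, `|c2 t| <= K) (c4K : forall t, `|c4 t| <= K)
  (Mexp : forall e, 0 < e -> exists2 rho, 0 < rho & forall t h y, `|h| <= rho -> `|y| <= rho ->
    `|M t h 0 y - (c2 t * h + c4 t * y)| <= e * (`|h| + `|y|))
  (Mmeas : forall h e y : R -> R, (forall t, a < t < b -> {for t, continuous h}) ->
    (forall t, a < t < b -> {for t, continuous e}) ->
    (forall t, a < t < b -> {for t, continuous y}) ->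
    measurable_fun (`]a, b[%classic : set R) (fun t => M t (h t) (e t) (y t)))
  (cP : forall t, a < t < b -> {for t, continuous P})
  (P0 : forall t, a < t < b -> 0 < P t <= A * kern al (b - t))
  (IP : integrableR (cut a b P))
  (PE : forall t, a < t < b -> P t = fk al (b - t) + rrl al (cut a b (fun s => c4 s * P s)) t)
  (optimal : forall eta zeta : R -> R, continuous eta -> continuous zeta ->
    (forall t, `|eta t| <= 1) ->
    (forall t, `|rl al (cut a b eta) t| <= 1) -> (forall t, `|zeta t| <= 1) ->
    (forall t, zeta t =
       rl al (cut a b (fun s => M s (rl al (cut a b eta) s) (eta s) (zeta s))) t) ->
    0 <= zeta b).

(** The multiplier of the perturbation [eta] that accounts for the displacement of [x]:
the transpose of [eta |-> h] applied to [c2 * P]. *)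
Definition costate := rrl al (cut a b (fun s => c2 s * P s)).

(** The first-order payoff of the value [e] of the perturbation at time [t]. *)
Definition hamiltonian (t e : R) := P t * M t 0 e 0 + costate t * e.

Let n0 : `|0 : R| <= 1. Proof. by rewrite normr0. Qed.

Let pr (y : R) := clip (-1) 1 y.
Let m11 : (-1 : R) < 1. Proof. lra. Qed.
Let pr1 y : `|pr y| <= 1.
Proof. by rewrite ler_norml; exact: (clip_itv m11). Qed.
Let prE y : `|y| <= 1 -> pr y = y.
Proof. by rewrite ler_norml => h; exact: clip_id. Qed.
Let pr0 : pr 0 = 0. Proof. exact: prE. Qed.
Let prle y : `|pr y| <= `|y|.
Proof. by have := clip_lipschitz y 0 m11; rewrite -/(pr y) -/(pr 0) pr0 !subr0. Qed.

Section perturbation.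
Variable eta : R -> R.
Hypotheses (ceta : continuous eta) (eta1 : forall t, `|eta t| <= 1).
Local Notation h := (rl al (cut a b eta)).
Hypothesis h1 : forall t, `|h t| <= 1.

Let meta : measurable_fun [set: R] (cut a b eta).
Proof. by apply: measurable_cut; apply: measurable_funTS; exact: continuous_measurable_fun. Qed.

Let Ieta : integrableR (cut a b eta).
Proof.
apply: (@integrable_bounded_cut _ a b eta 1) => //.
by apply: measurable_funTS; exact: continuous_measurable_fun.
Qed.

Let ch : continuous h.
Proof.
move=> t; apply: (rl_continuous al0 al1 ltr01 ler01 Ieta) => s _.
by rewrite /cut; case: ifP => // _; rewrite normr0.
Qed.

(** A bounded datum on a bounded interval is integrable and locally bounded, which is
all that continuity requires. *)
Lemma bounded_rl_continuous (m : R -> R) (B : R) : 0 <= B ->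
  measurable_fun (`]a, b[%classic : set R) m -> (forall s, a < s < b -> `|m s| <= B) ->
  continuous (rl al (cut a b m)).
Proof.
move=> B0 mm mB t; have Im := integrable_bounded_cut mm mB.
apply: (rl_continuous al0 al1 ltr01 B0 Im) => s _.
by rewrite /cut; case: ifPn => [/mB//|_]; rewrite normr0.
Qed.

(** The increment is Lipschitz only for small displacements, so it is truncated at [1];
the truncation is inactive once the solution is known to be at most [1]. *)
Lemma perturbed_state : exists zeta : R -> R, continuous zeta /\
  forall t, zeta t = rl al (cut a b (fun s => M s (h s) (eta s) (pr (zeta s)))) t.
Proof.
pose F t x := M t (h t) (eta t) (pr x).
have kb0 : 0 < kern al (b - a) by rewrite kern_gt0// subr_gt0.
have FM t x y : a < t < b -> `|F t x - F t y| <= K * `|x - y|.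
  move=> _; apply: (le_trans (MK _ _ _ _ _ _ _)) => //.
  rewrite !subrr normr0 !add0r ler_wpM2l//; exact: clip_lipschitz.
have FB t x : `|F t x| <= 3 * K.
  rewrite -[F t x]subr0 -(M0 t); apply: (le_trans (MK _ _ _ _ _ _ _)) => //.
  rewrite !subr0 mulrC ler_wpM2r//; exact: ler_sum3.
have Fm y : (forall t, a < t < b -> {for t, continuous y}) ->
    measurable_fun (`]a, b[%classic : set R) (fun t => F t (y t)).
  move=> cy; apply: Mmeas => // t tab; first exact: ch.
    exact: ceta.
  apply: (@continuous_comp _ _ _ y pr); first exact: cy.
  exact: clip_continuous.
have [||||||y [A' [_ cy _ yE]]] := @picard R al a b al0 al1 ab F (cst 0) K (3 * K / kern al (b - a)) K0.
- by rewrite divr_ge0 ?mulr_ge0// ltW.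
- exact: FM.
- move=> t /andP[at_ tb]; apply: (le_trans (FB t 0)).
  rewrite -mulrA ler_peMr ?mulr_ge0// mulrC ler_pdivlMr// mul1r.
  by apply: kern_anti => //; lra.
- exact: Fm.
- by move=> t _; exact: cvg_cst.
- by move=> t _; rewrite normr0 mulr_ge0 ?kern_ge0// divr_ge0 ?mulr_ge0// ltW.
exists (rl al (cut a b (fun s => F s (y s)))); split.
  apply: (@bounded_rl_continuous _ (3 * K)); first exact: mulr_ge0.
    exact: Fm.
  by move=> s _; exact: FB.
move=> t; congr (rl _ _ _); apply/funext => s.
have [sab|sab] := boolP (a < s < b); last by rewrite !cut_out.
by rewrite !cutE// yE// add0r.
Qed.

Lemma remainder_measurable (zeta : R -> R) : continuous zeta ->
  measurable_fun (`]a, b[%classic : set R) (fun t => M t (h t) (eta t) (zeta t)).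
Proof. by move=> cz; apply: Mmeas => t _; [exact: ch|exact: ceta|exact: cz]. Qed.

(** Replace [fk (b - t)] in the formula of [zeta b] by [P - I_{b-}^al (c4 P)] and
transpose: the term [c4 * zeta] of the increment cancels, and the term
[c2 * h] becomes [costate * eta]. *)
Lemma payoff_formula (zeta : R -> R) : continuous zeta -> (forall t, `|zeta t| <= 1) ->
  (forall t, zeta t = rl al (cut a b (fun s => M s (h s) (eta s) (zeta s))) t) ->
  let rem t := M t (h t) (eta t) (zeta t) - M t 0 (eta t) 0 - (c2 t * h t + c4 t * zeta t) in
  [/\ integrableR (cut a b (fun t => P t * rem t)),
      integrableR (cut a b (fun t => hamiltonian t (eta t))) &
      zeta b = \int[lebesgue_measure]_t cut a b (fun t => hamiltonian t (eta t)) t +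
        \int[lebesgue_measure]_t cut a b (fun t => P t * rem t) t].
Proof.
move=> cz z1 zE rem.
pose m t := M t (h t) (eta t) (zeta t).
have mm : measurable_fun (`]a, b[%classic : set R) m by exact: remainder_measurable.
have mB t : `|m t| <= 3 * K.
  rewrite -[m t]subr0 -(M0 t); apply: (le_trans (MK _ _ _ _ _ _ _)) => //.
  by rewrite !subr0 mulrC ler_wpM2r//; exact: ler_sum3.
have m2 : measurable_fun (`]a, b[%classic : set R) (fun t => M t 0 (eta t) 0).
  by apply: Mmeas => t _; [exact: cvg_cst|exact: ceta|exact: cvg_cst].
have m2B t : `|M t 0 (eta t) 0| <= K.
  have := @MK t 0 (eta t) 0 0 0 0 n0 (eta1 t) n0 n0 n0 n0.
  rewrite M0 !subr0 normr0 add0r addr0 => hh; apply: (le_trans hh).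
  by rewrite -[leRHS]mulr1 ler_wpM2l.
have mP : measurable_fun (`]a, b[%classic : set R) P.
  by apply: pointwise_continuous_measurable => s; rewrite in_itv/=; exact: cP.
have IPg (g : R -> R) (B : R) : measurable_fun (`]a, b[%classic : set R) g ->
    (forall t, `|g t| <= B) -> integrableR (cut a b (fun t => P t * g t)).
  move=> mg gB; have [IB _] := RintegralZ B (integrable_norm IP).
  apply: le_integrableR IB.
    by apply: measurable_cut; exact: measurable_funM.
  move=> s /=; rewrite /cut; case: ifP => _; last by rewrite !normr0 mulr0.
  by rewrite normrM mulrC ler_wpM2r.
have cP_at (c : R -> R) s : continuous c -> a < s < b -> {for s, continuous (fun s => c s * P s)}.
  by move=> cc sab; apply: cvgM; [exact: cc|exact: cP].
have IcP (c : R -> R) : continuous c -> (forall t, `|c t| <= K) -> integrableR (cut a b (fun s => c s * P s)).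
  move=> cc cK; rewrite (_ : (fun s => _) = (fun s => P s * c s)); last by apply/funext => s; rewrite mulrC.
  by apply: (@IPg _ K) => //; apply: measurable_funTS; exact: continuous_measurable_fun.
have transp (c f : R -> R) B : continuous c -> (forall t, `|c t| <= K) -> 0 <= B ->
    measurable_fun (`]a, b[%classic : set R) f -> (forall t, `|f t| <= B) ->
    \int[lebesgue_measure]_t cut a b (fun s => P s * (c s * rl al (cut a b f) s)) t =
    \int[lebesgue_measure]_t cut a b (fun s => rrl al (cut a b (fun s => c s * P s)) s * f s) t.
  move=> cc cK B0 mf fB.
  have fB' s : `|cut a b f s| <= B by rewrite /cut; case: ifP => // _; rewrite normr0.
  have Ic := IcP c cc cK.
  have Ifk s : a < s < b -> integrableR (fun t => fk al (t - s) * cut a b (fun s => c s * P s) t).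
    move=> /andP[as_ _].
    by have [] := @cut_local_right _ al a b (fun s => c s * P s) s al0 al1 ab Ic (fun s sab => cP_at c s cc sab) as_.
  have H := @rl_transpose R al al0 al1 (cut a b f) (cut a b (fun s => c s * P s)) a b B B0
    (measurable_cut mf) Ic (cut_out f) fB' (cut_out _) Ifk.
  transitivity (\int[lebesgue_measure]_t (cut a b (fun s => c s * P s) t * rl al (cut a b f) t)).
    by apply: eq_Rintegral => t _; rewrite /cut; case: ifP => _; [ring|rewrite mul0r].
  rewrite H; apply: eq_Rintegral => t _.
  by rewrite {1 3}/cut; case: ifP => _; [ring|rewrite mul0r].
have Ic4 := IcP c4 cc4 c4K.
have Ic2 := IcP c2 cc2 c2K.
have mz : measurable_fun (`]a, b[%classic : set R) zeta by apply: measurable_funTS; exact: continuous_measurable_fun.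
have mh : measurable_fun (`]a, b[%classic : set R) h by apply: measurable_funTS; exact: continuous_measurable_fun.
have me : measurable_fun (`]a, b[%classic : set R) eta by apply: measurable_funTS; exact: continuous_measurable_fun.
have mc (c : R -> R) : continuous c -> measurable_fun (`]a, b[%classic : set R) c.
  by move=> cc; apply: measurable_funTS; exact: continuous_measurable_fun.
have IPm := @IPg m (3 * K) mm mB.
have IPM := @IPg _ K m2 m2B.
have cB (c f : R -> R) : (forall t, `|c t| <= K) -> (forall t, `|f t| <= 1) -> forall t, `|c t * f t| <= K.
  by move=> cK f1 t; rewrite normrM -[leRHS]mulr1 ler_pM.
have IPh := @IPg (fun t => c2 t * h t) K (measurable_funM (mc _ cc2) mh) (cB _ _ c2K h1).
have IPz := @IPg (fun t => c4 t * zeta t) K (measurable_funM (mc _ cc4) mz) (cB _ _ c4K z1).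
have mrem : measurable_fun (`]a, b[%classic : set R) rem.
  apply: measurable_funB; first exact: measurable_funB.
  by apply: measurable_funD; apply: measurable_funM => //; exact: mc.
have IPr : integrableR (cut a b (fun t => P t * rem t)).
  apply: (@IPg rem (3 * K + K + (K + K))) => // t.
  apply: (le_trans (ler_normB _ _)); apply: lerD.
    by apply: (le_trans (ler_normB _ _)); apply: lerD; [exact: mB|exact: m2B].
  by apply: (le_trans (ler_normD _ _)); apply: lerD; [exact: cB|exact: cB].
have B3 : 0 <= 3 * K by exact: mulr_ge0.
have T2 := transp c2 eta 1 cc2 c2K ler01 me eta1.
have T4 := transp c4 m (3 * K) cc4 c4K B3 mm mB.
have zE' : rl al (cut a b m) = zeta by apply/funext => t; rewrite [RHS]zE.
rewrite zE' in T4.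
have Iqe : integrableR (cut a b (fun s => costate s * eta s)).
  apply: le_integrableR (integrable_norm (integrable_rrl a b al0 al1 Ic2)).
    apply: measurable_cut; apply: measurable_funM => //.
    have mQ : measurable_fun [set: R] (cut a b costate).
      by have /measurable_int/measurable_EFinP := integrable_rrl a b al0 al1 Ic2.
    have := measurable_funTS (D := `]a, b[%classic) mQ.
    by apply: eq_measurable_fun => s; rewrite inE/= in_itv/= => sab; rewrite cutE.
  move=> s /=; rewrite /cut; case: ifP => _; last by rewrite normr0.
  by rewrite normrM -[leRHS]mulr1 ler_wpM2l.
have [Ih Eh] := integrable_cutD IPM Iqe.
split => //.
have [Ifm Efm] : integrableR (fun t => fk al (b - t) * cut a b m t) /\
    \int[lebesgue_measure]_t (fk al (b - t) * cut a b m t) = zeta b.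
  split; last by rewrite -zE'.
  apply: (proj1 (@rl_bounded R al al0 al1 (cut a b m) a b b (3 * K) B3 (measurable_cut mm) (cut_out m) _)).
  by move=> s sab _; rewrite cutE.
have E1 : \int[lebesgue_measure]_t cut a b (fun t => P t * m t) t =
    zeta b + \int[lebesgue_measure]_t cut a b (fun t => P t * (c4 t * zeta t)) t.
  rewrite T4 -Efm -[in LHS](subrK (\int[lebesgue_measure]_t (fk al (b - t) * cut a b m t)) (\int[lebesgue_measure]_t cut a b (fun t => P t * m t) t)).
  rewrite addrC; congr (_ + _); rewrite -RintegralB//.
  apply: eq_Rintegral => t _; have [tab|tab] := boolP (a < t < b).
    by rewrite !cutE// PE//; ring.
  by rewrite !(cut_out _ tab) mulr0 subr0.
have [Is1 Es1] := integrable_cutD IPM IPh.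
have [Is2 Es2] := integrable_cutD Is1 IPz.
have [Is3 Es3] := integrable_cutD Is2 IPr.
have : \int[lebesgue_measure]_t cut a b (fun t => P t * m t) t =
    \int[lebesgue_measure]_t cut a b (fun t => P t * M t 0 (eta t) 0 + P t * (c2 t * h t) + P t * (c4 t * zeta t) + P t * rem t) t.
  by apply: eq_Rintegral => t _; rewrite /cut; case: ifP => // _; rewrite /m /rem; ring.
rewrite Es3 Es2 Es1 T2 E1 Eh => Ez; apply: (addIr (\int[lebesgue_measure]_t cut a b (fun t => P t * (c4 t * zeta t)) t)).
by rewrite Ez; ring.
Qed.

End perturbation.

(** On the needle the displacements [h] and [zeta] are of order [d ^ al], hence the
remainder is [o(1)] on a set of length [2 d].  Off the needle it is at most
[eps * P * (|h| + |zeta|)]; the integral of [P * (|h| + |zeta|)] is of order [d], by transposition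
against a weight above [P].  The Hamiltonian part is at most [- c * d]. *)
Lemma needle_variation (t0 v r c : R) : 0 < r -> a < t0 - r -> t0 + r < b -> `|v| <= 1 -> 0 < c ->
  (forall t x, t0 - r < t < t0 + r -> 0 <= x <= 1 -> hamiltonian t (v * x) <= 0) ->
  (forall t x, t0 - r < t < t0 + r -> 1 / 2 <= x <= 1 -> hamiltonian t (v * x) <= - c) ->
  False.
Proof.
move=> r0 atr trb v1 c0 H0 Hc.
have e10 : 0 < (2 * (K + 1))^-1 by rewrite invr_gt0 mulr_gt0// ltr_wpDl.
(* [K * e1 <= 1 / 2] lets the weighted norm of [zeta] be absorbed *)
pose e1 := (2 * (K + 1))^-1; rewrite -/e1 in e10.
have Ke1 : K * e1 <= 1 / 2 by rewrite /e1 ler_pdivrMr ?mulr_gt0 ?ltr_wpDl//; lra.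
have e11 : e1 <= 1 by rewrite /e1 invf_le1 ?mulr_gt0 ?ltr_wpDl//; move: K0; lra.
have [W [Cw [[mW IW] W0 Wout Wk hW]]] := singular_weight_right al0 al1 ab e10.
have [Kg Kg0 gron] := gronwall_bounded al0 al1 ab K0.
pose k0 := kern al (b - (t0 + r)).
have k00 : 0 <= k0 := kern_ge0 _ _.
pose Rl := rlcst al (b - a).
have Rl0 : 0 <= Rl by exact: rlcst_ge0.
pose G := Kg * (K * (1 + Rl)).
have G0 : 0 <= G by rewrite /G !mulr_ge0// addr_ge0.
pose C1 := K * (1 + Rl + G * Rl).
have C10 : 0 <= C1 by rewrite /C1 mulr_ge0// !addr_ge0// mulr_ge0.
pose Wb := `|Cw| * k0.
have Wb0 : 0 <= Wb by rewrite mulr_ge0.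
(* [eps] and [smin] make each of the two parts of the remainder at most [c / 3 * d] *)
pose eps := c / (18 * (A * Wb + 1)).
have AW1 : 0 < A * Wb + 1 by rewrite ltr_wpDl// mulr_ge0.
have eps0 : 0 < eps by rewrite divr_gt0// mulr_gt0.
pose D := A * k0 * K * (1 + C1).
have D0 : 0 <= D by rewrite /D !mulr_ge0// addr_ge0.
have [rho rho0 hrho] := Mexp eps0.
pose smin := Num.min (Num.min 1 rho / (1 + C1)) (c / (12 * (D + 1))).
have smin0 : 0 < smin.
  rewrite lt_min; apply/andP; split; apply: divr_gt0 => //.
  - by rewrite lt_min ltr01.
  - by rewrite ltr_pwDl.
  - by rewrite mulr_gt0// ltr_wpDl.
have [d [d0 dr dS]] : exists d, [/\ 0 < d, d < r & rlcst al (2 * d) <= smin].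
  have /cvgrPdist_lt/(_ _ smin0)/(nbhs_ballP _ _).1[q /= q0 hq] := @rlcst_cvg0 R al al0.
  pose d := Num.min (r / 2) (q / 4).
  have d0 : 0 < d by rewrite lt_min !divr_gt0.
  have dr : d <= r / 2 by rewrite ge_min lexx.
  have dq : d <= q / 4 by rewrite ge_min lexx orbT.
  exists d; split => //; first by lra.
  have : ball (0 : R) q (2 * d) by rewrite /ball/= sub0r normrN gtr0_norm ?mulr_gt0//; lra.
  move=> /hq; rewrite /= sub0r normrN => hd; apply/ltW; apply: le_lt_trans hd; exact: ler_norm.
pose S := rlcst al (2 * d).
have S0 : 0 <= S by exact: rlcst_ge0.
have S1 : (1 + C1) * S <= Num.min 1 rho.
  rewrite mulrC -ler_pdivlMr ?ltr_wpDr//; apply: (le_trans dS).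
  by rewrite ge_min lexx.
have S2 : S <= c / (12 * (D + 1)) by apply: (le_trans dS); rewrite ge_min lexx orbT.
pose eta t := v * tent t0 d t.
have ceta : continuous eta by move=> t; apply: cvgM; [exact: cvg_cst|exact: tent_continuous].
have eta1 t : `|eta t| <= 1.
  rewrite normrM; have /andP[h1 h2] := tent_itv t0 t d0; rewrite (ger0_norm h1).
  by rewrite -[leRHS]mulr1 ler_pM.
have uv : t0 - d < t0 + d by rewrite ltrD2l gtrN.
have dd : t0 - d / 2 <= t0 + d / 2 by rewrite lerD2l ge0_cp ?divr_ge0// ltW.
have half t : t0 - d / 2 < t < t0 + d / 2 -> t0 - d < t < t0 + d.
  by apply: centered_itv_widen; rewrite ler_pdivrMr// ler_peMr ?ltW// ltr1n.
have near_r t : t0 - d < t < t0 + d -> t0 - r < t < t0 + r by exact/centered_itv_widen/ltW.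
have eta_out t : ~~ (t0 - d < t < t0 + d) -> eta t = 0 by move=> h; rewrite /eta tent_out// mulr0.
have nab t : t0 - d < t < t0 + d -> a < t < b by move=> /near_r/andP[t1 t2]; rewrite (lt_trans atr t1) (lt_trans t2 trb).
have cutE' : cut a b eta = eta.
  apply/funext => t; rewrite /cut; case: ifPn => // tab.
  by rewrite eta_out//; apply: contra tab; exact: nab.
have meta : measurable_fun [set: R] eta by exact: continuous_measurable_fun.
pose h := rl al (cut a b eta).
have hS t : integrableR (fun s => fk al (t - s) * eta s) /\ `|h t| <= S.
  have := rl_needle al0 al1 t uv ler01 meta eta_out eta1.
  by rewrite /h cutE' mul1r (_ : t0 + d - (t0 - d) = 2 * d)//; ring.
have hS1 : S <= (1 + C1) * S by rewrite ler_peMl// lerDl.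
have zS1 : C1 * S <= (1 + C1) * S by rewrite ler_wpM2r// lerDr.
have SS1 : (1 + C1) * S <= 1 by apply: (le_trans S1); rewrite ge_min lexx.
have SSr : (1 + C1) * S <= rho by apply: (le_trans S1); rewrite ge_min lexx orbT.
have h1 t : `|h t| <= 1 by have [_ h'] := hS t; apply: (le_trans h'); exact: le_trans hS1 SS1.
have [zeta [cz zE]] := perturbed_state ceta eta1 h1.
pose m s := M s (h s) (eta s) (pr (zeta s)).
have ch : continuous h.
  by apply: (bounded_rl_continuous ler01 (measurable_funTS meta)) => s _; exact: eta1.
have cpz : continuous (fun s => pr (zeta s)).
  move=> s; apply: (@continuous_comp _ _ _ zeta pr); first exact: cz.
  exact: clip_continuous.
have mm : measurable_fun (`]a, b[%classic : set R) m by exact: (remainder_measurable ceta eta1 cpz).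
have mK s : `|m s| <= K * (`|h s| + `|eta s| + `|zeta s|).
  have := @MK s (h s) (eta s) (pr (zeta s)) 0 0 0 (h1 s) (eta1 s) (pr1 _) n0 n0 n0.
  rewrite M0 !subr0 => hh; apply: (le_trans hh); rewrite ler_wpM2l// lerD2l; exact: prle.
have mB s : `|m s| <= 3 * K.
  have := @MK s (h s) (eta s) (pr (zeta s)) 0 0 0 (h1 s) (eta1 s) (pr1 _) n0 n0 n0.
  rewrite M0 !subr0 => hh; apply: (le_trans hh); rewrite mulrC ler_wpM2r//.
  exact: ler_sum3.
have K30 : 0 <= 3 * K by exact: mulr_ge0.
have mB' s : `|cut a b m s| <= 3 * K by rewrite /cut; case: ifP => // _; rewrite normr0.
have zB t : integrableR (fun s => fk al (t - s) * cut a b m s) /\ `|zeta t| <= 3 * K * Rl.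
  by rewrite zE; exact: (rl_needle al0 al1 t ab K30 (measurable_cut mm) (cut_out m) mB').
have mabs (f : R -> R) : continuous f -> measurable_fun [set: R] (fun s => `|f s|).
  by move=> cf; apply: measurableT_comp => //; exact: continuous_measurable_fun.
have rlabs (f : R -> R) (B t : R) : 0 <= B -> continuous f -> (forall s, a < s < b -> `|f s| <= B) ->
    integrableR (fun s => fk al (t - s) * cut a b (fun s => `|f s|) s) /\
    rl al (cut a b (fun s => `|f s|)) t <= B * Rl.
  move=> B0 cf fB; have fB' s : `|cut a b (fun s => `|f s|) s| <= B.
    by rewrite /cut; case: ifPn => [sab|_]; rewrite ?normr_id ?normr0//; exact: fB.
  have [I1 I2] := rl_needle al0 al1 t ab B0 (measurable_cut (measurable_funTS (mabs _ cf))) (cut_out _) fB'.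
  by split => //; apply: le_trans I2; exact: ler_norm.
have eta_abs t : integrableR (fun s => fk al (t - s) * `|eta s|) /\ rl al (fun s => `|eta s|) t <= S.
  have eo s : ~~ (t0 - d < s < t0 + d) -> `|eta s| = 0 by move=> so; rewrite eta_out// normr0.
  have e1' s : `| `|eta s| | <= 1 by rewrite normr_id.
  have [I1 I2] := rl_needle al0 al1 t uv ler01 (mabs _ ceta) eo e1'.
  split => //; apply: le_trans (ler_norm _) (le_trans I2 _).
  by rewrite mul1r (_ : t0 + d - (t0 - d) = 2 * d)//; ring.
pose u s := cut a b (fun s => `|h s|) s + `|eta s| + cut a b (fun s => `|zeta s|) s.
have cab0 (f : R -> R) s : 0 <= cut a b (fun s => `|f s|) s by rewrite /cut; case: ifP.
have hSb s : a < s < b -> `|h s| <= S by move=> _; have [] := hS s.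
have zBb s : a < s < b -> `|zeta s| <= 3 * K * Rl by move=> _; have [] := zB s.
have KRl0 : 0 <= 3 * K * Rl by exact: mulr_ge0.
have urlE t : integrableR (fun s => fk al (t - s) * u s) /\ rl al u t =
    rl al (cut a b (fun s => `|h s|)) t + rl al (fun s => `|eta s|) t + rl al (cut a b (fun s => `|zeta s|)) t.
  have [I1 _] := rlabs h S t S0 ch hSb.
  have [I2 _] := eta_abs t.
  have [I3 _] := rlabs zeta (3 * K * Rl) t KRl0 cz zBb.
  by have [J1 E1] := rlD I1 I2; have [J2 E2] := rlD J1 I3; rewrite E2 E1.
have zrl t : `|zeta t| <= K * rl al u t.
  have [Im _] := zB t; have [Iu _] := urlE t.
  rewrite zE; have [Ia ha] := ler_norm_rl al0 al1 Im; apply: (le_trans ha).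
  have [IKu <-] := rlZ K Iu; apply: rl_le => // s _; rewrite /u /cut.
  case: ifP => _; first exact: mK.
  by rewrite normr0 add0r addr0 mulr_ge0.
have zle t : `|zeta t| <= K * (1 + Rl) * S + K * rl al (cut a b (fun s => `|zeta s|)) t.
  apply: (le_trans (zrl t)); have [_ ->] := urlE t.
  rewrite mulrDr lerD2r -mulrA ler_wpM2l// mulrDl mul1r addrC lerD//.
    by have [] := eta_abs t.
  by rewrite mulrC; have [] := rlabs h S t S0 ch hSb.
have zG t : a < t < b -> `|zeta t| <= G * S.
  move=> tab; rewrite /G -mulrA.
  apply: (gron (fun s => `|zeta s|) (K * (1 + Rl) * S) (3 * K * Rl) _ _ _ _ _ t tab).
  - by rewrite mulr_ge0// mulr_ge0// addr_ge0.
  - exact: KRl0.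
  - by apply: measurable_funTS; exact: mabs.
  - by move=> s sab; rewrite normr_ge0 zBb.
  - by move=> s _; exact: zle.
have zS t : `|zeta t| <= C1 * S.
  apply: (le_trans (zle t)).
  have GS0 : 0 <= G * S by exact: mulr_ge0.
  have [_ hz] := rlabs zeta (G * S) t GS0 cz zG.
  rewrite (_ : C1 * S = K * (1 + Rl) * S + K * (G * S * Rl)); last by rewrite /C1; ring.
  by rewrite lerD2l ler_wpM2l.
have z1 t : `|zeta t| <= 1 by apply: (le_trans (zS t)); exact: le_trans zS1 SS1.
have zE' t : zeta t = rl al (cut a b (fun s => M s (h s) (eta s) (zeta s))) t.
  rewrite zE; congr (rl _ _ _); apply/funext => s; congr (cut _ _ _ _).
  by apply/funext => s'; rewrite prE.
have zb := optimal ceta cz eta1 h1 z1 zE'.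
have [Irem Iham zbE] := payoff_formula ceta eta1 h1 cz z1 zE'.
set rem := (fun t => P t * (M t (h t) (eta t) (zeta t) - _ - _)) in Irem zbE.
have kW t : a < t < t0 + r -> W t <= Wb.
  move=> /andP[at_ tr]; have tab : a < t < b by rewrite at_ (lt_trans tr).
  have /andP[_ h2] := Wk t tab; apply: (le_trans h2).
  have kt : kern al (b - t) <= k0.
    by apply: kern_anti => //; [rewrite subr_gt0|rewrite lerB// ltW].
  apply: (@le_trans _ _ (`|Cw| * kern al (b - t))); last by rewrite ler_wpM2l.
  by rewrite ler_wpM2r ?kern_ge0 ?ler_norm.
have IE : integrableR (fun t => W t * `|eta t|) /\ \int[lebesgue_measure]_t (W t * `|eta t|) <= 2 * d * Wb.
  have [I1 E1] := @integral_cut_cst R Wb (t0 - d) (t0 + d) (ltW uv).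
  have le1 t : W t * `|eta t| <= cut (t0 - d) (t0 + d) (cst Wb) t.
    have [tn|tn] := boolP (t0 - d < t < t0 + d); last by rewrite eta_out// normr0 mulr0 cut_out.
    rewrite cutE// -[leRHS]mulr1 ler_pM//; apply: kW.
    by have /andP[_ ->] := near_r t tn; have /andP[->] := nab t tn.
  have I2 : integrableR (fun t => W t * `|eta t|).
    apply: le_integrableR I1; first by apply: measurable_funM => //; exact: mabs.
    by move=> t; rewrite ger0_norm ?mulr_ge0.
  split => //; rewrite (_ : 2 * d * Wb = Wb * (t0 + d - (t0 - d))); last by ring.
  by rewrite -E1; apply: le_Rintegral.
have IH : integrableR (fun t => W t * `|cut a b h t|) /\ \int[lebesgue_measure]_t (W t * `|cut a b h t|) <= 2 * d * Wb.
  have eo s : ~~ (a < s < b) -> `|eta s| = 0.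
    by move=> so; rewrite eta_out ?normr0//; apply: contra so; exact: nab.
  have hh t : a < t < b -> integrableR (fun s => fk al (t - s) * `|eta s|) /\ `|h t| <= 1 * rl al (fun s => `|eta s|) t.
    move=> _; have [I1 _] := hS t; have [I2 I3] := ler_norm_rl al0 al1 I1.
    by rewrite mul1r /h cutE'.
  have [I1 I2] := weight_rl_le al0 al1 ler01 (ltW e10) mW W0 Wout (mabs _ ceta) (fun s => normr_ge0 _) eo IE.1 hW
    (measurable_funTS (continuous_measurable_fun ch)) hh.
  split; first by have := integrable_norm I1; apply: eq_integrable => // s _ /=; rewrite normrM (ger0_norm (W0 s)).
  apply: (le_trans I2); rewrite mul1r; have [_ I3] := IE; apply: le_trans I3.
  by rewrite ler_piMl//; apply: Rintegral_ge0 => s _; rewrite mulr_ge0.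
have IZ : integrableR (fun t => W t * `|cut a b zeta t|) /\ \int[lebesgue_measure]_t (W t * `|cut a b zeta t|) <= 4 * d * Wb.
  have u_out s : ~~ (a < s < b) -> u s = 0.
    move=> so; rewrite /u !(cut_out _ so) eta_out ?normr0 ?addr0//.
    by apply: contra so; exact: nab.
  have u0 s : 0 <= u s by rewrite !addr_ge0.
  have mu_ : measurable_fun [set: R] u.
    apply: measurable_funD; first apply: measurable_funD.
    - by apply: measurable_cut; apply: measurable_funTS; exact: mabs.
    - exact: mabs.
    - by apply: measurable_cut; apply: measurable_funTS; exact: mabs.
  have cabs (f : R -> R) s : cut a b (fun s => `|f s|) s = `|cut a b f s|.
    by rewrite /cut; case: ifP => //; rewrite normr0.
  have IWz : integrableR (fun t => W t * `|cut a b zeta t|).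
    have [I1 _] := RintegralZ (3 * K * Rl) IW; apply: le_integrableR I1.
      apply: measurable_funM => //; apply: measurableT_comp => //; apply: measurable_cut.
      by apply: measurable_funTS; exact: continuous_measurable_fun.
    move=> s /=; rewrite ger0_norm ?mulr_ge0// mulrC ler_wpM2r// -cabs /cut; case: ifP => // sab.
    exact: zBb.
  have WuE : (fun t => W t * u t) = (fun t => W t * `|cut a b h t| + W t * `|eta t| + W t * `|cut a b zeta t|).
    by apply/funext => t; rewrite /u !cabs !mulrDr.
  have IH2 := integrableD measurableT IH.1 IE.1.
  have IWu : integrableR (fun t => W t * u t).
    by rewrite WuE; exact: (integrableD measurableT IH2 IWz).
  have EWu : \int[lebesgue_measure]_t (W t * u t) = \int[lebesgue_measure]_t (W t * `|cut a b h t|) +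
     \int[lebesgue_measure]_t (W t * `|eta t|) + \int[lebesgue_measure]_t (W t * `|cut a b zeta t|).
    by rewrite WuE (RintegralD measurableT IH2 IWz) (RintegralD measurableT IH.1 IE.1).
  have hz t : a < t < b -> integrableR (fun s => fk al (t - s) * u s) /\ `|zeta t| <= K * rl al u t.
    by move=> _; split; [have [] := urlE t|exact: zrl].
  have [_ I2] := weight_rl_le al0 al1 K0 (ltW e10) mW W0 Wout mu_ u0 u_out IWu hW
    (measurable_funTS (continuous_measurable_fun cz)) hz.
  split => //; rewrite EWu mulrA in I2.
  have ge0 (f : R -> R) : 0 <= \int[lebesgue_measure]_t (W t * `|f t|).
    by apply: Rintegral_ge0 => s _; rewrite mulr_ge0.
  apply: le_trans (ler_half_sum (ge0 _) (addr_ge0 (addr_ge0 (ge0 _) (ge0 _)) (ge0 _)) Ke1 I2) _.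
  rewrite (_ : 4 * d * Wb = 2 * d * Wb + 2 * d * Wb); last by ring.
  by apply: lerD; [exact: IH.2|exact: IE.2].
have remle t : `|cut a b rem t| <= eps * A * (W t * `|cut a b h t| + W t * `|cut a b zeta t|) +
    cut (t0 - d) (t0 + d) (cst (2 * D * S)) t.
  have rhs0 : 0 <= eps * A * (W t * `|cut a b h t| + W t * `|cut a b zeta t|).
    by apply: mulr_ge0; [rewrite mulr_ge0// ltW|apply: addr_ge0; exact: mulr_ge0].
  have cut0 : 0 <= cut (t0 - d) (t0 + d) (cst (2 * D * S)) t.
    by rewrite /cut; case: ifP => // _ /=; rewrite mulr_ge0// mulr_ge0.
  have [tab|tab] := boolP (a < t < b); last by rewrite (cut_out _ tab) normr0 addr_ge0.
  have /andP[Pt0 PtA] := P0 tab.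
  have /andP[kW1 _] := Wk t tab.
  have PW : P t <= A * W t by apply: (le_trans PtA); rewrite ler_wpM2l.
  rewrite (cutE _ tab) /rem normrM (gtr0_norm Pt0).
  have [tn|tn] := boolP (t0 - d < t < t0 + d); last first.
    rewrite (cut_out _ tn) addr0 !(cutE _ tab) eta_out// M0 subr0.
    have hr1 : `|h t| <= rho by have [_ h'] := hS t; apply: (le_trans h'); exact: le_trans hS1 SSr.
    have zr1 : `|zeta t| <= rho by apply: (le_trans (zS t)); exact: le_trans zS1 SSr.
    apply: (@le_trans _ _ (A * W t * (eps * (`|h t| + `|zeta t|)))).
      by apply: ler_pM; rewrite ?(ltW Pt0)//; exact: hrho.
    by rewrite le_eqVlt; apply/orP; left; apply/eqP; ring.
  rewrite -[leLHS]add0r; apply: lerD => //; rewrite (cutE _ tn) /=.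
  have PA : P t <= A * k0.
    apply: (le_trans PtA); rewrite ler_wpM2l//; apply: kern_anti => //.
      by rewrite subr_gt0.
    by have /andP[_ tr] := near_r t tn; rewrite lerB// ltW.
  have r1 : `|M t (h t) (eta t) (zeta t) - M t 0 (eta t) 0| <= K * (`|h t| + `|zeta t|).
    have := @MK t (h t) (eta t) (zeta t) 0 (eta t) 0 (h1 t) (eta1 t) (z1 t) n0 (eta1 t) n0.
    by rewrite !subr0 subrr normr0 addr0.
  have r2 : `|c2 t * h t + c4 t * zeta t| <= K * (`|h t| + `|zeta t|).
    apply: (le_trans (ler_normD _ _)); rewrite !normrM mulrDr.
    by apply: lerD; apply: ler_wpM2r.
  have hz : `|h t| + `|zeta t| <= (1 + C1) * S.
    by rewrite mulrDl mul1r lerD//; have [] := hS t.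
  apply: (@le_trans _ _ (A * k0 * (2 * (K * ((1 + C1) * S))))).
    apply: ler_pM => //; first exact: ltW.
    apply: (le_trans (ler_normB _ _)); rewrite mulr2n mulrDl mul1r; apply: lerD.
      by apply: (le_trans r1); rewrite ler_wpM2l.
    by apply: (le_trans r2); rewrite ler_wpM2l.
  by rewrite le_eqVlt; apply/orP; left; apply/eqP; rewrite /D; ring.
have intrem : \int[lebesgue_measure]_t cut a b rem t <= eps * A * (6 * d * Wb) + 2 * D * S * (2 * d).
  have [I1 E1] := @integral_cut_cst R (2 * D * S) (t0 - d) (t0 + d) (ltW uv).
  have IW2 := integrableD measurableT IH.1 IZ.1.
  have [IW3 EW3] := RintegralZ (eps * A) IW2.
  have E2 : \int[lebesgue_measure]_t (W t * `|cut a b h t| + W t * `|cut a b zeta t|) <= 6 * d * Wb.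
    rewrite RintegralD//; [|exact: IH.1|exact: IZ.1].
    rewrite (_ : 6 * d * Wb = 2 * d * Wb + 4 * d * Wb); last by ring.
    by apply: lerD; [exact: IH.2|exact: IZ.2].
  apply: (@le_trans _ _ (\int[lebesgue_measure]_t (eps * A * (W t * `|cut a b h t| + W t * `|cut a b zeta t|) +
    cut (t0 - d) (t0 + d) (cst (2 * D * S)) t))).
    apply: le_Rintegral => //; first exact: (integrableD measurableT IW3 I1).
    by move=> t _; apply: le_trans (ler_norm _) (remle t).
  rewrite (RintegralD measurableT IW3 I1).
  rewrite E1 EW3; apply: lerD.
    by apply: ler_wpM2l => //; rewrite mulr_ge0// ltW.
  by rewrite le_eqVlt; apply/orP; left; apply/eqP; ring.
have intham : \int[lebesgue_measure]_t cut a b (fun t => hamiltonian t (eta t)) t <= - c * d.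
  have [I1 E1] := @integral_cut_cst R (- c) (t0 - d / 2) (t0 + d / 2) dd.
  rewrite (_ : - c * d = - c * (t0 + d / 2 - (t0 - d / 2))); last by field.
  rewrite -E1; apply: le_Rintegral => // t _.
  have [tab|tab] := boolP (a < t < b); last first.
    by rewrite cut_out// cut_out//; apply: contra tab => /half/nab.
  rewrite (cutE _ tab).
  have [tn|tn] := boolP (t0 - d < t < t0 + d); last first.
    rewrite eta_out// /hamiltonian M0 !mulr0 addr0 cut_out//.
    by apply: contra tn => /half.
  have tr := near_r t tn.
  have /andP[tt0 tt1] := tent_itv t0 t d0.
  rewrite /cut; case: ifPn => [th|_]; last by apply: H0 => //; rewrite tt0.
  by apply: Hc => //; rewrite tt1 andbT; exact: tent_half.
have e1' : eps * A * (6 * d * Wb) <= c / 3 * d.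
  have := @ler_quotient_succ R c (A * Wb) 18 (ltW c0) (mulr_ge0 A0 Wb0) ltac:(by rewrite ltr0n).
  move=> q1; apply: (@le_trans _ _ (6 * d * (c / 18))); last by rewrite le_eqVlt; apply/orP; left; apply/eqP; field.
  rewrite (_ : eps * A * (6 * d * Wb) = 6 * d * (c / (18 * (A * Wb + 1)) * (A * Wb))); last by rewrite /eps; ring.
  by rewrite ler_wpM2l// mulr_ge0// ltW.
have e2' : 2 * D * S * (2 * d) <= c / 3 * d.
  have := @ler_quotient_succ R c D 12 (ltW c0) D0 ltac:(by rewrite ltr0n).
  move=> q1; apply: (@le_trans _ _ (4 * d * (c / 12))); last by rewrite le_eqVlt; apply/orP; left; apply/eqP; field.
  rewrite (_ : 2 * D * S * (2 * d) = 4 * d * (S * D)); last by ring.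
  rewrite ler_wpM2l//; first by rewrite mulr_ge0// ltW.
  by apply: le_trans q1; rewrite ler_wpM2r.
have cd0 : 0 < c * d by exact: mulr_gt0.
exact: (needle_balance zb zbE intham intrem e1' e2' cd0).
Qed.

End needle.

(** * The Lagrangian along the extremal *)

Section mean_value.
Context {R : realType}.

Lemma mvt_between (f df : R -> R) (u v : R) : (forall x : R, is_derive x (1 : R) f (df x)) ->
  exists2 x, Num.min u v <= x <= Num.max u v & f u - f v = df x * (u - v).
Proof.
move=> fd; have cf : forall A : set R, {within A, continuous f}.
  move=> B; apply: continuous_subspaceT => x; apply: differentiable_continuous.
  by apply/derivable1_diffP; have [] := fd x.
have [uv|vu] := leP u v.
  have [c ci E] := MVT_segment uv (fun x _ => fd x) (cf _).
  by exists c; [move: ci; rewrite in_itv/=|rewrite -opprB E; ring].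
have [c ci E] := MVT_segment (ltW vu) (fun x _ => fd x) (cf _).
by exists c; [move: ci; rewrite in_itv/=|].
Qed.

Lemma mvt_norm (f df : R -> R) (u v N : R) : (forall x : R, is_derive x (1 : R) f (df x)) ->
  `|u| <= N -> `|v| <= N -> exists2 x, `|x| <= N & f u - f v = df x * (u - v).
Proof.
move=> fd uN vN; have [x /andP[x1 x2] E] := mvt_between u v fd; exists x => //.
move: uN vN x1 x2; rewrite !ler_norml => /andP[u1 u2] /andP[v1 v2].
by rewrite ge_min le_max => /orP[h1|h1] /orP[h2|h2]; apply/andP; split; lra.
Qed.

Lemma continuous_pair (T U V : topologicalType) (f : T -> U) (g : T -> V) (x : T) :
  {for x, continuous f} -> {for x, continuous g} -> {for x, continuous (fun y => (f y, g y))}.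
Proof. by move=> cf cg; exact: (cvg_pair cf cg). Qed.

(** A compact set of values of the second variable makes the continuity in the first
one uniform. *)
Lemma tube_continuous (D : R -> R -> R) (t0 N e : R) : 0 < e ->
  (forall x, {for (t0, x), continuous (fun p : R * R => D p.1 p.2)}) ->
  \forall t \near t0, forall x, `|x| <= N -> `|D t x - D t0 x| < e.
Proof.
move=> e0 cD; have e2 : 0 < e / 2 by rewrite divr_gt0.
have loc (x : R) : \forall x' \near x & t \near nbhs t0, `|D t x' - D t0 x'| < e.
  have /cvgrPdist_lt/(_ _ e2) := cD x.
  case=> -[A B] /= [At Bx] AB; exists (B, A) => //= -[x' t] /= [Bx' At'].
  have k1 := AB (t, x') (conj At' Bx').
  have k2 := AB (t0, x') (conj (nbhs_singleton At) Bx').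
  rewrite /= in k1 k2; move: k1 k2; rewrite !ltr_norml => /andP[? ?] /andP[? ?].
  by apply/andP; split; lra.
have H := (compact_near_coveringP (`[- N, N]%classic : set R)).1 (@segment_compact R _ _)
  R (nbhs t0) (fun t x => `|D t x - D t0 x| < e) (nbhs_filter t0) (fun x _ => loc x).
apply: filterS H => t h x xN; apply: h.
by rewrite /= in_itv/= -ler_norml.
Qed.

(** By the mean value theorem, applied to the difference of [phi t] and [phi t0], whose
slope is small when [t] is near [t0]. *)
Lemma increment_continuous (phi D : R -> R -> R) (v : R -> R) (t0 : R) :
  (forall t x : R, is_derive (x : R) (1 : R) (phi t) (D t x)) ->
  (forall x, {for (t0, x), continuous (fun p : R * R => D p.1 p.2)}) ->
  {for t0, continuous v} ->
  {for t0, continuous (fun t => phi t (v t) - phi t 0)}.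
Proof.
move=> dphi cD cv; apply/cvgrPdist_lt => e e0.
pose N := `|v t0| + 1; have N0 : 0 < N by rewrite ltr_wpDl.
have e2 : 0 < e / 2 by rewrite divr_gt0.
have eN : 0 < e / 2 / N by rewrite divr_gt0.
have tube := tube_continuous N eN cD.
have cphi : {for v t0, continuous (phi t0)}.
  by apply: differentiable_continuous; apply/derivable1_diffP; have [] := dphi t0 (v t0).
have /cvgrPdist_lt/(_ _ e2) close := @continuous_comp _ _ _ v (phi t0) t0 cv cphi.
have /cvgrPdist_lt/(_ _ ltr01) near1 := cv.
near=> t.
have vN : `|v t| <= N.
  have h : `|v t0 - v t| < 1 by near: t.
  have := lerB_dist (v t) (v t0); rewrite distrC /N; lra.
have h1 : `|phi t0 (v t0) - phi t0 (v t)| < e / 2 by near: t.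
have h2 : forall x, `|x| <= N -> `|D t x - D t0 x| < e / 2 / N by near: t.
have dpsi x : is_derive (x : R) (1 : R) (phi t - phi t0) (D t x - D t0 x).
  exact: is_deriveB.
have n0 : `|0 : R| <= N by rewrite normr0 ltW.
have [x xN] := mvt_norm dpsi vN n0; rewrite subr0 => E.
have E' : (phi t (v t) - phi t 0) - (phi t0 (v t) - phi t0 0) = (D t x - D t0 x) * v t.
  by rewrite -E !fctE; ring.
have h3 : `|(phi t (v t) - phi t 0) - (phi t0 (v t) - phi t0 0)| <= e / 2.
  rewrite E' normrM; apply: (@le_trans _ _ (e / 2 / N * N)); last by rewrite divfK// gt_eqF.
  by apply: ler_pM => //; apply/ltW/h2.
have -> : phi t0 (v t0) - phi t0 0 - (phi t (v t) - phi t 0) =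
  (phi t0 (v t0) - phi t0 (v t)) - ((phi t (v t) - phi t 0) - (phi t0 (v t) - phi t0 0)) by ring.
apply: le_lt_trans (ler_normB _ _) _; lra.
Unshelve. all: by end_near. Qed.

Lemma is_derive_shift (f : R -> R) (x0 h : R) : derivable f (x0 + h) 1 ->
  is_derive (h : R) (1 : R) (fun h => f (x0 + h)) (derive1 f (x0 + h)).
Proof.
move=> df; have i1 : is_derive (x0 + h) (1 : R) f (derive1 f (x0 + h)).
  by have := DeriveDef df erefl; rewrite -derive1E.
have i2 : is_derive (h : R) (1 : R) (fun h => x0 + h) (0 + 1) by exact: is_deriveD.
have := @is_derive1_comp R f (fun h => x0 + h) h _ _ i1 i2.
by rewrite add0r mulr1.
Qed.

End mean_value.

Section lagrangian.
Context {R : realType} (a b : R).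
Hypothesis ab : a < b.
Variables (L : R -> R -> R -> R -> R) (X U Z : R -> R).
Hypotheses (cX : {within `[a, b], continuous X}) (cU : {within `[a, b], continuous U})
  (cZ : {within `[a, b], continuous Z}).
Local Notation c := (clip a b).

(** [g] along the extremal, displaced by increments of its last three arguments;
    clipping the time makes it a function on the whole of [R ^ 4]. *)
Definition shifted (g : R -> R -> R -> R -> R) (t h e y : R) : R :=
  g (c t) (X (c t) + h) (U (c t) + e) (Z (c t) + y).

Definition shifted4 g (q : R * R * R * R) := shifted g q.1.1.1 q.1.1.2 q.1.2 q.2.

Lemma shifted_continuous g : continuous_on_strip a b g -> continuous (shifted4 g).
Proof.
move=> cg q.
pose Phi (q : R * R * R * R) : R * R * R * R :=
  (c q.1.1.1, X (c q.1.1.1) + q.1.1.2, U (c q.1.1.1) + q.1.2, Z (c q.1.1.1) + q.2).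
have p1 : {for q, continuous (fun q : R * R * R * R => q.1.1.1)}.
  apply: (@continuous_comp _ _ _ fst (fun p : R * R * R => p.1.1)); first exact: cvg_fst.
  apply: (@continuous_comp _ _ _ fst (fun p : R * R => p.1)); first exact: cvg_fst.
  exact: cvg_fst.
have p2 : {for q, continuous (fun q : R * R * R * R => q.1.1.2)}.
  apply: (@continuous_comp _ _ _ fst (fun p : R * R * R => p.1.2)); first exact: cvg_fst.
  apply: (@continuous_comp _ _ _ fst (fun p : R * R => p.2)); first exact: cvg_fst.
  exact: cvg_snd.
have p3 : {for q, continuous (fun q : R * R * R * R => q.1.2)}.
  apply: (@continuous_comp _ _ _ fst (fun p : R * R * R => p.2)); first exact: cvg_fst.
  exact: cvg_snd.
have p4 : {for q, continuous (fun q : R * R * R * R => q.2)} by exact: cvg_snd.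
have cc (f : R -> R) : {within `[a, b], continuous f} -> {for q, continuous (fun q : R * R * R * R => f (c q.1.1.1))}.
  move=> cf; apply: (@continuous_comp _ _ _ (fun q : R * R * R * R => q.1.1.1) (fun t => f (c t))) => //.
  exact: clip_comp_continuous.
have cPhi : {for q, continuous Phi}.
  apply: continuous_pair; last by apply: cvgD; [exact: cc|exact: p4].
  apply: continuous_pair; last by apply: cvgD; [exact: cc|exact: p3].
  apply: continuous_pair; last by apply: cvgD; [exact: cc|exact: p2].
  apply: (@continuous_comp _ _ _ (fun q : R * R * R * R => q.1.1.1) c) => //.
  exact: clip_continuous.
have sP q' : [set q : R * R * R * R | q.1.1.1 \in `[a, b]] (Phi q').
  by rewrite /= in_itv/=; exact: clip_itv.
apply/cvgrPdist_lt => e e0.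
have [r r0 hr] := (within_continuousP _ _).1 cg _ (sP q) e e0.
have H : \forall q' \near q, ball (Phi q) r (Phi q') := cPhi _ (nbhsx_ballx (Phi q) r r0).
by apply: filterS H => q' hq'; exact: (hr _ (sP q') hq').
Qed.

Lemma shifted_bounded g : continuous_on_strip a b g -> exists2 K, 0 <= K &
  forall t h e y, `|h| <= 1 -> `|e| <= 1 -> `|y| <= 1 -> `|shifted g t h e y| <= K.
Proof.
move=> cg; pose I1 := `[-1, 1]%classic : set R.
pose B := (((`[a, b]%classic : set R) `*` I1) `*` I1) `*` I1 : set (R * R * R * R).
have cB : compact B.
  by do 3 (apply: compact_setX; last exact: segment_compact); exact: segment_compact.
have cI : compact (shifted4 g @` B).
  apply: continuous_compact => //.
  by apply: continuous_subspaceT; exact: shifted_continuous.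
have [K [_ hK]] := compact_bounded cI.
have K1 : K < `|K| + 1 by have := ler_norm K; lra.
exists (`|K| + 1) => [|t h e y h1 e1 y1]; first by rewrite addr_ge0.
have -> : shifted g t h e y = shifted g (c t) h e y.
  by rewrite /shifted (clip_id (t := c t))//; exact: clip_itv.
apply: (hK _ K1); exists (c t, h, e, y) => //.
by rewrite /B/I1/= !in_itv/= -!ler_norml h1 e1 y1 clip_itv.
Qed.

Lemma shifted_uniform g (eps : R) : continuous_on_strip a b g -> 0 < eps -> exists2 rho, 0 < rho &
  forall t h y, `|h| <= rho -> `|y| <= rho -> `|shifted g t h 0 y - shifted g t 0 0 0| <= eps.
Proof.
move=> cg eps0; have cS := shifted_continuous cg.
have loc (t : R) : \forall t' \near t & i \near nbhs ((0, 0) : R * R), `|shifted g t' i.1 0 i.2 - shifted g t' 0 0 0| < eps.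
  have e2 : 0 < eps / 2 by rewrite divr_gt0.
  have H : \forall q \near ((t, 0, 0, 0) : R * R * R * R), `|shifted4 g (t, 0, 0, 0) - shifted4 g q| < eps / 2.
    by have /cvgrPdist_lt/(_ _ e2) := cS (t, 0, 0, 0).
  have [r /= r0 hr] := (nbhs_ballP _ _).1 H.
  have n0 : ball (0 : R) r 0 by exact: ballxx.
  exists (ball t r, ball ((0, 0) : R * R) r) => /=.
    by split; exact: nbhsx_ballx.
  move=> [t' [h y]] /= [tt [hh yy]]; rewrite /= in hh yy.
  have k1 := hr (t', h, 0, y) (conj (conj (conj tt hh) n0) yy).
  have k2 := hr (t', 0, 0, 0) (conj (conj (conj tt n0) n0) n0).
  rewrite /shifted4/= in k1 k2; move: k1 k2; rewrite !ltr_norml => /andP[? ?] /andP[? ?].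
  by apply/andP; split; lra.
have H := (compact_near_coveringP (`[a, b]%classic : set R)).1 (@segment_compact R _ _)
  (R * R)%type (nbhs ((0, 0) : R * R)) (fun i t => `|shifted g t i.1 0 i.2 - shifted g t 0 0 0| < eps) (nbhs_filter ((0, 0) : R * R)) (fun t _ => loc t).
have [r /= r0 hr] := (nbhs_ballP _ _).1 H.
exists (r / 2); first by rewrite divr_gt0.
move=> t h y hh yy.
have cE h' y' : shifted g t h' 0 y' = shifted g (c t) h' 0 y'.
  by rewrite /shifted (clip_id (t := c t))//; exact: clip_itv.
rewrite !cE; apply/ltW; apply: (hr (h, y)).
  by split; rewrite /ball/= sub0r normrN; lra.
by rewrite /= in_itv/= clip_itv.
Qed.

Hypothesis hL : C1_xuz a b L.

Let cI t : c t \in `[a, b]. Proof. by rewrite in_itv/= clip_itv. Qed.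

Lemma shifted_derive_x t h e y :
  is_derive (h : R) (1 : R) (fun h => shifted L t h e y) (shifted (d2 L) t h e y).
Proof.
have [dL _ _ _] := hL; have [d _ _] := dL (c t) (X (c t) + h) (U (c t) + e) (Z (c t) + y) (cI t).
exact: (@is_derive_shift _ (fun x => L (c t) x (U (c t) + e) (Z (c t) + y)) (X (c t)) h d).
Qed.

Lemma shifted_derive_u t h e y :
  is_derive (e : R) (1 : R) (fun e => shifted L t h e y) (shifted (d3 L) t h e y).
Proof.
have [dL _ _ _] := hL; have [_ d _] := dL (c t) (X (c t) + h) (U (c t) + e) (Z (c t) + y) (cI t).
exact: (@is_derive_shift _ (fun u => L (c t) (X (c t) + h) u (Z (c t) + y)) (U (c t)) e d).
Qed.

Lemma shifted_derive_z t h e y :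
  is_derive (y : R) (1 : R) (fun y => shifted L t h e y) (shifted (d4 L) t h e y).
Proof.
have [dL _ _ _] := hL; have [_ _ d] := dL (c t) (X (c t) + h) (U (c t) + e) (Z (c t) + y) (cI t).
exact: (@is_derive_shift _ (fun z => L (c t) (X (c t) + h) (U (c t) + e) z) (Z (c t)) y d).
Qed.

Definition increment (t h e y : R) : R := shifted L t h e y - shifted L t 0 0 0.

Lemma increment0 t : increment t 0 0 0 = 0. Proof. exact: subrr. Qed.

(** Mean value theorem, one argument at a time, and compactness of the box. *)
Lemma increment_lipschitz : exists K, [/\ 0 <= K,
  (forall t h e y h' e' y', `|h| <= 1 -> `|e| <= 1 -> `|y| <= 1 ->
    `|h'| <= 1 -> `|e'| <= 1 -> `|y'| <= 1 ->
    `|increment t h e y - increment t h' e' y'| <= K * (`|h - h'| + `|e - e'| + `|y - y'|)),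
  (forall t, `|shifted (d2 L) t 0 0 0| <= K) & (forall t, `|shifted (d4 L) t 0 0 0| <= K)].
Proof.
have [_ s2 s3 s4] := hL.
have [K2 K20 b2] := shifted_bounded s2.
have [K3 K30 b3] := shifted_bounded s3.
have [K4 K40 b4] := shifted_bounded s4.
pose K := K2 + K3 + K4.
have n0 : `|0 : R| <= 1 by rewrite normr0.
exists K; split.
- by rewrite !addr_ge0.
- move=> t h e y h' e' y' h1 e1 y1 h1' e1' y1'.
  have [x x1 Ex] := mvt_norm (shifted_derive_x t ^~ e ^~ y) h1 h1'.
  have [v v1 Ev] := mvt_norm (shifted_derive_u t h' ^~ y) e1 e1'.
  have [z z1 Ez] := mvt_norm (shifted_derive_z t h' e') y1 y1'.
  have -> : increment t h e y - increment t h' e' y' =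
    (shifted L t h e y - shifted L t h' e y) + (shifted L t h' e y - shifted L t h' e' y) +
    (shifted L t h' e' y - shifted L t h' e' y') by rewrite /increment; ring.
  rewrite Ex Ev Ez [leRHS]mulrDr [X in _ <= X + _]mulrDr.
  apply: (le_trans (ler_normD _ _)); apply: lerD; first (apply: (le_trans (ler_normD _ _)); apply: lerD).
  + rewrite normrM ler_wpM2r//; apply: (le_trans (b2 t x e y x1 e1 y1)); rewrite /K; lra.
  + rewrite normrM ler_wpM2r//; apply: (le_trans (b3 t h' v y h1' v1 y1)); rewrite /K; lra.
  + rewrite normrM ler_wpM2r//; apply: (le_trans (b4 t h' e' z h1' e1' z1)); rewrite /K; lra.
- by move=> t; apply: (le_trans (b2 t 0 0 0 n0 n0 n0)); rewrite /K; lra.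
- by move=> t; apply: (le_trans (b4 t 0 0 0 n0 n0 n0)); rewrite /K; lra.
Qed.

(** The expansion is uniform in time because the partial derivatives are uniformly
continuous near the compact extremal. *)
Lemma increment_expansion (eps : R) : 0 < eps -> exists2 rho, 0 < rho &
  forall t h y, `|h| <= rho -> `|y| <= rho ->
    `|increment t h 0 y - (shifted (d2 L) t 0 0 0 * h + shifted (d4 L) t 0 0 0 * y)| <= eps * (`|h| + `|y|).
Proof.
move=> eps0; have [_ s2 _ s4] := hL.
have [r2 r20 h2] := shifted_uniform s2 eps0.
have [r4 r40 h4] := shifted_uniform s4 eps0.
exists (Num.min r2 r4); first by rewrite lt_min r20.
move=> t h y; rewrite !le_min => /andP[hr2 hr4] /andP[yr2 yr4].
have n2 : `|0 : R| <= r2 by rewrite normr0 ltW.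
have n4 : `|0 : R| <= r4 by rewrite normr0 ltW.
have [x x1 Ex] := mvt_norm (shifted_derive_x t ^~ 0 ^~ y) hr2 n2.
have [z z1 Ez] := mvt_norm (shifted_derive_z t 0 0) yr4 n4.
have -> : increment t h 0 y - (shifted (d2 L) t 0 0 0 * h + shifted (d4 L) t 0 0 0 * y) =
  ((shifted L t h 0 y - shifted L t 0 0 y) - shifted (d2 L) t 0 0 0 * h) +
  ((shifted L t 0 0 y - shifted L t 0 0 0) - shifted (d4 L) t 0 0 0 * y) by rewrite /increment; ring.
rewrite Ex Ez !subr0 -!mulrBl mulrDr.
apply: (le_trans (ler_normD _ _)); rewrite !normrM; apply: lerD; apply: ler_wpM2r => //.
  exact: h2.
exact: h4.
Qed.

(** The increments of [L] inherit continuity along continuous arguments from its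
partial derivatives; move one argument at a time. *)
Lemma increment_measurable h e y : (forall t, a < t < b -> {for t, continuous h}) ->
  (forall t, a < t < b -> {for t, continuous e}) ->
  (forall t, a < t < b -> {for t, continuous y}) ->
  measurable_fun (`]a, b[%classic : set R) (fun t => increment t (h t) (e t) (y t)).
Proof.
move=> ch ce cy; apply: pointwise_continuous_measurable => t; rewrite in_itv/= => tab.
have [_ s2 s3 s4] := hL.
have comp g (f1 f2 f3 : R -> R -> R) x : continuous_on_strip a b g ->
    {for (t, x), continuous (fun p : R * R => f1 p.1 p.2)} ->
    {for (t, x), continuous (fun p : R * R => f2 p.1 p.2)} ->
    {for (t, x), continuous (fun p : R * R => f3 p.1 p.2)} ->
    {for (t, x), continuous (fun p : R * R => shifted g p.1 (f1 p.1 p.2) (f2 p.1 p.2) (f3 p.1 p.2))}.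
  move=> sg c1 c2 c3.
  apply: (@continuous_comp _ _ _ (fun p : R * R => (p.1, f1 p.1 p.2, f2 p.1 p.2, f3 p.1 p.2)) (shifted4 g)); last exact: shifted_continuous.
  have c0 : {for (t, x), continuous (fun p : R * R => p.1)} by exact: cvg_fst.
  exact: (continuous_pair (continuous_pair (continuous_pair c0 c1) c2) c3).
have fst_c (f : R -> R) x : {for t, continuous f} -> {for (t, x), continuous (fun p : R * R => f p.1)}.
  by move=> cf; apply: (@continuous_comp _ _ _ fst f); [exact: cvg_fst|exact: cf].
have snd_c x : {for (t, x), continuous (fun p : R * R => p.2)} by exact: cvg_snd.
have cst_c x (k : R) : {for (t, x), continuous (fun p : R * R => k)} by exact: cvg_cst.
have -> : (fun t => increment t (h t) (e t) (y t)) = (fun t =>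
   (shifted L t (h t) (e t) (y t) - shifted L t 0 (e t) (y t)) +
   (shifted L t 0 (e t) (y t) - shifted L t 0 0 (y t)) +
   (shifted L t 0 0 (y t) - shifted L t 0 0 0)).
  by apply/funext => s; rewrite /increment; ring.
apply: cvgD; first apply: cvgD.
- apply: (@increment_continuous R (fun t x => shifted L t x (e t) (y t)) (fun t x => shifted (d2 L) t x (e t) (y t))).
  + by move=> s x; exact: shifted_derive_x.
  + move=> x; apply: (comp (d2 L) (fun t x => x) (fun t x => e t) (fun t x => y t)) => //.
      exact/fst_c/ce.
    exact/fst_c/cy.
  + exact: ch.
- apply: (@increment_continuous R (fun t x => shifted L t 0 x (y t)) (fun t x => shifted (d3 L) t 0 x (y t))).
  + by move=> s x; exact: shifted_derive_u.
  + move=> x; apply: (comp (d3 L) (fun t x => 0) (fun t x => x) (fun t x => y t)) => //.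
    exact/fst_c/cy.
  + exact: ce.
- apply: (@increment_continuous R (fun t x => shifted L t 0 0 x) (fun t x => shifted (d4 L) t 0 0 x)).
  + by move=> s x; exact: shifted_derive_z.
  + by move=> x; apply: (comp (d4 L) (fun t x => 0) (fun t x => 0) (fun t x => x)).
  + exact: cy.
Qed.

End lagrangian.

(** * Necessary conditions *)

Section caputo_perturbation.
Context {R : realType} (al a b : R).
Hypotheses (al0 : 0 < al) (al1 : al <= 1) (ab : a < b).

Lemma measurable_within_continuous (f : R -> R) : {within `[a, b], continuous f} ->
  measurable_fun (`]a, b[%classic : set R) f.
Proof.
move=> cf; apply: pointwise_continuous_measurable => t; rewrite in_itv/= => tab.
apply: (@within_itvco_continuous _ a b f t _ tab).
by apply: continuous_subspaceW cf => s; rewrite /= !in_itv/= => /andP[-> /ltW ->].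
Qed.

Lemma frac_int_leftD (f g : R -> R) (B : R) t : a <= t <= b -> 0 <= B ->
  measurable_fun (`]a, b[%classic : set R) f -> measurable_fun (`]a, b[%classic : set R) g ->
  (forall s, a < s < b -> `|f s| <= B) -> (forall s, a < s < b -> `|g s| <= B) ->
  frac_int_left a (1 - al) (fun s => f s + g s) t =
  frac_int_left a (1 - al) f t + frac_int_left a (1 - al) g t.
Proof.
move=> /andP[at_ tb] B0 mf mg fB gB.
move: al1; rewrite le_eqVlt => /predU1P[->|al1'].
  by rewrite subrr /frac_int_left eqxx.
have be0 : 0 < 1 - al by rewrite subr_gt0.
have be1 : 1 - al <= 1 by rewrite gerBl ltW.
have I (h : R -> R) : measurable_fun (`]a, b[%classic : set R) h -> (forall s, a < s < b -> `|h s| <= B) ->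
    integrableR (fun s => fk (1 - al) (t - s) * cut a b h s).
  move=> mh hB; apply: (proj1 (@rl_bounded R _ be0 be1 (cut a b h) a b t B B0 (measurable_cut mh) (cut_out h) _)).
  by move=> s sab _; rewrite cutE// hB.
have [I1 E1] := rlD (I f mf fB) (I g mg gB).
have cE : cut a b (fun s => f s + g s) = (fun s => cut a b f s + cut a b g s).
  by apply/funext => s; rewrite /cut; case: ifP => //; rewrite addr0.
rewrite (@frac_left_rl _ a b _ _ t be0 be1 tb); last by rewrite cE.
rewrite (@frac_left_rl _ a b _ f t be0 be1 tb); last exact: I.
rewrite (@frac_left_rl _ a b _ g t be0 be1 tb); last exact: I.
by rewrite cE.
Qed.

(** The fractional integral of order [1 - al] of the displacement is the primitive of
[m], so the representative gains an absolutely continuous term with density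
[m]. *)
Lemma caputo_perturb (f m : R -> R) (B : R) : caputo_AC_left a b al f -> 0 <= B ->
  measurable_fun (`]a, b[%classic : set R) m -> (forall s, a < s < b -> `|m s| <= B) ->
  let g t := f t + rl al (cut a b m) t in
  [/\ caputo_AC_left a b al g, g a = f a &
    {ae @lebesgue_measure R, forall t, t \in `[a, b] ->
       caputo_left a b al g t = caputo_left a b al f t + m t}].
Proof.
move=> [cf [L1f [F0 F0r]]] B0 mm mB g.
have ch := bounded_rl_continuous al0 al1 B0 mm mB.
have ga : g a = f a by rewrite /g rl_before// addr0.
have cg : {within `[a, b], continuous g}.
  by move=> s; apply: cvgD; [exact: cf|exact: (continuous_subspaceT ch)].
have csub (u : R -> R) : {within `[a, b], continuous u} -> {within `[a, b], continuous (fun t => u t - u a)}.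
  by move=> cu s; apply: cvgB; [exact: cu|exact: cvg_cst].
have L1g : L1 a b (fun t => g t - g a).
  by apply: continuous_compact_integrable; [exact: segment_compact|exact: csub].
have [acF0 eF0] := F0r.
have [f0 [If0 F0E F0d]] := abs_cont_derive_ae ab acF0.
have Im := integrable_bounded_cut mm mB.
have Is : integrableR (fun s => f0 s + cut a b m s) by exact: (integrableD measurableT If0 Im).
pose F t := F0 t + \int[lebesgue_measure]_(s in `]a, t]) cut a b m s.
have FE t : a <= t <= b -> F t = F0 a + \int[lebesgue_measure]_(s in `]a, t]) (f0 s + cut a b m s).
  move=> tab; rewrite /F F0E// RintegralD//; [ring|exact: integrable_itvR|exact: integrable_itvR].
have acF : abs_cont a b F by exact: (abs_cont_prim Is FE).
have [C C0 fC] := within_continuous_bounded ab (csub f cf).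
have fC' s : a < s < b -> `|f s - f a| <= C.
  by move=> /andP[as_ sb]; have := fC s; rewrite clip_id// !ltW.
have [D D0 hD] := within_continuous_bounded ab (continuous_subspaceT ch : {within `[a, b], continuous (rl al (cut a b m))}).
have hD' s : a < s < b -> `|rl al (cut a b m) s| <= D.
  by move=> /andP[as_ sb]; have := hD s; rewrite clip_id// !ltW.
have gE : (fun t => g t - g a) = (fun t => (f t - f a) + rl al (cut a b m) t).
  by apply/funext => t; rewrite ga /g; ring.
have Fr : ac_repr_of a b (frac_int_left a (1 - al) (fun t => g t - g a)) F.
  split => //; apply: (@filterS _ _ (ae_filter_ringOfSetsType (@lebesgue_measure R)) _ _ _ eF0) => t h tI.
  have tab : a <= t <= b by move: tI; rewrite in_itv.
  rewrite gE (@frac_int_leftD _ _ (C + D))//.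
  - by rewrite h// (@frac_left_rl_semigroup _ al a b m B).
  - exact: addr_ge0.
  - by apply: measurable_within_continuous; exact: csub.
  - by apply: measurable_funTS; exact: continuous_measurable_fun.
  - by move=> s sab; apply: (le_trans (fC' s sab)); rewrite lerDl.
  - by move=> s sab; apply: (le_trans (hD' s sab)); rewrite lerDr.
split => //; first by split => //; split => //; exists F.
have dF := prim_derive_ae ab Is FE.
have ne (c : R) : {ae @lebesgue_measure R, forall t, t != c}.
  exists [set c]; split => //; first exact: lebesgue_measure_set1.
  by move=> t /= /negP; rewrite negbK => /eqP.
have flt := ae_filter_ringOfSetsType (@lebesgue_measure R).
apply: (@filterS2 _ _ flt _ _ _ _ (@filterI _ _ flt _ _ (ne a) (ne b)) (@filterI _ _ flt _ _ F0d dF)).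
move=> t [/= ta tb] [h0 h1] tI.
rewrite /caputo_left /RL_deriv_left (eq_derive_on tI (ac_repr_eq ab Fr)).
rewrite (eq_derive_on tI (ac_repr_eq ab F0r)) h0// h1//; congr (_ + _).
by rewrite cutE//; move: tI; rewrite in_itv/= !le_eqVlt eq_sym (negbTE ta) (negbTE tb).
Qed.

End caputo_perturbation.

Section herglotz.
Context {R : realType} (a b al xa za : R) (L : R -> R -> R -> R -> R) (xs zs : R -> R).
Hypotheses (ab : a < b) (al0 : 0 < al) (al1 : al <= 1) (hL : C1_xuz a b L)
  (cU : {within `[a, b], continuous (caputo_left a b al xs)})
  (hsol : solves_herglotz a b al xa za L xs zs).
Local Notation us := (caputo_left a b al xs).
Local Notation sh := (shifted a b xs us zs).
Local Notation M := (increment a b L xs us zs).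

Let cX : {within `[a, b], continuous xs}. Proof. by case: hsol => -[[[]]]. Qed.
Let cZ : {within `[a, b], continuous zs}. Proof. by case: hsol => -[[_ []]]. Qed.

Lemma along_shifted g t : t \in `[a, b] -> along a b al xs zs g t = sh g t 0 0 0.
Proof. by rewrite in_itv/= => tab; rewrite /along /shifted clip_id// !addr0. Qed.

Lemma along_clip g s : along a b al xs zs g (clip a b s) = sh g s 0 0 0.
Proof. by rewrite /along /shifted !addr0. Qed.

Lemma shifted_along_continuous g : continuous_on_strip a b g -> continuous (fun t => sh g t 0 0 0).
Proof.
move=> cg t; apply: (@continuous_comp _ _ _ (fun t : R => (t, 0, 0, 0) : R * R * R * R) (shifted4 a b xs us zs g)).
  have c0 : {for t, continuous (fun t : R => t)} by exact: cvg_id.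
  have k0 : {for t, continuous (fun t : R => 0 : R)} by exact: cvg_cst.
  exact: (continuous_pair (continuous_pair (continuous_pair c0 k0) k0) k0).
exact: (shifted_continuous ab cX cU cZ).
Qed.

Lemma along_continuous g : continuous_on_strip a b g -> {within `[a, b], continuous (along a b al xs zs g)}.
Proof.
move=> cg; apply/within_continuousP => t tI e e0.
have ct : {for t, continuous (fun t => sh g t 0 0 0)} by exact: shifted_along_continuous.
have /cvgrPdist_lt/(_ _ e0)/(nbhs_ballP _ _).1[r /= r0 hr] := ct.
exists r => // s sI ts; rewrite !along_shifted//; exact: hr.
Qed.

(** A continuous control perturbation yields an admissible pair, which
    cannot beat the minimizer. *)
Lemma perturbation_payoff (eta zeta : R -> R) : continuous eta -> continuous zeta ->
  (forall t, `|eta t| <= 1) ->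
  (forall t, `|rl al (cut a b eta) t| <= 1) -> (forall t, `|zeta t| <= 1) ->
  (forall t, zeta t = rl al (cut a b (fun s => M s (rl al (cut a b eta) s) (eta s) (zeta s))) t) ->
  0 <= zeta b.
Proof.
move=> ceta cz eta1 h1 z1 zE.
have [[[ACx ACz] eq xsa zsa] opt] := hsol.
have n0 : `|0 : R| <= 1 by rewrite normr0.
have meta : measurable_fun (`]a, b[%classic : set R) eta.
  by apply: measurable_funTS; exact: continuous_measurable_fun.
have ch := bounded_rl_continuous al0 al1 ler01 meta (fun s _ => eta1 s).
pose m s := M s (rl al (cut a b eta) s) (eta s) (zeta s).
have mm : measurable_fun (`]a, b[%classic : set R) m.
  apply: (increment_measurable ab cX cU cZ hL) => t _; [exact: ch|exact: ceta|exact: cz].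
have [K [K0 MK _ _]] := increment_lipschitz ab cX cU cZ hL.
have mB s : `|m s| <= 3 * K.
  have := MK s (rl al (cut a b eta) s) (eta s) (zeta s) 0 0 0 (h1 s) (eta1 s) (z1 s) n0 n0 n0.
  rewrite increment0 !subr0 => hh; apply: (le_trans hh); rewrite mulrC ler_wpM2r//.
  exact: ler_sum3.
have [ACx' xa' ux] := caputo_perturb al0 al1 ab ACx ler01 meta (fun s _ => eta1 s).
have K30 : 0 <= 3 * K by exact: mulr_ge0.
have [ACz' za' uz] := caputo_perturb al0 al1 ab ACz K30 mm (fun s _ => mB s).
have := opt _ _ (_ : admissible a b al xa za L _ _).
move=> /(_ (fun t => xs t + rl al (cut a b eta) t) (fun t => zs t + rl al (cut a b m) t)).
rewrite -zE lerDl; apply; split => //.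
- have flt := ae_filter_ringOfSetsType (@lebesgue_measure R).
  apply: (@filterS2 _ _ flt _ _ _ _ (@filterI _ _ flt _ _ ux uz) eq) => t [/= hx hz] ht tI.
  rewrite hz// ht// /along hx// /m /increment /shifted.
  have tab : a <= t <= b by move: tI; rewrite in_itv.
  by rewrite clip_id// !addr0 -zE; ring.
- by rewrite xa'.
- by rewrite za'.
Qed.

Variables (P : R -> R) (A : R).
Hypotheses (IP : integrableR (cut a b P))
  (cP : forall t, a < t < b -> {for t, continuous P})
  (P0 : forall t, a < t < b -> 0 < P t <= A * kern al (b - t))
  (PE : forall t, a < t < b -> P t = fk al (b - t) + rrl al (cut a b (fun s => sh (d4 L) s 0 0 0 * P s)) t).
Local Notation Q := (costate al a b (fun s => sh (d2 L) s 0 0 0) P).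
Local Notation H := (hamiltonian al a b M (fun s => sh (d2 L) s 0 0 0) P).

(** The needle estimate, for the data of the extremal. *)
Lemma extremal_no_needle (t0 v r c : R) : 0 < r -> a < t0 - r -> t0 + r < b -> `|v| <= 1 -> 0 < c ->
  (forall t x, t0 - r < t < t0 + r -> 0 <= x <= 1 -> H t (v * x) <= 0) ->
  (forall t x, t0 - r < t < t0 + r -> 1 / 2 <= x <= 1 -> H t (v * x) <= - c) ->
  False.
Proof.
have [_ s2 _ s4] := hL.
have [K [K0 MK c2K c4K]] := increment_lipschitz ab cX cU cZ hL.
apply: (@needle_variation R al a b al0 al1 ab M (fun s => sh (d2 L) s 0 0 0) (fun s => sh (d4 L) s 0 0 0) P K `|A| K0 (normr_ge0 _) _ MK _ _ c2K c4K _ _ cP _ IP PE).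
- exact: increment0.
- exact: shifted_along_continuous.
- exact: shifted_along_continuous.
- exact: (increment_expansion ab cX cU cZ hL).
- exact: (increment_measurable ab cX cU cZ hL).
- move=> t tab; have /andP[-> h] := P0 tab; apply: (le_trans h).
  by rewrite ler_wpM2r ?kern_ge0 ?ler_norm.
- exact: perturbation_payoff.
Qed.

Let IcP : integrableR (cut a b (fun s => sh (d2 L) s 0 0 0 * P s)).
Proof.
have [_ s2 _ _] := hL; have [K [_ _ c2K _]] := increment_lipschitz ab cX cU cZ hL.
have [IB _] := RintegralZ K (integrable_norm IP).
have cE : cut a b (fun s => sh (d2 L) s 0 0 0 * P s) = (fun s => sh (d2 L) s 0 0 0 * cut a b P s).
  by apply/funext => s; rewrite /cut; case: ifP => //; rewrite mulr0.
have mP : measurable_fun [set: R] (cut a b P) by have /measurable_int/measurable_EFinP := IP.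
rewrite cE; apply: le_integrableR IB.
  by apply: measurable_funM => //; apply: continuous_measurable_fun; exact: shifted_along_continuous.
by move=> s /=; rewrite normrM ler_wpM2r//; exact: c2K.
Qed.

Let cQ t : a < t < b -> {for t, continuous Q}.
Proof.
move=> /andP[at_ tb]; have [_ s2 _ _] := hL.
have cg s : a < s < b -> {for s, continuous (fun s => sh (d2 L) s 0 0 0 * P s)}.
  by move=> sab; apply: cvgM; [exact: shifted_along_continuous|exact: cP].
by have [_] := @cut_local_right _ al a b _ t al0 al1 ab IcP cg at_; apply.
Qed.

Let interior_nbhs (t0 : R) (S : R -> R -> Prop) : a < t0 < b ->
  (\forall p \near ((t0, 0) : R * R), S p.1 p.2) ->
  exists2 r, [/\ 0 < r, r <= 1, a < t0 - r & t0 + r < b] &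
    forall t x, t0 - r < t < t0 + r -> `|x| <= r -> S t x.
Proof.
move=> /andP[at0 t0b] /(nbhs_ballP _ _).1[r /= r0 hr].
pose d := Num.min (Num.min (r / 2) 1) (Num.min ((t0 - a) / 2) ((b - t0) / 2)).
have d0 : 0 < d by rewrite !lt_min ltr01 !divr_gt0// subr_gt0.
have [d1 d2 d3 d4] : [/\ d <= r / 2, d <= 1, d <= (t0 - a) / 2 & d <= (b - t0) / 2].
  by split; rewrite /d !ge_min lexx ?orbT.
exists d; first by split => //; lra.
move=> t x /andP[t1 t2] xd; apply: (hr (t, x)); split; rewrite /ball/=.
  by rewrite ltr_norml; apply/andP; split; lra.
by rewrite sub0r normrN; lra.
Qed.

Let shifted_pair_continuous g t x : continuous_on_strip a b g ->
  {for (t, x), continuous (fun p : R * R => sh g p.1 0 p.2 0)}.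
Proof.
move=> cg; apply: (@continuous_comp _ _ _ (fun p : R * R => (p.1, 0, p.2, 0) : R * R * R * R) (shifted4 a b xs us zs g)).
  have c0 : {for (t, x), continuous (fun p : R * R => p.1)} by exact: cvg_fst.
  have c1 : {for (t, x), continuous (fun p : R * R => p.2)} by exact: cvg_snd.
  have k0 : {for (t, x), continuous (fun p : R * R => 0 : R)} by exact: cvg_cst.
  exact: (continuous_pair (continuous_pair (continuous_pair c0 k0) c1) k0).
exact: (shifted_continuous ab cX cU cZ).
Qed.

(** If the slope of [H t] at [0] is not zero, a small needle of the opposite sign decreases
the payoff. *)
Lemma euler_lagrange t : a < t < b -> Q t + P t * sh (d3 L) t 0 0 0 = 0.
Proof.
move=> tab; have [_ s2 s3 s4] := hL.
pose G t x := Q t + P t * sh (d3 L) t 0 x 0.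
rewrite -/(G t 0); apply/eqP; apply/negPn/negP => G0.
have g0 : 0 < `|G t 0| / 2 by rewrite divr_gt0// normr_gt0.
have cG : {for (t, 0), continuous (fun p : R * R => G p.1 p.2)}.
  apply: cvgD.
    by apply: (@continuous_comp _ _ _ fst Q); [exact: cvg_fst|exact: cQ].
  apply: cvgM; last exact: shifted_pair_continuous.
  by apply: (@continuous_comp _ _ _ fst P); [exact: cvg_fst|exact: cP].
have nG : \forall p \near ((t, 0) : R * R), `|G t 0 - G p.1 p.2| < `|G t 0| / 2.
  by have /cvgrPdist_lt/(_ _ g0) := cG.
have [r [r0 r1 ar rb] hr] := @interior_nbhs t (fun s x => `|G t 0 - G s x| < `|G t 0| / 2) tab nG.
(* the slope of the Hamiltonian is at least half of [`|G t 0|] against the sign *)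
have slope s x : t - r < s < t + r -> 0 <= x <= 1 ->
    H s (- Num.sg (G t 0) * r * x) <= - (r * x * (`|G t 0| / 2)).
  move=> sr /andP[x0 x1]; set v := - Num.sg (G t 0) * r * x.
  have vr : `|v| <= r.
    rewrite /v normrM normrM normrN normr_sg G0 mul1r (ger0_norm x0) (gtr0_norm r0).
    by rewrite -[leRHS]mulr1 ler_wpM2l// ltW.
  have n0 : `|0 : R| <= r by rewrite normr0 ltW.
  have [y yr Ey] := mvt_norm (fun e => shifted_derive_u ab xs us zs hL s 0 e 0) vr n0.
  rewrite subr0 in Ey.
  have -> : H s v = G s y * v.
    by rewrite /hamiltonian /increment Ey /G; ring.
  have := hr s y sr yr; rewrite /v ltr_norml => /andP[h1 h2].
  have rx : 0 <= r * x by rewrite mulr_ge0// ltW.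
  have [Gn|Gp|Gz] := ltgtP (G t 0) 0; last by move: G0; rewrite Gz eqxx.
  - rewrite ltr0_sg// ltr0_norm// opprK mul1r [leLHS]mulrC -mulrN ler_wpM2l//.
    by move: h1 h2; rewrite ltr0_norm//; lra.
  - rewrite gtr0_sg// gtr0_norm// mulrC !mulNr mul1r lerN2 ler_wpM2l//.
    by move: h1 h2; rewrite gtr0_norm//; lra.
apply: (@extremal_no_needle t (- Num.sg (G t 0) * r) r (r * (`|G t 0| / 4)) r0 ar rb).
- by rewrite normrM normrN normr_sg G0 mul1r gtr0_norm.
- by rewrite mulr_gt0// divr_gt0// normr_gt0.
- move=> s x sr x01; apply: (le_trans (slope s x sr x01)).
  by rewrite oppr_le0 !mulr_ge0 ?(ltW r0) ?(ltW g0)//; case/andP: x01.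
- move=> s x sr /andP[x0 x1]; have x01 : 0 <= x <= 1 by rewrite x1 andbT; lra.
  apply: (le_trans (slope s x sr x01)); rewrite lerN2.
  rewrite -mulrA ler_wpM2l ?(ltW r0)//.
  by rewrite (_ : `|G t 0| / 4 = 1 / 2 * (`|G t 0| / 2)) ?ler_wpM2r ?(ltW g0)//; field.
Qed.

(** By the Euler-Lagrange equation [H s e] is [P s] times [k s e], where [k s] has slope
[0] at [0]; a negative second derivative makes [k s] decrease at least as fast as
[- m * e ^ 2 / 4]. *)
Lemma legendre_interior t : C2_u a b L -> a < t < b -> 0 <= sh (d33 L) t 0 0 0.
Proof.
move=> [dd3 _ s33] tab; have [_ s2 s3 s4] := hL.
rewrite leNgt; apply/negP => neg; set g := sh (d33 L) t 0 0 0 in neg.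
have /andP[Pt0 _] := P0 tab.
have cg : {for (t, 0), continuous (fun p : R * R => sh (d33 L) p.1 0 p.2 0)} by exact: shifted_pair_continuous.
have gm : 0 < - g / 2 by lra.
have n1 : \forall p \near ((t, 0) : R * R), `|g - sh (d33 L) p.1 0 p.2 0| < - g / 2.
  by have /cvgrPdist_lt/(_ _ gm) := cg.
have cP1 : {for (t, 0), continuous (fun p : R * R => P p.1)}.
  by apply: (@continuous_comp _ _ _ fst P); [exact: cvg_fst|exact: cP].
have Pt2 : 0 < P t / 2 by rewrite divr_gt0.
have n2 : \forall p \near ((t, 0) : R * R), `|P t - P p.1| < P t / 2.
  by have /cvgrPdist_lt/(_ _ Pt2) := cP1.
have [r [r0 r1 ar rb] hr] := @interior_nbhs t (fun s x => `|g - sh (d33 L) s 0 x 0| < - g / 2 /\ `|P t - P s| < P t / 2) tab (filterI n1 n2).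
pose m := - g / 2.
have d3d s e : is_derive (e : R) (1 : R) (fun e => sh (d3 L) s 0 e 0) (sh (d33 L) s 0 e 0).
  have sI : clip a b s \in `[a, b] by rewrite in_itv/= clip_itv.
  have [_ d] := dd3 (clip a b s) (xs (clip a b s) + 0) (us (clip a b s) + e) (zs (clip a b s) + 0) sI.
  exact: (@is_derive_shift _ (fun u => d3 L (clip a b s) (xs (clip a b s) + 0) u (zs (clip a b s) + 0)) (us (clip a b s)) e d).
pose k s e := M s 0 e 0 - sh (d3 L) s 0 0 0 * e.
have dk s e : is_derive (e : R) (1 : R) (k s) (sh (d3 L) s 0 e 0 - sh (d3 L) s 0 0 0).
  have i1 : is_derive (e : R) (1 : R) (fun e => M s 0 e 0) (sh (d3 L) s 0 e 0 - 0).
    exact: (is_deriveB (shifted_derive_u ab xs us zs hL s 0 e 0) (is_derive_cst _ e 1)).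
  have i2 : is_derive (e : R) (1 : R) (fun e => sh (d3 L) s 0 0 0 * e) (sh (d3 L) s 0 0 0).
    by have := is_deriveZ (sh (d3 L) s 0 0 0) (is_derive_id e 1); rewrite [_ *: 1]mulr1.
  by have := is_deriveB i1 i2; rewrite subr0.
have n0 : `|0 : R| <= r by rewrite normr0 ltW.
have slope s e : t - r < s < t + r -> 0 <= e <= r -> sh (d3 L) s 0 e 0 - sh (d3 L) s 0 0 0 <= - m * e.
  move=> sr /andP[e0 er]; have er' : `|e| <= r by rewrite ger0_norm.
  have [x xr ->] := mvt_norm (d3d s) er' n0.
  rewrite subr0 ler_wpM2r//; have [] := hr s x sr xr; rewrite /= ltr_norml => /andP[h _] _.
  by rewrite /m; lra.
have m0 : 0 < m by [].
have r40 : 0 < r / 4 by rewrite divr_gt0.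
have mr0 : 0 <= m * (r / 4) * (r / 4) by apply: mulr_ge0; [apply: mulr_ge0|]; exact: ltW.
have kdec s u v : t - r < s < t + r -> 0 <= u -> u <= v -> v <= r -> k s v - k s u <= - m * u * (v - u).
  move=> sr u0 uv vr; have [x /andP[x1 x2] ->] := mvt_between v u (dk s).
  rewrite ler_wpM2r ?subr_ge0//.
  have ux : u <= x by move: x1; rewrite (min_idPr uv).
  have xv : x <= v by move: x2; rewrite (max_idPl uv).
  apply: (le_trans (slope s x sr _)); first by rewrite (le_trans u0 ux) (le_trans xv vr).
  by rewrite !mulNr lerN2 ler_wpM2l// ltW.
have k0 s : k s 0 = 0 by rewrite /k increment0 mulr0 subr0.
have HE s e : t - r < s < t + r -> H s e = P s * k s e.
  move=> /andP[s1 s2']; have sab : a < s < b by rewrite (lt_trans ar s1) (lt_trans s2' rb).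
  have := euler_lagrange sab; rewrite /hamiltonian /k => /eqP; rewrite addr_eq0 => /eqP ->.
  by ring.
have Ps s : t - r < s < t + r -> P t / 2 <= P s.
  by move=> sr; have [] := hr s 0 sr n0; rewrite /= => _; rewrite ltr_norml => /andP[_]; lra.
apply: (@extremal_no_needle t r r (P t / 2 * (m * (r / 4) * (r / 4))) r0 ar rb).
- by rewrite gtr0_norm.
- by apply: mulr_gt0 => //; apply: mulr_gt0 => //; exact: mulr_gt0.
- move=> s x sr /andP[x0 x1]; rewrite HE//.
  have h := kdec s 0 (r * x) sr (lexx 0) (mulr_ge0 (ltW r0) x0) _.
  rewrite mulr_ge0_le0//; first by apply: le_trans (Ps s sr); exact: ltW.
  by have := h ltac:(by rewrite -[leRHS]mulr1 ler_wpM2l// ltW); rewrite k0 mulr0 mul0r subr0.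
- move=> s x sr /andP[x0 x1]; rewrite HE//.
  have x0' : 0 <= x by lra.
  have rx : 0 <= r * x by rewrite mulr_ge0// ltW.
  have rxr : r * x <= r by rewrite -[leRHS]mulr1 ler_wpM2l// ltW.
  have rx4 : r / 4 <= r * x / 2.
    by rewrite (_ : r / 4 = r * (1 / 2) / 2); [rewrite ler_wpM2r// ler_wpM2l// ltW|field].
  have h1 := kdec s 0 (r * x / 2) sr (lexx 0) _ _.
  have h2 := kdec s (r * x / 2) (r * x) sr _ _ rxr.
  have e1 : 0 <= r * x / 2 by rewrite divr_ge0.
  have e2 : r * x / 2 <= r * x by lra.
  have := h1 e1 (le_trans e2 rxr); rewrite k0 mulr0 mul0r subr0 => k1.
  have := h2 e1 e2; rewrite (_ : r * x - r * x / 2 = r * x / 2); last by field.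
  move=> k2; have k3 : k s (r * x) <= - (m * (r / 4) * (r / 4)).
    apply: (@le_trans _ _ (- (m * (r * x / 2) * (r * x / 2)))).
      by move: k2; rewrite !mulNr; lra.
    rewrite lerN2; apply: ler_pM => //; [by rewrite mulr_ge0 ?(ltW m0) ?(ltW r40)|exact: ltW|].
    by rewrite ler_wpM2l ?(ltW m0).
  apply: (@le_trans _ _ (P s * - (m * (r / 4) * (r / 4)))).
    by rewrite ler_wpM2l//; apply: le_trans (Ps s sr); exact: ltW.
  by rewrite mulrN lerN2 ler_wpM2r// Ps.
Qed.

End herglotz.

Lemma continuous_ge0_closure (R : realType) (a b : R) (g : R -> R) : a < b -> continuous g ->
  (forall t, a < t < b -> 0 <= g t) -> forall t, a <= t <= b -> 0 <= g t.
Proof.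
move=> ab cg g0 t /andP[at_ tb]; rewrite leNgt; apply/negP => gt0.
have e0 : 0 < - g t by rewrite oppr_gt0.
have /cvgrPdist_lt/(_ _ e0)/(nbhs_ballP _ _).1[r /= r0 hr] := cg t.
pose u := Num.max a (t - r); pose v := Num.min b (t + r).
have uv : u < v by rewrite /u /v lt_min !gt_max; lra.
pose s := (u + v) / 2.
have us : u < s by rewrite /s; lra.
have sv : s < v by rewrite /s; lra.
move: us sv; rewrite /u /v gt_max lt_min => /andP[as_ rs] /andP[sb sr].
have : ball t r s by rewrite /ball/= ltr_norml; apply/andP; split; lra.
move=> /hr; have := g0 s; rewrite as_ sb => /(_ isT) gs.
by rewrite ltr_norml => /andP[]; lra.
Qed.

Lemma eq_frac_int_right (R : realType) (b be : R) (f g : R -> R) (t : R) : t <= b ->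
  (forall s, t <= s <= b -> f s = g s) -> frac_int_right b be f t = frac_int_right b be g t.
Proof.
move=> tb fg; rewrite /frac_int_right; case: ifP => _; first by rewrite fg// lexx.
congr (_ * _); apply: eq_Rintegral => s; rewrite inE/= in_itv/= => sI.
by rewrite fg.
Qed.

Unset Implicit Arguments.

Theorem theorem3p11 (R : realType) (a b alpha xa za : R)
    (L : R -> R -> R -> R -> R) (xs zs : R -> R)
    (hab : a < b) (halpha0 : 0 < alpha) (halpha1 : alpha <= 1)
    (hL : C1_xuz a b L)
    (hu : {within `[a, b], continuous (caputo_left a b alpha xs)})
    (hsol : solves_herglotz a b alpha xa za L xs zs) :
  (exists p : R -> R,
    [/\ adjoint_solution a b alpha (along a b alpha xs zs (d4 L)) p,
        forall p', adjoint_solution a b alpha (along a b alpha xs zs (d4 L)) p' ->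
          forall t, t \in `[a, b[ -> p' t = p t &
        forall t, t \in `[a, b[ ->
          frac_int_right b alpha (fun s => p s * along a b alpha xs zs (d2 L) s) t
          + p t * along a b alpha xs zs (d3 L) t = 0]) /\
  (C2_u a b L ->
    forall t, t \in `[a, b] -> 0 <= along a b alpha xs zs (d33 L) t).
Proof.
have [_ s2 s3 s4] := hL.
have cq := along_continuous hab hu hsol s4.
have [P [A [[IP IP1] cP1 P0 PE adj]]] := adjoint_solution_kernel halpha0 halpha1 hab cq.
set us := caputo_left a b alpha xs in hu.
have cP t : a < t < b -> {for t, continuous P}.
  by move=> /andP[at_ tb]; apply: cP1; rewrite tb andbT; lra.
have P0' t : a < t < b -> 0 < P t <= A * kern alpha (b - t).
  by move=> /andP[at_ tb]; apply: P0; rewrite tb ltW.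
have PE' t : a < t < b -> P t = fk alpha (b - t) +
    rrl alpha (cut a b (fun s => shifted a b xs us zs (d4 L) s 0 0 0 * P s)) t.
  have <- : (fun s => along a b alpha xs zs (d4 L) (clip a b s) * P s) =
      (fun s => shifted a b xs us zs (d4 L) s 0 0 0 * P s).
    by apply/funext => s; rewrite along_clip.
  exact: PE.
have EL := euler_lagrange hab halpha0 halpha1 hL hu hsol IP cP P0' PE'.
split; last first.
  move=> hC2 t tI; have [_ _ s33] := hC2.
  rewrite along_shifted//.
  apply: (continuous_ge0_closure hab (shifted_along_continuous hab hu hsol s33)); last by move: tI; rewrite in_itv.
  by move=> s; exact: (legendre_interior hab halpha0 halpha1 hL hu hsol IP cP P0' PE' hC2).
exists (fun t => - cut (a - 1) b P t); split => //.
  by move=> p' hp'; exact: (adjoint_solution_unique halpha0 halpha1 hab cq adj hp').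
have a1b : a - 1 < b by move: hab; lra.
pose c2 t := shifted a b xs us zs (d2 L) t 0 0 0.
pose c3 t := shifted a b xs us zs (d3 L) t 0 0 0.
have cc2 : continuous c2 := shifted_along_continuous hab hu hsol s2.
have cc3 : continuous c3 := shifted_along_continuous hab hu hsol s3.
have cg s : a - 1 < s < b -> {for s, continuous (fun s => c2 s * P s)}.
  by move=> sab; apply: cvgM; [exact: cc2|exact: cP1].
have Ig : integrableR (cut (a - 1) b (fun s => c2 s * P s)).
  have [M M0 hM] := within_continuous_bounded hab (along_continuous hab hu hsol s2).
  have [IM _] := RintegralZ M (integrable_norm IP1).
  have gE : cut (a - 1) b (fun s => c2 s * P s) = (fun s => c2 s * cut (a - 1) b P s).
    by apply/funext => s; rewrite /cut; case: ifP => //; rewrite mulr0.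
  have mP : measurable_fun [set: R] (cut (a - 1) b P) by have /measurable_int/measurable_EFinP := IP1.
  rewrite gE; apply: le_integrableR IM.
    by apply: measurable_funM => //; exact: continuous_measurable_fun.
  move=> s /=; rewrite normrM ler_wpM2r//; have := hM s.
  by rewrite along_clip.
pose T t := rrl alpha (cut (a - 1) b (fun s => c2 s * P s)) t + P t * c3 t.
have cT t : t \in `[a, b[ -> {for t, continuous T}.
  rewrite in_itv/= => /andP[at_ tb]; have a1t : a - 1 < t by lra.
  have t1b : a - 1 < t < b by rewrite a1t.
  apply: cvgD.
    by have [_] := @cut_local_right _ alpha (a - 1) b _ t halpha0 halpha1 a1b Ig cg a1t; apply.
  by apply: cvgM; [exact: cP1|exact: cc3].
have T0 : forall t, t \in `[a, b[ -> T t = 0.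
  apply: (within_itvco_eq0 hab).
    by apply: continuous_in_subspaceT => t; rewrite inE; exact: cT.
  move=> t tab; rewrite -(EL t tab) /T; congr (_ + _).
  apply: eq_Rintegral => s _; have /andP[at_ tb] := tab.
  have [ts|st] := ltP t s; last by rewrite fk_le0 ?mul0r// subr_le0.
  by congr (_ * _); rewrite /cut (lt_trans at_ ts) (_ : a - 1 < s)//; lra.
move=> t tI; have := tI; rewrite in_itv/= => /andP[at_ tb].
have a1t : a - 1 < t by lra.
have tI' : t \in `[a, b] by rewrite in_itv/= at_ ltW.
rewrite (@eq_frac_int_right _ _ _ _ (fun s => - (cut (a - 1) b (fun s => c2 s * P s) s))) ?(ltW tb)//; last first.
  move=> s /andP[ts sb]; have sI : s \in `[a, b] by rewrite in_itv/= sb (le_trans at_ ts).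
  rewrite along_shifted// -/us -/(c2 s) /cut; case: ifP => _; last by rewrite oppr0 mul0r.
  by ring.
rewrite along_shifted// -/us -/(c3 t) cutE ?a1t//.
set f := cut (a - 1) b (fun s => c2 s * P s) in T cT T0 *.
have fE : cut (a - 1) b (fun s => - f s) = (fun s => - f s).
  apply/funext => s; have [h|h] := boolP (a - 1 < s < b); first by rewrite cutE.
  by rewrite (cut_out _ h) /f (cut_out _ h) oppr0.
have [I1 _] := @cut_local_right _ alpha (a - 1) b _ t halpha0 halpha1 a1b Ig cg a1t.
have [I2 E2] := RintegralZ (-1) I1.
have nE s : -1 * (fk alpha (s - t) * f s) = fk alpha (s - t) * - f s by ring.
rewrite (@frac_right_rrl _ (a - 1))// ?(ltW a1t)//; last first.
  by rewrite fE; move: I2; apply: eq_integrable => // s _ /=; rewrite nE.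
have -> : rrl alpha (cut (a - 1) b (fun s => - f s)) t = - rrl alpha f t.
  rewrite fE -[RHS]mulN1r -E2; apply: eq_Rintegral => s _; rewrite nE//.
by rewrite mulNr -opprD -/(T t) T0// oppr0.
Qed.
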